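(* Let $\mathbb{F}\in\{\mathbb{R},\mathbb{C}\}$ and let $W$ be a random positive-semidefinite $d\times d$ matrix over $\mathbb{F}$ with $\mathbb{E}\|W\|^2<+\infty$. Let $X$ be any self-adjoint Gaussian $d\times d$ random matrix over $\mathbb{F}$ such that \[ \mathbb{E}[X]=\mathbb{E}[W]\quad\text{and}\quad \mathsf{Var}[X](M)\ge \mathsf{Mom}[W](M)\ \text{ for all self-adjoint } M. \] For $n\in\mathbb{N}$ define $Y=\sum_{i=1}^n W_i$ with $W_1,\dots,W_n$ iid copies of $W$, and $Z=\sum_{i=1}^n X_i$ with $X_1,\dots,X_n$ iid copies of $X$. Let $\sigma_*^2(Z)=\max_{\|u\|=1}\operatorname{Var}[u^*Zu]$. Then \[ \mathbb{E}\,\lambda_{\min}(Y)\ge \mathbb{E}\,\lambda_{\min}(Z)-\sqrt{2\sigma_*^2(Z)\log(2d)}, \] and for all $t\ge0$, \[ \mathbb{P}\big\{\lambda_{\min}(Y)\le\mathbb{E}\,\lambda_{\min}(Z)-t\big\}\le 2d\cdot e^{-t^2/(2\sigma_*^2(Z))}. \]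
   Context: $\mathbb{H}_d$ denotes the real-linear space of self-adjoint $d\times d$ matrices over $\mathbb{F}$, with trace inner product $\langle M,A\rangle=\operatorname{Tr}[M^*A]$. For a random self-adjoint matrix $X$, the second moment function is $\mathsf{Mom}[X](M)=\mathbb{E}\,|\langle M,X\rangle|^2=\mathbb{E}[(\operatorname{Tr}[MX])^2]$ and the variance function is $\mathsf{Var}[X](M)=\operatorname{Var}[\operatorname{Tr}[MX]]$, for $M\in\mathbb{H}_d$. A random matrix is Gaussian if the real and imaginary parts of its entries form a jointly Gaussian family of real random variables. $\lambda_{\min}$ is the minimum eigenvalue. *)

(* Defs.v *)
From HB Require Import structures.
From mathcomp Require Import all_boot all_order all_algebra.
From mathcomp Require Import all_classical all_reals all_analysis.
From mathcomp.real_closed Require Import complex.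

Set Implicit Arguments.
Unset Strict Implicit.
Unset Printing Implicit Defensive.

Import Order.TTheory GRing.Theory Num.Theory.
Local Open Scope classical_set_scope.
Local Open Scope ring_scope.

(* The scalar field F in {R, C} is encoded by a boolean [realF]:
   realF = true  : F = R, seen as the subfield of R[i] of elements with Im = 0;
   realF = false : F = C = R[i].                                            *)

Section Matrices.
Variables (R : realType) (d : nat).
Local Notation C := (R[i]).

Definition Fmx (realF : bool) (A : 'M[C]_d) : Prop :=
  realF -> forall i j, complex.Im (A i j) = 0.
Definition Fvec (realF : bool) (u : 'cV[C]_d) : Prop :=
  realF -> forall i, complex.Im (u i 0) = 0.

Definition adjmx m p (A : 'M[C]_(m, p)) : 'M[C]_(p, m) :=
  \matrix_(i, j) conjc (A j i).

Definition selfadj (A : 'M[C]_d) : Prop := adjmx A = A.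

Definition vnorm2 (u : 'cV[C]_d) : R :=
  \sum_i ((complex.Re (u i 0)) ^+ 2 + (complex.Im (u i 0)) ^+ 2).

Definition unitF (realF : bool) : set 'cV[C]_d :=
  [set u | Fvec realF u /\ vnorm2 u = 1].

Definition qform (u : 'cV[C]_d) (A : 'M[C]_d) : C := (adjmx u *m A *m u) 0 0.

Definition psd (realF : bool) (A : 'M[C]_d) : Prop :=
  selfadj A /\ forall u, Fvec realF u -> 0 <= qform u A.

(* minimum eigenvalue (the eigenvalues of a self-adjoint matrix are real) *)
Definition lambda_min (A : 'M[C]_d) : R :=
  inf [set x : R | eigenvalue A (x%:C)%C].

Definition opnorm (realF : bool) (A : 'M[C]_d) : R :=
  sup [set Num.sqrt (vnorm2 (A *m u)) | u in unitF realF].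

(* <M, A> = Tr[M^* A], real for self-adjoint M, A *)
Definition trip (M A : 'M[C]_d) : R := complex.Re (\tr (adjmx M *m A)).

Definition coordK := ('I_d * 'I_d * bool)%type.
Definition mxcoord (A : 'M[C]_d) (k : coordK) : R :=
  if k.2 then complex.Im (A k.1.1 k.1.2) else complex.Re (A k.1.1 k.1.2).

End Matrices.

Section Probability.
Context {R : realType} {dT : measure_display} {T : measurableType dT}.
Variable P : probability T R.
Local Notation C := (R[i]).

Definition gaussian_rv (Z : T -> R) : Prop :=
  measurable_fun setT Z /\
  exists m s : R, forall A : set R, measurable A ->
    P (Z @^-1` A) = (if s == 0 then \d_m A else normal_prob m s A).

Definition jointly_gaussian (K : finType) (Y : K -> T -> R) : Prop :=
  forall c : K -> R, gaussian_rv (fun w => \sum_k c k * Y k w).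

Variable d : nat.

Definition random_matrix (X : T -> 'M[C]_d) : Prop :=
  forall k : coordK d, measurable_fun setT (fun w => mxcoord (X w) k).

Definition gaussian_matrix (X : T -> 'M[C]_d) : Prop :=
  jointly_gaussian (fun (k : coordK d) w => mxcoord (X w) k).

(* X and X' have the same distribution (joint law of all real coordinates,
   tested on measurable rectangles, which determine the law) *)
Definition same_law (X X' : T -> 'M[C]_d) : Prop :=
  forall A : coordK d -> set R, (forall k, measurable (A k)) ->
    P (\bigcap_k ((fun w => mxcoord (X w) k) @^-1` A k)) =
    P (\bigcap_k ((fun w => mxcoord (X' w) k) @^-1` A k)).

Definition indep_matrices n (Xs : 'I_n -> T -> 'M[C]_d) : Prop :=
  forall A : 'I_n -> coordK d -> set R, (forall i k, measurable (A i k)) ->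
    fine (P (\bigcap_i \bigcap_k ((fun w => mxcoord (Xs i w) k) @^-1` A i k))) =
    \prod_(i < n) fine (P (\bigcap_k ((fun w => mxcoord (Xs i w) k) @^-1` A i k))).

Definition sigma_star2 (realF : bool) (Z : T -> 'M[C]_d) : R :=
  sup [set fine ('V_P[fun w => complex.Re (qform u (Z w))]) | u in unitF realF].

End Probability.

(* Main.v *)
(* Fix theta > 0, let F A = Tr exp (- theta A), m = E W and G = X - m.

   Analytic core.  For B self-adjoint the polynomial
   t |-> Tr (1 - theta (A + t B) / N) ^ N, N odd, has a nonnegative fourth
   derivative, because the corresponding sum of words in which B occurs four
   times is a sum of squares.  In the limit this yields, for V psd,
     F (A + V) <= F A + DF A [V] + D2F A [V, V] / 2
   and a matching lower bound for the symmetric differences of F.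

   Poissonization.  Since E W = m and Mom W <= Var X, the two bounds give
   E F (A + s m + sqrt s G) >= (1 - O(s ^ 2)) ((1 - s) F A + s E F (A + W)) for
   small s.  By the Gaussian semigroup property the iterates of this inequality
   up to time n give E F Z >= E F (W_1 + ... + W_N), N a Poisson variable of
   mean n.  Since F decreases when a psd matrix is added and P (N <= n) >= 1/2,
   E F Y <= 2 E F Z; this is the 2 in 2d.

   Conclusion.  Gaussian concentration, by interpolation along the semigroup for
   the maximum of - u^* Z u over finer and finer nets of unit vectors u, gives
     E exp (- theta lambda_min Z) <= exp (- theta E lambda_min Z + theta^2 s2/2).
   Hence E exp (- theta lambda_min Y) is at most 2 d times the right-hand side,
   and Jensen's and Markov's inequalities with the optimal theta conclude. *)
Require Import Defs.
From HB Require Import structures.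
From mathcomp Require Import all_boot all_order all_algebra.
From mathcomp Require Import all_classical all_reals all_analysis.
From mathcomp.real_closed Require Import complex polyrcf.
From mathcomp Require Import measurable_realfun ring lra zify.
Set Implicit Arguments.
Unset Strict Implicit.
Unset Printing Implicit Defensive.
Import Order.TTheory GRing.Theory Num.Theory.
Import numFieldNormedType.Exports.
Local Open Scope classical_set_scope.
Local Open Scope ring_scope.

(** * Words of length four in a tracial ring *)

(** The hypothesis bounds a second moment and not a variance because generators are compared. E F (A
    + W) - F A is the generator of the compound Poisson process with jumps W; by the upper bound it
    is at most DF A [m] + E D2F A [W, W] / 2, which Mom W <= Var X compares with the generator of
    the Gaussian process with drift m. The obstacle is noncommutativity: along a psd direction V one
    would like the third derivative of F to be nonpositive, but words with three letters V carry no
    sign of their own. The sign of the fourth derivative suffices: the third order Taylor remainder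
    divided by t ^ 3 is then nondecreasing in t, while F (A + t V) <= F A keeps the remainder from
    growing that fast unless it is nonpositive. For the lower bound put s = t ^ 2. Averaging over G
    and - G removes the words with an odd number of letters G, so each cubic word that is left
    contains s m and the error is of order t ^ 4 = s ^ 2. It is also proportional to F A; hence it
    can be integrated over the unbounded G and costs a factor 1 - O(s ^ 2) per step, whose product
    over n / s steps tends to 1. *)

Section CyclicSum.
Variables (V : nmodType) (m : nat).
Implicit Types g : nat -> nat -> nat -> nat -> V.

Definition sum4 g := \sum_(a < m.+1) \sum_(b < m.+1) \sum_(c < m.+1)
  \sum_(e < m.+1 | (a + b + c + e == m)%N) g a b c e.

Lemma sum4_rot g : sum4 g = sum4 (fun a b c e => g b c e a).
Proof.
rewrite /sum4.
under eq_bigr do under eq_bigr do under eq_bigr do rewrite big_mkcond /=.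
under [RHS]eq_bigr do under eq_bigr do under eq_bigr do rewrite big_mkcond /=.
rewrite [RHS]exchange_big /=; apply: eq_bigr => a _.
rewrite [RHS]exchange_big /=; apply: eq_bigr => b _.
rewrite [RHS]exchange_big /=; apply: eq_bigr => c _.
by apply: eq_bigr => e _; congr (if _ == m then _ else _); lia.
Qed.

Lemma eq_sum4 g h : (forall a b c e, (a + b + c + e = m)%N -> g a b c e = h a b c e) ->
  sum4 g = sum4 h.
Proof.
move=> gh; rewrite /sum4; do 3 (apply: eq_bigr => ? _).
by apply: eq_bigr => ? /eqP; apply: gh.
Qed.

Lemma sum4D g h : sum4 g + sum4 h = sum4 (fun a b c e => g a b c e + h a b c e).
Proof.
rewrite /sum4 -big_split; apply: eq_bigr => a _.
rewrite -big_split; apply: eq_bigr => b _.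
rewrite -big_split; apply: eq_bigr => c _.
by rewrite -big_split.
Qed.

(** With [c] outermost and [a] solved for, what remains for fixed [c] is a double sum over [b] and
    [e], the shape of a square. *)
Lemma sum4_elim g : sum4 g = \sum_(c < m.+1) \sum_(b < m.+1)
  \sum_(e < m.+1 | (b + c + e <= m)%N) g (m - (b + c + e))%N b c e.
Proof.
rewrite /sum4 exchange_big /=.
under eq_bigr do rewrite exchange_big /=.
rewrite exchange_big /=; apply: eq_bigr => c _; apply: eq_bigr => b _.
under eq_bigr do rewrite big_mkcond.
rewrite exchange_big [RHS]big_mkcond; apply: eq_bigr => e _.
case: ifPn => [le|nle]; last first.
  by rewrite big1 // => a _; case: ifP => // /eqP; lia.
have lt : (m - (b + c + e) < m.+1)%N by lia.
rewrite (bigD1 (Ordinal lt)) //= big1 ?addr0.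
  by case: ifP => // /eqP; lia.
move=> a /eqP na; case: ifP => // /eqP ae; case: na; apply: val_inj => /=; lia.
Qed.

End CyclicSum.

Section TracialRing.
Variables (R : numDomainType) (K : pzRingType) (tau : {additive K -> R}).
Variable st : {additive K -> K}.
Hypothesis st1 : st 1 = 1.
Hypothesis tauC : forall x y, tau (x * y) = tau (y * x).
Hypothesis stM : forall x y, st (x * y) = st y * st x.
Hypothesis tau_ge0 : forall x, 0 <= tau (x * st x).

Definition word4 B M a b c e := tau (B * M ^+ a * B * M ^+ b * B * M ^+ c * B * M ^+ e).

Lemma word4_rot B M a b c e : word4 B M a b c e = word4 B M b c e a.
Proof. by rewrite /word4 -!mulrA mulrA tauC -!mulrA. Qed.

Lemma stX x n : st x = x -> st (x ^+ n) = x ^+ n.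
Proof.
by move=> sx; elim: n => [|n IH]; [rewrite expr0|rewrite exprS stM IH sx -exprSr exprS].
Qed.

(** In terms of the root [X] of the letter [X ^+ 2] the circle has 2 m letters. It is cut in the
    middle of the arc [c] and at the opposite point, which the two conditions place inside the arc
    [a]. Each half carries m letters [X], so for fixed [c] one half depends on [b] only and the
    other on [e] only. *)
Lemma word4_split B X m b c e : (2 * (b + c) < m)%N -> (2 * (e + c) < m)%N ->
  word4 B (X ^+ 2) (m - (b + c + e)) b c e =
  tau (X ^+ (m - (2 * b + c)) * B * X ^+ (2 * b) * B * X ^+ c *
       (X ^+ c * B * X ^+ (2 * e) * B * X ^+ (m - (2 * e + c)))).
Proof.
move=> hb he; rewrite /word4 -!exprM.
pose x := X ^+ (m - (2 * b + c)); pose y := X ^+ (m - (2 * e + c)).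
pose w := B * X ^+ (2 * b) * B * X ^+ (2 * c) * B * X ^+ (2 * e).
transitivity (tau (w * B * (y * x))).
  rewrite -exprD (_ : (m - (2 * e + c) + (m - (2 * b + c)) = 2 * (m - (b + c + e)))%N); last lia.
  set p := X ^+ _; transitivity (tau (B * p * w)); last by rewrite tauC mulrA.
  by rewrite /w !mulrA.
rewrite mulrA tauC /w /x /y (_ : (2 * c = c + c)%N) ?exprD ?mulrA //; lia.
Qed.

(* The arcs a, b, c, e of a circle of odd length m satisfy exactly one of the
   four rotations of the condition [b + c < a + e] and [c + e < a + b].  Under
   that condition the word can be cut in the middle of the arc c into two
   half-words of equal length, so that the sum becomes a sum of squares.     *)
Lemma sum4_word4_ge0 m B X : odd m -> st B = B -> st X = X ->
  0 <= sum4 m (word4 B (X ^+ 2)).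
Proof.
move=> om sB sX; set f := word4 B (X ^+ 2).
pose J (a b c e : nat) := (b + c < a + e)%N && (c + e < a + b)%N.
pose g a b c e := if J a b c e then f a b c e else 0.
have -> : sum4 m f = sum4 m g + sum4 m g + (sum4 m g + sum4 m g).
  have g1 := sum4_rot m g.
  have g2 := etrans g1 (sum4_rot m _); have g3 := etrans g2 (sum4_rot m _).
  rewrite {1}g3 {1}g2 {1}g1 !sum4D; apply: eq_sum4 => a b c e abce.
  rewrite /g /f (word4_rot B _ b c e a) (word4_rot B _ c e a b) (word4_rot B _ e a b c).
  rewrite /J; move: (word4 _ _ _ _ _ _) => w.
  (* The two comparisons have four outcomes, one for each rotation. A tie in either of them would
     make m even. *)
  have [h1|h1] := ltnP (a + b) (c + e); have [h2|h2] := ltnP (b + c) (a + e);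
    repeat (case: ifPn => ?); rewrite ?addr0 ?add0r //; lia.
suff g0 : 0 <= sum4 m g by rewrite !addr_ge0.
rewrite sum4_elim sumr_ge0 // => c _.
(* For fixed [c] the condition splits into one on [b] and the same one on [e], and an admissible
   pair contributes [tau (U b * st (U e))]; the double sum is therefore [tau (V * st V)]. *)
pose U (b : nat) := X ^+ (m - (2 * b + c)) * B * X ^+ (2 * b) * B * X ^+ c.
pose V := \sum_(b < m.+1 | (2 * (b + c) < m)%N) U b.
suff -> : \sum_(b < m.+1) \sum_(e < m.+1 | (b + c + e <= m)%N)
    g (m - (b + c + e))%N b c e = tau (V * st V) by [].
rewrite /V raddf_sum /= big_distrlr /= raddf_sum [RHS]big_mkcond /=.
apply: eq_bigr => b _; case: ifPn => hb; last first.
  by rewrite big1 // => e he; rewrite /g /J ifF //; lia.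
rewrite raddf_sum big_mkcond [RHS]big_mkcond; apply: eq_bigr => e _ /=.
rewrite /g /J; case: ifPn => he; last by rewrite ifF //; lia.
have -> : (b + c < m - (b + c + e) + e)%N = true by lia.
have -> : (c + e < m - (b + c + e) + b)%N = (2 * (e + c) < m)%N by lia.
rewrite andTb; case: ifP => // hec.
rewrite /U !stM !stX // sB -!mulrA.
by apply: etrans (word4_split B X hb hec) _; rewrite -!mulrA.
Qed.

(** With two letters [B] a single word is already a square: both arcs are cut in the middle. *)
Lemma word2_ge0 B X a b : st B = B -> st X = X ->
  0 <= tau (B * (X ^+ 2) ^+ a * B * (X ^+ 2) ^+ b).
Proof.
move=> sB sX; have := tau_ge0 (X ^+ b * B * X ^+ a); rewrite !stM !stX // sB.
congr (_ <= _); rewrite -!exprM !mul2n -!addnn (exprD X b) [in RHS]mulrA.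
by rewrite [RHS]tauC exprD !mulrA.
Qed.

(** Noncommutative binomial coefficient: the sum of the words of length n in [M] and [B] with
    exactly j letters [B], that is, the coefficient of t ^ j in (M + t B) ^ n. *)
Fixpoint wsum M B n j : K := match n, j with
  | 0, 0 => 1
  | 0, _.+1 => 0
  | n'.+1, 0 => M * wsum M B n' 0
  | n'.+1, j'.+1 => M * wsum M B n' j'.+1 + B * wsum M B n' j'
  end.

Lemma wsum0 M B n : wsum M B n 0 = M ^+ n.
Proof. by elim: n => [|n /= ->]; rewrite ?expr0 ?exprS. Qed.

Lemma wsum_gt M B n j : (n < j)%N -> wsum M B n j = 0.
Proof.
by elim: n j => [|n IH] [|j] //= nj; rewrite !IH ?mulr0 ?addr0 //; lia.
Qed.

Lemma wsumS M B n j :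
  wsum M B n j.+1 = \sum_(a < n) M ^+ a * B * wsum M B (n - a.+1) j.
Proof.
elim: n => [|n IH]; first by rewrite big_ord0.
rewrite big_ord_recl /= expr0 mul1r subSS subn0 IH addrC; congr (_ + _).
by rewrite mulr_sumr; apply: eq_bigr => a _; rewrite exprS !mulrA.
Qed.

Lemma expr_wsum M B t n : (forall x, t * x = x * t) ->
  (M + t * B) ^+ n = \sum_(j < n.+1) t ^+ j * wsum M B n j.
Proof.
move=> ct; have cX k x : t ^+ k * x = x * t ^+ k.
  by elim: k => [|k IH]; [rewrite mul1r mulr1|rewrite exprS -mulrA IH mulrA ct -!mulrA].
elim: n => [|n IH]; first by rewrite big_ord1 expr0 mul1r.
rewrite exprS IH mulrDl !mulr_sumr [X in X + _]big_ord_recl [RHS]big_ord_recl /=.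
rewrite !expr0 !mul1r -addrA; congr (_ + _).
under [RHS]eq_bigr do rewrite mulrDr.
rewrite big_split /=; congr (_ + _).
  rewrite [RHS]big_ord_recr /= wsum_gt // !mulr0 addr0.
  by apply: eq_bigr => j _; rewrite mulrA -cX -mulrA.
by apply: eq_bigr => j _; rewrite exprS -!mulrA (mulrA B) -cX -mulrA.
Qed.

(** Cyclicity of [tau] brings the only letter [B] of each of the n + 1 words to the front. *)
Lemma tau_wsum1 M B n : tau (wsum M B n.+1 1) = tau (B * M ^+ n) *+ n.+1.
Proof.
rewrite wsumS raddf_sum -[in RHS](card_ord n.+1) -sumr_const /=.
apply: eq_bigr => a _; rewrite wsum0 [LHS]tauC mulrA -exprD [LHS]tauC.
by congr (tau (B * M ^+ _)); have := ltn_ord a; lia.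
Qed.

Lemma tau_wsum_B1 M B n : tau (B * wsum M B n 1) =
  \sum_(a < n) tau (B * M ^+ a * B * M ^+ (n - a.+1)).
Proof.
by rewrite wsumS mulr_sumr raddf_sum; apply: eq_bigr => a _; rewrite wsum0 !mulrA.
Qed.

Lemma tau_wsum_B2 M B n : tau (B * wsum M B n 2) =
  \sum_(a < n) \sum_(b < n - a.+1)
    tau (B * M ^+ a * B * M ^+ b * B * M ^+ (n - a.+1 - b.+1)).
Proof.
rewrite wsumS mulr_sumr raddf_sum; apply: eq_bigr => a _.
rewrite wsumS !mulr_sumr raddf_sum; apply: eq_bigr => b _.
by rewrite wsum0 !mulrA.
Qed.

(** Once one [B] stands in front, a word with three further letters [B] is given by the lengths of
    the four gaps between them, which add up to m. Up to a factor these sums are the fourth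
    derivatives of trace polynomials. *)
Lemma tau_wsum_B3 M B m : tau (B * wsum M B m.+3 3) = sum4 m (word4 B M).
Proof.
have ext (f : nat -> R) k : (k <= m.+1)%N -> \sum_(i < k) f i = \sum_(i < m.+1 | (i < k)%N) f i.
  by move=> km; rewrite -(big_mkord xpredT) (big_nat_widen _ _ _ _ _ km) big_mkord.
have ext0 (f : nat -> R) k k' : (k <= k')%N -> (forall i, (k <= i < k')%N -> f i = 0) ->
    \sum_(i < k') f i = \sum_(i < k) f i.
  move=> kk f0; rewrite -(big_mkord xpredT f) (big_cat_nat _ kk) //= big_mkord.
  by rewrite [X in _ + X]big_nat_cond [X in _ + X]big1 ?addr0 // => i /andP[/f0].
pose w a b c e := tau (B * M ^+ a * B * M ^+ b * B * M ^+ c * B * M ^+ e).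
transitivity (\sum_(a < m.+1) \sum_(b < m.+1 | (b < m.+1 - a)%N)
    \sum_(c < m.+1 | (c < m.+1 - a - b)%N) w a b c (m - a - b - c)%N).
  rewrite wsumS mulr_sumr raddf_sum /=.
  (* The two largest values of [a] leave fewer than two places for the remaining letters [B], so
     these terms vanish. The same happens below with [b]. *)
  rewrite (ext0 (fun a => tau (B * (M ^+ a * B * wsum M B (m.+3 - a.+1) 2))) m.+1); last 2 first.
  - by lia.
  - by move=> a ha; rewrite wsum_gt ?mulr0 ?raddf0 //; lia.
  apply: eq_bigr => a _; rewrite -(ext (fun b => \sum_(c < m.+1 | (c < m.+1 - a - b)%N) w a b c (m - a - b - c)%N)) ?leq_subr //.
  rewrite wsumS !mulr_sumr raddf_sum /=.
  rewrite (ext0 (fun b => tau (B * (M ^+ a * B * (M ^+ b * B * wsum M B (m.+3 - a.+1 - b.+1) 1)))) (m.+1 - a)%N); last 2 first.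
  - by have := ltn_ord a; lia.
  - by move=> b hb; rewrite wsum_gt ?mulr0 ?raddf0 //; lia.
  apply: eq_bigr => b _; have hab : (a + b < m.+1)%N by have := ltn_ord b; lia.
  rewrite -(ext (fun c => w a b c (m - a - b - c)%N)); last lia.
  rewrite wsumS !mulr_sumr raddf_sum /= (_ : (m.+3 - a.+1 - b.+1 = m.+1 - a - b)%N); last lia.
  apply: eq_bigr => c _; have hc := ltn_ord c.
  by rewrite wsum0 /w (_ : (m.+1 - a - b - c.+1 = m - a - b - c)%N) ?mulrA //; lia.
rewrite /sum4; apply: eq_bigr => a _; rewrite big_mkcond; apply: eq_bigr => b _.
case: ifPn => hb; last first.
  rewrite big1 // => c _; rewrite big1 // => e /eqP; lia.
rewrite big_mkcond; apply: eq_bigr => c _; case: ifPn => hc; last first.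
  rewrite big1 // => e /eqP; lia.
have lt : (m - a - b - c < m.+1)%N by lia.
rewrite (big_pred1 (Ordinal lt)) // => e; apply/eqP/eqP => [h|->]; [apply: val_inj|] => /=; lia.
Qed.

End TracialRing.

(** * Trace polynomials and Taylor estimates for real polynomials *)

Lemma poly_eq_horner (R : numDomainType) (p q : {poly R}) :
  (forall t, p.[t] = q.[t]) -> p = q.
Proof.
move=> pq; apply/eqP; rewrite -subr_eq0; apply/eqP.
apply: (@roots_geq_poly_eq0 _ _ [seq i%:R | i <- iota 0 (size (p - q))]).
- by apply/allP => _ /mapP[i _ ->]; rewrite rootE hornerD hornerN pq subrr.
- by rewrite map_inj_uniq ?iota_uniq // => i j /eqP; rewrite eqr_nat => /eqP.
- by rewrite size_map size_iota.
Qed.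

Section TracePoly.
Variables (R : numDomainType) (K : pzRingType) (tau : {additive K -> R}).
Variable iota : {rmorphism R -> K}.
Hypothesis iotaC : forall a x, iota a * x = x * iota a.
Hypothesis tauC : forall x y, tau (x * y) = tau (y * x).
Hypothesis tauZ : forall a x, tau (iota a * x) = a * tau x.

Definition trpoly x M B n : {poly R} := \poly_(j < n.+1) tau (x * wsum M B n j).

Lemma horner_trpoly x M B n t : (trpoly x M B n).[t] = tau (x * (M + iota t * B) ^+ n).
Proof.
rewrite horner_poly expr_wsum; last exact: iotaC.
rewrite mulr_sumr raddf_sum; apply: eq_bigr => j _.
by rewrite -rmorphXn mulrA -iotaC -mulrA tauZ mulrC.
Qed.

Lemma trpoly_shift x M B n t :
  trpoly x M B n \Po ('X + t%:P) = trpoly x (M + iota t * B) B n.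
Proof.
apply: poly_eq_horner => s; rewrite horner_comp !hornerE !horner_trpoly.
by rewrite rmorphD mulrDl addrA -(addrA M) (addrC (_ * B)) addrA.
Qed.

(** Shifting the variable by t moves the base point from [M] to [M + iota t * B], so that the
    derivative at t becomes a coefficient of the shifted polynomial. *)
Lemma derivn_trpoly x M B n k t :
  (trpoly x M B n)^`(k).[t] = tau (x * wsum (M + iota t * B) B n k) *+ k`!.
Proof.
have sh (p : {poly R}) : p^`(k) \Po ('X + t%:P) = (p \Po ('X + t%:P))^`(k).
  elim: k => [//|i IH]; rewrite !derivnS -IH deriv_comp derivD derivX derivC.
  by rewrite addr0 mulr1.
have -> (p : {poly R}) : p.[t] = (p \Po ('X + t%:P)).[0].
  by rewrite horner_comp !hornerE.
rewrite sh trpoly_shift horner_coef0 coef_derivn addn0 coef_poly ffactnn.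
by case: ifPn => //; rewrite -leqNgt => nk; rewrite wsum_gt ?mulr0 ?raddf0 ?mul0rn.
Qed.

(** The first derivative is the only place where cyclicity is used: it pins a letter [B] in front,
    and the higher derivatives are then coefficients of words that begin with this [B], as in
    [sum4]. *)
Lemma deriv_trpoly M B n : (trpoly 1 M B n.+1)^`() = trpoly B M B n *+ n.+1.
Proof.
apply: poly_eq_horner => t; rewrite -derivn1 derivn_trpoly mul1r tau_wsum1 //.
by rewrite hornerMn horner_trpoly mulr1n.
Qed.

End TracePoly.

Section PolyTaylor.
Variable R : rcfType.
Implicit Types p q r : {poly R}.

Lemma poly_nondecr p a b : a <= b -> (forall t, a <= t <= b -> 0 <= p^`().[t]) ->
  p.[a] <= p.[b].
Proof.
rewrite le_eqVlt => /predU1P[-> //|ab] pd.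
have [c /itvP cab e] := poly_mvt p ab.
by rewrite -subr_ge0 e mulr_ge0 ?subr_ge0 ?(ltW ab) // pd // !cab.
Qed.

(** Repeated integration from 0, where all the lower derivatives of [r] vanish. *)
Lemma poly_ge0_derivn k r T : (forall t, 0 <= t <= T -> 0 <= r^`(k).[t]) ->
  (forall i, (i < k)%N -> r`_i = 0) -> forall t, 0 <= t <= T -> 0 <= r.[t].
Proof.
elim: k r => [|k IH] r rk r0 t /andP[t0 tT]; first by apply: rk; rewrite t0.
have r0E : r.[0] = 0 by rewrite horner_coef0 r0.
rewrite -r0E; apply: poly_nondecr => // s /andP[s0 st].
apply: IH; rewrite ?s0 ?(le_trans st) //.
- by move=> u /rk; rewrite derivSn.
- by move=> i ik; rewrite coef_deriv r0 // mul0rn.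
Qed.

Lemma derivn_small p n : (size p <= n)%N -> p^`(n) = 0.
Proof.
move=> sp; apply/polyP => i; rewrite coef_derivn nth_default ?mul0rn ?coef0 //.
by rewrite (leq_trans sp) ?leq_addr.
Qed.

Lemma poly_ge_taylor k p : (forall t, 0 <= t <= 1 -> 0 <= p^`(k).[t]) ->
  \sum_(i < k) p`_i <= p.[1].
Proof.
move=> pk; have -> : \sum_(i < k) p`_i = (take_poly k p).[1].
  by rewrite horner_poly; apply: eq_bigr => i _; rewrite expr1n mulr1.
rewrite -subr_ge0 -hornerN -hornerD.
apply: (@poly_ge0_derivn k _ 1); rewrite ?ler01 ?lexx //.
- by move=> t /pk; rewrite derivnB [(take_poly _ _)^`(_)]derivn_small ?subr0 ?size_take_poly.
- by move=> i ik; rewrite coefB coef_take_poly ik subrr.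
Qed.

Lemma poly_ge_taylor4 p : (forall t, 0 <= t <= 1 -> 0 <= p^`(4).[t]) ->
  p`_0 + p`_1 + p`_2 + p`_3 <= p.[1].
Proof. by move=> /poly_ge_taylor; rewrite !big_ord_recr big_ord0 /= add0r. Qed.

Lemma derivn_compZ p c k : (p \Po (c *: 'X))^`(k) = c ^+ k *: (p^`(k) \Po (c *: 'X)).
Proof.
elim: k => [|k IH]; first by rewrite expr0 scale1r.
rewrite derivnS IH derivZ deriv_comp derivZ derivX -scalerAr mulr1 scalerA.
by rewrite -exprSr derivnS.
Qed.

(* If the fourth derivative is nonnegative then the third order Taylor
   remainder q(t) at 0 is such that q(t) / t ^ 3 is nondecreasing.        *)
Lemma poly_taylor3_mono p T : 1 <= T -> (forall t, 0 <= t <= T -> 0 <= p^`(4).[t]) ->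
  (p.[1] - p`_0 - p`_1 - p`_2) * T ^+ 3 <= p.[T] - p`_0 - p`_1 * T - p`_2 * T ^+ 2.
Proof.
move=> T1 p4; set q := p - take_poly 3 p.
have T0 : 0 <= T by rewrite (le_trans _ T1).
have qE t : q.[t] = p.[t] - p`_0 - p`_1 * t - p`_2 * t ^+ 2.
  rewrite hornerD hornerN horner_poly !big_ord_recr big_ord0 /=.
  by rewrite expr0 mulr1 expr1 add0r !opprD !addrA.
have := qE 1; rewrite expr1n !mulr1 => <-; rewrite -qE.
have q3 : q^`(3) = p^`(3).
  by rewrite derivnB [(take_poly _ _)^`(_)]derivn_small ?subr0 ?size_take_poly.
(* The third derivative of [r] at t is T ^ 3 times the increment of the third derivative of [q] from
   t to T t. It is nonnegative because the fourth derivative is, and the claim is the value of [r]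
   at 1. *)
pose r := (q \Po (T *: 'X)) - T ^+ 3 *: q.
have : 0 <= r.[1].
  apply: (@poly_ge0_derivn 3 _ 1); rewrite ?ler01 ?lexx //.
    move=> t /andP[t0 t1]; rewrite derivnB derivn_compZ derivnZ -scalerBr hornerZ.
    rewrite mulr_ge0 ?exprn_ge0 // hornerD hornerN horner_comp !hornerE q3 subr_ge0.
    apply: poly_nondecr; first by rewrite ler_peMl.
    move=> s /andP[ts sT]; rewrite -derivnS p4 // (le_trans t0 ts) (le_trans sT) //.
    by rewrite ler_piMr.
  move=> i i3; rewrite coefB coefZ comp_polyE.
  have q0 j : (j < 3)%N -> q`_j = 0 by move=> j3; rewrite coefB coef_take_poly j3 subrr.
  rewrite q0 // mulr0 subr0 coef_sum big1 // => j _.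
  rewrite coefZ exprZn coefZ coefXn; case: eqP => [ij|]; last by rewrite !mulr0.
  by rewrite q0 ?mul0r // -ij.
by rewrite hornerD hornerN horner_comp !hornerZ hornerX mulr1 subr_ge0 [X in _ -> X <= _]mulrC.
Qed.

End PolyTaylor.

(** * Self-adjoint matrices *)

Section Adjoint.
Variable R : realType.
Local Notation C := R[i].

Lemma adjmxM m n p (A : 'M[C]_(m, n)) (B : 'M[C]_(n, p)) :
  adjmx (A *m B) = adjmx B *m adjmx A.
Proof.
apply/matrixP => i j; rewrite !mxE rmorph_sum /=; apply: eq_bigr => k _.
by rewrite !mxE rmorphM mulrC.
Qed.

Lemma adjmxK m n (A : 'M[C]_(m, n)) : adjmx (adjmx A) = A.
Proof. by apply/matrixP => i j; rewrite !mxE conjcK. Qed.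

Lemma adjmx_is_additive m n : additive (@adjmx R m n).
Proof. by move=> A B; apply/matrixP => i j; rewrite !mxE rmorphB. Qed.

HB.instance Definition _ m n :=
  GRing.isAdditive.Build _ _ (@adjmx R m n) (@adjmx_is_additive m n).

Lemma adjmxZ m n (a : R) (A : 'M[C]_(m, n)) :
  adjmx (a%:C%C *: A) = a%:C%C *: adjmx A.
Proof. by apply/matrixP => i j; rewrite !mxE rmorphM /= oppr0. Qed.

Lemma adjmx1 n : adjmx (1%:M : 'M[C]_n) = 1%:M.
Proof. by apply/matrixP => i j; rewrite !mxE eq_sym conjc_nat. Qed.

Lemma ReD (x y : C) : complex.Re (x + y) = complex.Re x + complex.Re y.
Proof. by case: x y => [a b] [c e]. Qed.

Lemma ReN (x : C) : complex.Re (- x) = - complex.Re x.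
Proof. by case: x. Qed.

Lemma Re_sum I r (P : pred I) (F : I -> C) :
  complex.Re (\sum_(i <- r | P i) F i) = \sum_(i <- r | P i) complex.Re (F i).
Proof. by rewrite (big_morph _ ReD (id1 := 0)). Qed.

Lemma ReZ (a : R) (x : C) : complex.Re (a%:C%C * x) = a * complex.Re x.
Proof. by case: x => [b c] /=; rewrite mul0r subr0. Qed.

Variable d : nat.
Implicit Types A B X M U : 'M[C]_d.

Definition trr A : R := complex.Re (\tr A).

Lemma trr_is_additive : additive trr.
Proof. by move=> A B; rewrite /trr raddfB ReD ReN. Qed.

HB.instance Definition _ := GRing.isAdditive.Build _ _ trr trr_is_additive.

Lemma trrZ (a : R) A : trr (a%:C%C *: A) = a * trr A.
Proof. by rewrite /trr mxtraceZ ReZ. Qed.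

Lemma trrC A B : trr (A * B) = trr (B * A).
Proof. by rewrite /trr [\tr _]mxtrace_mulC. Qed.

Lemma trr_sqr_ge0 A : 0 <= trr (A * adjmx A).
Proof.
rewrite /trr Re_sum sumr_ge0 // => i _; rewrite -[A * _]/(A *m _) mxE Re_sum sumr_ge0 // => j _.
by rewrite mxE; case: (A i j) => a b /=; rewrite mulrN opprK addr_ge0 // -expr2 sqr_ge0.
Qed.

(** Real scalars as a ring morphism into the matrices: together with the real-valued trace [trr] and
    the involution [adjmx] it provides the data of the abstract tracial ring. *)
Definition realmul (a : R) : 'M[C]_d := (a%:C%C)%:M.

Lemma realmul_is_additive : additive realmul.
Proof. by move=> a b; rewrite /realmul rmorphB raddfB. Qed.

Lemma realmul_is_multiplicative : multiplicative realmul.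
Proof. by split => [a b|]; rewrite /realmul ?rmorphM ?scalar_mxM ?rmorph1. Qed.

HB.instance Definition _ := GRing.isAdditive.Build _ _ realmul realmul_is_additive.
HB.instance Definition _ := GRing.isMultiplicative.Build _ _ realmul realmul_is_multiplicative.

Lemma realmulE a A : realmul a * A = a%:C%C *: A.
Proof. exact: mul_scalar_mx. Qed.

Lemma realmulC a A : realmul a * A = A * realmul a.
Proof. by apply/esym/scalar_mxC. Qed.

Lemma trr_realmul a A : trr (realmul a * A) = a * trr A.
Proof. by rewrite realmulE trrZ. Qed.

End Adjoint.

Section MxRing.
Variables (R : realType) (d : nat).
Lemma mxmulE (A B : 'M[R[i]]_d) : A * B = A *m B. Proof. by []. Qed.
Lemma mxoneE : (1 : 'M[R[i]]_d) = 1%:M. Proof. by []. Qed.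
End MxRing.

Section Spectral.
Variables (R : realType) (d : nat).
Local Notation C := R[i].
Implicit Types A B X M U : 'M[C]_d.

(** A crude norm that is read off the real coordinates, yet dominates the eigenvalues ([lam_le]) and
    the entries in any eigenbasis ([conjU_le]). *)
Definition l1mx A : R := \sum_(k : coordK d) `|mxcoord A k|.

Lemma l1mxE A : l1mx A =
  \sum_i \sum_j (`|complex.Re (A i j)| + `|complex.Im (A i j)|).
Proof.
rewrite /l1mx -(pair_bigA _ (fun (p : 'I_d * 'I_d) (b : bool) => `|mxcoord A (p, b)|)) /=.
rewrite -(pair_bigA _ (fun i j => \sum_(b : bool) `|mxcoord A (i, j, b)|)) /=.
by apply: eq_bigr => i _; apply: eq_bigr => j _; rewrite big_bool addrC.
Qed.

Lemma l1mx_ge0 A : 0 <= l1mx A. Proof. by rewrite sumr_ge0. Qed.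

Lemma normc_le_l1 (z : C) : `|z| <= (`|complex.Re z| + `|complex.Im z|)%:C%C.
Proof.
rewrite {1}(complexE z) (le_trans (ler_normD _ _)) // normrM.
rewrite (_ : `|'i%C : C| = 1) ?mul1r; last first.
  by rewrite normc_def /= expr0n /= add0r expr1n sqrtr1.
by rewrite rmorphD /= !normc_def /= expr0n /= !addr0 !sqrtr_sqr.
Qed.

Lemma Re_le_norm (z : C) (b : R) : `|z| <= b%:C%C -> `|complex.Re z| <= b.
Proof. by move=> zb; rewrite -lecR (le_trans _ zb) // normc_ge_Re. Qed.

Definition sqnormc (z : C) : R := complex.Re z ^+ 2 + complex.Im z ^+ 2.

Lemma sqnormcE z : z * conjc z = (sqnormc z)%:C%C.
Proof.
case: z => a b; rewrite /sqnormc /=; simpc; congr (_ +i* _)%C; ring.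
Qed.

Definition eigU A : 'M[C]_d := spectralmx A.
Definition lam A i : R := complex.Re (spectral_diag A 0 i).
Definition conjU A B : 'M[C]_d := eigU A *m B *m adjmx (eigU A).

Lemma adjmx_trC m n (B : 'M[C]_(m, n)) : adjmx B = map_mx Num.conj B^T.
Proof. by apply/matrixP => i j; rewrite !mxE. Qed.

Lemma eigU_adj A : eigU A *m adjmx (eigU A) = 1%:M.
Proof. by rewrite adjmx_trC; apply/unitarymxP/spectral_unitarymx. Qed.

Lemma adj_eigU A : adjmx (eigU A) *m eigU A = 1%:M.
Proof. exact/mulmx1C/eigU_adj. Qed.

Definition diagr (mu : 'I_d -> R) : 'M[C]_d := diag_mx (\row_i (mu i)%:C%C).

(** Functional calculus: for a self-adjoint [A] and mu = f o [lam A] this is f (A). All powers and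
    square roots of functions of [A] are computed in this form. *)
Definition ediag A (mu : 'I_d -> R) : 'M[C]_d := adjmx (eigU A) *m diagr mu *m eigU A.

Lemma selfadj_ediag A : selfadj A -> A = ediag A (lam A).
Proof.
move=> sA; have hA : A \is hermsymmx.
  by apply/sesquiP; rewrite expr0 scale1r -adjmx_trC sA.
have /orthomx_spectralP := hermitian_normalmx hA.
rewrite (invmx_unitary (spectral_unitarymx A)) -adjmx_trC => e.
have re := mxOverP (hermitian_spectral_diag_real hA).
have dE : diag_mx (spectral_diag A) = diagr (lam A).
  by congr diag_mx; apply/rowP => i; rewrite mxE /lam (RRe_real (re 0 i)).
exact: (etrans e (congr1 (fun D => adjmx (eigU A) *m D *m eigU A) dE)).
Qed.

Lemma diagrM mu nu : diagr mu *m diagr nu = diagr (fun i => mu i * nu i).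
Proof.
rewrite /diagr mulmx_diag; congr diag_mx; apply/rowP => i; rewrite !mxE.
by rewrite rmorphM.
Qed.

Lemma ediagM A mu nu : ediag A mu * ediag A nu = ediag A (fun i => mu i * nu i).
Proof.
rewrite mxmulE /ediag -(diagrM mu nu) !mulmxA.
by rewrite -(mulmxA _ (eigU A) (adjmx (eigU A))) eigU_adj mulmx1.
Qed.

Lemma ediag1 A : ediag A (fun=> 1) = 1.
Proof.
rewrite /ediag mxoneE.
have -> : diagr (fun=> 1) = 1%:M.
  by apply/matrixP => i j; rewrite !mxE.
by rewrite mulmx1 adj_eigU.
Qed.

Lemma ediagX A mu n : ediag A mu ^+ n = ediag A (fun i => mu i ^+ n).
Proof.
elim: n => [|n IH]; first by rewrite expr0 -[in LHS](ediag1 A); congr ediag; apply/funext.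
by rewrite exprS IH ediagM; congr (ediag A _); apply/funext => i; rewrite exprS.
Qed.

Lemma ediagD A mu nu : ediag A mu + ediag A nu = ediag A (fun i => mu i + nu i).
Proof.
rewrite /ediag -mulmxDl -mulmxDr; congr (_ *m _ *m _).
rewrite /diagr -raddfD /=; congr diag_mx; apply/rowP => i; rewrite !mxE.
by rewrite rmorphD.
Qed.

Lemma ediagZ A a mu : realmul d a * ediag A mu = ediag A (fun i => a * mu i).
Proof.
rewrite realmulE /ediag scalemxAl scalemxAr; congr (_ *m _ *m _).
rewrite /diagr -linearZ /=; congr diag_mx; apply/rowP => i; rewrite !mxE.
by rewrite rmorphM.
Qed.

Lemma adj_ediag A mu : adjmx (ediag A mu) = ediag A mu.
Proof.
rewrite /ediag !adjmxM adjmxK mulmxA; congr (_ *m _ *m _).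
apply/matrixP => i j; rewrite !mxE eq_sym; case: eqP => [->|_]; rewrite ?mulr1n ?mulr0n.
  by rewrite conjc_real.
by rewrite conjc0.
Qed.

Lemma eigU_norm1 A i j : `|eigU A i j| <= 1.
Proof.
have : (eigU A *m adjmx (eigU A)) i i = 1 by rewrite eigU_adj mxE eqxx.
rewrite mxE => e; rewrite -(@expr_le1 _ 2) // -e (bigD1 j) //= mxE.
rewrite sqr_normc lerDl sumr_ge0 // => k _; rewrite mxE.
exact: mulcJ_ge0.
Qed.

Lemma conjU_le A B i j : `|conjU A B i j| <= (l1mx B)%:C%C.
Proof.
rewrite mxE (le_trans (ler_norm_sum _ _ _)) // l1mxE exchange_big rmorph_sum /=.
apply: ler_sum => k _; rewrite rmorph_sum.
rewrite normrM !mxE (le_trans (ler_wpM2l _ (_ : _ <= 1))) //.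
  by rewrite [`|_^*%C|]normcJ eigU_norm1.
rewrite mulr1 (le_trans (ler_norm_sum _ _ _)) //; apply: ler_sum => l _.
by rewrite normrM (le_trans (ler_piMl _ (eigU_norm1 _ _ _))) // normc_le_l1.
Qed.

Lemma lam_le A i : selfadj A -> `|lam A i| <= l1mx A.
Proof.
move=> sA; have /(Re_le_norm) := conjU_le A A i i.
suff -> : complex.Re (conjU A A i i) = lam A i by [].
rewrite /conjU {2}(selfadj_ediag sA) /ediag !mulmxA eigU_adj mul1mx -mulmxA eigU_adj mulmx1.
by rewrite !mxE eqxx mulr1n.
Qed.

Lemma trr_ediag A mu : trr (ediag A mu) = \sum_i mu i.
Proof.
rewrite /trr /ediag mxtrace_mulC mulmxA eigU_adj mul1mx mxtrace_diag Re_sum.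
by apply: eq_bigr => i _; rewrite mxE.
Qed.

Lemma conjU_adj A B i j : selfadj B -> conjU A B j i = conjc (conjU A B i j).
Proof.
move=> sB; have -> : conjc (conjU A B i j) = (adjmx (conjU A B)) j i by rewrite [RHS]mxE.
by rewrite /conjU !adjmxM adjmxK sB mulmxA.
Qed.

Lemma trr_conjU A X : trr (conjU A X) = trr X.
Proof. by rewrite /trr mxtrace_mulC mulmxA adj_eigU mul1mx. Qed.

Lemma conjUM A X Y : conjU A (X * Y) = conjU A X *m conjU A Y.
Proof.
rewrite /conjU mxmulE !mulmxA.
by rewrite -(mulmxA _ (adjmx (eigU A)) (eigU A)) adj_eigU mulmx1.
Qed.

Lemma conjU_ediag A mu : conjU A (ediag A mu) = diagr mu.
Proof. by rewrite /conjU /ediag !mulmxA eigU_adj mul1mx -mulmxA eigU_adj mulmx1. Qed.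

#[local] Opaque ediag conjU.

Lemma mulmx_diagrE B mu i j : (B *m diagr mu) i j = (mu j)%:C%C * B i j.
Proof. by rewrite mul_mx_diag !mxE mulrC. Qed.

Lemma trr_mul_ediag A B mu :
  trr (B * ediag A mu) = \sum_i mu i * complex.Re (conjU A B i i).
Proof.
rewrite -(trr_conjU A) conjUM conjU_ediag /trr Re_sum; apply: eq_bigr => i _.
by rewrite mulmx_diagrE ReZ.
Qed.

Lemma trr_mul2_ediag A B mu nu : selfadj B ->
  trr (B * ediag A mu * B * ediag A nu) =
  \sum_i \sum_j mu j * nu i * sqnormc (conjU A B i j).
Proof.
move=> sB; rewrite -(trr_conjU A) (conjUM A (B * ediag A mu * B)) (conjUM A (B * ediag A mu)).
rewrite (conjUM A B) !conjU_ediag /trr Re_sum.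
apply: eq_bigr => i _; rewrite mulmx_diagrE ReZ mxE Re_sum mulr_sumr.
apply: eq_bigr => j _; rewrite mulmx_diagrE [conjU A B j i]conjU_adj //.
by rewrite -(mulrA (mu j)%:C%C) sqnormcE ReZ /=; ring.
Qed.

Lemma trr_mul3_ediag A B1 B2 B3 mu nu xi :
  trr (B1 * ediag A mu * B2 * ediag A nu * B3 * ediag A xi) =
  \sum_i \sum_k \sum_j (mu j * nu k * xi i) *
     complex.Re (conjU A B1 i j * conjU A B2 j k * conjU A B3 k i).
Proof.
rewrite -(trr_conjU A) (conjUM A (B1 * ediag A mu * B2 * ediag A nu * B3)).
rewrite (conjUM A (B1 * ediag A mu * B2 * ediag A nu)) (conjUM A (B1 * ediag A mu * B2)).
rewrite (conjUM A (B1 * ediag A mu)) (conjUM A B1) !conjU_ediag /trr Re_sum.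
apply: eq_bigr => i _; rewrite mulmx_diagrE ReZ mxE Re_sum mulr_sumr.
apply: eq_bigr => k _; rewrite mulmx_diagrE mxE mulr_sumr mulr_suml Re_sum mulr_sumr.
apply: eq_bigr => j _; rewrite mulmx_diagrE.
rewrite [X in complex.Re X](_ : _ = (nu k * mu j)%:C%C *
   (conjU A B1 i j * conjU A B2 j k * conjU A B3 k i)); last by rewrite rmorphM /=; ring.
by rewrite ReZ; ring.
Qed.

(** Each product mu_j ^ a mu_k ^ b mu_i ^ c is at most the power a + b + c of the largest of the
    three eigenvalues, hence at most the trace of that power. The bound is thus proportional to a
    trace of the same kind as F, and not to a norm of [A]; this is what makes the Taylor error
    relative to F. *)
Lemma trr_mul3_le A B1 B2 B3 mu a b c : (forall i, 0 <= mu i) ->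
  `|trr (B1 * ediag A (fun i => mu i ^+ a) * B2 * ediag A (fun i => mu i ^+ b) *
         B3 * ediag A (fun i => mu i ^+ c))| <=
  d%:R ^+ 3 * (l1mx B1 * l1mx B2 * l1mx B3) * \sum_i mu i ^+ (a + b + c).
Proof.
move=> mu0; set S := \sum_i _; set L := _ * l1mx B3.
have L0 : 0 <= L by rewrite !mulr_ge0 ?l1mx_ge0.
have muS i : mu i ^+ (a + b + c) <= S.
  by rewrite /S (bigD1 i) //= lerDl sumr_ge0 // => k _; rewrite exprn_ge0.
have bnd i j k : mu j ^+ a * mu k ^+ b * mu i ^+ c <= S.
  pose M := Num.max (mu i) (Num.max (mu j) (mu k)).
  have [l Ml] : exists l, M = mu l by rewrite /M; case: leP => _; [case: leP => _|]; eexists.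
  apply: le_trans (muS l); rewrite -Ml !exprD; have M0 : 0 <= M by rewrite Ml.
  have le1 x n : x \in [:: mu i; mu j; mu k] -> x ^+ n <= M ^+ n.
    rewrite !inE => xM; apply: lerXn2r; rewrite ?nnegrE //.
      by case/or3P: xM => /eqP ->.
    by rewrite /M !le_max; case/or3P: xM => /eqP ->; rewrite lexx ?orbT.
  by do 2 (apply: ler_pM; rewrite ?mulr_ge0 ?exprn_ge0 ?le1 ?inE ?eqxx ?orbT //).
rewrite trr_mul3_ediag (le_trans (ler_norm_sum _ _ _)) //.
have -> : d%:R ^+ 3 * L * S = \sum_(i < d) \sum_(j < d) \sum_(k < d) (S * L).
  by rewrite !sumr_const !card_ord -!mulrnA -[in RHS]mulr_natl !natrM; ring.
apply: ler_sum => i _; rewrite (le_trans (ler_norm_sum _ _ _)) //.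
apply: ler_sum => k _; rewrite (le_trans (ler_norm_sum _ _ _)) //.
apply: ler_sum => j _; rewrite normrM ler_pM //.
  by rewrite ger0_norm ?mulr_ge0 ?exprn_ge0.
apply: Re_le_norm; rewrite !normrM /L !rmorphM /=.
by rewrite !ler_pM ?mulr_ge0 ?conjU_le.
Qed.

End Spectral.

(** * The trace exponential *)

Section ExpLimits.
Variable R : realType.
Implicit Types x y : R.

Lemma expR_le_1B x : x < 1 -> expR (- (x / (1 - x))) <= 1 - x.
Proof.
move=> x1; have p : 0 < 1 - x by rewrite subr_gt0.
rewrite expRN -[leRHS]invrK lef_pV2 ?posrE ?invr_gt0 ?expR_gt0 //.
rewrite [leLHS](_ : _ = 1 + x / (1 - x)) ?expR_ge1Dx //.
by field; rewrite gt_eqF.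
Qed.

(** Squeezed between exponentials by 1 + y <= e ^ y and [expR_le_1B]. The exponent n is allowed to
    differ from N so that the powers N - 1, N - 2 and N - 3, left over by differentiation, are
    covered too. *)
Lemma cvg_expn_expR (N n : nat -> nat) x :
  (N k)%:R^-1 @[k --> \oo] --> (0 : R) -> (n k)%:R / (N k)%:R @[k --> \oo] --> (1 : R) ->
  (1 - x / (N k)%:R) ^+ n k @[k --> \oo] --> expR (- x).
Proof.
move=> N0 n1.
have c0 : x / (N k)%:R @[k --> \oo] --> (0 : R).
  by rewrite -[0 : R](mulr0 x); apply: cvgM => //; exact: cvg_cst.
have lim1 : expR (- (x * ((n k)%:R / (N k)%:R))) @[k --> \oo] --> expR (- x).
  apply: continuous_cvg; first exact: continuous_expR.
  by apply: cvgN; rewrite -[X in _ --> X](mulr1 x); apply: cvgM => //; exact: cvg_cst.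
have lim2 : expR (- (x * ((n k)%:R / (N k)%:R) / (1 - x / (N k)%:R))) @[k --> \oo] --> expR (- x).
  apply: continuous_cvg; first exact: continuous_expR.
  apply: cvgN; rewrite -[X in _ --> X]divr1; apply: cvgM.
    by rewrite -[X in _ --> X](mulr1 x); apply: cvgM => //; exact: cvg_cst.
  apply: cvgV; first exact: oner_neq0.
  by rewrite -[X in _ --> X]subr0; apply: cvgB => //; exact: cvg_cst.
apply: (squeeze_cvgr _ lim2 lim1); near=> k.
have xN : x / (N k)%:R < 1.
  by near: k; apply: (cvgr_lt 0) => //; rewrite ltr01.
apply/andP; split.
  rewrite (_ : - _ = - (x / (N k)%:R / (1 - x / (N k)%:R)) * (n k)%:R); last by ring.
  by rewrite expRM_natr lerXn2r ?nnegrE ?expR_ge0 ?subr_ge0 ?(ltW xN) ?expR_le_1B.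
rewrite [- (x * (_ / _))](_ : _ = - (x / (N k)%:R) * (n k)%:R); last by ring.
rewrite expRM_natr lerXn2r ?nnegrE ?expR_ge0 ?subr_ge0 ?(ltW xN) //.
exact: expR_ge1Dx.
Unshelve. all: by end_near.
Qed.

(** Minus the first divided difference of x |-> e ^ (- x), with its limit on the diagonal. It is the
    kernel of the second derivative of A |-> Tr exp (- A) in an eigenbasis. *)
Definition expdd x y : R := if x == y then expR (- x) else (expR (- x) - expR (- y)) / (y - x).

Lemma expdd_ge0 x y : 0 <= expdd x y.
Proof.
rewrite /expdd; case: eqP => [_|/eqP xy]; first exact: expR_ge0.
have [l|l] := leP x y.
  by rewrite divr_ge0 ?subr_ge0 // ler_expR lerN2.
by rewrite -mulrNN -invrN divr_ge0 // oppr_ge0 subr_le0 ?ler_expR ?lerN2 ltW.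
Qed.

(** The sum over the position of the second letter [B] is geometric: its terms are all equal when x
    = y, and otherwise it telescopes to a difference of two powers. *)
Lemma cvg_expdd (N : nat -> nat) x y : (forall k, (2 <= N k)%N) ->
  (N k)%:R^-1 @[k --> \oo] --> (0 : R) ->
  (N k)%:R^-1 * (\sum_(a < (N k).-1) (1 - x / (N k)%:R) ^+ a *
     (1 - y / (N k)%:R) ^+ ((N k).-1 - a.+1)) @[k --> \oo] --> expdd x y.
Proof.
move=> N2 N0; have Nn0 k : (N k)%:R != 0 :> R.
  by rewrite pnatr_eq0; have := N2 k; case: (N k).
have cB r : (forall k, (r <= N k)%N) -> (N k - r)%:R / (N k)%:R @[k --> \oo] --> (1 : R).
  move=> rN; rewrite (_ : (fun k => _) = fun k => 1 - r%:R * (N k)%:R^-1).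
    by rewrite -[X in _ --> X]subr0 -(mulr0 r%:R); apply: cvgB; [exact: cvg_cst|apply: cvgM => //; exact: cvg_cst].
  by apply/funext => k; rewrite natrB // mulrBl divff.
rewrite /expdd; case: eqP => [<-|/eqP xy].
  rewrite (_ : (fun k => _) = fun k => ((N k - 1)%:R / (N k)%:R) * (1 - x / (N k)%:R) ^+ (N k - 2)).
    rewrite -[X in _ --> X]mul1r; apply: cvgM; first by apply: cB => k; rewrite ltnW.
    by apply: cvg_expn_expR => //; apply: cB.
  apply/funext => k; rewrite subn1 (eq_bigr (fun=> (1 - x / (N k)%:R) ^+ (N k - 2))).
    by rewrite sumr_const card_ord -mulr_natl; ring.
  by move=> a _; rewrite -exprD; congr (_ ^+ _); have := ltn_ord a; have := N2 k; lia.
rewrite (_ : (fun k => _) = fun k => ((1 - x / (N k)%:R) ^+ (N k - 1) - (1 - y / (N k)%:R) ^+ (N k - 1)) / (y - x)).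
  apply: cvgM; last exact: cvg_cst.
  by apply: cvgB; apply: cvg_expn_expR => //; apply: cB => k; rewrite ltnW.
apply/funext => k; rewrite subn1; have yx : y - x != 0 by rewrite subr_eq0 eq_sym.
set S := \sum_(a < _) _.
have -> : (1 - x / (N k)%:R) ^+ (N k).-1 - (1 - y / (N k)%:R) ^+ (N k).-1 =
    - ((1 - y / (N k)%:R) - (1 - x / (N k)%:R)) * S.
  rewrite -[LHS]opprB subrXX mulNr; congr (- (_ * _)); apply: eq_bigr => i _.
  by rewrite mulrC; congr (_ * _ ^+ _); lia.
by field; rewrite Nn0 yx.
Qed.

(* The sums of squares for words of length four need an odd exponent. *)
Definition Nodd k : nat := k.*2 + 5.

Lemma cvg_Nodd : (Nodd k)%:R^-1 @[k --> \oo] --> (0 : R).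
Proof.
apply: (squeeze_cvgr _ (cvg_cst 0) (@cvg_harmonic R)); near=> k.
rewrite invr_ge0 ler0n /= /harmonic /= lef_pV2 ?posrE ?ltr0n ?ler_nat /Nodd //; lia.
Unshelve. all: by end_near.
Qed.

End ExpLimits.

Section TraceExp.
Variables (R : realType) (d : nat).
Local Notation C := R[i].
Implicit Types A B V W X M : 'M[C]_d.
Local Notation rm := (realmul d).

(** For self-adjoint [A]: Tr exp (- A), then its first and second derivatives in the direction B,
    written in an eigenbasis of [A]. They are identified as limits of coefficients of the
    polynomials [pk], not by differentiating the exponential. *)
Definition trexp A : R := \sum_i expR (- lam A i).
Definition dtrexp A B : R := - \sum_i expR (- lam A i) * complex.Re (conjU A B i i).
Definition d2trexp A B : R :=
  \sum_i \sum_j expdd (lam A j) (lam A i) * sqnormc (conjU A B i j).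

Lemma trexp_ge0 A : 0 <= trexp A.
Proof. by rewrite sumr_ge0 // => i _; rewrite expR_ge0. Qed.

Lemma d2trexp_ge0 A B : 0 <= d2trexp A B.
Proof.
rewrite sumr_ge0 // => i _; rewrite sumr_ge0 // => j _.
by rewrite mulr_ge0 ?expdd_ge0 // addr_ge0 ?sqr_ge0.
Qed.

Lemma selfadjD A B : selfadj A -> selfadj B -> selfadj (A + B).
Proof. by rewrite /selfadj raddfD /= => -> ->. Qed.

Lemma selfadjN A : selfadj A -> selfadj (- A).
Proof. by rewrite /selfadj raddfN /= => ->. Qed.

Lemma selfadj_rm a A : selfadj A -> selfadj (rm a * A).
Proof. by rewrite /selfadj realmulE adjmxZ => ->. Qed.

Lemma selfadj1 : selfadj (1 : 'M[C]_d).
Proof. exact: adjmx1. Qed.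

Lemma l1mxD A B : l1mx (A + B) <= l1mx A + l1mx B.
Proof.
rewrite /l1mx -big_split ler_sum //= => -[[i j] b] _.
rewrite /mxcoord /= mxE; case: b; case: (A i j) (B i j) => [? ?] [? ?] /=; exact: ler_normD.
Qed.

Lemma l1mx_rm a A : l1mx (rm a * A) = `|a| * l1mx A.
Proof.
rewrite realmulE /l1mx mulr_sumr; apply: eq_bigr => -[[i j] b] _.
rewrite /mxcoord /= mxE -normrM; case: b; case: (A i j) => x y /=; congr `|_|; ring.
Qed.

Definition approx A k : 'M[C]_d := 1 + rm (- (Nodd k)%:R^-1) * A.

Lemma selfadj_approx A k : selfadj A -> selfadj (approx A k).
Proof. by move=> sA; apply: selfadjD; [exact: selfadj1|exact: selfadj_rm]. Qed.

Lemma approxE A k : selfadj A ->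
  approx A k = ediag A (fun i => 1 - lam A i / (Nodd k)%:R).
Proof.
move=> sA; rewrite /approx {1}(selfadj_ediag sA) ediagZ -(ediag1 A) ediagD.
by congr (ediag A _); apply/funext => i; rewrite mulNr mulrC.
Qed.

Lemma approxD A B t k :
  approx A k + rm t * (rm (- (Nodd k)%:R^-1) * B) = approx (A + rm t * B) k.
Proof.
rewrite /approx mulrDr -addrA; congr (_ + (_ + _)).
by rewrite !mulrA -!rmorphM mulrC.
Qed.

(** As soon as N exceeds the norm of [A], the matrix 1 - A / N is psd. The positivity of words
    requires it in this form, as the square of a self-adjoint matrix. *)
Lemma approx_sqr A k : selfadj A -> l1mx A <= (Nodd k)%:R ->
  exists2 X, selfadj X & approx A k = X ^+ 2.
Proof.
move=> sA lA; exists (ediag A (fun i => Num.sqrt (1 - lam A i / (Nodd k)%:R))).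
  exact: adj_ediag.
rewrite approxE // expr2 ediagM; congr (ediag A _); apply/funext => i.
rewrite -expr2 sqr_sqrtr // subr_ge0 ler_pdivrMr ?ltr0n ?mul1r; last by rewrite /Nodd; lia.
by rewrite (le_trans _ lA) // (le_trans (ler_norm _)) // lam_le.
Qed.

Definition pk A B k : {poly R} := trpoly (@trr R d) 1 (approx A k) (rm (- (Nodd k)%:R^-1) * B) (Nodd k).

Lemma adjmxMr (X Y : 'M[C]_d) : adjmx (X * Y) = adjmx Y * adjmx X.
Proof. exact: adjmxM. Qed.

Lemma horner_pk A B k t : (pk A B k).[t] = trr (approx (A + rm t * B) k ^+ Nodd k).
Proof.
by rewrite (horner_trpoly (@realmulC R d) (@trr_realmul R d)) mul1r approxD.
Qed.

Lemma deriv_pk A B k : (pk A B k)^`() =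
  trpoly (@trr R d) (rm (- (Nodd k)%:R^-1) * B) (approx A k) (rm (- (Nodd k)%:R^-1) * B) (Nodd k).-1
  *+ Nodd k.
Proof.
rewrite /pk (_ : Nodd k = (Nodd k).-1.+1); last by rewrite /Nodd; lia.
exact: (deriv_trpoly (@realmulC R d) (@trrC R d) (@trr_realmul R d)).
Qed.

Lemma derivS_pk A B k j t : (pk A B k)^`(j.+1).[t] =
  trr (rm (- (Nodd k)%:R^-1) * B *
       wsum (approx (A + rm t * B) k) (rm (- (Nodd k)%:R^-1) * B) (Nodd k).-1 j)
  *+ j`! *+ Nodd k.
Proof.
rewrite derivSn deriv_pk derivnMn hornerMn.
rewrite (derivn_trpoly (@realmulC R d) (@trr_realmul R d)).
by rewrite approxD.
Qed.

Lemma deriv4_pk_ge0 A B k t : selfadj A -> selfadj B ->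
  l1mx (A + rm t * B) <= (Nodd k)%:R -> 0 <= (pk A B k)^`(4).[t].
Proof.
move=> sA sB lt; rewrite derivS_pk !mulrn_wge0 //.
have sAt : selfadj (A + rm t * B) by apply: selfadjD => //; exact: selfadj_rm.
have [X sX ->] := approx_sqr sAt lt.
(* One letter [B] is pinned in front and three stand among the other N - 1 places, so the gaps have
   total length N - 4 = 2 k + 1, which is odd. *)
rewrite (_ : (Nodd k).-1 = (k.*2.+1).+3); last by rewrite /Nodd; lia.
rewrite (tau_wsum_B3 (@trr R d)).
apply: (@sum4_word4_ge0 R _ (@trr R d) (@adjmx R d d)) => //.
- exact: adjmx1.
- exact: trrC.
- exact: adjmxMr.
- exact: trr_sqr_ge0.
- by rewrite /= odd_double.
- exact: selfadj_rm.
Qed.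

Lemma deriv2_pk_ge0 A B k t : selfadj A -> selfadj B ->
  l1mx (A + rm t * B) <= (Nodd k)%:R -> 0 <= (pk A B k)^`(2).[t].
Proof.
move=> sA sB lt; rewrite derivS_pk !mulrn_wge0 //.
have sAt : selfadj (A + rm t * B) by apply: selfadjD => //; exact: selfadj_rm.
have [X sX ->] := approx_sqr sAt lt.
rewrite (tau_wsum_B1 (@trr R d)) sumr_ge0 // => a _.
apply: (@word2_ge0 R _ (@trr R d) (@adjmx R d d)) => //.
- exact: adjmx1.
- exact: trrC.
- exact: adjmxMr.
- exact: trr_sqr_ge0.
- exact: selfadj_rm.
Qed.

End TraceExp.

Lemma cvg_sumr (R : realType) (I : finType) (f : I -> nat -> R) (l : I -> R) :
  (forall i, f i k @[k --> \oo] --> l i) ->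
  \sum_i f i k @[k --> \oo] --> \sum_i l i.
Proof.
move=> fl; rewrite -[\sum_i l i]/(\sum_(i <- index_enum I) l i).
elim: (index_enum I) => [|i s IH].
  rewrite big_nil (_ : (fun k => _) = cst 0); first exact: cvg_cst.
  by apply/funext => k; rewrite big_nil.
rewrite big_cons (_ : (fun k => _) = fun k => f i k + \sum_(j <- s) f j k).
  exact: cvgD.
by apply/funext => k; rewrite big_cons.
Qed.

(** * Passage to the limit and the upper Taylor bound along psd directions *)

Section TraceExpIneq.
Variables (R : realType) (d : nat).
Local Notation C := R[i].
Implicit Types A B V W X Y M : 'M[C]_d.
Local Notation rm := (realmul d).

Lemma trr_psd_ge0 W Y : psd false W -> selfadj Y -> 0 <= trr (W * (Y * Y)).
Proof.
move=> [_ W0] sY; rewrite mulrA trrC mulrA.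
have -> : trr (Y * W * Y) = \sum_i complex.Re (qform (col i Y) W).
  rewrite /trr Re_sum; apply: eq_bigr => i _; congr complex.Re.
  rewrite /qform -{1}sY !mxmulE !mxE; apply: eq_bigr => j _.
  by rewrite !mxE; congr (_ * _); apply: eq_bigr => l _; rewrite !mxE.
apply: sumr_ge0 => i _; have : 0 <= qform (col i Y) W by apply: W0.
by rewrite lecE => /andP[].
Qed.

Lemma adjmx_expX (X : 'M[C]_d) n : selfadj X -> selfadj (X ^+ n).
Proof.
move=> sX; apply: (@stX _ (@adjmx R d d)) => //; [exact: adjmx1|exact: adjmxMr].
Qed.

Lemma trexp_cvg A : selfadj A ->
  trr (approx A k ^+ Nodd k) @[k --> \oo] --> trexp A.
Proof.
move=> sA.
rewrite (_ : (fun k => _) = fun k => \sum_i (1 - lam A i / (Nodd k)%:R) ^+ Nodd k); last first.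
  by apply/funext => k; rewrite approxE // ediagX trr_ediag.
apply: cvg_sumr => i; apply: cvg_expn_expR; first exact: cvg_Nodd.
rewrite (_ : (fun k => _) = cst 1); first exact: cvg_cst.
by apply/funext => k; rewrite divff // pnatr_eq0 /Nodd; lia.
Qed.

Lemma pk_cvg A B t : selfadj A -> selfadj B ->
  (pk A B k).[t] @[k --> \oo] --> trexp (A + rm t * B).
Proof.
move=> sA sB; under eq_fun do rewrite horner_pk.
by apply: trexp_cvg; apply: selfadjD => //; exact: selfadj_rm.
Qed.

Lemma addr_rm0 A B : A + rm 0 * B = A.
Proof. by rewrite raddf0 mul0r addr0. Qed.

Lemma addr_rm1 A B : A + rm 1 * B = A + B.
Proof. by rewrite rmorph1 mul1r. Qed.

Lemma pk0_cvg A B : selfadj A -> selfadj B ->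
  (pk A B k)`_0 @[k --> \oo] --> trexp A.
Proof.
move=> sA sB; under eq_fun do rewrite -horner_coef0.
by have := pk_cvg (t := 0) sA sB; rewrite addr_rm0.
Qed.

Lemma trexp_psd_le A W : selfadj A -> psd false W -> trexp (A + W) <= trexp A.
Proof.
move=> sA pW; have sW : selfadj W by case: pW.
have c1 := pk_cvg (t := 1) sA sW; have c0 := pk_cvg (t := 0) sA sW.
rewrite addr_rm1 in c1; rewrite addr_rm0 in c0.
apply: (ler_cvg_to c1 c0); near=> k.
rewrite -lerN2 -!hornerN; apply: poly_nondecr => // t _.
rewrite derivN hornerN -derivn1 derivS_pk wsum0.
(* N - 1 is even, so the power is the square of a self-adjoint matrix, whatever the size of the base
   point. *)
rewrite (_ : (Nodd k).-1 = (k.+2 + k.+2)%N); last by rewrite /Nodd; lia.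
rewrite exprD -mulrA trr_realmul mulr1n -mulrnAr mulNr opprK.
rewrite mulr_ge0 ?invr_ge0 ?ler0n // mulrn_wge0 // trr_psd_ge0 //.
by apply: adjmx_expX; apply: selfadj_approx; apply: selfadjD => //; exact: selfadj_rm.
Unshelve. all: by end_near.
Qed.

Lemma pk_coefS A B k j : (pk A B k)`_j.+1 *+ j.+1`! =
  trr (rm (- (Nodd k)%:R^-1) * B * wsum (approx A k) (rm (- (Nodd k)%:R^-1) * B) (Nodd k).-1 j)
  *+ j`! *+ Nodd k.
Proof.
have := derivS_pk A B k j 0; rewrite addr_rm0 => <-.
by rewrite horner_coef0 coef_derivn addn0 ffactnn.
Qed.

Lemma pk_coef2 A B k : 2 * (pk A B k)`_2 = (Nodd k)%:R *
  trr (rm (- (Nodd k)%:R^-1) * B * wsum (approx A k) (rm (- (Nodd k)%:R^-1) * B) (Nodd k).-1 1).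
Proof.
have h : (pk A B k)`_2 *+ 2 = _ *+ Nodd k := pk_coefS A B k 1.
by rewrite mulr_natl h mulr_natl.
Qed.

Lemma pk_coef3 A B k : 3 * (pk A B k)`_3 = (Nodd k)%:R *
  trr (rm (- (Nodd k)%:R^-1) * B * wsum (approx A k) (rm (- (Nodd k)%:R^-1) * B) (Nodd k).-1 2).
Proof.
have h : (pk A B k)`_3 *+ 6 = _ *+ 2 *+ Nodd k := pk_coefS A B k 2.
apply: (@mulfI _ 2); first by rewrite pnatr_eq0.
rewrite mulrA -natrM mulr_natl h mulrCA [in RHS]mulr_natl -[in RHS]mulrnAr mulr_natl.
by rewrite -mulrnA mulnC mulrnA.
Qed.

Lemma Nodd_neq0 k : (Nodd k)%:R != 0 :> R.
Proof. by rewrite pnatr_eq0 /Nodd; lia. Qed.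

Lemma pk1E A B k : (pk A B k)`_1 = - trr (B * approx A k ^+ (Nodd k).-1).
Proof.
have := pk_coefS A B k 0; rewrite !mulr1n wsum0 -mulrA trr_realmul => ->.
by rewrite -mulr_natl; field; exact: Nodd_neq0.
Qed.

Lemma cvg_subNodd r : (r <= 5)%N -> (Nodd k - r)%:R / (Nodd k)%:R @[k --> \oo] --> (1 : R).
Proof.
move=> r5; rewrite (_ : (fun k => _) = fun k => 1 - r%:R * (Nodd k)%:R^-1).
  rewrite -[X in _ --> X]subr0 -(mulr0 r%:R); apply: cvgB; first exact: cvg_cst.
  by apply: cvgM; [exact: cvg_cst|exact: cvg_Nodd].
apply/funext => k; rewrite natrB ?mulrBl ?divff ?Nodd_neq0 //.
by rewrite /Nodd; lia.
Qed.

Lemma pk1_cvg A B : selfadj A -> (pk A B k)`_1 @[k --> \oo] --> dtrexp A B.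
Proof.
move=> sA; rewrite (_ : (fun k => _) = fun k => - \sum_i (1 - lam A i / (Nodd k)%:R) ^+ (Nodd k - 1) * complex.Re (conjU A B i i)); last first.
  by apply/funext => k; rewrite pk1E approxE // ediagX trr_mul_ediag subn1.
apply: cvgN; apply: cvg_sumr => i; apply: cvgM; last exact: cvg_cst.
by apply: cvg_expn_expR; [exact: cvg_Nodd|exact: cvg_subNodd].
Qed.

Lemma trr_realmul2 c B1 B2 X Y :
  trr (rm c * B1 * X * (rm c * B2) * Y) = c ^+ 2 * trr (B1 * X * B2 * Y).
Proof.
have cm (Z : 'M[C]_d) : rm c * Z = Z * rm c by exact: realmulC.
have -> : rm c * B1 * X * (rm c * B2) * Y = rm c * (rm c * (B1 * X * B2 * Y)).
  by rewrite (cm (rm c * _)) (cm B2) !mulrA -(mulrA _ (rm c) Y) (cm Y) !mulrA.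
by rewrite trr_realmul trr_realmul expr2 mulrA.
Qed.

Lemma trr_realmul3 c B1 B2 B3 X Y Z :
  trr (rm c * B1 * X * (rm c * B2) * Y * (rm c * B3) * Z) =
  c ^+ 3 * trr (B1 * X * B2 * Y * B3 * Z).
Proof.
have cm (W : 'M[C]_d) : rm c * W = W * rm c by exact: realmulC.
have -> : rm c * B1 * X * (rm c * B2) * Y * (rm c * B3) * Z =
    rm c * (rm c * B1 * X * (rm c * B2) * (Y * B3 * Z)).
  by rewrite (cm (_ * (Y * B3 * Z))) (cm B3) !mulrA -(mulrA _ (rm c) Z) (cm Z) !mulrA.
by rewrite trr_realmul trr_realmul2 (exprS c 2) !mulrA.
Qed.

Lemma pk2E A B k : (pk A B k)`_2 = (Nodd k)%:R^-1 / 2 *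
  \sum_(a < (Nodd k).-1) trr (B * approx A k ^+ a * B * approx A k ^+ ((Nodd k).-1 - a.+1)).
Proof.
have := pk_coef2 A B k; rewrite (tau_wsum_B1 (@trr R d)).
rewrite (eq_bigr (fun a : 'I_ _ => (Nodd k)%:R^-1 ^+ 2 *
  trr (B * approx A k ^+ a * B * approx A k ^+ ((Nodd k).-1 - a.+1)))); last first.
  by move=> a _; apply: (etrans (trr_realmul2 _ _ _ _ _)); rewrite sqrrN.
rewrite -mulr_sumr; set S := \sum_(a < _) _; move: (_`_2) => p h.
have -> : p = 2 * p / 2 by field.
by rewrite h; field; exact: Nodd_neq0.
Qed.

Lemma pk2_cvg A B : selfadj A -> selfadj B ->
  (pk A B k)`_2 @[k --> \oo] --> d2trexp A B / 2.
Proof.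
move=> sA sB; rewrite (_ : (fun k => _) = fun k => (\sum_i \sum_j
   ((Nodd k)%:R^-1 * (\sum_(a < (Nodd k).-1) (1 - lam A j / (Nodd k)%:R) ^+ a *
   (1 - lam A i / (Nodd k)%:R) ^+ ((Nodd k).-1 - a.+1))) * sqnormc (conjU A B i j)) / 2); last first.
  apply/funext => k; rewrite pk2E mulrAC; congr (_ / 2).
  under eq_bigr do rewrite approxE // !ediagX trr_mul2_ediag //.
  rewrite exchange_big mulr_sumr; apply: eq_bigr => i _.
  rewrite exchange_big mulr_sumr; apply: eq_bigr => j _.
  by rewrite -mulr_suml mulrA.
apply: cvgM; last exact: cvg_cst.
apply: cvg_sumr => i; apply: cvg_sumr => j; apply: cvgM; last exact: cvg_cst.
by apply: cvg_expdd; [move=> k; rewrite /Nodd; lia|exact: cvg_Nodd].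
Qed.

Lemma near_l1mx_le (r : R) : \forall k \near \oo, r <= (Nodd k)%:R.
Proof.
near=> k; apply: (le_trans (_ : _ <= k%:R)); last by rewrite ler_nat /Nodd; lia.
by near: k; exact: nbhs_infty_ger.
Unshelve. all: by end_near.
Qed.

Lemma l1mx_line A B (t T : R) : 0 <= t <= T -> l1mx (A + rm t * B) <= l1mx A + T * l1mx B.
Proof.
move=> /andP[t0 tT]; rewrite (le_trans (l1mxD _ _)) // lerD2l l1mx_rm ger0_norm //.
by rewrite ler_wpM2r ?l1mx_ge0.
Qed.

(** Convexity along the segment, from the words with two letters [B]. It serves to show that F is
    log-Lipschitz. *)
Lemma trexp_ge_tangent A B : selfadj A -> selfadj B ->
  trexp A + dtrexp A B <= trexp (A + B).
Proof.
move=> sA sB.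
have c : (pk A B k)`_0 + (pk A B k)`_1 @[k --> \oo] --> trexp A + dtrexp A B.
  by apply: cvgD; [exact: pk0_cvg|exact: pk1_cvg].
have c1 := pk_cvg (t := 1) sA sB; rewrite addr_rm1 in c1.
apply: (ler_cvg_to c c1).
have := near_l1mx_le (l1mx A + 1 * l1mx B); apply: filterS => k hk.
have := @poly_ge_taylor _ 2 (pk A B k); rewrite !big_ord_recl big_ord0 addr0 => -> // t t01.
by apply: deriv2_pk_ge0 => //; apply: le_trans hk; exact: l1mx_line.
Qed.

(** Let x be the excess of the left-hand side over the right-hand side. The monotonicity of the
    remainder over t ^ 3 bounds x T ^ 3 by the remainder at T, and F (A + T W) <= F A bounds the
    latter by a multiple of T. Letting T grow forces x <= 0. *)
Lemma trexp_psd_taylor A W : selfadj A -> psd false W ->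
  trexp (A + W) <= trexp A + dtrexp A W + d2trexp A W / 2.
Proof.
move=> sA pW; have sW : selfadj W by case: pW.
have key (T : R) : 1 <= T -> (trexp (A + W) - trexp A - dtrexp A W - d2trexp A W / 2) * T ^+ 3 <=
    - dtrexp A W * T.
  move=> T1; have T0 : 0 <= T by rewrite (le_trans _ T1).
  apply: (@le_trans _ _ (trexp (A + rm T * W) - trexp A - dtrexp A W * T - d2trexp A W / 2 * T ^+ 2)).
    have c0 := pk0_cvg sA sW; have c1 := pk1_cvg (B := W) sA; have c2 := pk2_cvg sA sW.
    have h1 := pk_cvg (t := 1) sA sW; have hT := pk_cvg (t := T) sA sW; rewrite addr_rm1 in h1.
    have L : ((pk A W k).[1] - (pk A W k)`_0 - (pk A W k)`_1 - (pk A W k)`_2) * T ^+ 3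
        @[k --> \oo] --> (trexp (A + W) - trexp A - dtrexp A W - d2trexp A W / 2) * T ^+ 3.
      by apply: cvgM; [apply: cvgB => //; apply: cvgB => //; exact: cvgB|exact: cvg_cst].
    have Rr : (pk A W k).[T] - (pk A W k)`_0 - (pk A W k)`_1 * T - (pk A W k)`_2 * T ^+ 2
        @[k --> \oo] --> trexp (A + rm T * W) - trexp A - dtrexp A W * T - d2trexp A W / 2 * T ^+ 2.
      apply: cvgB; last by apply: cvgM => //; exact: cvg_cst.
      by apply: cvgB; [exact: cvgB|apply: cvgM => //; exact: cvg_cst].
    apply: (ler_cvg_to L Rr).
    have := near_l1mx_le (l1mx A + T * l1mx W); apply: filterS => k hk.
    apply: poly_taylor3_mono => // t tT; apply: deriv4_pk_ge0 => //.
    by apply: le_trans hk; exact: l1mx_line.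
  have q0 := d2trexp_ge0 A W.
  have : trexp (A + rm T * W) <= trexp A.
    apply: trexp_psd_le => //; split; first exact: selfadj_rm.
    move=> u _; rewrite /qform realmulE -scalemxAr -scalemxAl mxE.
    by rewrite mulr_ge0 ?ler0c //; case: pW => _; apply.
  have : 0 <= d2trexp A W / 2 * T ^+ 2 by rewrite mulr_ge0 ?divr_ge0 ?exprn_ge0.
  lra.
rewrite -subr_le0; set x := (X in X <= 0); have {}key T : 1 <= T -> x * T ^+ 2 <= - dtrexp A W.
  move=> T1; rewrite -(@ler_pM2r _ T) ?(lt_le_trans _ T1) //.
  by rewrite -mulrA -exprSr (le_trans _ (key _ T1)) // /x; lra.
(* This T gives x T = x + |DF|, which already exceeds - DF, and T ^ 2 >= T. *)
rewrite leNgt; apply/negP => x0; pose T := 1 + `|dtrexp A W| / x.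
have T1 : 1 <= T by rewrite lerDl divr_ge0 // ltW.
have := key _ T1; apply/negP; rewrite -ltNge.
apply: (@lt_le_trans _ _ (x * T)).
  by rewrite /T mulrDr mulr1 mulrCA divff ?gt_eqF // mulr1 ltr_pwDl // -normrN ler_norm.
by rewrite ler_pM2l // expr2 ler_peMl // (le_trans _ T1).
Qed.

End TraceExpIneq.

(** The terms that are odd in [Y] cancel between the two values. What is left is odd in [X], hence
    small when [X] is the second order increment. *)
Lemma trilinear_symm (R : comPzRingType) (V : zmodType) (t : V -> V -> V -> R) X Y :
  (forall B B' E G, t (B + B') E G = t B E G + t B' E G) ->
  (forall B B' E G, t E (B + B') G = t E B G + t E B' G) ->
  (forall B B' E G, t E G (B + B') = t E G B + t E G B') ->
  t (X + Y) (X + Y) (X + Y) + t (X - Y) (X - Y) (X - Y) =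
  2 * (t X X X + t X Y Y + t Y X Y + t Y Y X).
Proof.
move=> D1 D2 D3.
have N1 B E G : t (- B) E G = - t B E G.
  apply/eqP; rewrite -addr_eq0 -D1 addNr; apply/eqP.
  by apply: (addrI (t 0 E G)); rewrite -D1 !addr0.
have N2 B E G : t E (- B) G = - t E B G.
  apply/eqP; rewrite -addr_eq0 -D2 addNr; apply/eqP.
  by apply: (addrI (t E 0 G)); rewrite -D2 !addr0.
have N3 B E G : t E G (- B) = - t E G B.
  apply/eqP; rewrite -addr_eq0 -D3 addNr; apply/eqP.
  by apply: (addrI (t E G 0)); rewrite -D3 !addr0.
rewrite !D1 !D2 !D3 !N1 !N2 !N3; ring.
Qed.

Lemma ler_cvg_combination (R : realType) (a b c a' b' c' s u v : nat -> R) (K A B C A' B' C' S U V : R) :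
  a @ \oo --> A -> b @ \oo --> B -> c @ \oo --> C ->
  a' @ \oo --> A' -> b' @ \oo --> B' -> c' @ \oo --> C' ->
  s @ \oo --> S -> u @ \oo --> U -> v @ \oo --> V ->
  (\forall k \near \oo, a k + b k + c k + (a' k + b' k + c' k) - K * s k <= u k + v k) ->
  A + B + C + (A' + B' + C') - K * S <= U + V.
Proof.
move=> ha hb hc ha' hb' hc' hs hu hv le.
have cR : u k + v k @[k --> \oo] --> U + V by exact: cvgD.
have cL : a k + b k + c k + (a' k + b' k + c' k) - K * s k @[k --> \oo] -->
    A + B + C + (A' + B' + C') - K * S.
  apply: cvgB; last by apply: cvgM => //; exact: cvg_cst.
  by apply: cvgD; (apply: cvgD => //; exact: cvgD).
exact: (ler_cvg_to cL cR).
Qed.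

(** [Q1] and [Q2] are the second order terms at X + Y and X - Y. The parallelogram law turns their
    sum into twice [QX + QY], and [QX], being nonnegative, is dropped from the lower bound. *)
Lemma symm_taylor_arith (R : realFieldType) (F D D' Q1 Q2 QX QY K U V : R) :
  0 <= QX -> Q1 + Q2 = 2 * (QX + QY) -> 0 <= K * F ->
  F + (D + D') + Q1 / 2 + (F + (D - D') + Q2 / 2) - K * F <= U + V ->
  F + D + QY / 2 - K * F <= (U + V) / 2.
Proof. lra. Qed.

Lemma lerD_remainder (R : realFieldType) (a b c e a' b' c' e' K : R) :
  - K <= e + e' -> a + b + c + (a' + b' + c') - K <= a + b + c + e + (a' + b' + c' + e').
Proof. lra. Qed.

Lemma oppr_le_sum_scaled (R : numDomainType) (p q c W1 W2 x : R) :
  p = - c * W1 -> q = - c * W2 -> c * (W1 + W2) <= x -> - x <= p + q.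
Proof. by move=> -> -> h; rewrite -mulrDr mulNr lerN2. Qed.

Section TraceExpSymm.
Variables (R : realType) (d : nat).
Local Notation C := R[i].
Implicit Types A B V W X Y M : 'M[C]_d.
Local Notation rm := (realmul d).

Lemma conjUD A X Y : conjU A (X + Y) = conjU A X + conjU A Y.
Proof. by rewrite /conjU mulmxDr mulmxDl. Qed.

Lemma conjUN A X : conjU A (- X) = - conjU A X.
Proof. by rewrite /conjU mulmxN mulNmx. Qed.

Lemma conjU_rm A a X : conjU A (rm a * X) = a%:C%C *: conjU A X.
Proof. by rewrite realmulE /conjU -scalemxAr -scalemxAl. Qed.

Lemma dtrexpD A X Y : dtrexp A (X + Y) = dtrexp A X + dtrexp A Y.
Proof.
rewrite /dtrexp -opprD -big_split /=; congr (- _); apply: eq_bigr => i _.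
by rewrite conjUD mxE ReD mulrDr.
Qed.

Lemma dtrexp_rm A a X : dtrexp A (rm a * X) = a * dtrexp A X.
Proof.
rewrite /dtrexp mulrN mulr_sumr; congr (- _); apply: eq_bigr => i _.
by rewrite conjU_rm mxE ReZ mulrCA.
Qed.

Lemma dtrexpN A X : dtrexp A (- X) = - dtrexp A X.
Proof.
rewrite /dtrexp; congr (- _); rewrite -sumrN; apply: eq_bigr => i _.
by rewrite conjUN mxE ReN mulrN.
Qed.

Lemma d2trexp_rm A a X : d2trexp A (rm a * X) = a ^+ 2 * d2trexp A X.
Proof.
rewrite /d2trexp mulr_sumr; apply: eq_bigr => i _; rewrite mulr_sumr; apply: eq_bigr => j _.
rewrite conjU_rm mxE mulrCA; congr (_ * _); rewrite /sqnormc.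
by case: (conjU A X i j) => x y /=; ring.
Qed.

Lemma d2trexp_parallelogram A X Y :
  d2trexp A (X + Y) + d2trexp A (X - Y) = 2 * (d2trexp A X + d2trexp A Y).
Proof.
rewrite /d2trexp mulrDr !mulr_sumr -!big_split; apply: eq_bigr => i _ /=.
rewrite !mulr_sumr -!big_split; apply: eq_bigr => j _ /=.
rewrite !conjUD conjUN !mxE /sqnormc.
by case: (conjU A X i j) (conjU A Y i j) => x y [z w] /=; ring.
Qed.

Definition word3 P Q S (B1 B2 B3 : 'M[C]_d) := trr (B1 * P * B2 * Q * B3 * S).

Lemma word3_symm P Q S X Y :
  word3 P Q S (X + Y) (X + Y) (X + Y) + word3 P Q S (X - Y) (X - Y) (X - Y) =
  2 * (word3 P Q S X X X + word3 P Q S X Y Y + word3 P Q S Y X Y + word3 P Q S Y Y X).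
Proof.
by apply: trilinear_symm => B B' E G; rewrite /word3 ?mulrDr ?mulrDl raddfD.
Qed.

Lemma pk3E A B k : (pk A B k)`_3 = - ((Nodd k)%:R^-1 ^+ 2 / 3) *
  \sum_(a < (Nodd k).-1) \sum_(b < (Nodd k).-1 - a.+1)
    word3 (approx A k ^+ a) (approx A k ^+ b) (approx A k ^+ ((Nodd k).-1 - a.+1 - b.+1)) B B B.
Proof.
have := pk_coef3 A B k; rewrite (tau_wsum_B2 (@trr R d)).
rewrite (eq_bigr (fun a : 'I_ _ => - (Nodd k)%:R^-1 ^+ 3 * \sum_(b < (Nodd k).-1 - a.+1)
    word3 (approx A k ^+ a) (approx A k ^+ b) (approx A k ^+ ((Nodd k).-1 - a.+1 - b.+1)) B B B)); last first.
  move=> a _; rewrite mulr_sumr; apply: eq_bigr => b _.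
  by apply: (etrans (trr_realmul3 _ _ _ _ _ _ _)); rewrite exprNn /word3 -signr_odd /= expr1 mulN1r.
rewrite -mulr_sumr; set S := \sum_(a < _) _; move: (_`_3) => p h.
have -> : p = 3 * p / 3 by field.
by rewrite h; field; exact: Nodd_neq0.
Qed.

Lemma word3_symm_le A k X Y a b c : selfadj A -> l1mx A <= (Nodd k)%:R ->
  word3 (approx A k ^+ a) (approx A k ^+ b) (approx A k ^+ c) (X + Y) (X + Y) (X + Y) +
  word3 (approx A k ^+ a) (approx A k ^+ b) (approx A k ^+ c) (X - Y) (X - Y) (X - Y) <=
  2 * (d%:R ^+ 3 * (l1mx X ^+ 3 + 3 * l1mx X * l1mx Y ^+ 2)) *
   \sum_i (1 - lam A i / (Nodd k)%:R) ^+ (a + b + c).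
Proof.
move=> sA lA; rewrite word3_symm -mulrA ler_pM2l // /word3.
have mu0 i : 0 <= 1 - lam A i / (Nodd k)%:R.
  rewrite subr_ge0 ler_pdivrMr ?ltr0n ?mul1r; last by rewrite /Nodd; lia.
  by rewrite (le_trans _ lA) // (le_trans (ler_norm _)) // lam_le.
rewrite approxE // !ediagX; set S := \sum_i _.
have le3 B1 B2 B3 := le_trans (ler_norm _) (trr_mul3_le A B1 B2 B3 a b c mu0).
have h1 := le3 X X X; have h2 := le3 X Y Y; have h3 := le3 Y X Y; have h4 := le3 Y Y X.
apply: (le_trans (lerD (lerD (lerD h1 h2) h3) h4)); rewrite -/S le_eqVlt; apply/orP; left.
apply/eqP; ring.
Qed.

Lemma sum_le_const n N (F : 'I_n -> R) x : (n <= N)%N -> 0 <= x ->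
  (forall i, F i <= x) -> \sum_(i < n) F i <= N%:R * x.
Proof.
move=> nN x0 Fx; apply: (@le_trans _ _ (\sum_(i < n) x)); first exact: ler_sum.
by rewrite sumr_const card_ord -[x *+ n]mulr_natl ler_wpM2r ?ler_nat.
Qed.

(** At most N ^ 2 words occur, each contributing at most 2 K S to the symmetric sum, against a
    prefactor N ^ -2 / 3; the resulting 2/3 K S is rounded up to K S. A word has N - 3 letters
    besides the three increments, whence the exponent in S. *)
Lemma pk3_symm_ge A k X Y : selfadj A -> l1mx A <= (Nodd k)%:R ->
  - (d%:R ^+ 3 * (l1mx X ^+ 3 + 3 * l1mx X * l1mx Y ^+ 2) *
     \sum_i (1 - lam A i / (Nodd k)%:R) ^+ (Nodd k - 3)) <=
  (pk A (X + Y) k)`_3 + (pk A (X - Y) k)`_3.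
Proof.
move=> sA lA; set S := \sum_i _; set K := d%:R ^+ 3 * _.
have K0 : 0 <= K by rewrite !(mulr_ge0, addr_ge0, exprn_ge0) ?l1mx_ge0.
have N0 : 0 < (Nodd k)%:R :> R by rewrite ltr0n /Nodd; lia.
have S0 : 0 <= S.
  rewrite sumr_ge0 // => i _; rewrite exprn_ge0 // subr_ge0 ler_pdivrMr // mul1r.
  by rewrite (le_trans _ lA) // (le_trans (ler_norm _)) // lam_le.
pose w (a b : nat) B := word3 (approx A k ^+ a) (approx A k ^+ b) (approx A k ^+ ((Nodd k).-1 - a.+1 - b.+1)) B B B.
apply: (oppr_le_sum_scaled (pk3E A (X + Y) k) (pk3E A (X - Y) k)).
have le1 (a : 'I_(Nodd k).-1) (b : 'I_((Nodd k).-1 - a.+1)) :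
    w a b (X + Y) + w a b (X - Y) <= 2 * K * S.
  apply: (le_trans (word3_symm_le X Y a b _ sA lA)).
  rewrite /S (_ : (a + b + ((Nodd k).-1 - a.+1 - b.+1) = Nodd k - 3)%N) //.
  by have := ltn_ord a; have := ltn_ord b; lia.
have KS0 : 0 <= 2 * K * S by exact: mulr_ge0 (mulr_ge0 (ler0n _ 2) K0) S0.
set W1 := \sum_(a < _) _; set W2 := \sum_(a < _) _.
have -> : W1 + W2 = \sum_(a < (Nodd k).-1) \sum_(b < (Nodd k).-1 - a.+1) (w a b (X + Y) + w a b (X - Y)).
  by rewrite /W1 /W2 -big_split; apply: eq_bigr => a _; rewrite big_split.
have le2 (a : 'I_(Nodd k).-1) : \sum_(b < (Nodd k).-1 - a.+1) (w a b (X + Y) + w a b (X - Y)) <=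
    (Nodd k)%:R * (2 * K * S).
  apply: sum_le_const; [lia|exact: KS0|exact: (le1 a)].
apply: (@le_trans _ _ ((Nodd k)%:R^-1 ^+ 2 / 3 * ((Nodd k)%:R * ((Nodd k)%:R * (2 * K * S))))).
  rewrite ler_wpM2l ?divr_ge0 ?exprn_ge0 ?invr_ge0 //.
  apply: sum_le_const; [exact: leq_pred| |exact: le2].
  exact: mulr_ge0 (ler0n _ _) KS0.
rewrite [leLHS](_ : _ = 2 / 3 * (K * S)); last by field; rewrite gt_eqF.
have := mulr_ge0 K0 S0; move: (K * S) => x x0; lra.
Qed.

(** Both lines A + t (X + Y) and A + t (X - Y) have a nonnegative fourth derivative, so the cubic
    Taylor polynomial at 0 is a lower bound at 1. In the average the first order terms in [Y] cancel
    and the cubic ones reduce to the types XXX and XYY. With X of order t ^ 2 and Y of order t the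
    error is of order t ^ 4. *)
Lemma trexp_symm_taylor A X Y : selfadj A -> selfadj X -> selfadj Y ->
  trexp A + dtrexp A X + d2trexp A Y / 2 -
    d%:R ^+ 3 * (l1mx X ^+ 3 + 3 * l1mx X * l1mx Y ^+ 2) * trexp A <=
  (trexp (A + (X + Y)) + trexp (A + (X - Y))) / 2.
Proof.
move=> sA sX sY; have sV : selfadj (X + Y) by exact: selfadjD.
have sV' : selfadj (X - Y) by apply: selfadjD => //; exact: selfadjN.
set K := _ * (_ + _).
have K0 : 0 <= K by rewrite !(mulr_ge0, addr_ge0, exprn_ge0) ?l1mx_ge0.
pose S k := \sum_i (1 - lam A i / (Nodd k)%:R) ^+ (Nodd k - 3).
have cS : S k @[k --> \oo] --> trexp A.
  apply: cvg_sumr => i; apply: cvg_expn_expR; [exact: cvg_Nodd|exact: cvg_subNodd].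
have cV : (pk A (X + Y) k).[1] @[k --> \oo] --> trexp (A + (X + Y)).
  by have := pk_cvg (t := 1) sA sV; rewrite addr_rm1.
have cV' : (pk A (X - Y) k).[1] @[k --> \oo] --> trexp (A + (X - Y)).
  by have := pk_cvg (t := 1) sA sV'; rewrite addr_rm1.
have c0 := pk0_cvg sA sV; have c0' := pk0_cvg sA sV'.
have c1 := pk1_cvg (B := X + Y) sA; have c1' := pk1_cvg (B := X - Y) sA.
have c2 := pk2_cvg sA sV; have c2' := pk2_cvg sA sV'.
have q0 := d2trexp_ge0 A X; have qp := d2trexp_parallelogram A X Y.
have F0 := mulr_ge0 K0 (trexp_ge0 A).
apply: (symm_taylor_arith (D' := dtrexp A Y) q0 qp F0); rewrite -dtrexpN -!dtrexpD.
apply: (ler_cvg_combination c0 c1 c2 c0' c1' c2' cS cV cV').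
have nA := near_l1mx_le (l1mx A + 1 * l1mx A); have nV := near_l1mx_le (l1mx A + 1 * l1mx (X + Y)).
have nV' := near_l1mx_le (l1mx A + 1 * l1mx (X - Y)).
near=> k.
have hA : l1mx A + 1 * l1mx A <= (Nodd k)%:R by near: k.
have hV : l1mx A + 1 * l1mx (X + Y) <= (Nodd k)%:R by near: k.
have hV' : l1mx A + 1 * l1mx (X - Y) <= (Nodd k)%:R by near: k.
have t1 := @poly_ge_taylor4 _ (pk A (X + Y) k); have t2 := @poly_ge_taylor4 _ (pk A (X - Y) k).
have {}t1 := t1 (fun t t01 => deriv4_pk_ge0 sA sV (le_trans (l1mx_line A (X + Y) t01) hV)).
have {}t2 := t2 (fun t t01 => deriv4_pk_ge0 sA sV' (le_trans (l1mx_line A (X - Y) t01) hV')).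
apply: (le_trans _ (lerD t1 t2)); apply: lerD_remainder.
apply: pk3_symm_ge => //.
by apply: le_trans hA; rewrite mul1r lerDl l1mx_ge0.
Unshelve. all: by end_near.
Qed.

End TraceExpSymm.

(** * Expectations and laws of random vectors *)

Section RealExpectation.
Context {R : realType} {dT : measure_display} {T : measurableType dT}.
Variable P : probability T R.
Implicit Types f g : T -> R.

Definition intg f := P.-integrable [set: T] (EFin \o f).
Definition Ex f : R := \int[P]_w f w.

Lemma intg_mf f : intg f -> measurable_fun [set: T] f.
Proof. by move=> /integrableP[/measurable_EFinP]. Qed.

Lemma intg_le f g : measurable_fun [set: T] f -> (forall w, `|f w| <= g w) ->
  intg g -> intg f.
Proof.
move=> mf fg; apply: le_integrable => //; first exact/measurable_EFinP.
by move=> w _ /=; rewrite lee_fin (le_trans (fg w)) // ler_norm.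
Qed.

Lemma intg_cst (c : R) : intg (fun=> c).
Proof. exact: finite_measure_integrable_cst. Qed.

Lemma intg_bounded f (M : R) : measurable_fun [set: T] f -> (forall w, `|f w| <= M) -> intg f.
Proof. by move=> mf fM; apply: (intg_le mf fM); exact: intg_cst. Qed.

Lemma intgD f g : intg f -> intg g -> intg (fun w => f w + g w).
Proof. by move=> hf hg; rewrite /intg (_ : _ \o _ = (EFin \o f) \+ (EFin \o g))%E //; exact: integrableD. Qed.

Lemma intgZ (c : R) f : intg f -> intg (fun w => c * f w).
Proof. by move=> hf; apply: (integrableZl _ c hf). Qed.

Lemma intgN f : intg f -> intg (fun w => - f w).
Proof. by move=> hf; apply: (integrableN hf). Qed.

Lemma intgB f g : intg f -> intg g -> intg (fun w => f w - g w).
Proof. by move=> hf hg; apply: intgD => //; exact: intgN. Qed.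

Lemma intg_abs f : intg f -> intg (fun w => `|f w|).
Proof. by move=> hf; apply: (integrable_abse hf). Qed.

Lemma intg_sum (I : Type) (s : seq I) (F : I -> T -> R) :
  (forall i, intg (F i)) -> intg (fun w => \sum_(i <- s) F i w).
Proof.
move=> hF; elim: s => [|i s IH].
  by under eq_fun do rewrite big_nil; exact: intg_cst.
by under eq_fun do rewrite big_cons; exact: intgD.
Qed.

Lemma EFin_Ex f : intg f -> (Ex f)%:E = (\int[P]_w (f w)%:E)%E.
Proof. by move=> hf; rewrite fineK //; exact: integrable_fin_num. Qed.

Lemma ExD f g : intg f -> intg g -> Ex (fun w => f w + g w) = Ex f + Ex g.
Proof. exact: RintegralD. Qed.

Lemma ExZ (c : R) f : intg f -> Ex (fun w => c * f w) = c * Ex f.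
Proof. exact: RintegralZl. Qed.

Lemma ExB f g : intg f -> intg g -> Ex (fun w => f w - g w) = Ex f - Ex g.
Proof. exact: RintegralB. Qed.

Lemma Ex_cst (c : R) : Ex (fun=> c) = c.
Proof.
rewrite /Ex Rintegral_cst // [X in fine X](_ : _ = 1%E) ?mulr1 //.
exact: probability_setT.
Qed.

Lemma eq_Ex f g : (forall w, f w = g w) -> Ex f = Ex g.
Proof. by move=> fg; congr Rintegral; apply/funext. Qed.

Lemma Ex_sum (I : Type) (s : seq I) (F : I -> T -> R) :
  (forall i, intg (F i)) -> Ex (fun w => \sum_(i <- s) F i w) = \sum_(i <- s) Ex (F i).
Proof.
move=> hF; elim: s => [|i s IH].
  by rewrite big_nil -[RHS](Ex_cst 0); apply: eq_Ex => w; rewrite big_nil.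
rewrite big_cons -IH -ExD //; last exact: intg_sum.
by apply: eq_Ex => w; rewrite big_cons.
Qed.

Lemma Ex_le f g : intg f -> intg g -> (forall w, f w <= g w) -> Ex f <= Ex g.
Proof. by move=> hf hg fg; apply: le_Rintegral. Qed.

Lemma Ex_ge0 f : (forall w, 0 <= f w) -> 0 <= Ex f.
Proof. by move=> f0; apply: Rintegral_ge0. Qed.

Lemma Ex_abs f : intg f -> `|Ex f| <= Ex (fun w => `|f w|).
Proof. by move=> hf; apply: le_normr_Rintegral. Qed.

Lemma Ex_gt0 f : intg f -> (forall w, 0 < f w) -> 0 < Ex f.
Proof.
move=> hf f0; rewrite lt0r Ex_ge0 ?andbT; last by move=> w; exact: ltW.
apply/eqP => e; have := EFin_Ex hf; rewrite e => /esym h.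
have : ae_eq P setT (EFin \o f) (cst 0%E).
  apply/ae_eq_integral_abs => //; first exact/measurable_EFinP/intg_mf.
  by rewrite -[RHS]h; apply: eq_integral => w _ /=; rewrite gtr0_norm.
case=> N [mN N0 sub].
have : N = setT.
  by apply/seteqP; split => // w _; apply: sub => /= /(_ I) [] /eqP; rewrite gt_eqF.
move=> NT; rewrite NT in N0.
by have /eqP := etrans (esym (probability_setT P)) N0; rewrite onee_eq0.
Qed.

Lemma Ex_cvg (F : nat -> T -> R) f g : (forall k, measurable_fun [set: T] (F k)) ->
  (forall w, F k w @[k --> \oo] --> f w) -> intg g -> (forall k w, `|F k w| <= g w) ->
  intg f /\ Ex (F k) @[k --> \oo] --> Ex f.
Proof.
move=> mF Ff ig Fg.
have mf : measurable_fun [set: T] f.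
  by apply: (@measurable_fun_cvg _ _ _ _ F) => // w _; exact: Ff.
have mFE k : measurable_fun [set: T] (EFin \o F k) by exact/measurable_EFinP.
have mfE : measurable_fun [set: T] (EFin \o f) by exact/measurable_EFinP.
have FfE w : (F k w)%:E @[k --> \oo] --> (f w)%:E.
  by apply: cvg_EFin; [exact: nearW|exact: Ff].
have [i1 _ i3] := @dominated_convergence _ _ _ P setT measurableT
  (fun k => EFin \o F k) (EFin \o f) (EFin \o g) mFE mfE
  (aeW _ (fun w _ => FfE w)) ig (aeW _ (fun w k _ => Fg k w)).
split => //; apply: fine_cvg; rewrite EFin_Ex //.
Qed.

End RealExpectation.

(** * Expectations on product spaces *)

Section ProductExpectation.
Context {R : realType} {d1 d2 : measure_display} {T1 : measurableType d1} {T2 : measurableType d2}.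
Variables (P1 : probability T1 R) (P2 : probability T2 R).

Definition pprod : probability (T1 * T2)%type R := (P1 \x P2)%E.

Lemma measurable_section1 (f : T1 * T2 -> R) w1 : measurable_fun [set: _] f ->
  measurable_fun [set: T2] (fun w2 => f (w1, w2)).
Proof. by move=> mf; apply: measurableT_comp => //; exact: pair1_measurable. Qed.

Lemma Ex_fubini (f : T1 * T2 -> R) : measurable_fun [set: _] f -> (forall w, 0 <= f w) ->
  (forall w1, intg P2 (fun w2 => f (w1, w2))) ->
  intg P1 (fun w1 => Ex P2 (fun w2 => f (w1, w2))) ->
  intg pprod f /\ Ex pprod f = Ex P1 (fun w1 => Ex P2 (fun w2 => f (w1, w2))).
Proof.
move=> mf f0 i2 i1; have mfE : measurable_fun [set: _] (EFin \o f) by exact/measurable_EFinP.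
have f0E w : (0 <= (EFin \o f) w)%E by rewrite lee_fin.
have e := fubini_tonelli1 (m1 := P1) (m2 := P2) _ mfE f0E.
have e1 : (\int[P1]_w1 fubini_F P2 (EFin \o f) w1 = (Ex P1 (fun w1 => Ex P2 (fun w2 => f (w1, w2))))%:E)%E.
  by rewrite EFin_Ex //; apply: eq_integral => w1 _; rewrite /fubini_F /= EFin_Ex.
rewrite e1 in e.
have ig : intg pprod f.
  apply/integrableP; split => //; under eq_integral do rewrite /= ger0_norm //.
  by rewrite [X in (X < _)%E]e ltry.
by split => //; apply/EFin_inj; rewrite EFin_Ex.
Qed.

Lemma Ex_fubini_mf (f : T1 * T2 -> R) : measurable_fun [set: _] f -> (forall w, 0 <= f w) ->
  measurable_fun [set: T1] (fun w1 => Ex P2 (fun w2 => f (w1, w2))).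
Proof.
move=> mf f0; have mfE : measurable_fun [set: _] (EFin \o f) by exact/measurable_EFinP.
have f0E w : (0 <= (EFin \o f) w)%E by rewrite lee_fin.
have h := measurable_fun_fubini_tonelli_F (m2 := P2) _ mfE f0E.
exact: (measurableT_comp (fine_measurable _) h).
Qed.

(** Tonelli's theorem for the nonnegative function f + M; the constant M is then cancelled on both
    sides. *)
Lemma Ex_fubini_bounded (f : T1 * T2 -> R) M : measurable_fun [set: _] f -> (forall w, `|f w| <= M) ->
  Ex pprod f = Ex P1 (fun w1 => Ex P2 (fun w2 => f (w1, w2))).
Proof.
move=> mf fM; pose g w := f w + M.
have g0 w : 0 <= g w by rewrite -lerBlDr sub0r; have := fM w; rewrite ler_norml => /andP[].
have mg : measurable_fun [set: _] g by exact: measurable_funD.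
have i2 w1 : intg P2 (fun w2 => f (w1, w2)).
  by apply: (@intg_bounded _ _ _ _ _ M) => //; exact: measurable_section1.
have mF := Ex_fubini_mf mg g0.
have gE w1 : Ex P2 (fun w2 => g (w1, w2)) = Ex P2 (fun w2 => f (w1, w2)) + M.
  by rewrite ExD ?Ex_cst //; exact: intg_cst.
have i1 : intg P1 (fun w1 => Ex P2 (fun w2 => g (w1, w2))).
  apply: (@intg_bounded _ _ _ _ _ (M + M)) => // w1; rewrite ger0_norm ?Ex_ge0 // gE lerD2r.
  rewrite -[leRHS](Ex_cst P2); apply: Ex_le => // [|w2]; first exact: intg_cst.
  by rewrite (le_trans (ler_norm _)).
have [ig e] := Ex_fubini mg g0 (fun w1 => intgD (i2 w1) (intg_cst P2 M)) i1.
have if_ : intg pprod f by exact: (@intg_bounded _ _ _ _ _ M).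
move: e; rewrite ExD ?Ex_cst //; last exact: intg_cst.
rewrite (_ : Ex P1 _ = Ex P1 (fun w1 => Ex P2 (fun w2 => f (w1, w2)) + M)); last exact: eq_Ex.
rewrite ExD ?Ex_cst; [exact: addIr| |exact: intg_cst].
rewrite (_ : (fun _ => _) = fun w1 => Ex P2 (fun w2 => g (w1, w2)) - M).
  by apply: intgB => //; exact: intg_cst.
by apply/funext => w1; rewrite gE addrK.
Qed.

End ProductExpectation.

Lemma Ex_swap {R : realType} {d1 d2} {T1 : measurableType d1} {T2 : measurableType d2}
    (P1 : probability T1 R) (P2 : probability T2 R) (f : T1 -> T2 -> R) :
  measurable_fun [set: T1 * T2] (fun w => f w.1 w.2) -> (forall w1 w2, 0 <= f w1 w2) ->
  (forall w1, intg P2 (f w1)) -> (forall w2, intg P1 (fun w1 => f w1 w2)) ->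
  Ex P1 (fun w1 => Ex P2 (f w1)) = Ex P2 (fun w2 => Ex P1 (fun w1 => f w1 w2)).
Proof.
move=> mf f0 i1 i2; rewrite /Ex {1 3}/Rintegral.
have mfE : measurable_fun [set: T1 * T2] (fun w => (f w.1 w.2)%:E) by exact/measurable_EFinP.
have f0E w : (0 <= (fun w : T1 * T2 => (f w.1 w.2)%:E) w)%E by rewrite lee_fin.
have := fubini_tonelli (m1 := P1) (m2 := P2) _ mfE f0E; rewrite /fubini_F /fubini_G /= => e; congr fine.
transitivity (\int[P1]_x \int[P2]_y (f x y)%:E)%E.
  by apply: eq_integral => w _; rewrite EFin_Ex.
by rewrite e; apply: eq_integral => w _; rewrite EFin_Ex.
Qed.

Lemma natr_bool01 (R : numDomainType) (b : bool) : 0 <= (b%:R : R) <= 1.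
Proof. by rewrite ler0n lern1 leq_b1. Qed.

(** * Continuous functions of finitely many variables and their step approximations *)

Section Cont.
Variables (R : realType) (I : finType).
Implicit Types (x y a b : I -> R) (phi psi : (I -> R) -> R).

(** Continuity for the sup distance; as [I] is finite this is the usual topology of R^I. *)
Definition cont phi := forall x (e : R), 0 < e ->
  exists2 dl : R, 0 < dl & forall y, (forall i, `|y i - x i| < dl) -> `|phi y - phi x| < e.

Lemma contD phi psi : cont phi -> cont psi -> cont (fun x => phi x + psi x).
Proof.
move=> c1 c2 x e e0; have e2 : 0 < e / 2 by rewrite divr_gt0.
have [d1 d10 h1] := c1 x _ e2; have [d2 d20 h2] := c2 x _ e2.
exists (Num.min d1 d2); first by rewrite lt_min d10.
move=> y hy; rewrite opprD addrACA (splitr e) (le_lt_trans (ler_normD _ _)) // ltrD //.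
  by apply: h1 => i; have := hy i; rewrite lt_min => /andP[].
by apply: h2 => i; have := hy i; rewrite lt_min => /andP[].
Qed.

Lemma cont_comp (f : R -> R) phi : continuous f -> cont phi -> cont (fun x => f (phi x)).
Proof.
move=> cf c x e e0; have /cvgr_dist_lt /(_ e e0) := cf (phi x).
move=> /nbhs_ballP[r /= r0 hr]; have [dl dl0 h] := c x _ r0.
exists dl => // y hy; rewrite distrC; apply: hr; rewrite /ball /= distrC; exact: h.
Qed.

Lemma cont_abs phi : cont phi -> cont (fun x => `|phi x|).
Proof.
move=> c x e e0; have [dl dl0 h] := c x _ e0; exists dl => // y hy.
by apply: le_lt_trans (h y hy); exact: ler_dist_dist.
Qed.

Lemma cont_cst (c : R) : cont (fun=> c).
Proof. by move=> x e e0; exists 1 => // y _; rewrite subrr normr0. Qed.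

Lemma contZ (c : R) phi : cont phi -> cont (fun x => c * phi x).
Proof. by apply: cont_comp; exact: mulrl_continuous. Qed.

Lemma cont_min phi (M : R) : cont phi -> cont (fun x => Num.min (phi x) M).
Proof.
move=> c; rewrite (_ : (fun x => _) = fun x => 2^-1 * (phi x + M + (-1) * `|phi x + - M|)).
  apply: contZ; apply: contD; first by apply: contD => //; exact: cont_cst.
  by apply: contZ; apply: cont_abs; apply: contD => //; exact: cont_cst.
by apply/funext => x; rewrite minr_absE mulN1r mulrC.
Qed.

Definition box a b x : R := \prod_i ((a i < x i) && (x i <= b i))%:R.

Lemma box_ge0 a b x : 0 <= box a b x.
Proof. by rewrite /box prodr_ge0. Qed.

(** Mesh 1 / (k + 1) starting at - (k + 1). The [ncell k] cells end at k + 1, so the half-open cells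
    tile a cube that exhausts the space while the mesh shrinks. *)
Definition grid k (j : nat) : R := j%:R / k.+1%:R - k.+1%:R.

Lemma grid_sum k n (t : R) :
  \sum_(j < n) ((grid k j < t) && (t <= grid k j.+1))%:R =
  ((grid k 0 < t) && (t <= grid k n))%:R :> R.
Proof.
have mono m1 m2 : (m1 <= m2)%N -> grid k m1 <= grid k m2.
  by move=> le; rewrite lerD2r ler_pM2r ?invr_gt0 ?ltr0n // ler_nat.
elim: n => [|n IH].
  by rewrite big_ord0; case: ltP => //= h; rewrite leNgt h.
rewrite big_ord_recr /= IH; have h0 := mono 0 n isT; have h1 := mono n n.+1 (leqnSn n).
case: (ltP (grid k 0) t) => a0; case: (leP t (grid k n)) => an; case: (ltP (grid k n) t) => bn;
  case: (leP t (grid k n.+1)) => cn; rewrite ?addr0 ?add0r //; lra.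
Qed.

Definition ncell k := (2 * k.+1 * k.+1)%N.

(** The value of [phi] at the upper corner of the cell of x, a corner that belongs to the half-open
    cell; outside the cube the sum is 0. *)
Definition stepf k phi x : R := \sum_(j : {ffun I -> 'I_(ncell k)})
  phi (fun i => grid k (j i).+1) * box (fun i => grid k (j i)) (fun i => grid k (j i).+1) x.

Lemma box_sum k x : \sum_(j : {ffun I -> 'I_(ncell k)})
    box (fun i => grid k (j i)) (fun i => grid k (j i).+1) x =
  \prod_i ((grid k 0 < x i) && (x i <= grid k (ncell k)))%:R.
Proof.
rewrite -(bigA_distr_bigA (fun i (j : 'I_(ncell k)) => ((grid k j < x i) && (x i <= grid k j.+1))%:R)).
by apply: eq_bigr => i _; exact: grid_sum.
Qed.

Lemma grid_ncell k : grid k (ncell k) = k.+1%:R.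
Proof. by rewrite /grid /ncell !natrM mulfK ?pnatr_eq0 //; ring. Qed.

Lemma box_sum_le1 k x : \sum_(j : {ffun I -> 'I_(ncell k)})
    box (fun i => grid k (j i)) (fun i => grid k (j i).+1) x <= 1.
Proof.
by rewrite box_sum prodr_ile1 // => i _; exact: natr_bool01.
Qed.

Lemma stepf_cvg phi x : cont phi -> stepf k phi x @[k --> \oo] --> phi x.
Proof.
move=> c; apply/cvgrPdist_le => e e0; have [dl dl0 h] := c x _ e0.
near=> k.
have dk : k.+1%:R^-1 < dl.
  by near: k; apply: (@cvgr_lt _ _ _ _ _ 0 (@cvg_harmonic R) dl dl0).
have xk : forall i, `|x i| < k.+1%:R.
  move=> i; apply: (@le_lt_trans _ _ (\sum_i `|x i|)).
    by rewrite (bigD1 i) //= lerDl sumr_ge0.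
  apply: (@le_lt_trans _ _ k%:R); last by rewrite ltr_nat.
  by near: k; exact: nbhs_infty_ger.
have s1 : \sum_(j : {ffun I -> 'I_(ncell k)})
    box (fun i => grid k (j i)) (fun i => grid k (j i).+1) x = 1.
  rewrite box_sum big1 // => i _; rewrite grid_ncell /grid mul0r sub0r.
  by have := xk i; rewrite ltr_norml => /andP[-> /ltW ->].
rewrite -[phi x]mulr1 -s1 mulr_sumr -sumrB (le_trans (ler_norm_sum _ _ _)) //.
rewrite -[leRHS]mulr1 -[X in _ <= _ * X]s1 mulr_sumr; apply: ler_sum => j _.
rewrite -mulrBl normrM (ger0_norm (box_ge0 _ _ _)).
have [->|] := eqVneq (box (fun i => grid k (j i)) (fun i => grid k (j i).+1) x) 0.
  by rewrite !mulr0.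
move=> /prodf_neq0 bx; rewrite ler_wpM2r ?box_ge0 // ltW // distrC; apply: h => i.
have := bx i isT; rewrite pnatr_eq0 eqb0 negbK => /andP[h1 h2].
rewrite ger0_norm ?subr_ge0 //; apply: lt_trans dk.
rewrite ltrBlDl -ltrBlDr; apply: le_lt_trans h1; rewrite /grid -natr1 mulrDl mul1r.
by rewrite addrAC addrK.
Unshelve. all: by end_near.
Qed.

End Cont.

(** * Equality in law and the transfer of expectations *)

Section EqLaw.
Context {R : realType} {I : finType}.
Implicit Types (a b : I -> R) (phi : (I -> R) -> R).

Definition rvec {d} {T : measurableType d} (U : T -> I -> R) :=
  forall i, measurable_fun [set: T] (fun w => U w i).

Lemma measurable_box d (T : measurableType d) (U : T -> I -> R) a b :
  rvec U -> measurable_fun [set: T] (fun w => box a b (U w)).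
Proof.
move=> mU; apply: measurable_prod => i _.
apply: measurableT_comp; first by [].
apply: measurableT_comp; first by [].
by apply: measurable_and; [exact: measurable_fun_ltr|exact: measurable_fun_ler].
Qed.

Lemma measurable_stepf d (T : measurableType d) (U : T -> I -> R) k phi :
  rvec U -> measurable_fun [set: T] (fun w => stepf k phi (U w)).
Proof.
move=> mU; apply: measurable_sum => j; apply: measurable_funM; first exact: measurable_cst.
exact: measurable_box.
Qed.

Lemma measurable_cont d (T : measurableType d) (U : T -> I -> R) phi :
  cont phi -> rvec U -> measurable_fun [set: T] (fun w => phi (U w)).
Proof.
move=> c mU; apply: (@measurable_fun_cvg _ _ _ _ (fun k w => stepf k phi (U w))).
  by move=> k; exact: measurable_stepf.
by move=> w _; exact: stepf_cvg.
Qed.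

Section two.
Context {d1 d2 : measure_display} {T1 : measurableType d1} {T2 : measurableType d2}.
Variables (P1 : probability T1 R) (P2 : probability T2 R).
Variables (U : T1 -> I -> R) (V : T2 -> I -> R).
Hypotheses (mU : rvec U) (mV : rvec V).

(** Tested on half-open boxes only, which is what step functions require. Expectations of continuous
    functions follow below. *)
Definition eqlaw := forall a b, Ex P1 (fun w => box a b (U w)) = Ex P2 (fun w => box a b (V w)).

Hypothesis UV : eqlaw.

Lemma intg_box d (T : measurableType d) (P : probability T R) (X : T -> I -> R) a b :
  rvec X -> intg P (fun w => box a b (X w)).
Proof.
move=> mX; apply: (@intg_bounded _ _ _ _ _ 1); first exact: measurable_box.
move=> w; by rewrite ger0_norm ?box_ge0 // prodr_ile1 // => i _; exact: natr_bool01.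
Qed.

Lemma eqlaw_bounded phi (M : R) : cont phi -> (forall x, 0 <= phi x <= M) ->
  Ex P1 (fun w => phi (U w)) = Ex P2 (fun w => phi (V w)).
Proof.
move=> c phiM.
have lim d (T : measurableType d) (P : probability T R) (X : T -> I -> R) : rvec X ->
    Ex P (fun w => stepf k phi (X w)) @[k --> \oo] --> Ex P (fun w => phi (X w)).
  move=> mX; have [] // := @Ex_cvg _ _ _ P (fun k w => stepf k phi (X w))
      (fun w => phi (X w)) (fun=> M).
  - by move=> k; exact: measurable_stepf.
  - by move=> w; exact: stepf_cvg.
  - exact: intg_cst.
  - move=> k w; have M0 : 0 <= M by have /andP[] := phiM (X w); exact: le_trans.
    rewrite ger0_norm; last first.
      by rewrite sumr_ge0 // => j _; rewrite mulr_ge0 ?box_ge0 //; have /andP[] := phiM (fun i => grid R k (j i).+1).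
    rewrite -[leRHS]mulr1 (le_trans _ (ler_wpM2l M0 (box_sum_le1 k (X w)))) //.
    rewrite mulr_sumr; apply: ler_sum => j _; rewrite ler_wpM2r ?box_ge0 //.
    by have /andP[] := phiM (fun i => grid R k (j i).+1).
have l1 := lim _ _ P1 _ mU; have l2 := lim _ _ P2 _ mV.
suff e : (fun k => Ex P1 (fun w => stepf k phi (U w))) = (fun k => Ex P2 (fun w => stepf k phi (V w))).
  by rewrite e in l1; exact: cvg_unique l1 l2.
apply/funext => k; rewrite !Ex_sum; try by move=> j; apply: intgZ; exact: intg_box.
by apply: eq_bigr => j _; rewrite !ExZ; [rewrite UV|exact: intg_box..].
Qed.

(** The truncations min (phi, n) increase to [phi]. Being an identity between extended integrals, it
    also transfers integrability from one space to the other. *)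
Lemma eqlaw_ge0 phi : cont phi -> (forall x, 0 <= phi x) ->
  (\int[P1]_w (phi (U w))%:E = \int[P2]_w (phi (V w))%:E)%E.
Proof.
move=> c phi0; pose ph (n : nat) x := Num.min (phi x) n%:R.
have cph n : cont (ph n) by exact: cont_min.
have ph0 n x : 0 <= ph n x <= n%:R.
  by rewrite /ph le_min phi0 ler0n /= ge_min lexx orbT.
have mono d (T : measurableType d) (P : probability T R) (X : T -> I -> R) : rvec X ->
    (\int[P]_w (ph n (X w))%:E)%E @[n --> \oo] --> (\int[P]_w (phi (X w))%:E)%E.
  move=> mX; rewrite (_ : (\int[P]_w (phi (X w))%:E)%E =
     (\int[P]_w (limn (fun n => (ph n (X w))%:E)))%E); last first.
    apply: eq_integral => w _; apply/esym/cvg_lim => //; apply: cvg_EFin.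
      exact: nearW.
    apply: cvg_near_cst; near=> n; rewrite /ph /= min_l //.
    by near: n; exact: nbhs_infty_ger.
  apply: cvg_monotone_convergence => //.
  - by move=> n; apply/measurable_EFinP; exact: measurable_cont.
  - by move=> n w _; rewrite lee_fin; have /andP[] := ph0 n (X w).
  - move=> w _ n m nm; rewrite lee_fin /ph le_min ge_min lexx /= ge_min.
    by rewrite ler_nat nm orbT.
have l1 := mono _ _ P1 _ mU; have l2 := mono _ _ P2 _ mV.
suff e : (fun k => \int[P1]_w (ph k (U w))%:E)%E = (fun k => (\int[P2]_w (ph k (V w))%:E)%E).
  by rewrite e in l1; exact: cvg_unique l1 l2.
apply/funext => n; rewrite -!EFin_Ex; last 2 first.
- apply: (@intg_bounded _ _ _ _ _ n%:R); first exact: measurable_cont.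
  by move=> w; have /andP[h1 h2] := ph0 n (V w); rewrite ger0_norm.
- apply: (@intg_bounded _ _ _ _ _ n%:R); first exact: measurable_cont.
  by move=> w; have /andP[h1 h2] := ph0 n (U w); rewrite ger0_norm.
by rewrite (eqlaw_bounded (M := n%:R)).
Unshelve. all: by end_near.
Qed.

Lemma eqlaw_intg phi : cont phi -> intg P1 (fun w => phi (U w)) ->
  intg P2 (fun w => phi (V w)).
Proof.
move=> c /integrableP[_ h]; apply/integrableP; split.
  by apply/measurable_EFinP; exact: measurable_cont.
move: h => /=; under eq_integral do rewrite /=.
by rewrite (eqlaw_ge0 (cont_abs c)).
Qed.

Lemma eqlaw_Ex_ge0 phi : cont phi -> (forall x, 0 <= phi x) ->
  Ex P1 (fun w => phi (U w)) = Ex P2 (fun w => phi (V w)).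
Proof. by move=> c phi0; rewrite /Ex /Rintegral eqlaw_ge0. Qed.

Lemma eqlaw_Ex phi : cont phi -> intg P1 (fun w => phi (U w)) ->
  Ex P1 (fun w => phi (U w)) = Ex P2 (fun w => phi (V w)).
Proof.
move=> c i1; have i2 := eqlaw_intg c i1.
have ca := cont_abs c; have ia1 := intg_abs i1; have ia2 := intg_abs i2.
have e1 : Ex P1 (fun w => `|phi (U w)|) = Ex P2 (fun w => `|phi (V w)|).
  by apply: (@eqlaw_Ex_ge0 (fun x => `|phi x|)) => // x; exact: normr_ge0.
have e2 : Ex P1 (fun w => phi (U w) + `|phi (U w)|) = Ex P2 (fun w => phi (V w) + `|phi (V w)|).
  by apply: (@eqlaw_Ex_ge0 (fun x => phi x + `|phi x|) (contD c ca)) => x; have := ler_norm (- phi x); rewrite normrN; lra.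
by move: e2; rewrite !ExD // e1; exact: addIr.
Qed.

End two.
End EqLaw.

(** * Laws are determined by cosines of linear forms *)

Section AbsIteration.
Variable R : realType.
Implicit Types y : R.

(* Polynomials in y converging to |y| on [-1, 1]; through them absolute values,
   hence indicators of half-spaces, are limits of trigonometric polynomials. *)
Fixpoint absit k y : R := if k is k'.+1 then absit k' y + (y * y - absit k' y * absit k' y) / 2 else 0.

(** With t = |y|, one step from q multiplies the gap t - q by 1 - (t + q) / 2, which is at most 1 -
    t / 2. The iteration depends on y through y * y only, so y may be replaced by t. *)
Lemma absit_bounds k y : `|y| <= 1 -> 0 <= absit k y /\ 0 <= `|y| - absit k y <= (1 - `|y| / 2) ^+ k.
Proof.
move=> y1; have y0 := normr_ge0 y; rewrite (_ : absit k y = absit k `|y|); last first.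
  have e : `|y| * `|y| = y * y by rewrite -expr2 real_normK // num_real.
  by elim: k => //= k ->; rewrite e.
move: `|y| y0 y1 => t t0 t1; elim: k => [|k [h1 /andP[h2 h3]]] /=; first by split; lra.
move: h1 h2 h3; move: (absit k t) => q q0 qt qk.
have e : t - (q + (t * t - q * q) / 2) = (t - q) * (1 - (t + q) / 2) by field.
split; first nra.
rewrite e mulr_ge0 //=; last lra.
rewrite exprSr; apply: (@le_trans _ _ ((t - q) * (1 - t / 2))).
  by rewrite ler_wpM2l //; lra.
by rewrite ler_wpM2r //; lra.
Qed.

Lemma cvg_absit y : `|y| <= 1 -> absit k y @[k --> \oo] --> `|y|.
Proof.
move=> y1; have [->|y0] := eqVneq y 0.
  rewrite normr0; apply: cvg_near_cst; apply: nearW => k.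
  by elim: k => //= k ->; rewrite !mulr0 subrr mul0r addr0.
have y0' : 0 < `|y| by rewrite normr_gt0.
have c : (1 - `|y| / 2) ^+ k @[k --> \oo] --> (0 : R).
  by apply: cvg_expr; rewrite ger0_norm; lra.
apply/cvgrPdist_le => e e0; move/cvgrPdist_le : c => /(_ e e0); apply: filterS => k.
have [_ /andP[h2 h3]] := absit_bounds k y1.
rewrite sub0r normrN (ger0_norm h2) ger0_norm ?exprn_ge0 //; last lra.
exact: le_trans.
Qed.

End AbsIteration.

Section Determinacy.
Context {R : realType} {I : finType} {d1 d2 : measure_display}.
Context {T1 : measurableType d1} {T2 : measurableType d2}.
Variables (P1 : probability T1 R) (P2 : probability T2 R).
Variables (U : T1 -> I -> R) (V : T2 -> I -> R).
Hypotheses (mU : rvec U) (mV : rvec V).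
Implicit Types h m : (I -> R) -> R.

Definition dotv (c x : I -> R) := \sum_i c i * x i.

Hypothesis cosUV : forall c b, Ex P1 (fun w => cos (dotv c (U w) + b)) = Ex P2 (fun w => cos (dotv c (V w) + b)).

Let bm h := [/\ (exists M, forall x, `|h x| <= M), measurable_fun [set: T1] (fun w => h (U w))
  & measurable_fun [set: T2] (fun w => h (V w))].

Let tested h := bm h /\ forall c b, Ex P1 (fun w => h (U w) * cos (dotv c (U w) + b)) =
                                   Ex P2 (fun w => h (V w) * cos (dotv c (V w) + b)).

(** Multipliers of the class of tested functions. They form an algebra closed under bounded
    pointwise limits; starting from sines of coordinates, it is enlarged until it contains the
    indicators of boxes. *)
Let mult m := forall h, tested h -> tested (fun x => h x * m x).

Lemma measurable_dotv d (T : measurableType d) (X : T -> I -> R) c :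
  rvec X -> measurable_fun [set: T] (fun w => dotv c (X w)).
Proof. by move=> mX; apply: measurable_sum => i; apply: measurable_funM. Qed.

Lemma measurable_cos_dotv d (T : measurableType d) (X : T -> I -> R) c b :
  rvec X -> measurable_fun [set: T] (fun w => cos (dotv c (X w) + b)).
Proof.
move=> mX; apply: measurableT_comp; first by apply: continuous_measurable_fun; exact: continuous_cos.
by apply: measurable_funD => //; exact: measurable_dotv.
Qed.

Lemma norm_cos_le1 (x : R) : `|cos x| <= 1.
Proof. by rewrite ler_norml cos_geN1 cos_le1. Qed.

Lemma intg_mul_cos d (T : measurableType d) (P : probability T R) (X : T -> I -> R) h c b (M : R) :
  rvec X -> measurable_fun [set: T] (fun w => h (X w)) -> (forall x, `|h x| <= M) ->
  intg P (fun w => h (X w) * cos (dotv c (X w) + b)).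
Proof.
move=> mX mh hM; apply: (@intg_bounded _ _ _ _ _ M) => [|w].
  by apply: measurable_funM => //; exact: measurable_cos_dotv.
rewrite normrM -[leRHS]mulr1 ler_pM //; exact: norm_cos_le1.
Qed.

Lemma tested1 : tested (fun=> 1).
Proof.
split; first by split=> //; exists 1 => x; rewrite normr1.
move=> c b; transitivity (Ex P1 (fun w => cos (dotv c (U w) + b))).
  by apply: eq_Ex => w; rewrite mul1r.
by rewrite cosUV; apply: eq_Ex => w; rewrite mul1r.
Qed.

Lemma mult_ext m m' : (forall x, m x = m' x) -> mult m -> mult m'.
Proof. by move=> /funext ->. Qed.

Lemma mult_cst (a : R) : mult (fun=> a).
Proof.
move=> h [[[M hM] m1 m2] e]; split; first split.
- exists (M * `|a|) => x; rewrite normrM ler_wpM2r //.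
- by apply: measurable_funM.
- by apply: measurable_funM.
move=> c b; transitivity (a * Ex P1 (fun w => h (U w) * cos (dotv c (U w) + b))).
  by rewrite -ExZ; [apply: eq_Ex => w; ring|exact: intg_mul_cos hM].
by rewrite e -ExZ; [apply: eq_Ex => w; ring|exact: intg_mul_cos hM].
Qed.

Lemma multD m m' : mult m -> mult m' -> mult (fun x => m x + m' x).
Proof.
move=> h1 h2 h th; have [[[M hM] p1 p2] e] := h1 h th; have [[[M' hM'] p1' p2'] e'] := h2 h th.
split; first split.
- by exists (M + M') => x; rewrite mulrDr (le_trans (ler_normD _ _)) // lerD.
- by under eq_fun do rewrite mulrDr; exact: measurable_funD.
- by under eq_fun do rewrite mulrDr; exact: measurable_funD.
move=> c b.
transitivity (Ex P1 (fun w => h (U w) * m (U w) * cos (dotv c (U w) + b)) + Ex P1 (fun w => h (U w) * m' (U w) * cos (dotv c (U w) + b))).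
  by rewrite -ExD; [apply: eq_Ex => w; ring|exact: (intg_mul_cos _ _ _ mU p1 hM)|exact: (intg_mul_cos _ _ _ mU p1' hM')].
by rewrite e e' -ExD; [apply: eq_Ex => w; ring|exact: (intg_mul_cos _ _ _ mV p2 hM)|exact: (intg_mul_cos _ _ _ mV p2' hM')].
Qed.

Lemma multM m m' : mult m -> mult m' -> mult (fun x => m x * m' x).
Proof.
move=> h1 h2 h th; have := h2 _ (h1 h th); rewrite (_ : (fun x => h x * m x * m' x) = fun x => h x * (m x * m' x)) //.
by apply/funext => x; rewrite mulrA.
Qed.

Lemma mult_exp m k : mult m -> mult (fun x => m x ^+ k).
Proof.
move=> hm; elim: k => [|k IH]; first exact: (mult_cst 1).
by apply: (mult_ext _ (multM hm IH)) => x; rewrite exprS.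
Qed.

Lemma mult_lim (mk : nat -> (I -> R) -> R) m (M : R) : (forall k, mult (mk k)) ->
  (forall k x, `|mk k x| <= M) -> (forall x, mk k x @[k --> \oo] --> m x) -> mult m.
Proof.
move=> hk bk lk h th; have [[[B hB] q1 q2] _] := th.
have lim x a : h x * mk k x * a @[k --> \oo] --> h x * m x * a.
  by apply: cvgMl; apply: cvgMr; exact: lk.
have lim1 x : h x * mk k x @[k --> \oo] --> h x * m x by apply: cvgMr; exact: lk.
have bd k x : `|h x * mk k x| <= B * M by rewrite normrM ler_pM.
have mm1 : measurable_fun [set: T1] (fun w => h (U w) * m (U w)).
  apply: (@measurable_fun_cvg _ _ _ _ (fun k w => h (U w) * mk k (U w))) => [k|w _]; last exact: lim1.
  by have [[_ ? _] _] := hk k h th.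
have mm2 : measurable_fun [set: T2] (fun w => h (V w) * m (V w)).
  apply: (@measurable_fun_cvg _ _ _ _ (fun k w => h (V w) * mk k (V w))) => [k|w _]; last exact: lim1.
  by have [[_ _ ?] _] := hk k h th.
split; first split => //.
  exists (B * M) => x; have l : `|h x * mk k x| @[k --> \oo] --> `|h x * m x| by exact: cvg_norm.
  have l' : (fun _ : nat => B * M) k @[k --> \oo] --> B * M by exact: cvg_cst.
  by apply: (ler_cvg_to l l'); apply: nearW => k; exact: bd.
move=> c b.
have [] // := @Ex_cvg _ _ _ P1 (fun k w => h (U w) * mk k (U w) * cos (dotv c (U w) + b))
  (fun w => h (U w) * m (U w) * cos (dotv c (U w) + b)) (fun=> B * M).
- move=> k; apply: measurable_funM; last exact: measurable_cos_dotv.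
  by have [[_ ? _] _] := hk k h th.
- exact: intg_cst.
- by move=> k w; rewrite normrM -[leRHS]mulr1 ler_pM // norm_cos_le1.
move=> _ l1.
have [] // := @Ex_cvg _ _ _ P2 (fun k w => h (V w) * mk k (V w) * cos (dotv c (V w) + b))
  (fun w => h (V w) * m (V w) * cos (dotv c (V w) + b)) (fun=> B * M).
- move=> k; apply: measurable_funM; last exact: measurable_cos_dotv.
  by have [[_ _ ?] _] := hk k h th.
- exact: intg_cst.
- by move=> k w; rewrite normrM -[leRHS]mulr1 ler_pM // norm_cos_le1.
move=> _ l2.
suff e : (fun k => Ex P1 (fun w => h (U w) * mk k (U w) * cos (dotv c (U w) + b))) =
         (fun k => Ex P2 (fun w => h (V w) * mk k (V w) * cos (dotv c (V w) + b))).
  by rewrite e in l1; exact: cvg_unique l1 l2.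
by apply/funext => k; have [_ ->] := hk k h th.
Qed.

(** A product of a sine and a cosine is a combination of two cosines of other linear forms, and
    tested functions are tested against all [c] and [b]. *)
Lemma mult_sin i (a r : R) : mult (fun x => sin (r * (x i - a))).
Proof.
move=> h [[[M hM] m1 m2] e].
have ms d (T : measurableType d) (X : T -> I -> R) : rvec X ->
    measurable_fun [set: T] (fun w => sin (r * (X w i - a))).
  move=> mX; apply: measurableT_comp; first by apply: continuous_measurable_fun; exact: continuous_sin.
  by apply: measurable_funM => //; apply: measurable_funB.
split; first split.
- exists M => x; rewrite normrM -[leRHS]mulr1 ler_pM //.
  by rewrite ler_norml sin_geN1 sin_le1.
- by apply: measurable_funM => //; exact: ms.
- by apply: measurable_funM => //; exact: ms.
move=> c b; pose e_ i' : R := (i' == i)%:R * r.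
have eE x : dotv e_ x = r * x i.
  rewrite /dotv (bigD1 i) //= big1 ?addr0 /e_ ?eqxx ?mul1r // => j /negbTE ->.
  by rewrite !mul0r.
have dD x (c1 c2 : I -> R) : dotv (fun i => c1 i + c2 i) x = dotv c1 x + dotv c2 x.
  by rewrite /dotv -big_split /=; apply: eq_bigr => j _; rewrite mulrDl.
have dB x (c1 c2 : I -> R) : dotv (fun i => c1 i - c2 i) x = dotv c1 x - dotv c2 x.
  by rewrite /dotv -sumrB; apply: eq_bigr => j _; rewrite mulrBl.
have key x : h x * sin (r * (x i - a)) * cos (dotv c x + b) =
    2^-1 * (h x * cos (dotv (fun i => c i + e_ i) x + (b - r * a - pi / 2)) +
     - (h x * cos (dotv (fun i => c i - e_ i) x + (b + r * a - pi / 2)))).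
  have s t : cos (t - pi / 2) = sin t :> R by rewrite cosB cos_pihalf sin_pihalf; ring.
  rewrite !addrA !s dD dB eE.
  rewrite (_ : _ + _ + b - r * a = (dotv c x + b) + r * (x i - a)); last by ring.
  rewrite (_ : _ - _ + b + r * a = (dotv c x + b) - r * (x i - a)); last by ring.
  by rewrite sinD sinB; field.
transitivity (2^-1 * (Ex P1 (fun w => h (U w) * cos (dotv (fun i => c i + e_ i) (U w) + (b - r * a - pi / 2))) -
   Ex P1 (fun w => h (U w) * cos (dotv (fun i => c i - e_ i) (U w) + (b + r * a - pi / 2))))).
  rewrite -ExB; [|exact: intg_mul_cos hM..].
  rewrite -ExZ; first by apply: eq_Ex => w; exact: key.
  by apply: intgB; exact: intg_mul_cos hM.
rewrite !e -ExB; [|exact: intg_mul_cos hM..].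
rewrite -ExZ; first by apply: eq_Ex => w; rewrite key.
by apply: intgB; exact: intg_mul_cos hM.
Qed.

Lemma mult_absit m k : mult m -> mult (fun x => absit k (m x)).
Proof.
move=> hm; elim: k => [|k IH] /=; first exact: (mult_cst 0).
apply: multD => //; apply: (multM _ (mult_cst 2^-1)); apply: multD; first exact: multM.
by apply: (mult_ext _ (multM (mult_cst (-1)) (multM IH IH))) => x; rewrite mulN1r.
Qed.

Lemma mult_abs m : mult m -> (forall x, `|m x| <= 1) -> mult (fun x => `|m x|).
Proof.
move=> hm m1; apply: (@mult_lim (fun k x => absit k (m x)) _ 1).
- by move=> k; exact: mult_absit.
- move=> k x; have [h1 /andP[h2 _]] := absit_bounds k (m1 x); rewrite ger0_norm //.
  by have := m1 x; lra.
- by move=> x; exact: cvg_absit.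
Qed.

(** The indicator is the limit of 1 - (1 - p) ^ k, where p in [0, 1] is the positive part of m,
    obtained from the absolute value. *)
Lemma mult_pos m : mult m -> (forall x, `|m x| <= 1) -> mult (fun x => (0 < m x)%R%:R).
Proof.
move=> hm m1; have ha := mult_abs hm m1.
have hp : mult (fun x => 1 - (m x + `|m x|) / 2).
  apply: (mult_ext _ (multD (mult_cst 1) (multM (mult_cst (- 2^-1)) (multD hm ha)))) => x.
  by field.
have b01 x : 0 <= 1 - (m x + `|m x|) / 2 <= 1.
  by have := m1 x; have := ler_norm (m x); have := ler_norm (- m x); rewrite normrN; lra.
have hk k : mult (fun x => 1 - (1 - (m x + `|m x|) / 2) ^+ k).
  by apply: (mult_ext _ (multD (mult_cst 1) (multM (mult_cst (-1)) (mult_exp k hp)))) => x; rewrite mulN1r.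
apply: (mult_lim (M := 1) hk) => [k x|x].
  have /andP[b0 b1] := b01 x; rewrite ler_norml; have := exprn_ge0 k b0; have := exprn_ile1 k b0 b1.
  by lra.
case: ltP => h.
  rewrite -[X in _ --> X](subr0 1); apply: cvgB; first exact: cvg_cst.
  apply: cvg_expr; have /andP[b0 b1] := b01 x; rewrite ger0_norm // ger0_norm ?ltW //; lra.
rewrite ler0_norm // subrr mul0r subr0.
by apply: cvg_near_cst; apply: nearW => k; rewrite expr1n subrr.
Qed.

(** For a small enough frequency r, depending on x, the sine of r (x_i - a) has the sign of x_i -
    a. *)
Lemma mult_gt i a : mult (fun x => (a < x i)%R%:R).
Proof.
apply: (@mult_lim (fun k x => (0 < sin (k.+1%:R^-1 * (x i - a)))%R%:R) _ 1).
- move=> k; apply: mult_pos; first exact: mult_sin.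
  by move=> x; rewrite ler_norml sin_geN1 sin_le1.
- by move=> k x; rewrite ger0_norm // lern1 leq_b1.
move=> x; apply: cvg_near_cst; near=> k.
have k0 : 0 < (k.+1%:R^-1 : R) by rewrite invr_gt0.
have small : k.+1%:R^-1 * `|x i - a| < pi.
  rewrite mulrC ltr_pdivrMr // -ltr_pdivrMl ?pi_gt0 //.
  apply: (@le_lt_trans _ _ k%:R); last by rewrite ltr_nat.
  by near: k; exact: nbhs_infty_ger.
congr (nat_of_bool _)%:R; case: (ltP a (x i)) => h.
  by rewrite sin_gt0_pi // mulr_gt0 ?subr_gt0 //= (le_lt_trans _ small) // ler_wpM2l ?ler_norm // ltW.
apply/negbTE; rewrite -leNgt -oppr_ge0 -sinN; apply: sin_ge0_pi.
rewrite -mulrN opprB mulr_ge0 ?subr_ge0 //= ?ltW //.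
by apply: le_lt_trans small; rewrite ler_wpM2l ?(ltW k0) // distrC ler_norm.
Unshelve. all: by end_near.
Qed.

Lemma cos_eqlaw : eqlaw P1 P2 U V.
Proof.
move=> a b.
have hm : mult (box a b).
  have : forall s : seq I, mult (fun x => \prod_(i <- s) ((a i < x i) && (x i <= b i))%R%:R).
    elim=> [|i s IH].
      by apply: (mult_ext _ (mult_cst 1)) => x; rewrite big_nil.
    have := multM (multM (mult_gt i (a i)) (multD (mult_cst 1) (multM (mult_cst (-1)) (mult_gt i (b i))))) IH.
    apply: mult_ext => x; rewrite big_cons; congr (_ * _).
    by rewrite leNgt; case: (a i < _); case: (b i < _); rewrite /= ?mul0r ?mulr0 ?mulr1 ?mul1r ?subrr ?addr0.
  by move/(_ (index_enum I)).
have [_ /(_ (fun=> 0) 0) e] := hm _ tested1.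
have c0 x : cos (dotv (fun=> 0) x + 0) = 1 :> R.
  by rewrite /dotv big1 ?addr0 ?cos0 // => i _; rewrite mul0r.
transitivity (Ex P1 (fun w => 1 * box a b (U w) * cos (dotv (fun=> 0) (U w) + 0))).
  by apply: eq_Ex => w; rewrite c0 mulr1 mul1r.
by rewrite e; apply: eq_Ex => w; rewrite c0 mulr1 mul1r.
Qed.

End Determinacy.

(** * Gaussian vectors *)

Section NormalIntegral.
Variable R : realType.
Local Notation mu := (@lebesgue_measure R).

Lemma ge0_integral_normal_prob (m s : R) (f : R -> R) : measurable_fun [set: R] f ->
  (forall x, 0 <= f x) ->
  (\int[normal_prob m s]_x (f x)%:E = \int[mu]_x (f x * normal_pdf m s x)%:E)%E.
Proof.
move=> mf f0; have dom := normal_prob_dominates m s.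
have mfE : measurable_fun [set: R] (EFin \o f) by exact/measurable_EFinP.
have f0E x : (0 <= (EFin \o f) x)%E by rewrite lee_fin.
have mpdf : measurable_fun [set: R] (EFin \o normal_pdf m s).
  by apply/measurable_EFinP; exact: measurable_normal_pdf.
rewrite -(Radon_Nikodym_SigmaFinite.change_of_variables dom f0E measurableT mfE).
have ig := Radon_Nikodym_SigmaFinite.f_integrable dom.
apply: ae_eq_integral => //.
- by apply: emeasurable_funM => //; exact: measurable_int ig.
- by rewrite (_ : (fun x => _) = (EFin \o f) \* (EFin \o normal_pdf m s))%E //; exact: emeasurable_funM.
rewrite (_ : (fun x => (f x * _)%:E) = (EFin \o f) \* (EFin \o normal_pdf m s))%E //.
apply: ae_eqe_mul2l; apply: integral_ae_eq => // E _ mE.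
by rewrite -(Radon_Nikodym_SigmaFinite.f_integral dom mE).
Qed.

Lemma integral_translate (a : R) (f : R -> R) : continuous f -> (forall x, 0 <= f x) ->
  (\int[mu]_x (f x)%:E = \int[mu]_x (f (x + a))%:E)%E.
Proof.
move=> cf f0; pose F (x : R) := x + a.
have F'E : F^`()%classic = cst 1.
  apply/funext => x; rewrite /F derive1E deriveD // derive_id derive_cst addr0 //.
rewrite (@increasing_ge0_integration_by_substitutionT R F f) //.
- by apply: eq_integral => x _; rewrite F'E /= !fctE mulr1.
- by move=> x y xy; rewrite /F ltrD2r.
- by rewrite F'E => ?; exact: cvg_cst.
- by rewrite F'E; exact: is_cvg_cst.
- by rewrite F'E; exact: is_cvg_cst.
- exact: cvg_addrr_Ny.
- exact: cvg_addrr.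
Qed.

(** Cameron-Martin formula in dimension one: complete the square in the density, then translate by c
    s ^ 2. *)
Lemma normal_prob_shift (m s c : R) (f : R -> R) : s != 0 -> continuous f -> (forall x, 0 <= f x) ->
  (\int[normal_prob m s]_x (f x * expR (c * (x - m)))%:E =
   (expR (c ^+ 2 * s ^+ 2 / 2))%:E * \int[normal_prob m s]_x (f (x + c * s ^+ 2))%:E)%E.
Proof.
move=> s0 cf f0; have mf : measurable_fun [set: R] f by exact: continuous_measurable_fun.
have cft a : continuous (fun x => f (x + a)).
  by move=> x; apply: continuous_comp; [by apply: continuousD; [exact: cvg_id|exact: cvg_cst]|exact: cf].
have ce : continuous (fun x => expR (c * (x - m))).
  move=> x; apply: (@continuous_comp _ _ _ (fun x => c * (x - m)) expR); last exact: continuous_expR.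
  by apply: continuousM; [exact: cvg_cst|apply: continuousB; [exact: cvg_id|exact: cvg_cst]].
have cfe : continuous (fun x => f x * expR (c * (x - m))).
  by move=> x; apply: (@continuousM _ R _ _ x (cf x) (ce x)).
have cpdf := @continuous_normal_pdf R m s s0.
have mft a : measurable_fun [set: R] (fun x => f (x + a)).
  by apply: continuous_measurable_fun; exact: cft.
have mfe : measurable_fun [set: R] (fun x => f x * expR (c * (x - m))).
  apply: measurable_funM => //; apply: measurableT_comp => //.
  by apply: measurable_funM => //; apply: measurable_funB.
have fe0 x : 0 <= f x * expR (c * (x - m)) by rewrite mulr_ge0 ?expR_ge0.
rewrite (ge0_integral_normal_prob _ _ mfe fe0) (ge0_integral_normal_prob _ _ (mft _)) //.
rewrite -ge0_integralZl //; last 2 first.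
- apply/measurable_EFinP; apply: measurable_funM; last exact: measurable_normal_pdf.
  exact: mft.
- by move=> x _; rewrite lee_fin mulr_ge0 ?normal_pdf_ge0.
rewrite (@integral_translate (c * s ^+ 2)).
- apply: eq_integral => x _; rewrite -EFinM; congr EFin.
  rewrite normal_pdfE // /normal_fun -!mulrA [RHS]mulrCA; congr (_ * _).
  rewrite [LHS]mulrCA [RHS]mulrCA; congr (_ * _); rewrite -!expRD; congr expR.
  by field; rewrite s0.
- by move=> x; apply: (@continuousM _ R _ _ x (cfe x) (cpdf x)).
- by move=> x; rewrite !mulr_ge0 ?expR_ge0 ?normal_pdf_ge0.
Qed.

End NormalIntegral.

Section RealInequalities.
Variable R : realType.
Implicit Types x y h t : R.

Lemma expR_taylor1 y : 0 <= expR y - 1 - y <= y ^+ 2 * expR `|y|.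
Proof.
have e1 := expR_ge1Dx y; have e2 := expR_ge1Dx (- y); have p := expR_gt0 y; have q := expR_gt0 (- y).
have pq : expR y * expR (- y) = 1 by rewrite -expRD subrr expR0.
apply/andP; split; first lra.
have h : expR y * (1 - y) <= 1 by rewrite -pq ler_wpM2l //; lra.
case: (ger0P y) => y0.
  have h1 : y * (expR y - 1) <= y * (y * expR y) by rewrite ler_wpM2l //; lra.
  by rewrite expr2 -mulrA; lra.
have h1 : - y * (1 - expR y) <= - y * - y by rewrite ler_wpM2l //; lra.
have h2 : y ^+ 2 * 1 <= y ^+ 2 * expR (- y) by rewrite ler_wpM2l ?sqr_ge0 //; lra.
by rewrite mulrNN -expr2 in h1; lra.
Qed.

Lemma sqr_le_expR y : y ^+ 2 <= 2 * expR `|y|.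
Proof.
have := @expR_ge1Dxn R `|y| 1 (normr_ge0 y); rewrite real_normK ?num_real // (_ : 2`!%:R = 2) // => h.
have : y ^+ 2 / 2 <= expR `|y| by lra.
by lra.
Qed.

Lemma norm_sin_le x : `|sin x| <= `|x|.
Proof.
wlog x0 : x / 0 <= x.
  move=> wl; case: (lerP 0 x) => h; first exact: wl.
  by rewrite -normrN -sinN -[`|x|]normrN; apply: wl; lra.
have [|c _ e] := @MVT_segment R sin cos 0 x x0 (fun c _ => is_derive_sin c).
  by apply: continuous_subspaceT; exact: continuous_sin.
move: e; rewrite sin0 !subr0 => ->; rewrite normrM -[leRHS]mul1r ler_wpM2r //.
exact: norm_cos_le1.
Qed.

Lemma one_sub_cos x : 0 <= 1 - cos x <= x ^+ 2 / 2.
Proof.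
rewrite subr_ge0 cos_le1 /=.
have e : cos x = 1 - 2 * sin (x / 2) ^+ 2.
  rewrite {1}(_ : x = x / 2 + x / 2); last by field.
  by rewrite cosD -!expr2 cos2sin2; ring.
have := norm_sin_le (x / 2); rewrite -ler_sqr ?nnegrE // !real_normK ?num_real // => h.
by rewrite e; lra.
Qed.

Lemma sin_sub_id x : `|sin x - x| <= x ^+ 2.
Proof.
wlog x0 : x / 0 <= x.
  move=> wl; case: (lerP 0 x) => h; first exact: wl.
  by rewrite -normrN -(sqrrN x) opprD -sinN; apply: wl; lra.
have [|c /andP[c0 cx] e] := @MVT_segment R (fun x => sin x - x) (fun x => cos x - 1) 0 x x0 (fun c _ => is_deriveB _ _).
  apply: continuous_subspaceT => y; apply: continuousB; [exact: continuous_sin|exact: cvg_id].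
move: e c0 cx; rewrite sin0 !subr0 !bnd_simp => -> c0 cx.
rewrite normrM (ger0_norm x0) expr2 ler_wpM2r // distrC ger0_norm; last by have /andP[] := one_sub_cos c.
have /andP[_ h] := one_sub_cos c; have h2 := cos_geN1 c; apply: le_trans cx.
case: (lerP c 2) => h3; nra.
Qed.

Lemma sin_taylor x h : `|sin (x + h) - sin x - h * cos x| <= 2 * h ^+ 2.
Proof.
rewrite sinD (_ : _ - _ = - (sin x * (1 - cos h)) + cos x * (sin h - h)); last by ring.
have /andP[c0 c1] := one_sub_cos h; have s := sin_sub_id h.
apply: (le_trans (ler_normD _ _)); rewrite normrN !normrM (ger0_norm c0).
have s1 : `|sin x| <= 1 by rewrite ler_norml sin_geN1 sin_le1.
have c2 := norm_cos_le1 x.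
have := normr_ge0 (sin x); have := normr_ge0 (cos x); have := normr_ge0 (sin h - h).
by nra.
Qed.

Lemma cos_taylor x h : `|cos (x + h) - cos x + h * sin x| <= 2 * h ^+ 2.
Proof.
have e y : cos y = sin (y + pi / 2) :> R by rewrite sinD cos_pihalf sin_pihalf; ring.
have e' y : cos (y + pi / 2) = - sin y :> R by rewrite cosD cos_pihalf sin_pihalf; ring.
have := sin_taylor (x + pi / 2) h.
by rewrite (_ : x + pi / 2 + h = x + h + pi / 2) -?(e x) -?(e (x + h)) ?e' ?mulrN ?opprK //; ring.
Qed.

(** A quadratic error bound passes through an expectation, so with this criterion one differentiates
    under the expectation without dominating difference quotients. *)
Lemma is_derive_quadratic (f : R -> R) t l K :
  (forall h, `|f (t + h) - f t - h * l| <= K * h ^+ 2) -> is_derive t 1 f l.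
Proof.
move=> H; have K0 : 0 <= K by have := H 1; rewrite expr1n mulr1; exact: le_trans.
have c : h^-1 *: (f (h *: 1 + t) - f t) @[h --> 0^'] --> l.
  apply/cvgrPdist_le => e e0; near=> h.
  have h0 : h != 0 by near: h; exact: nbhs_dnbhs_neq.
  have hs : `|h| <= e / (K + 1).
    near: h; apply: dnbhs0_le; rewrite divr_gt0 //; lra.
  have hh := H h; rewrite [t + h]addrC in hh; rewrite scaler1.
  rewrite distrC (_ : _ - l = h^-1 * (f (h + t) - f t - h * l)); last first.
    by rewrite /GRing.scale /=; field.
  rewrite normrM normfV ler_pdivrMl ?normr_gt0 // (le_trans hh) //.
  rewrite -real_normK ?num_real //; move: hs; rewrite ler_pdivlMr; last lra.
  by have := normr_ge0 h; nra.
by apply: DeriveDef; [apply/cvg_ex; exists l|exact: cvg_lim].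
Unshelve. all: by end_near.
Qed.

End RealInequalities.

(** * One-dimensional Gaussian variables, all facts drawn from the shift identity *)

Section GaussianVariable.
Context {R : realType} {dT : measure_display} {T : measurableType dT}.
Variable P : probability T R.
Implicit Types (f : R -> R) (c t b : R).

(** A single identity for both cases of the definition: for a point mass v = 0 and it is trivial,
    otherwise v = s ^ 2. Moments, integrability and the characteristic function below use nothing
    else about the law. *)
Lemma gaussian_shift (Z : T -> R) : gaussian_rv P Z ->
  exists m v : R, 0 <= v /\ forall f c, continuous f -> (forall x, 0 <= f x) ->
  (\int[P]_w (f (Z w - m) * expR (c * (Z w - m)))%:E =
   (expR (c ^+ 2 * v / 2))%:E * \int[P]_w (f (Z w - m + c * v))%:E)%E.
Proof.
case=> mZ [m [s law]].
have push (nu : {measure set (measurableTypeR R) -> \bar R}) (g : R -> R) : measurable_fun [set: R] g -> (forall x, 0 <= g x) ->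
    (forall A, measurable A -> P (Z @^-1` A) = nu A) ->
    (\int[P]_w (g (Z w))%:E = \int[nu]_x (g x)%:E)%E.
  move=> mg g0 e; transitivity (\int[pushforward P (Z : T -> measurableTypeR R)]_x (g x)%:E)%E.
    rewrite ge0_integral_pushforward //; first by apply/measurable_EFinP.
    by move=> x _; rewrite lee_fin.
  by apply: eq_measure_integral => A mA _; exact: e.
exists m, (s ^+ 2); split; first exact: sqr_ge0.
move=> f c cf f0.
have cfs a : continuous (fun x => f (x - m + a)).
  move=> x; apply: (@continuous_comp _ _ _ (fun x => x - m + a) f); last exact: cf.
  by apply: continuousD; [apply: continuousB; [exact: cvg_id|exact: cvg_cst]|exact: cvg_cst].
have mfs a : measurable_fun [set: R] (fun x => f (x - m + a)).
  by apply: continuous_measurable_fun; exact: cfs.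
have mfs0 : measurable_fun [set: R] (fun x => f (x - m)).
  by rewrite (_ : (fun x => _) = (fun x => f (x - m + 0))) //; apply/funext => x; rewrite addr0.
have me : measurable_fun [set: R] (fun x => f (x - m) * expR (c * (x - m))).
  apply: measurable_funM => //; apply: measurableT_comp => //.
  by apply: measurable_funM => //; apply: measurable_funB.
have e0 x : 0 <= f (x - m) * expR (c * (x - m)) by rewrite mulr_ge0 ?expR_ge0.
have [s0|s0] := eqVneq s 0.
  have law0 A : measurable A -> P (Z @^-1` A) = (@dirac _ (measurableTypeR R) m R) A.
    by move=> mA; rewrite law // s0 eqxx.
  rewrite (push _ _ me e0 law0) (push _ _ (mfs _) (fun=> f0 _) law0).
  have idir (g : R -> R) : measurable_fun [set: R] g ->
      (\int[@dirac _ (measurableTypeR R) m R]_x (g x)%:E = (g m)%:E)%E.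
    move=> mg; rewrite integral_dirac //; first by rewrite diracT mul1e.
    by apply/measurable_EFinP.
  rewrite (idir _ me) (idir _ (mfs _)).
  by rewrite s0 expr0n /= !mulr0 mul0r addr0 subrr mulr0 expR0 mulr1 mul1e.
have law1 A : measurable A -> P (Z @^-1` A) = normal_prob m s A.
  by move=> mA; rewrite law // (negbTE s0).
rewrite (push _ _ me e0 law1) (push _ _ (mfs _) (fun=> f0 _) law1).
rewrite (@normal_prob_shift R m s c (fun x => f (x - m))) //.
- by congr (_ * _)%E; apply: eq_integral => x _; rewrite addrAC.
- by rewrite (_ : (fun x => _) = (fun x => f (x - m + 0))) //; apply/funext => x; rewrite addr0.
Qed.

Section Centered.
Variables (eta : T -> R) (v : R).
Hypotheses (meta : measurable_fun [set: T] eta) (v0 : 0 <= v).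
Hypothesis shiftE : forall f c, continuous f -> (forall x, 0 <= f x) ->
  (\int[P]_w (f (eta w) * expR (c * eta w))%:E =
   (expR (c ^+ 2 * v / 2))%:E * \int[P]_w (f (eta w + c * v))%:E)%E.

Let mexp c : measurable_fun [set: T] (fun w => expR (c * eta w)).
Proof. by apply: measurableT_comp => //; apply: measurable_funM. Qed.

Let cont1 : continuous (fun _ : R => 1 : R).
Proof. by move=> x; exact: cvg_cst. Qed.

Lemma shift_intg_expR c : intg P (fun w => expR (c * eta w)).
Proof.
apply/integrableP; split; first by apply/measurable_EFinP; exact: mexp.
have := @shiftE (fun=> 1) c cont1 (fun=> ler01).
under eq_integral do rewrite mul1r.
under [in RHS]eq_integral do rewrite /=.
rewrite integral_cst // mul1e [X in (_ * X)%E](_ : _ = 1%E); last exact: probability_setT.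
move=> e; under eq_integral do rewrite /= gtr0_norm ?expR_gt0 //.
by rewrite e mule1 ltry.
Qed.

Lemma shift_intg_expR_abs c : 0 <= c -> intg P (fun w => expR (c * `|eta w|)).
Proof.
move=> c0; apply: (@intg_le _ _ _ _ _ (fun w => expR (c * eta w) + expR (- c * eta w))).
- by apply: measurableT_comp => //; apply: measurable_funM => //; apply: measurableT_comp.
- move=> w; rewrite gtr0_norm ?expR_gt0 //.
  case: (ger0P (eta w)) => h; first by rewrite lerDl expR_ge0.
  by rewrite mulrN mulNr lerDr expR_ge0.
- by apply: intgD; exact: shift_intg_expR.
Qed.

Lemma shift_intg_sqr_expR : intg P (fun w => eta w ^+ 2 * expR `|eta w|).
Proof.
apply: (@intg_le _ _ _ _ _ (fun w => 2 * expR (2 * `|eta w|))).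
- apply: measurable_funM; first by apply: measurable_funX.
  by apply: measurableT_comp => //; apply: measurableT_comp.
- move=> w; rewrite (ger0_norm (mulr_ge0 (sqr_ge0 _) (expR_ge0 _))).
  by rewrite [2 * `|_|]mulr_natl mulr2n expRD mulrA ler_wpM2r ?expR_ge0 // sqr_le_expR.
- by apply: intgZ; exact: shift_intg_expR_abs.
Qed.

Lemma shift_intg_sqr : intg P (fun w => eta w ^+ 2).
Proof.
apply: (intg_le _ _ shift_intg_sqr_expR); first by apply: measurable_funX.
move=> w; rewrite ger0_norm ?sqr_ge0 // -[leLHS]mulr1 ler_wpM2l ?sqr_ge0 //.
by rewrite -expR0 ler_expR.
Qed.

Lemma shift_intg1 : intg P eta.
Proof.
apply: (@intg_le _ _ _ _ _ (fun w => 1 + eta w ^+ 2)) => //.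
  move=> w; rewrite -real_normK ?num_real //; have := normr_ge0 (eta w); nra.
by apply: intgD; [exact: intg_cst|exact: shift_intg_sqr].
Qed.

Lemma measurable_sin_eta t b : measurable_fun [set: T] (fun w => sin (t * eta w + b)).
Proof.
apply: measurableT_comp; first by apply: continuous_measurable_fun; exact: continuous_sin.
by apply: measurable_funD => //; apply: measurable_funM.
Qed.

Lemma measurable_cos_eta t b : measurable_fun [set: T] (fun w => cos (t * eta w + b)).
Proof.
apply: measurableT_comp; first by apply: continuous_measurable_fun; exact: continuous_cos.
by apply: measurable_funD => //; apply: measurable_funM.
Qed.

Lemma norm_sin_le1 x : `|sin x| <= 1 :> R.
Proof. by rewrite ler_norml sin_geN1 sin_le1. Qed.

Lemma intg_sin_eta t b : intg P (fun w => sin (t * eta w + b)).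
Proof. apply: (@intg_bounded _ _ _ _ _ 1); [exact: measurable_sin_eta|move=> w; exact: norm_sin_le1]. Qed.

Lemma intg_cos_eta t b : intg P (fun w => cos (t * eta w + b)).
Proof. apply: (@intg_bounded _ _ _ _ _ 1); [exact: measurable_cos_eta|move=> w; exact: norm_cos_le1]. Qed.

Lemma intg_sin_mul t b g : intg P g -> intg P (fun w => sin (t * eta w + b) * g w).
Proof.
move=> ig; apply: (intg_le _ _ (intg_abs ig)).
  by apply: measurable_funM; [exact: measurable_sin_eta|exact: intg_mf ig].
by move=> w; rewrite normrM -[leRHS]mul1r ler_wpM2r // norm_sin_le1.
Qed.

Lemma shift_sin c t b : Ex P (fun w => sin (t * eta w + b) * expR (c * eta w)) =
  expR (c ^+ 2 * v / 2) * Ex P (fun w => sin (t * (eta w + c * v) + b)).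
Proof.
(* The shift identity is available for nonnegative functions. It is used for 1 + sin and for 1, and
   the two are subtracted. *)
pose f (x : R) := 1 + sin (t * x + b).
have cf : continuous f.
  move=> x; apply: continuousD; first exact: cvg_cst.
  apply: (@continuous_comp _ _ _ (fun x => t * x + b) sin); last exact: continuous_sin.
  by apply: continuousD; [apply: continuousM; [exact: cvg_cst|exact: cvg_id]|exact: cvg_cst].
have f0 x : 0 <= f x by rewrite /f; have := @sin_geN1 R (t * x + b); lra.
have i1 := intg_sin_mul t b (shift_intg_expR c).
have i2 : intg P (fun w => sin (t * (eta w + c * v) + b)).
  rewrite (_ : (fun w => _) = (fun w => sin (t * eta w + (t * (c * v) + b)))); first exact: intg_sin_eta.
  by apply/funext => w; rewrite mulrDr addrA.
have i3 : intg P (fun w => f (eta w) * expR (c * eta w)).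
  rewrite (_ : (fun w => _) = fun w => expR (c * eta w) + sin (t * eta w + b) * expR (c * eta w)).
    by apply: intgD => //; exact: shift_intg_expR.
  by apply/funext => w; rewrite /f mulrDl mul1r.
have i4 : intg P (fun w => f (eta w + c * v)) by apply: intgD => //; exact: intg_cst.
have i5 : intg P (fun w => 1 * expR (c * eta w)).
  by under eq_fun do rewrite mul1r; exact: shift_intg_expR.
have e1 : Ex P (fun w => f (eta w) * expR (c * eta w)) =
    expR (c ^+ 2 * v / 2) * Ex P (fun w => f (eta w + c * v)).
  by apply/EFin_inj; rewrite EFinM !EFin_Ex //; exact: shiftE.
have e2 : Ex P (fun w => 1 * expR (c * eta w)) = expR (c ^+ 2 * v / 2) * Ex P (fun _ : T => 1).
  by apply/EFin_inj; rewrite EFinM !EFin_Ex //; [exact: (shiftE c cont1)|exact: intg_cst].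
rewrite (@ExD _ _ _ P (fun=> 1)) // in e1; last exact: intg_cst.
rewrite mulrDr -e2 in e1; move: e1.
rewrite (_ : Ex P (fun w => f (eta w) * _) =
  Ex P (fun w => 1 * expR (c * eta w)) + Ex P (fun w => sin (t * eta w + b) * expR (c * eta w))).
  exact: addrI.
rewrite -ExD //; by apply: eq_Ex => w; rewrite /f mulrDl.
Qed.

(** Gaussian integration by parts, as the derivative at c = 0 of the shift identity [shift_sin]. [L]
    and [Rr] expand its two sides to first order in c, and [D] says that the factor expR (c ^ 2 v /
    2) contributes only at order c ^ 2. *)
Lemma stein_sin t b : Ex P (fun w => sin (t * eta w + b) * eta w) = t * v * Ex P (fun w => cos (t * eta w + b)).
Proof.
set A := LHS; set B := Ex P _; pose S := Ex P (fun w => sin (t * eta w + b)).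
pose K1 := Ex P (fun w => eta w ^+ 2 * expR `|eta w|).
have L c : 0 < c <= 1 -> `|Ex P (fun w => sin (t * eta w + b) * expR (c * eta w)) - S - c * A| <= c ^+ 2 * K1.
  case/andP=> c0 c1.
  have i1 := intg_sin_mul t b (shift_intg_expR c); have i2 := intg_sin_eta t b.
  have i3 := intg_sin_mul t b shift_intg1.
  rewrite /A /S -ExZ // -ExB // -ExB //; last 2 first.
  - exact: intgB.
  - exact: intgZ.
  rewrite /K1 -ExZ; last exact: shift_intg_sqr_expR.
  apply: (le_trans (Ex_abs _)); first by apply: intgB; [exact: intgB|exact: intgZ].
  apply: Ex_le; first by apply: intg_abs; apply: intgB; [exact: intgB|exact: intgZ].
    by apply: intgZ; exact: shift_intg_sqr_expR.
  move=> w; rewrite (_ : _ - _ - _ = sin (t * eta w + b) * (expR (c * eta w) - 1 - c * eta w)); last by ring.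
  have /andP[h0 h1] := expR_taylor1 (c * eta w).
  rewrite normrM -[leRHS]mul1r ler_pM ?norm_sin_le1 // (ger0_norm h0) (le_trans h1) //.
  rewrite exprMn -mulrA ler_wpM2l ?sqr_ge0 // ler_wpM2l ?sqr_ge0 // ler_expR normrM (gtr0_norm c0).
  by rewrite -[leRHS]mul1r ler_wpM2r.
have Rr c : `|Ex P (fun w => sin (t * (eta w + c * v) + b)) - S - t * c * v * B| <= 2 * (t * c * v) ^+ 2.
  have i1 := intg_sin_eta t b; have i2 := intg_cos_eta t b.
  have i3 := intg_sin_eta t (b + t * c * v).
  rewrite (_ : Ex P (fun w => sin (t * (eta w + c * v) + b)) = Ex P (fun w => sin (t * eta w + (b + t * c * v)))); last first.
    by apply: eq_Ex => w; congr sin; ring.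
  rewrite /B /S -ExZ // -ExB // -ExB //; last 2 first.
  - exact: intgB.
  - exact: intgZ.
  rewrite -[leRHS](Ex_cst P).
  apply: (le_trans (Ex_abs _)); first by apply: intgB; [exact: intgB|exact: intgZ].
  apply: Ex_le; first by apply: intg_abs; apply: intgB; [exact: intgB|exact: intgZ].
    exact: intg_cst.
  by move=> w; rewrite addrA; exact: sin_taylor.
have D c : 0 < c <= 1 -> `|expR (c ^+ 2 * v / 2) * Ex P (fun w => sin (t * (eta w + c * v) + b)) -
    Ex P (fun w => sin (t * (eta w + c * v) + b))| <= c ^+ 2 * (v / 2 * expR (v / 2)).
  case/andP=> c0 c1; set E := Ex P _.
  have E1 : `|E| <= 1.
    rewrite -[leRHS](Ex_cst P) /E (_ : (fun w => sin _) = fun w => sin (t * eta w + (t * (c * v) + b))); last first.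
      by apply/funext => w; rewrite mulrDr addrA.
    apply: (le_trans (Ex_abs (intg_sin_eta _ _))); apply: Ex_le; last by move=> w; exact: norm_sin_le1.
    - by apply: intg_abs; exact: intg_sin_eta.
    - exact: intg_cst.
  rewrite -[X in _ - X]mul1r -mulrBl normrM -[leRHS]mulr1 ler_pM //.
  set q := c ^+ 2 * v / 2.
  have q0 : 0 <= q by rewrite /q divr_ge0 // mulr_ge0 ?sqr_ge0.
  have qv : q <= v / 2.
    by rewrite /q ler_pM2r // -[leRHS]mul1r ler_wpM2r // expr_le1 // ltW.
  have h : expR q - 1 <= q * expR q.
    have h1 := expR_ge1Dx (- q); have h2 : expR q * (1 - q) <= expR q * expR (- q) by rewrite ler_wpM2l // expR_ge0.
    by rewrite -expRD subrr expR0 in h2; lra.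
  rewrite ger0_norm; last by rewrite subr_ge0 -expR0 ler_expR.
  apply: (le_trans h); rewrite mulrA -/q (_ : c ^+ 2 * (v / 2) = q); last by rewrite /q mulrA.
  by rewrite ler_wpM2l // ler_expR.
suff : A - t * v * B = 0 by lra.
pose K := K1 + v / 2 * expR (v / 2) + 2 * (t * v) ^+ 2.
have HK c : 0 < c <= 1 -> `|A - t * v * B| <= c * K.
  move=> c01; have c0 : 0 < c by case/andP: c01.
  have := D c c01; rewrite -shift_sin; have := L c c01; have := Rr c.
  set x := Ex P _; set y := Ex P _ => h1 h2 h3.
  rewrite -(ler_pM2l c0) -{1}(gtr0_norm c0) -normrM.
  rewrite (_ : c * (A - t * v * B) = (x - S - t * c * v * B) - (y - S - c * A) + (y - x)); last by ring.
  apply: (le_trans (ler_normD _ _)); apply: (le_trans (lerD (ler_normB _ _) (lexx _))).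
  apply: (le_trans (lerD (lerD h1 h2) h3)); rewrite le_eqVlt; apply/orP; left; apply/eqP.
  by rewrite /K; ring.
apply/eqP; rewrite -normr_le0; apply/ler_addgt0Pl => e e0; rewrite addr0.
have K0 : 0 <= K by have := HK 1; rewrite mul1r ltr01 lexx => /(_ isT); exact: le_trans.
apply: (le_trans (HK (Num.min 1 (e / (K + 1))) _)).
  by rewrite lt_min ltr01 ge_min lexx /= divr_gt0 //; lra.
apply: (@le_trans _ _ (e / (K + 1) * (K + 1))); last by rewrite divfK //; apply/eqP; lra.
by rewrite ler_pM //; [rewrite le_min ler01 divr_ge0 //; lra|rewrite ge_min lexx orbT|lra].
Qed.

(** By Stein's identity the left-hand side phi satisfies phi' (s) = - s v phi (s); hence [psi], its
    product with e ^ (s ^ 2 v / 2), is constant. *)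
Lemma shift_cos t b : Ex P (fun w => cos (t * eta w + b)) = expR (- (t ^+ 2 * v / 2)) * cos b.
Proof.
pose phi s := Ex P (fun w => cos (s * eta w + b)).
have dphi (s : R) : is_derive s 1 phi (- (s * v * phi s)).
  apply: (@is_derive_quadratic _ _ _ _ (2 * Ex P (fun w => eta w ^+ 2))) => h.
  have i1 := intg_cos_eta s b; have i2 := intg_cos_eta (s + h) b.
  have i3 := intg_sin_mul s b shift_intg1.
  pose g w := cos ((s + h) * eta w + b) - cos (s * eta w + b) + h * (sin (s * eta w + b) * eta w).
  have ig : intg P g by apply: intgD; [exact: intgB|exact: intgZ].
  have -> : phi (s + h) - phi s - h * - (s * v * phi s) = Ex P g.
    rewrite /g ExD ?ExZ ?ExB //; [|exact: intgB|exact: intgZ].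
    by rewrite stein_sin mulrN opprK.
  have -> : 2 * Ex P (fun w => eta w ^+ 2) * h ^+ 2 = Ex P (fun w => 2 * (h ^+ 2 * eta w ^+ 2)).
    rewrite ExZ; last by apply: intgZ; exact: shift_intg_sqr.
    by rewrite ExZ; [ring|exact: shift_intg_sqr].
  apply: (le_trans (Ex_abs ig)).
  apply: Ex_le; first exact: intg_abs.
    by do 2 apply: intgZ; exact: shift_intg_sqr.
  move=> w; have := cos_taylor (s * eta w + b) (h * eta w).
  rewrite (_ : s * eta w + b + h * eta w = (s + h) * eta w + b); last by ring.
  by rewrite exprMn (_ : h * eta w * sin _ = h * (sin (s * eta w + b) * eta w)) //=; ring.
pose psi (s : R) := phi s * expR (s * (s * (v / 2))).
have dpsi (s : R) : is_derive s 1 psi 0.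
  have e1 : is_derive s 1 (fun s : R => s * (s * (v / 2))) (s * v).
    apply: (@is_derive_quadratic _ _ _ _ (v / 2)) => h.
    by rewrite (_ : _ - _ = v / 2 * h ^+ 2) ?ger0_norm //; [rewrite mulr_ge0 ?sqr_ge0 ?divr_ge0|field].
  have e2 := @is_derive1_comp _ expR (fun s : R => s * (s * (v / 2))) s _ _ (is_derive_expR _) e1.
  have e3 := @is_deriveM _ _ _ _ s 1 _ _ (dphi s) e2.
  apply: is_derive_eq e3 _; rewrite /GRing.scale /=; ring.
have := is_derive_0_is_cst t 0 dpsi; rewrite /psi mul0r expR0 mulr1.
rewrite [phi 0](_ : _ = cos b); last first.
  by rewrite -[RHS](Ex_cst P); apply: eq_Ex => w; rewrite mul0r add0r.
move=> <-; rewrite -/(phi t) mulrCA -expRD (_ : _ + _ = 0) ?expR0 ?mulr1 //.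
by field.
Qed.

Lemma shift_mean : Ex P eta = 0.
Proof.
(* At frequency 0 and phase pi / 2 the sine is the constant 1 and the right-hand side vanishes. *)
have := stein_sin 0 (pi / 2); rewrite !mul0r => <-.
by apply: eq_Ex => w; rewrite mul0r add0r sin_pihalf mul1r.
Qed.

(** Stein's identity divided by the frequency t, in the limit t -> 0: sin (t eta) / t tends to eta
    and the cosine to 1, with dominating functions eta ^ 2 and 1. *)
Lemma shift_var : Ex P (fun w => eta w ^+ 2) = v.
Proof.
pose t (k : nat) : R := k.+1%:R^-1.
have t0 k : 0 < t k by rewrite invr_gt0.
have st k : Ex P (fun w => (t k)^-1 * (sin (t k * eta w + 0) * eta w)) = v * Ex P (fun w => cos (t k * eta w + 0)).
  rewrite ExZ ?stein_sin; first by rewrite !mulrA mulVf ?mul1r // gt_eqF.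
  by apply: intg_sin_mul; exact: shift_intg1.
have ct : t k @[k --> \oo] --> (0 : R) by exact: cvg_harmonic.
have [] // := @Ex_cvg _ _ _ P (fun k w => (t k)^-1 * (sin (t k * eta w + 0) * eta w)) (fun w => eta w ^+ 2) (fun w => eta w ^+ 2).
- move=> k; apply: measurable_funM => //; apply: measurable_funM => //; exact: measurable_sin_eta.
- move=> w; apply/cvgrPdist_le => e e0.
  have : t k * (`|eta w| ^+ 3 + 1) @[k --> \oo] --> 0 * (`|eta w| ^+ 3 + 1) by apply: cvgMl.
  rewrite mul0r => /cvgrPdist_le /(_ e e0); apply: filterS => k; rewrite sub0r normrN => h.
  rewrite addr0 distrC (_ : _ - _ = (t k)^-1 * eta w * (sin (t k * eta w) - t k * eta w)); last first.
    by field; rewrite gt_eqF.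
  rewrite normrM normrM gtr0_norm ?invr_gt0 // -mulrA ler_pdivrMl //.
  apply: le_trans (ler_wpM2l _ (sin_sub_id _)) _ => //.
  have h0 : 0 <= t k * (`|eta w| ^+ 3 + 1) by rewrite mulr_ge0 ?(ltW (t0 k)) // addr_ge0 // exprn_ge0.
  rewrite ger0_norm // in h; rewrite -(real_normK (num_real (_ * _))) normrM (gtr0_norm (t0 k)).
  rewrite (_ : _ * _ = t k * (t k * `|eta w| ^+ 3)); last by ring.
  by rewrite ler_pM2l //; have := t0 k; lra.
- exact: shift_intg_sqr.
- move=> k w; rewrite addr0 normrM gtr0_norm ?invr_gt0 // ler_pdivrMl // normrM.
  rewrite -(real_normK (num_real (eta w))) expr2 mulrA ler_wpM2r // (le_trans (norm_sin_le _)) //.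
  by rewrite normrM (gtr0_norm (t0 k)).
move=> _ l1.
have [] // := @Ex_cvg _ _ _ P (fun k w => cos (t k * eta w + 0)) (fun w => 1) (fun w => 1).
- move=> k; exact: measurable_cos_eta.
- move=> w; rewrite -(@cos0 R).
  have : t k * eta w + 0 @[k --> \oo] --> (0 : R).
    by rewrite -[X in _ --> X](addr0 0) -[X in _ --> X + 0](mul0r (eta w)); apply: cvgD; [apply: cvgMl|exact: cvg_cst].
  by move=> c; exact: (cvg_comp _ _ c (@continuous_cos R 0)).
- exact: intg_cst.
- by move=> k w; exact: norm_cos_le1.
rewrite Ex_cst => _ l2.
have l3 : v * Ex P (fun w => cos (t k * eta w + 0)) @[k --> \oo] --> v * 1 by apply: cvgMr.
rewrite mulr1 in l3; rewrite (_ : (fun k => Ex P _) = (fun k => v * Ex P (fun w => cos (t k * eta w + 0)))) in l1.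
  exact: cvg_unique l1 l3.
by apply/funext => k; rewrite st.
Qed.

End Centered.

Lemma gaussian_rv_facts (Z : T -> R) : gaussian_rv P Z ->
  let eta := fun w => Z w - Ex P Z in
  [/\ intg P Z, forall c, intg P (fun w => expR (c * eta w)) &
   forall t b, Ex P (fun w => cos (t * eta w + b)) =
     expR (- (t ^+ 2 * Ex P (fun w => eta w ^+ 2) / 2)) * cos b].
Proof.
move=> gZ; have [m [v [v0 H]]] := gaussian_shift gZ; case: gZ => mZ _.
pose eta w := Z w - m.
have meta : measurable_fun [set: T] eta by exact: measurable_funB.
have i1 := shift_intg1 meta H; have m0 := shift_mean meta v0 H.
have iZ : intg P Z.
  by rewrite (_ : Z = fun w => eta w + m); [apply: intgD => //; exact: intg_cst|apply/funext => w; rewrite subrK].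
have mE : Ex P Z = m by apply/eqP; rewrite -subr_eq0 -[X in _ - X](Ex_cst P) -ExB ?m0 //; exact: intg_cst.
rewrite mE; split => //; first by move=> c; exact: (shift_intg_expR meta H c).
by move=> t b; rewrite (shift_var meta v0 H); exact: (shift_cos meta v0 H).
Qed.

End GaussianVariable.

(** * Log-Lipschitz functions *)

Section LogLipschitz.
Context {R : realType} {I : finType}.
Implicit Types (x y z c : I -> R) (phi psi : (I -> R) -> R) (a s t : R).

Definition n1 x := \sum_i `|x i|.

Lemma n1_ge0 x : 0 <= n1 x. Proof. exact: sumr_ge0. Qed.

Lemma n1D x y : n1 (x + y) <= n1 x + n1 y.
Proof. by rewrite /n1 -big_split; apply: ler_sum => i _; exact: ler_normD. Qed.

Lemma n1Z a x : n1 (a *: x) = `|a| * n1 x.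
Proof. by rewrite /n1 mulr_sumr; apply: eq_bigr => i _; rewrite -normrM. Qed.

Lemma n1_0 : n1 0 = 0. Proof. by rewrite /n1 big1 // => i _; rewrite normr0. Qed.

Lemma dotvDr c x y : dotv c (x + y) = dotv c x + dotv c y.
Proof. by rewrite /dotv -big_split; apply: eq_bigr => i _; rewrite mulrDr. Qed.

Lemma dotvZr c a x : dotv c (a *: x) = a * dotv c x.
Proof. by rewrite /dotv mulr_sumr; apply: eq_bigr => i _; rewrite mulrCA. Qed.

Lemma dotvZl c a x : dotv (a *: c) x = a * dotv c x.
Proof. by rewrite /dotv mulr_sumr; apply: eq_bigr => i _; rewrite mulrA. Qed.

Lemma cont_dist_n1 phi : (forall x (e : R), 0 < e -> exists2 dl : R, 0 < dl &
  forall y, n1 (y - x) < dl -> `|phi y - phi x| < e) -> cont phi.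
Proof.
move=> h x e e0; have [dl dl0 hd] := h x e e0; pose N : R := #|I|%:R + 1.
have N0 : 0 < N by rewrite ltr_wpDl.
exists (dl / N) => [|y hy]; first exact: divr_gt0.
apply: hd; apply: (@le_lt_trans _ _ (\sum_(i : I) dl / N)).
  by apply: ler_sum => i _; exact: (ltW (hy i)).
rewrite sumr_const -mulr_natl mulrCA -[ltRHS]mulr1 ltr_pM2l // ltr_pdivrMr // mul1r.
by rewrite /N ltrDl.
Qed.

(** [phi] is positive and its logarithm is a-Lipschitz for the l1 norm. This one condition gives
    continuity and exponential growth, and is preserved by averaging over random translations. *)
Definition LL a phi := (forall x, 0 < phi x) /\ forall x y, phi (x + y) <= phi x * expR (a * n1 y).

Lemma LL_ge a phi x y : LL a phi -> phi x * expR (- (a * n1 y)) <= phi (x + y).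
Proof.
case=> p h; have := h (x + y) (- y); rewrite addrK -scaleN1r n1Z normrN1 mul1r => h1.
rewrite -[leRHS]mulr1 -expR0 -(subrr (a * n1 y)) expRD mulrA ler_wpM2r ?expR_ge0 //.
Qed.

Lemma LL_cont a phi : 0 <= a -> LL a phi -> cont phi.
Proof.
move=> a0 hphi; have [p h] := hphi; apply: cont_dist_n1 => x e e0.
have c : expR (a * r) @[r --> (0:R)] --> expR (a * 0).
  apply: (@continuous_comp _ _ _ (fun r => a * r) expR); last exact: continuous_expR.
  by apply: continuousM; [exact: cvg_cst|exact: cvg_id].
rewrite mulr0 expR0 in c.
have e1 : 0 < e / phi x by rewrite divr_gt0.
move/cvgrPdist_lt : c => /(_ _ e1) /nbhs_ballP[r /= r0 hr].
exists r => // y yx; have := hr (n1 (y - x)).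
rewrite /ball /= sub0r normrN ger0_norm ?n1_ge0 // => /(_ yx).
have h1 := h x (y - x); have h2 := LL_ge x (y - x) hphi; rewrite addrC subrK in h1 h2.
rewrite ltr_pdivlMr // => /le_lt_trans; apply.
have E1 : 1 <= expR (a * n1 (y - x)) by rewrite -expR0 ler_expR mulr_ge0 ?n1_ge0.
rewrite (distrC 1) [X in _ <= X * _]ger0_norm ?subr_ge0 // mulrBl mul1r.
rewrite ler_norml; apply/andP; split; last by rewrite mulrC; lra.
move: E1 h2; rewrite expRN; move: (expR _) => E E1 h2.
have E2 : 2 - E <= E^-1.
  rewrite -[leRHS]mul1r ler_pdivlMr; last lra.
  by have := sqr_ge0 (E - 1); rewrite expr2; lra.
have : phi x * (2 - E) <= phi x * E^-1 by rewrite ler_wpM2l // ltW.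
lra.
Qed.

Lemma LL_growth a phi x : LL a phi -> `|phi x| <= phi 0 * expR (a * n1 x).
Proof. by case=> p h; rewrite gtr0_norm // -{1}(add0r x). Qed.

Lemma cont_n1 : cont n1.
Proof.
apply: cont_dist_n1 => x e e0; exists e => // y h; apply: le_lt_trans h.
have h1 : n1 y <= n1 (y - x) + n1 x by rewrite -{1}(subrK x y) n1D.
have h2 : n1 x <= n1 (y - x) + n1 y.
  have := n1D (- 1 *: (y - x)) y; rewrite n1Z normrN1 mul1r scaleN1r opprB subrK //.
by rewrite ler_norml; lra.
Qed.

Lemma cont_shift phi x a : cont phi -> cont (fun y => phi (x + a *: y)).
Proof.
move=> c y e e0; have [dl dl0 h] := c (x + a *: y) e e0.
exists (dl / (`|a| + 1)) => [|z hz]; first by rewrite divr_gt0 // ltr_wpDl.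
apply: h => i; rewrite !fctE opprD addrACA subrr add0r -mulrBr normrM.
apply: (@le_lt_trans _ _ (`|a| * (dl / (`|a| + 1)))); first by rewrite ler_wpM2l // ltW.
by rewrite mulrCA -[ltRHS]mulr1 ltr_pM2l // ltr_pdivrMr ?ltr_wpDl // mul1r ltrDl.
Qed.

Lemma rvec_shift d (T : measurableType d) (U : T -> I -> R) x a :
  rvec U -> rvec (fun w => x + a *: U w).
Proof. by move=> mU i; apply: measurable_funD => //; apply: measurable_funM. Qed.

(** Bound e ^ (a |r|) by e ^ (a r) + e ^ (- a r) in each coordinate and expand the product over sign
    vectors: the exponential integrability of the norm is reduced to that of linear forms. *)
Lemma expR_n1_le x a : 0 <= a -> expR (a * n1 x) <=
  \sum_(e : {ffun I -> bool}) expR (a * dotv (fun i => (-1) ^+ e i) x).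
Proof.
move=> a0; rewrite /n1 mulr_sumr expR_sum.
apply: (@le_trans _ _ (\prod_i \sum_(b : bool) expR (a * ((-1) ^+ b * x i)))).
  apply: ler_prod => i _; rewrite expR_ge0 /= big_bool /= expr1 expr0 mul1r mulN1r.
  by case: (ger0P (x i)) => h; [rewrite lerDr expR_ge0|rewrite lerDl expR_ge0].
rewrite bigA_distr_bigA; apply: ler_sum => e _.
by rewrite /dotv mulr_sumr expR_sum.
Qed.

End LogLipschitz.

Section GaussianVector.
Context {R : realType} {I : finType} {dT : measure_display} {T : measurableType dT}.
Variable P : probability T R.
Implicit Types (x y c : I -> R) (phi : (I -> R) -> R) (a s t b : R).

(** Centred Gaussian vector, with a possibly degenerate covariance. The phase [b] makes the cosine
    identity equivalent to the formula for the full characteristic function. *)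
Definition gvec (xi : T -> I -> R) := [/\ rvec xi,
  forall c, intg P (fun w => expR (dotv c (xi w))) &
  forall c b, Ex P (fun w => cos (dotv c (xi w) + b)) =
    expR (- (Ex P (fun w => dotv c (xi w) ^+ 2) / 2)) * cos b].

Variable xi : T -> I -> R.
Hypothesis gxi : gvec xi.

Let mxi : rvec xi. Proof. by case: gxi. Qed.

Lemma gvec_intg_expR_n1 a : intg P (fun w => expR (a * n1 (xi w))).
Proof.
wlog a0 : a / 0 <= a.
  move=> wl; case: (lerP 0 a) => h; first exact: wl.
  apply: (@intg_bounded _ _ _ _ _ 1).
    apply: measurableT_comp => //; apply: measurable_funM => //.
    by apply: measurable_cont => //; exact: cont_n1.
  by move=> w; rewrite gtr0_norm ?expR_gt0 // -expR0 ler_expR mulr_le0_ge0 ?n1_ge0 // ltW.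
apply: (@intg_le _ _ _ _ _ (fun w => \sum_(e : {ffun I -> bool}) expR (a * dotv (fun i => (-1) ^+ e i) (xi w)))).
- apply: measurableT_comp => //; apply: measurable_funM => //.
  by apply: measurable_cont => //; exact: cont_n1.
- by move=> w; rewrite gtr0_norm ?expR_gt0 //; exact: expR_n1_le.
- apply: intg_sum => e; have [_ h _] := gxi.
  by under eq_fun do rewrite -dotvZl; exact: h.
Qed.

Definition growth phi := exists A a : R, [/\ 0 <= A, 0 <= a & forall x, `|phi x| <= A * expR (a * n1 x)].

Lemma growth_shift phi x a : growth phi -> growth (fun y => phi (x + a *: y)).
Proof.
case=> A [k [A0 k0 h]]; exists (A * expR (k * n1 x)), (k * `|a|); split.
- by rewrite mulr_ge0 ?expR_ge0.
- by rewrite mulr_ge0.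
move=> y; apply: (le_trans (h _)); rewrite -!mulrA -expRD ler_wpM2l // ler_expR -mulrDr.
by rewrite ler_wpM2l // -n1Z n1D.
Qed.

Lemma intg_growth phi : cont phi -> growth phi -> intg P (fun w => phi (xi w)).
Proof.
move=> c [A [k [A0 k0 h]]]; apply: (@intg_le _ _ _ _ _ (fun w => A * expR (k * n1 (xi w)))).
- exact: measurable_cont.
- by move=> w; exact: h.
- by apply: intgZ; exact: gvec_intg_expR_n1.
Qed.

Lemma intg_growth_shift phi x a : cont phi -> growth phi -> intg P (fun w => phi (x + a *: xi w)).
Proof. by move=> c g; apply: (intg_growth (cont_shift x a c) (growth_shift x a g)). Qed.

(** The heat semigroup attached to the covariance of [xi], at time s. *)
Definition Gam s phi x := Ex P (fun w => phi (x + Num.sqrt s *: xi w)).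

Let sqr_dotv_scale c a : Ex P (fun w => dotv (a *: c) (xi w) ^+ 2) = a ^+ 2 * Ex P (fun w => dotv c (xi w) ^+ 2).
Proof.
rewrite -ExZ; first by apply: eq_Ex => w; rewrite dotvZl exprMn.
apply: (@intg_le _ _ _ _ _ (fun w => 2 * (expR (dotv c (xi w)) + expR (dotv (-1 *: c) (xi w))))).
- by apply: measurable_funX; exact: measurable_dotv.
- move=> w; rewrite dotvZl mulN1r ger0_norm ?sqr_ge0 //; move: (dotv _ _) => r.
  have e2 (q : R) : 0 <= q -> q ^+ 2 <= 2 * expR q.
    by move=> q0; have := expR_ge1Dxn 1 q0; rewrite (_ : 2`!%:R = 2) //; lra.
  case: (lerP 0 r) => r0.
    by apply: (le_trans (e2 _ r0)); have := expR_ge0 (- r); lra.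
  have r1 : 0 <= - r by lra.
  by rewrite -sqrrN; apply: (le_trans (e2 _ r1)); have := expR_ge0 r; lra.
- by have [_ h _] := gxi; apply: intgZ; apply: intgD; exact: h.
Qed.

Lemma gvec_opp phi : cont phi -> intg P (fun w => phi (xi w)) ->
  Ex P (fun w => phi (- xi w)) = Ex P (fun w => phi (xi w)).
Proof.
move=> c i; have mo : rvec (fun w => - xi w).
  by move=> k; under eq_fun do rewrite !fctE; exact: measurableT_comp.
have e : eqlaw P P xi (fun w => - xi w).
  apply: cos_eqlaw => // c' b; have [_ _ h] := gxi.
  rewrite (_ : Ex P (fun w => cos (dotv c' (- xi w) + b)) = Ex P (fun w => cos (dotv (-1 *: c') (xi w) + b))); last first.
    by apply: eq_Ex => w; rewrite dotvZl -scaleN1r dotvZr.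
  by rewrite !h sqr_dotv_scale sqrrN expr1n mul1r.
by rewrite -(eqlaw_Ex mxi mo e).
Qed.

(** On the product space the sum of independent copies of sqrt s xi and sqrt t xi has the cosines,
    hence the law, of sqrt (s + t) xi. For nonnegative [phi] the rest is Tonelli's theorem. *)
Let semigroup_ge0 phi x s t : cont phi -> growth phi -> (forall y, 0 <= phi y) -> 0 <= s -> 0 <= t ->
  intg P (fun w => Gam t phi (x + Num.sqrt s *: xi w)) /\
  Gam (s + t) phi x = Gam s (Gam t phi) x.
Proof.
move=> c g phi0 s0 t0; have st0 : 0 <= s + t by exact: addr_ge0.
pose V (w : T * T) := Num.sqrt s *: xi w.1 + Num.sqrt t *: xi w.2.
pose U w := Num.sqrt (s + t) *: xi w.
have mU : rvec U by move=> i; apply: measurable_funM.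
have mV : rvec V.
  move=> i; apply: measurable_funD; apply: measurable_funM => //.
  - exact: (measurableT_comp (mxi i) measurable_fst).
  - exact: (measurableT_comp (mxi i) measurable_snd).
have e : eqlaw P (pprod P P) U V.
  apply: cos_eqlaw => // c' b; have [_ _ h] := gxi.
  have hs a b' : 0 <= a -> Ex P (fun w => cos (Num.sqrt a * dotv c' (xi w) + b')) =
      expR (- (a * Ex P (fun w => dotv c' (xi w) ^+ 2) / 2)) * cos b'.
    move=> a0; rewrite -[X in X * _ / 2](sqr_sqrtr a0) -sqr_dotv_scale -h.
    by apply: eq_Ex => w; rewrite dotvZl.
  rewrite (_ : Ex P _ = Ex P (fun w => cos (Num.sqrt (s + t) * dotv c' (xi w) + b))); last first.
    by apply: eq_Ex => w; rewrite /U dotvZr.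
  rewrite hs // (@Ex_fubini_bounded _ _ _ _ _ _ _ _ 1); last 2 first.
  - by apply: measurable_cos_dotv.
  - by move=> w; exact: norm_cos_le1.
  symmetry; transitivity (Ex P (fun w1 => expR (- (t * Ex P (fun w => dotv c' (xi w) ^+ 2) / 2)) *
      cos (Num.sqrt s * dotv c' (xi w1) + b))).
    apply: eq_Ex => w1.
    transitivity (Ex P (fun w2 => cos (Num.sqrt t * dotv c' (xi w2) + (Num.sqrt s * dotv c' (xi w1) + b)))).
      by apply: eq_Ex => w2; rewrite /V dotvDr !dotvZr /=; congr cos; ring.
    exact: hs.
  rewrite ExZ ?hs //.
    by rewrite mulrA -expRD; congr (expR _ * _); field.
  apply: (@intg_bounded _ _ _ _ _ 1); last by move=> w; exact: norm_cos_le1.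
  by under eq_fun do rewrite -dotvZl; exact: measurable_cos_dotv.
pose f (w : T * T) := phi (x + V w).
have cx : cont (fun y => phi (x + y)) by have := cont_shift x 1 c; under eq_fun do rewrite scale1r.
have mf : measurable_fun [set: T * T] f by apply: (measurable_cont cx mV).
have f0 w : 0 <= f w by exact: phi0.
have fE w1 : Ex P (fun w2 => f (w1, w2)) = Gam t phi (x + Num.sqrt s *: xi w1).
  by apply: eq_Ex => w2; rewrite /f /V addrA.
have i2 w1 : intg P (fun w2 => f (w1, w2)).
  by rewrite /f /V; under eq_fun do rewrite /= addrA; exact: intg_growth_shift.
have i1 : intg P (fun w1 => Ex P (fun w2 => f (w1, w2))).
  case: g => A [k [A0 k0 hA]].
  pose B := A * expR (k * n1 x) * Ex P (fun w => expR (k * Num.sqrt t * n1 (xi w))).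
  apply: (@intg_le _ _ _ _ _ (fun w => B * expR (k * Num.sqrt s * n1 (xi w)))).
  - exact: Ex_fubini_mf.
  - move=> w1; rewrite ger0_norm ?Ex_ge0 // /B -mulrA [Ex _ _ * _]mulrC mulrA -ExZ; last exact: gvec_intg_expR_n1.
    apply: Ex_le => //; first by apply: intgZ; exact: gvec_intg_expR_n1.
    move=> w2; rewrite -[leLHS](ger0_norm (f0 _)); apply: (le_trans (hA _)).
    rewrite -!mulrA -!expRD ler_wpM2l // ler_expR -!mulrDr ler_wpM2l //.
    have sE r y : Num.sqrt r * n1 y = n1 (Num.sqrt r *: y) by rewrite n1Z ger0_norm ?sqrtr_ge0.
    by rewrite !sE; apply: (le_trans (n1D _ _)); rewrite lerD2l n1D.
  - by apply: intgZ; exact: gvec_intg_expR_n1.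
split; first by rewrite (_ : (fun w => _) = fun w1 => Ex P (fun w2 => f (w1, w2))) //; apply/funext => w1; rewrite fE.
have [_ ef] := Ex_fubini mf f0 i2 i1.
have e3 := eqlaw_Ex_ge0 mU mV e cx (fun y => phi0 (x + y)).
by apply: (etrans e3); apply: (etrans ef); apply: eq_Ex => w1; exact: fE.
Qed.

Lemma Gam_semigroup phi x s t : cont phi -> growth phi -> 0 <= s -> 0 <= t ->
  Gam (s + t) phi x = Gam s (Gam t phi) x.
Proof.
move=> c g s0 t0; have [A [k [A0 k0 hA]]] := g.
(* Adding this exponential majorant makes [phi] nonnegative; its own semigroup identity is
   subtracted at the end. *)
pose h y := A * expR (k * n1 y).
have ch : cont h.
  apply: contZ; apply: (@cont_comp _ _ expR); first exact: continuous_expR.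
  by apply: contZ; exact: cont_n1.
have h0 y : 0 <= h y by rewrite mulr_ge0 ?expR_ge0.
have gh : growth h by exists A, k; split => // y; rewrite ger0_norm.
pose psi y := phi y + h y.
have cpsi : cont psi by exact: contD.
have psi0 y : 0 <= psi y.
  by have := hA y; rewrite ler_norml /psi -/(h y) => /andP[h1 _]; lra.
have gpsi : growth psi.
  exists (A + A), k; split => //; first exact: addr_ge0.
  by move=> y; rewrite mulrDl (le_trans (ler_normD _ _)) // lerD // ger0_norm.
have [i1 e1] := semigroup_ge0 x ch gh h0 s0 t0.
have [i2 e2] := semigroup_ge0 x cpsi gpsi psi0 s0 t0.
have split_ r y : Gam r psi y = Gam r phi y + Gam r h y.
  by rewrite /Gam -ExD; [|exact: intg_growth_shift..].
rewrite split_ e1 in e2; apply: (addIr (Gam s (Gam t h) x)); rewrite e2 /Gam.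
rewrite -ExD; [by apply: eq_Ex => w; exact: split_| |exact: i1].
rewrite (_ : (fun w => _) = fun w => Gam t psi (x + Num.sqrt s *: xi w) - Gam t h (x + Num.sqrt s *: xi w)).
  exact: (intgB i2 i1).
by apply/funext => w; rewrite split_ addrK.
Qed.

End GaussianVector.

Section ExpInequalities.
Variable R : realType.
Implicit Types u q : R.

Lemma expR_ge_Xn k q : 0 <= q -> q ^+ k <= k`!%:R * expR q.
Proof.
move=> q0; case: k => [|k]; first by rewrite expr0 fact0 mul1r -expR0 ler_expR.
have f0 : 0 < (k.+1)`!%:R :> R by rewrite ltr0n fact_gt0.
have := expR_ge1Dxn k q0 => h; rewrite mulrC -ler_pdivrMr //.
by apply: le_trans h; rewrite lerDr.
Qed.

Lemma expR_taylor2 u : expR u <= 1 + u + u ^+ 2 / 2 + `|u| ^+ 3 * expR `|u|.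
Proof.
case: (ger0P u) => u0.
  have d (c : R) : is_derive c 1 (fun x : R => x ^+ 3 * expR x + 1 + x + x ^+ 2 / 2 - expR x)
      (3 * c ^+ 2 * expR c + c ^+ 3 * expR c + 1 + c - expR c).
    by apply: is_derive_eq; rewrite /GRing.scale /=; field.
  have cc : {within `[0, u], continuous (fun x : R => x ^+ 3 * expR x + 1 + x + x ^+ 2 / 2 - expR x)}.
    apply: continuous_subspaceT => x; apply: differentiable_continuous; apply/derivable1_diffP.
    by have [] := d x.
  have [|c] := MVT_segment _ (fun c _ => d c) cc; first by [].
  rewrite in_itv /= => /andP[c0 cu] /=; rewrite expr0n /= mul0r expR0 !subr0 addr0 => e.
  have := expR_taylor1 c; rewrite ger0_norm // => /andP[_ h].
  have : 0 <= (3 * c ^+ 2 * expR c + c ^+ 3 * expR c + 1 + c - expR c) * u.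
    apply: mulr_ge0 => //; have h1 : 0 <= c ^+ 2 * expR c by rewrite mulr_ge0 ?sqr_ge0 ?expR_ge0.
    have h2 : 0 <= c ^+ 3 * expR c by rewrite mulr_ge0 ?exprn_ge0 ?expR_ge0.
    by rewrite -mulrA; lra.
  by rewrite -e; lra.
have d (c : R) : is_derive c 1 (fun x : R => 1 + x + x ^+ 2 / 2 - expR x) (1 + c - expR c).
  by apply: is_derive_eq; rewrite /GRing.scale /=; field.
have cc : {within `[u, 0], continuous (fun x : R => 1 + x + x ^+ 2 / 2 - expR x)}.
  apply: continuous_subspaceT => x; apply: differentiable_continuous; apply/derivable1_diffP.
  by have [] := d x.
have [|c _] := MVT_segment _ (fun c _ => d c) cc; first exact: ltW.
rewrite expr0n /= mul0r expR0 addr0 addr0 subrr sub0r => e.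
have h1 : 0 <= (expR c - 1 - c) * - u by apply: mulr_ge0; [have /andP[] := expR_taylor1 c|lra].
have h2 : 0 <= (- u) ^+ 3 * expR (- u) by rewrite mulr_ge0 ?expR_ge0 ?exprn_ge0 //; lra.
have h3 : (1 + c - expR c) * (0 - u) = - ((expR c - 1 - c) * - u) by ring.
by rewrite h3 in e; lra.
Qed.

End ExpInequalities.

(** * Gaussian concentration by interpolation along the semigroup *)

Section Concentration.
Context {R : realType} {I : finType} {dT : measure_display} {T : measurableType dT}.
Variable P : probability T R.
Variable xi : T -> I -> R.
Hypothesis gxi : gvec P xi.
Implicit Types (x y c : I -> R) (g : (I -> R) -> R) (a s t b : R).
Let mxi : rvec xi. Proof. by case: gxi. Qed.
Local Notation Gam := (Gam P xi).
Local Notation N1 w := (n1 (xi w)).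

Definition Lip a g := forall x y, `|g (x + y) - g x| <= a * n1 y.

Lemma Lip_expR a g : Lip a g -> LL a (fun x => expR (g x)).
Proof.
move=> l; split=> [x|x y]; first exact: expR_gt0.
rewrite -expRD ler_expR -lerBlDl; exact: le_trans (ler_norm _) (l x y).
Qed.

Lemma Lip_cont a g : 0 <= a -> Lip a g -> cont g.
Proof.
move=> a0 l; apply: cont_dist_n1 => x e e0; exists (e / (a + 1)).
  by rewrite divr_gt0 // ltr_wpDl.
move=> y; rewrite ltr_pdivlMr ?ltr_wpDl // => h.
have := l x (y - x); rewrite [x + _]addrC subrK => /le_lt_trans; apply; apply: le_lt_trans h.
by rewrite mulrC ler_wpM2l ?n1_ge0 // lerDl.
Qed.

Lemma Lip_growth a g : 0 <= a -> Lip a g -> growth g.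
Proof.
move=> a0 l; exists (`|g 0| + 1), a; split => // x.
have h := l 0 x; rewrite add0r in h.
have e := expR_ge1Dx (a * n1 x); have p : 0 <= a * n1 x by rewrite mulr_ge0 ?n1_ge0.
have := ler_normD (g x - g 0) (g 0); rewrite subrK => h1.
have := normr_ge0 (g 0); nra.
Qed.

Lemma intg_n1X k a : intg P (fun w => N1 w ^+ k * expR (a * N1 w)).
Proof.
apply: (@intg_le _ _ _ _ _ (fun w => k`!%:R * expR ((1 + a) * N1 w))).
- apply: measurable_funM; first by apply: measurable_funX; apply: measurable_cont => //; exact: cont_n1.
  apply: measurableT_comp => //; apply: measurable_funM => //.
  by apply: measurable_cont => //; exact: cont_n1.
- move=> w; rewrite ger0_norm ?mulr_ge0 ?exprn_ge0 ?n1_ge0 ?expR_ge0 //.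
  by rewrite mulrDl mul1r expRD mulrA ler_wpM2r ?expR_ge0 // expR_ge_Xn ?n1_ge0.
- by apply: intgZ; exact: gvec_intg_expR_n1.
Qed.

Lemma Lip_Gam a g s : 0 <= a -> Lip a g -> Lip a (Gam s g).
Proof.
move=> a0 l x y; have cg := Lip_cont a0 l; have gg := Lip_growth a0 l.
have i z : intg P (fun w => g (z + Num.sqrt s *: xi w)) by exact: intg_growth_shift.
rewrite /Gam -ExB // (le_trans (Ex_abs _)) //; first exact: intgB.
rewrite -[leRHS](Ex_cst P); apply: Ex_le; [apply: intg_abs; exact: intgB|exact: intg_cst|].
by move=> w; rewrite addrAC; exact: l.
Qed.

Lemma Ex_sqr_le (X : T -> R) : intg P X -> intg P (fun w => X w ^+ 2) -> Ex P X ^+ 2 <= Ex P (fun w => X w ^+ 2).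
Proof.
move=> i1 i2; set m := Ex P X.
have : 0 <= Ex P (fun w => X w ^+ 2 - 2 * m * X w + m ^+ 2).
  by apply: Ex_ge0 => w; rewrite (_ : _ + _ = (X w - m) ^+ 2) ?sqr_ge0 //; ring.
rewrite ExD; [|by apply: intgB => //; exact: intgZ|exact: intg_cst].
rewrite ExB //; last exact: intgZ.
by rewrite ExZ // Ex_cst -/m; lra.
Qed.

Variables (sigma2 : R) (sigma2_ge0 : 0 <= sigma2).

(** Infinitesimal variance bound. It replaces the condition that the gradient of g, measured by the
    covariance of [xi], has square norm at most [sigma2], and asks for no differentiability. *)
Definition vbound K g := forall x t, 0 <= t <= 1 ->
  Ex P (fun w => (g (x + t *: xi w) - g x) ^+ 2) <= t ^+ 2 * sigma2 + K * t ^+ 3.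

(** The factor [expR (0 * N1 w)] equals 1 and only gives the bound the shape of [intg_n1X]. *)
Lemma Lip_sqr_le a g x t w : 0 <= a -> 0 <= t <= 1 -> Lip a g ->
  (g (x + t *: xi w) - g x) ^+ 2 <= a ^+ 2 * (N1 w ^+ 2 * expR (0 * N1 w)).
Proof.
move=> a0 /andP[t0 t1] l; rewrite mul0r expR0 mulr1 -exprMn -real_normK ?num_real //.
rewrite ler_sqr ?nnegrE ?mulr_ge0 ?n1_ge0 //; apply: (le_trans (l _ _)).
by rewrite n1Z ger0_norm // ler_wpM2l // ler_piMl ?n1_ge0.
Qed.

Lemma measurable_Lip_shift a g x t : 0 <= a -> Lip a g -> measurable_fun [set: T] (fun w => g (x + t *: xi w)).
Proof. by move=> a0 l; apply: (measurable_cont (Lip_cont a0 l)); exact: rvec_shift. Qed.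

Lemma intg_Lip_sqr a g x t : 0 <= a -> 0 <= t <= 1 -> Lip a g ->
  intg P (fun w => (g (x + t *: xi w) - g x) ^+ 2).
Proof.
move=> a0 t01 l; apply: (@intg_le _ _ _ _ _ (fun w => a ^+ 2 * (N1 w ^+ 2 * expR (0 * N1 w)))).
- by apply: measurable_funX; apply: measurable_funB => //; exact: (measurable_Lip_shift _ _ a0 l).
- by move=> w; rewrite ger0_norm ?sqr_ge0 //; exact: Lip_sqr_le.
- by apply: intgZ; exact: intg_n1X.
Qed.

(** An increment of [Gam s g] is an average of increments of g at shifted points. Jensen's
    inequality brings the square inside, and after exchanging the two expectations the bound holds
    at each shifted point. *)
Lemma vbound_Gam K a g s : 0 <= a -> Lip a g -> vbound K g -> vbound K (Gam s g).
Proof.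
move=> a0 l v x t t01; have cg := Lip_cont a0 l; have gg := Lip_growth a0 l.
have i z r : intg P (fun w => g (z + r *: xi w)) by exact: intg_growth_shift.
have i' w1 : intg P (fun w2 => g (x + Num.sqrt s *: xi w2 + t *: xi w1)).
  by under eq_fun do rewrite addrAC; exact: i.
pose f w1 w2 := (g (x + Num.sqrt s *: xi w2 + t *: xi w1) - g (x + Num.sqrt s *: xi w2)) ^+ 2.
have mf : measurable_fun [set: T * T] (fun w => f w.1 w.2).
  have m1 : rvec (fun w : T * T => x + Num.sqrt s *: xi w.2).
    by move=> k; apply: measurable_funD => //; apply: measurable_funM => //; exact: (measurableT_comp (mxi k) measurable_snd).
  have m2 : rvec (fun w : T * T => x + Num.sqrt s *: xi w.2 + t *: xi w.1).
    move=> k; apply: measurable_funD; first exact: (m1 k).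
    by apply: measurable_funM => //; exact: (measurableT_comp (mxi k) measurable_fst).
  apply: measurable_funX; apply: measurable_funB; [exact: (measurable_cont cg m2)|exact: (measurable_cont cg m1)].
have i1 w1 : intg P (f w1).
  apply: (@intg_bounded _ _ _ _ _ (a ^+ 2 * (N1 w1 ^+ 2 * expR (0 * N1 w1)))).
    exact: (measurable_section1 w1 mf).
  by move=> w2; rewrite ger0_norm ?sqr_ge0 //; exact: Lip_sqr_le.
have i2 w2 : intg P (fun w1 => f w1 w2) by exact: (intg_Lip_sqr _ a0 t01 l).
have sw := Ex_swap mf (fun _ _ => sqr_ge0 _) i1 i2.
apply: (@le_trans _ _ (Ex P (fun w1 => Ex P (f w1)))).
  apply: Ex_le; first exact: (intg_Lip_sqr _ a0 t01 (Lip_Gam s a0 l)).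
    apply: (@intg_le _ _ _ _ _ (fun w => a ^+ 2 * (N1 w ^+ 2 * expR (0 * N1 w)))).
    - by apply: (@Ex_fubini_mf _ _ _ _ _ P (fun w => f w.1 w.2)); [exact: mf|move=> w; exact: sqr_ge0].
    - move=> w1; rewrite ger0_norm; last by apply: Ex_ge0 => w2; exact: sqr_ge0.
      rewrite -[leRHS](Ex_cst P); apply: Ex_le; [exact: i1|exact: intg_cst|].
      by move=> w2; exact: Lip_sqr_le.
    - by apply: intgZ; exact: intg_n1X.
  move=> w1; have -> : Gam s g (x + t *: xi w1) - Gam s g x =
      Ex P (fun w2 => g (x + Num.sqrt s *: xi w2 + t *: xi w1) - g (x + Num.sqrt s *: xi w2)).
    rewrite ExB; [|exact: i'|exact: i].
    by congr (_ - _); apply: eq_Ex => w2; rewrite addrAC.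
  by apply: Ex_sqr_le; [apply: intgB; [exact: i'|exact: i]|exact: i1].
rewrite sw -[leRHS](Ex_cst P); apply: Ex_le.
- apply: (@intg_bounded _ _ _ _ _ (t ^+ 2 * sigma2 + K * t ^+ 3)).
    apply: (@Ex_fubini_mf _ _ _ _ _ P (fun w => f w.2 w.1)); last by move=> w; exact: sqr_ge0.
    exact: (measurableT_comp mf (@measurable_swap _ _ _ _)).
  by move=> w; rewrite ger0_norm; [exact: v|apply: Ex_ge0 => w1; exact: sqr_ge0].
- exact: intg_cst.
- by move=> w2; exact: v.
Qed.

Lemma LL_Gam a (phi : (I -> R) -> R) s : 0 <= a -> LL a phi -> LL a (Gam s phi).
Proof.
move=> a0 l; have [p h] := l; have c := LL_cont a0 l.
have g : growth phi by exists (phi 0), a; split => // [|y]; [exact: ltW|exact: LL_growth].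
have i z : intg P (fun w => phi (z + Num.sqrt s *: xi w)) by exact: intg_growth_shift.
split=> [x|x y]; first by apply: Ex_gt0.
rewrite mulrC -ExZ; last exact: i.
apply: Ex_le; [exact: i|by apply: intgZ; exact: i|].
by move=> w; rewrite addrAC mulrC.
Qed.

Lemma LL_growthP a (phi : (I -> R) -> R) : 0 <= a -> LL a phi -> growth phi.
Proof. by move=> a0 l; exists (phi 0), a; split => // [|y]; [case: l => p _; exact: ltW|exact: LL_growth]. Qed.

Lemma Gam_le (phi psi : (I -> R) -> R) s x : cont phi -> growth phi -> cont psi -> growth psi ->
  (forall y, phi y <= psi y) -> Gam s phi x <= Gam s psi x.
Proof. by move=> c1 g1 c2 g2 h; apply: Ex_le => [||w]; [exact: intg_growth_shift..|exact: h]. Qed.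

Lemma Gam0 (phi : (I -> R) -> R) x : Gam 0 phi x = phi x.
Proof. by rewrite -[RHS](Ex_cst P); apply: eq_Ex => w; rewrite sqrtr0 scale0r addr0. Qed.

Lemma GamZ k (phi : (I -> R) -> R) s x : cont phi -> growth phi -> Gam s (fun y => k * phi y) x = k * Gam s phi x.
Proof. by move=> c g; rewrite -ExZ //; exact: intg_growth_shift. Qed.

Definition stepK K a := K / 2 + a ^+ 3 * Ex P (fun w => N1 w ^+ 3 * expR (a * N1 w)).

(** Second order expansion of exp of the increment D: its mean passes into [Gam (t ^+ 2) g x], its
    square is controlled by [vbound], the cubic rest by [stepK], and 1 + u <= e ^ u closes the
    estimate. *)
Lemma Gam_expR_step K a g t x : 0 <= a -> Lip a g -> vbound K g -> 0 <= t <= 1 ->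
  Gam (t ^+ 2) (fun y => expR (g y)) x <=
  expR (t ^+ 2 * sigma2 / 2 + stepK K a * t ^+ 3) * expR (Gam (t ^+ 2) g x).
Proof.
move=> a0 l v t01; have /andP[t0 t1] := t01; have cg := Lip_cont a0 l; have gg := Lip_growth a0 l.
have ts : Num.sqrt (t ^+ 2) = t by rewrite sqrtr_sqr ger0_norm.
pose D w := g (x + t *: xi w) - g x.
have ig : intg P (fun w => g (x + t *: xi w)) by exact: intg_growth_shift.
have iD : intg P D by apply: intgB => //; exact: intg_cst.
have iD2 : intg P (fun w => D w ^+ 2) by exact: (intg_Lip_sqr _ a0 t01 l).
have ED : Gam (t ^+ 2) g x = g x + Ex P D.
  by rewrite /D ExB ?Ex_cst; [rewrite /Gam ts addrC subrK|exact: ig|exact: intg_cst].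
have lD w : `|D w| <= t * (a * N1 w).
  by apply: (le_trans (l _ _)); rewrite n1Z ger0_norm // mulrCA.
have le w : expR (D w) <= 1 + D w + 2^-1 * D w ^+ 2 + t ^+ 3 * a ^+ 3 * (N1 w ^+ 3 * expR (a * N1 w)).
  apply: (le_trans (expR_taylor2 _)); rewrite [D w ^+ 2 / 2]mulrC lerD2l.
  have aN : 0 <= a * N1 w by rewrite mulr_ge0 ?n1_ge0.
  have h1 : `|D w| ^+ 3 <= t ^+ 3 * a ^+ 3 * N1 w ^+ 3.
    have tn : 0 <= t * (a * N1 w) by rewrite mulr_ge0.
    by rewrite -!exprMn -mulrA; apply: lerXn2r; rewrite ?nnegrE.
  rewrite mulrA; apply: ler_pM; [exact: exprn_ge0|exact: expR_ge0|exact: h1|].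
  by rewrite ler_expR (le_trans (lD w)) // ler_piMl.
have lE := Lip_expR l; have cE := LL_cont a0 lE; have gE := LL_growthP a0 lE.
have iE : intg P (fun w => expR (g (x + t *: xi w))) by exact: (intg_growth_shift gxi x t cE gE).
have iE' : intg P (fun w => expR (D w)).
  rewrite (_ : (fun w => _) = fun w => expR (- g x) * expR (g (x + t *: xi w))).
    exact: intgZ.
  by apply/funext => w; rewrite -expRD addrC.
have i3 := intgZ (t ^+ 3 * a ^+ 3) (intg_n1X 3 a).
have i0 : intg P (fun w => 1 + D w) by apply: intgD => //; exact: intg_cst.
have i1 : intg P (fun w => 1 + D w + 2^-1 * D w ^+ 2) by apply: intgD => //; exact: intgZ.
have h : Ex P (fun w => expR (D w)) <= 1 + (Ex P D + (t ^+ 2 * sigma2 / 2 + stepK K a * t ^+ 3)).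
  apply: le_trans (Ex_le iE' (intgD i1 i3) le) _.
  rewrite ExD // (@ExD _ _ _ P (fun w => 1 + D w)) //; last exact: intgZ.
  rewrite (@ExD _ _ _ P (fun=> 1)) //; last exact: intg_cst.
  rewrite Ex_cst !ExZ //; last exact: intg_n1X.
  by have := v x t t01; rewrite -/(D _) /stepK; set E := Ex P (fun w => D w ^+ 2); set E3 := Ex P _; lra.
rewrite ED /Gam ts (_ : (fun w => _) = fun w => expR (g x) * expR (D w)); last first.
  by apply/funext => w; rewrite -expRD [g x + _]addrC subrK.
rewrite ExZ // [expR (g x + _)]expRD mulrCA ler_wpM2l ?expR_ge0 // -expRD addrC.
by apply: (le_trans h); exact: expR_ge1Dx.
Qed.

(** Time 1 is cut into N = t ^ -2 steps of length t ^ 2. A step costs e ^ (t ^ 2 sigma2 / 2 + O(t ^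
    3)), so the total error is O(N t ^ 3) = O(t) and disappears in the limit. *)
Lemma gauss_expR_le K a f : 0 <= a -> Lip a f -> vbound K f ->
  Ex P (fun w => expR (f (xi w))) <= expR (Ex P (fun w => f (xi w)) + sigma2 / 2).
Proof.
move=> a0 l v; have cf := Lip_cont a0 l; have gf := Lip_growth a0 l.
have K0 : exists2 K', 0 <= K' & vbound K' f.
  exists `|K| => // x t t01; apply: (le_trans (v x t t01)); rewrite lerD2l ler_wpM2r ?ler_norm //.
  by rewrite exprn_ge0; case/andP: t01.
case: K0 => {v} {}K K0 v; set E := Ex P (fun w => f (xi w)).
have G1 phi : Gam 1 phi 0 = Ex P (fun w => phi (xi w)).
  by apply: eq_Ex => w; rewrite sqrtr1 scale1r add0r.
pose K' := stepK K a.
have main (k : nat) : Ex P (fun w => expR (f (xi w))) <= expR (E + sigma2 / 2 + K' * k.+1%:R^-1).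
  pose t : R := k.+1%:R^-1; have t0 : 0 < t by rewrite invr_gt0.
  have t01 : 0 <= t <= 1 by rewrite (ltW t0) invf_le1 // ler1n.
  have t2 : 0 <= t ^+ 2 by exact: sqr_ge0.
  pose N := (k.+1 ^ 2)%N; have Nt : N%:R * t ^+ 2 = 1.
    by rewrite /N natrX -exprMn divff ?expr1n.
  (* Interpolation between f at j = N and its smoothing over the whole unit of time at j = 0, whose
     value at 0 is the mean E. *)
  pose g j := Gam ((N - j)%:R * t ^+ 2) f.
  have gL j : Lip a (g j) by exact: Lip_Gam.
  have eL j : LL a (fun y => expR (g j y)) by exact: Lip_expR.
  have step j : (j <= N)%N -> Gam (j%:R * t ^+ 2) (fun y => expR (g j y)) 0 <=
      expR (t ^+ 2 * sigma2 / 2 + K' * t ^+ 3) ^+ j * expR E.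
    elim: j => [|j IH] jN.
      by rewrite mul0r Gam0 expr0 mul1r /g subn0 Nt G1.
    have ce := LL_cont a0 (eL j.+1); have ge := LL_growthP a0 (eL j.+1).
    have j0 : 0 <= j%:R * t ^+ 2 by rewrite mulr_ge0.
    rewrite -[j.+1]addn1 natrD mulrDl mul1r addn1 (Gam_semigroup gxi 0 ce ge j0 t2).
    have gjE y : Gam (t ^+ 2) (g j.+1) y = g j y.
      have u0 : 0 <= (N - j.+1)%:R * t ^+ 2 by rewrite mulr_ge0.
      rewrite /g -(Gam_semigroup gxi y cf gf t2 u0).
      have -> // : t ^+ 2 + (N - j.+1)%:R * t ^+ 2 = (N - j)%:R * t ^+ 2.
      by rewrite -(subnSK jN) -natr1; ring.
    have lG := LL_Gam (t ^+ 2) a0 (eL j.+1).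
    have cj := LL_cont a0 (eL j); have gj := LL_growthP a0 (eL j).
    apply: (@le_trans _ _ (Gam (j%:R * t ^+ 2) (fun y => expR (t ^+ 2 * sigma2 / 2 + K' * t ^+ 3) * expR (g j y)) 0)).
      apply: Gam_le.
      - exact: (LL_cont a0 lG).
      - exact: (LL_growthP a0 lG).
      - exact: (contZ _ cj).
      - case: gj => A [q [A0 q0 hA]]; set k' := expR (_ + _).
        exists (k' * A), q; split => //; first by rewrite mulr_ge0 ?expR_ge0.
        by move=> y; rewrite normrM ger0_norm ?expR_ge0 // -mulrA ler_wpM2l ?expR_ge0.
      - move=> y; rewrite -(gjE y); apply: Gam_expR_step => //.
        exact: (vbound_Gam _ a0 l v).
    rewrite (GamZ _ _ _ cj gj) (exprS _ j) -[leRHS]mulrA ler_wpM2l ?expR_ge0 //; apply: IH; exact: ltnW.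
  have := step N (leqnn N); rewrite Nt G1 (_ : Ex P _ = Ex P (fun w => expR (f (xi w)))); last first.
    by apply: eq_Ex => w; rewrite /g subnn mul0r Gam0.
  rewrite -expRM_natr -expRD (_ : _ + _ = E + sigma2 / 2 + K' * k.+1%:R^-1) // -/t.
  have -> : (t ^+ 2 * sigma2 / 2 + K' * t ^+ 3) * N%:R = (N%:R * t ^+ 2) * (sigma2 / 2 + K' * t) by ring.
  by rewrite Nt; ring.
have lim : expR (E + sigma2 / 2 + K' * k.+1%:R^-1) @[k --> \oo] --> expR (E + sigma2 / 2 + K' * 0).
  apply: (@cvg_comp _ _ _ _ expR); last exact: continuous_expR.
  by apply: cvgD; [exact: cvg_cst|apply: cvgM; [exact: cvg_cst|exact: cvg_harmonic]].
rewrite mulr0 addr0 in lim.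
have cst_ : (fun _ : nat => Ex P (fun w => expR (f (xi w)))) k @[k --> \oo] --> Ex P (fun w => expR (f (xi w))).
  exact: cvg_cst.
by apply: (ler_cvg_to cst_ lim); apply: nearW => k; exact: main.
Qed.

End Concentration.

(** * Maxima of affine functions of a Gaussian vector *)

Section WeightedExp.
Context {R : realType} {J : finType}.
Implicit Types (w u : J -> R) (B : R).

(** Jensen's inequality gives the lower bound. For 2 B <= 1 the second order expansion around the
    mean gives (2 B) ^ 2 e; otherwise the trivial bound 2 B is itself at most 4 B ^ 2. *)
Lemma ln_wsum_expR w u B : (forall j, 0 <= w j) -> \sum_j w j = 1 -> (forall j, `|u j| <= B) ->
  0 <= ln (\sum_j w j * expR (u j)) - \sum_j w j * u j <= 4 * expR 1 * B ^+ 2.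
Proof.
move=> w0 w1 uB; set mu := \sum_j w j * u j.
have avg (f g : J -> R) : (forall j, f j <= g j) -> \sum_j w j * f j <= \sum_j w j * g j.
  by move=> fg; apply: ler_sum => j _; rewrite ler_wpM2l.
have cst_ a : \sum_j w j * a = a by rewrite -mulr_suml w1 mul1r.
have splitE : \sum_j w j * expR (u j) = expR mu * \sum_j w j * expR (u j - mu).
  rewrite mulr_sumr; apply: eq_bigr => j _; rewrite mulrCA -expRD addrC subrK //.
have S1 : 1 <= \sum_j w j * expR (u j - mu).
  apply: (@le_trans _ _ (\sum_j w j * (1 + (u j - mu)))); last by apply: avg => j; exact: expR_ge1Dx.
  rewrite (eq_bigr (fun j => w j * u j + w j * (1 - mu))); last by move=> j _; ring.
  by rewrite big_split /= cst_ -/mu; lra.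
have Spos : 0 < \sum_j w j * expR (u j - mu) by lra.
have muB : `|mu| <= B.
  rewrite -[leRHS]cst_; apply: (le_trans (ler_norm_sum _ _ _)); apply: ler_sum => j _.
  by rewrite normrM ger0_norm // ler_wpM2l.
have B0 : 0 <= B by exact: le_trans muB.
have dB j : `|u j - mu| <= 2 * B.
  by apply: (le_trans (ler_normB _ _)); have := uB j; lra.
rewrite splitE lnM ?posrE ?expR_gt0 // expRK addrC addKr.
apply/andP; split; first by rewrite ln_ge0.
rewrite -ler_expR lnK ?posrE //.
have [B2|B2] := lerP (2 * B) 1.
  apply: (@le_trans _ _ (1 + 4 * expR 1 * B ^+ 2)); last exact: expR_ge1Dx.
  apply: (@le_trans _ _ (\sum_j w j * ((1 + 4 * expR 1 * B ^+ 2) + (u j - mu)))).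
    apply: avg => j; have h := dB j; move: (u j - mu) h => q h.
    have q1 : `|q| <= 1 by lra.
    have q2 : q ^+ 2 <= 4 * B ^+ 2.
      rewrite -real_normK ?num_real // (_ : 4 * _ = (2 * B) ^+ 2); last by ring.
      by rewrite ler_sqr ?nnegrE //; lra.
    have /andP[_ e1] := expR_taylor1 q.
    have e2 : q ^+ 2 * expR `|q| <= 4 * B ^+ 2 * expR 1.
      by rewrite ler_pM ?sqr_ge0 ?expR_ge0 // ler_expR.
    by lra.
  rewrite (eq_bigr (fun j => w j * u j + w j * (1 + 4 * expR 1 * B ^+ 2 - mu))); last by move=> j _; ring.
  by rewrite big_split /= cst_ -/mu; lra.
apply: (@le_trans _ _ (expR (2 * B))).
  rewrite -[leRHS]cst_; apply: avg => j; rewrite ler_expR; exact: le_trans (ler_norm _) (dB j).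
rewrite ler_expR; have e1 : 1 <= expR (1 : R) by rewrite -{1}expR0 ler_expR.
have : 2 * B <= 4 * B ^+ 2 by nra.
by have := sqr_ge0 B; nra.
Qed.
End WeightedExp.

Section GaussianMax.
Context {R : realType} {I J : finType} {dT : measure_display} {T : measurableType dT}.
Variable P : probability T R.
Variable xi : T -> I -> R.
Hypothesis gxi : gvec P xi.
Variables (b : J -> R) (c : J -> I -> R) (sigma2 : R) (j0 : J).
Hypothesis var_le : forall j, Ex P (fun w => dotv (c j) (xi w) ^+ 2) <= sigma2.
Implicit Types x y : I -> R.
Let mxi : rvec xi. Proof. by case: gxi. Qed.

Let M : R := \sum_j \sum_i `|c j i|.

Lemma dotv_le_n1 (e : I -> R) y : `|dotv e y| <= (\sum_i `|e i|) * n1 y.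
Proof.
apply: (le_trans (ler_norm_sum _ _ _)); rewrite mulr_suml; apply: ler_sum => i _.
rewrite normrM ler_wpM2l // /n1 (bigD1 i) //= lerDl; exact: sumr_ge0.
Qed.

Let M0 : 0 <= M. Proof. by apply: sumr_ge0 => j _; exact: sumr_ge0. Qed.

Let cM j y : `|dotv (c j) y| <= M * n1 y.
Proof.
apply: (le_trans (dotv_le_n1 _ _)); rewrite ler_wpM2r ?n1_ge0 // /M (bigD1 j) //= lerDl.
by apply: sumr_ge0 => j' _; exact: sumr_ge0.
Qed.

Let aff x j := b j + dotv (c j) x.

Variable be : R.
Hypothesis be0 : 0 < be.

Let S x := \sum_j expR (be * aff x j).
(** Soft maximum of the affine functions: it exceeds the maximum by at most ln #|J| / be ([lse_le])
    and has the second order control that the maximum lacks. *)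
Let f x := ln (S x) / be.

Let S_gt0 x : 0 < S x.
Proof. by rewrite /S (bigD1 j0) //= ltr_wpDr ?expR_gt0 // sumr_ge0 // => j _; exact: expR_ge0. Qed.

Let S_neq0 x : S x != 0. Proof. by rewrite gt_eqF ?S_gt0. Qed.

Let wt x j := expR (be * aff x j) / S x.

Let wt_ge0 x j : 0 <= wt x j. Proof. by rewrite divr_ge0 ?expR_ge0 // ltW ?S_gt0. Qed.
Let wt_sum x : \sum_j wt x j = 1.
Proof. by rewrite -mulr_suml divff ?S_neq0. Qed.

Let lin x y := \sum_j wt x j * dotv (c j) y.

Let lin_le x y : `|lin x y| <= M * n1 y.
Proof.
rewrite -[leRHS]mul1r -(wt_sum x) mulr_suml; apply: (le_trans (ler_norm_sum _ _ _)).
by apply: ler_sum => j _; rewrite normrM ger0_norm // ler_wpM2l.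
Qed.

(** [lin x] is the derivative of the soft maximum at x, the average of the linear parts for the
    Gibbs weights [wt x]. *)
Let lse_taylor x y : 0 <= f (x + y) - f x - lin x y <= 4 * expR 1 * be * M ^+ 2 * n1 y ^+ 2.
Proof.
have h := @ln_wsum_expR _ _ (wt x) (fun j => be * dotv (c j) y) (be * M * n1 y) (wt_ge0 x) (wt_sum x) _.
have {h} : 0 <= ln (\sum_j wt x j * expR (be * dotv (c j) y)) - \sum_j wt x j * (be * dotv (c j) y) <=
    4 * expR 1 * (be * M * n1 y) ^+ 2.
  by apply: h => j; rewrite normrM gtr0_norm // -mulrA ler_wpM2l // ltW.
have -> : \sum_j wt x j * (be * dotv (c j) y) = be * lin x y.
  by rewrite mulr_sumr; apply: eq_bigr => j _; rewrite mulrCA.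
have eS : S (x + y) = S x * \sum_j wt x j * expR (be * dotv (c j) y).
  rewrite mulr_sumr; apply: eq_bigr => j _; rewrite mulrA mulrCA divff ?mulr1 ?S_neq0 //.
  by rewrite -expRD -mulrDr /aff dotvDr addrA.
have Q0 : 0 < \sum_j wt x j * expR (be * dotv (c j) y).
  by have := S_gt0 (x + y); rewrite eS pmulr_rgt0.
have -> : f (x + y) - f x - lin x y =
    be^-1 * (ln (\sum_j wt x j * expR (be * dotv (c j) y)) - be * lin x y).
  by rewrite /f eS lnM ?posrE ?S_gt0 //; field; rewrite gt_eqF.
case/andP=> h1 h2; rewrite mulr_ge0 ?invr_ge0 ?(ltW be0) //=.
rewrite mulrC ler_pdivrMr // (le_trans h2) // le_eqVlt; apply/orP; left; apply/eqP; ring.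
Qed.

Let f_Lip : Lip M f.
Proof.
have half x y : f (x + y) <= f x + M * n1 y.
  rewrite /f ler_pdivrMr // mulrDl divfK ?gt_eqF //.
  have e : expR (M * n1 y * be) * S x = \sum_j expR (M * n1 y * be + be * aff x j).
    by rewrite mulr_sumr; apply: eq_bigr => j _; rewrite expRD.
  have le : S (x + y) <= expR (M * n1 y * be) * S x.
    rewrite e; apply: ler_sum => j _; rewrite ler_expR /aff dotvDr.
    have := le_trans (ler_norm _) (cM j y); rewrite -(ler_pM2l be0); lra.
  rewrite -ler_expR expRD !lnK ?posrE ?S_gt0 // mulrC; exact: le.
move=> x y; rewrite ler_norml; apply/andP; split; last by have := half x y; lra.
by have := half (x + y) (- y); rewrite addrK -scaleN1r n1Z normrN1 mul1r; lra.
Qed.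

Let E4 := Ex P (fun w => n1 (xi w) ^+ 4 * expR (0 * n1 (xi w))).
Let E3 := Ex P (fun w => n1 (xi w) ^+ 3 * expR (0 * n1 (xi w))).
Let q := 4 * expR 1 * be * M ^+ 2.

(** By convexity of the square, [lin x] squared is at most the [wt x]-average of the squared linear
    parts, whose expectations are at most [sigma2]. The remainder of [lse_taylor] enters at order t
    ^ 3; its dependence on [be] is harmless because K is absent from the conclusion of
    [gauss_expR_le]. *)
Let f_vbound : vbound P xi sigma2 (2 * M * q * E3 + q ^+ 2 * E4) f.
Proof.
move=> x t t01; have /andP[t0 t1] := t01.
have q0 : 0 <= q by rewrite !mulr_ge0 ?expR_ge0 ?sqr_ge0 ?(ltW be0).
have i2 j : intg P (fun w => dotv (c j) (xi w) ^+ 2).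
  apply: (@intg_le _ _ _ _ _ (fun w => M ^+ 2 * (n1 (xi w) ^+ 2 * expR (0 * n1 (xi w))))).
  - by apply: measurable_funX; exact: measurable_dotv.
  - move=> w; rewrite ger0_norm ?sqr_ge0 // mul0r expR0 mulr1 -exprMn -real_normK ?num_real //.
    by rewrite ler_sqr ?nnegrE ?mulr_ge0 ?n1_ge0.
  - by apply: intgZ; exact: intg_n1X.
have i3 := intg_n1X gxi 3 0; have i4 := intg_n1X gxi 4 0.
pose rhs w := t ^+ 2 * (\sum_j wt x j * dotv (c j) (xi w) ^+ 2) +
   t ^+ 3 * (2 * M * q * (n1 (xi w) ^+ 3 * expR (0 * n1 (xi w))) + q ^+ 2 * (n1 (xi w) ^+ 4 * expR (0 * n1 (xi w)))).
have is_ : intg P (fun w => \sum_j wt x j * dotv (c j) (xi w) ^+ 2) by apply: intg_sum => j; exact: intgZ.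
have ie : intg P (fun w => 2 * M * q * (n1 (xi w) ^+ 3 * expR (0 * n1 (xi w))) + q ^+ 2 * (n1 (xi w) ^+ 4 * expR (0 * n1 (xi w)))).
  by apply: intgD; exact: intgZ.
have ir : intg P rhs by apply: intgD; exact: intgZ.
have Erhs : Ex P rhs = t ^+ 2 * (\sum_j wt x j * Ex P (fun w => dotv (c j) (xi w) ^+ 2)) + t ^+ 3 * (2 * M * q * E3 + q ^+ 2 * E4).
  rewrite /rhs ExD; [|exact: intgZ..]; rewrite !ExZ // ExD; [|exact: intgZ..]; rewrite !ExZ //.
  congr (_ * _ + _); rewrite Ex_sum; last by move=> j; exact: intgZ.
  by apply: eq_bigr => j _; rewrite ExZ.
apply: (@le_trans _ _ (Ex P rhs)); last first.
  rewrite Erhs lerD ?[_ * t ^+ 3]mulrC // ler_wpM2l ?sqr_ge0 //.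
  rewrite -[leRHS]mul1r -(wt_sum x) mulr_suml; apply: ler_sum => j _.
  by rewrite ler_wpM2l.
apply: Ex_le => //; first exact: (intg_Lip_sqr gxi x M0 t01 f_Lip).
move=> w; have /andP[h1 h2] := lse_taylor x (t *: xi w).
have linZ : lin x (t *: xi w) = t * lin x (xi w).
  by rewrite /lin mulr_sumr; apply: eq_bigr => j _; rewrite dotvZr mulrCA.
have l1 := lin_le x (xi w); have N0 := n1_ge0 (xi w).
have l2 : lin x (xi w) ^+ 2 <= \sum_j wt x j * dotv (c j) (xi w) ^+ 2.
  set l := lin _ _.
  have : 0 <= \sum_j wt x j * (dotv (c j) (xi w) - l) ^+ 2.
    by apply: sumr_ge0 => j _; rewrite mulr_ge0 ?sqr_ge0.
  rewrite (eq_bigr (fun j => wt x j * dotv (c j) (xi w) ^+ 2 + (- (2 * l)) * (wt x j * dotv (c j) (xi w)) + l ^+ 2 * wt x j)); last first.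
    by move=> j _; ring.
  by rewrite !big_split /= -!mulr_sumr wt_sum -/(lin x (xi w)) -/l; lra.
rewrite /rhs mul0r expR0 !mulr1; move: h1 h2 l1 l2; rewrite linZ n1Z (ger0_norm t0) -/q.
move: (f _ - f x) (lin x (xi w)) (\sum_j _) (n1 (xi w)) N0 => D l s N N0 h1 h2 l1 l2.
pose e := D - t * l; have e0 : 0 <= e by [].
have e1 : e <= q * N ^+ 2 * t ^+ 2 by rewrite /e (le_trans h2) // exprMn; lra.
have -> : D ^+ 2 = t ^+ 2 * l ^+ 2 + 2 * (t * l) * e + e ^+ 2 by rewrite /e; ring.
have le : l * e <= M * N * (q * N ^+ 2 * t ^+ 2).
  apply: (@le_trans _ _ (`|l| * e)); first by rewrite ler_wpM2r // ler_norm.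
  by rewrite ler_pM.
have e2 : e ^+ 2 <= (q * N ^+ 2 * t ^+ 2) ^+ 2 by rewrite ler_sqr ?nnegrE // (le_trans e0).
have t43 : t ^+ 4 <= t ^+ 3 by rewrite exprS ler_piMl ?exprn_ge0.
have a1 : t ^+ 2 * l ^+ 2 <= t ^+ 2 * s by rewrite ler_wpM2l ?sqr_ge0.
have a2 : t * (l * e) <= t * (M * N * (q * N ^+ 2 * t ^+ 2)) by rewrite ler_wpM2l.
have a3 : (q * N ^+ 2) ^+ 2 * t ^+ 4 <= (q * N ^+ 2) ^+ 2 * t ^+ 3 by rewrite ler_wpM2l ?sqr_ge0.
have -> : t ^+ 2 * s + t ^+ 3 * (2 * M * q * N ^+ 3 + q ^+ 2 * N ^+ 4) =
  t ^+ 2 * s + 2 * (t * (M * N * (q * N ^+ 2 * t ^+ 2))) + (q * N ^+ 2) ^+ 2 * t ^+ 3 by ring.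
have e3 : (q * N ^+ 2 * t ^+ 2) ^+ 2 = (q * N ^+ 2) ^+ 2 * t ^+ 4 by ring.
by rewrite -(mulrA 2) -(mulrA t) e3 in e2 *; lra.
Qed.

Lemma lse_expR_le : Ex P (fun w => expR (f (xi w))) <= expR (Ex P (fun w => f (xi w)) + sigma2 / 2).
Proof. exact: (gauss_expR_le gxi M0 f_Lip f_vbound). Qed.

Variable h : (I -> R) -> R.
Hypothesis h_ub : forall x j, aff x j <= h x.
Hypothesis h_ex : forall x, exists j, h x = aff x j.

Lemma max_Lip : Lip M h.
Proof.
have half x y : h (x + y) <= h x + M * n1 y.
  have [j ->] := h_ex (x + y); rewrite /aff dotvDr addrA lerD //; first exact: h_ub.
  exact: le_trans (ler_norm _) (cM j y).
move=> x y; rewrite ler_norml; apply/andP; split; last by have := half x y; lra.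
by have := half (x + y) (- y); rewrite addrK -scaleN1r n1Z normrN1 mul1r; lra.
Qed.

Lemma lse_ge x : h x <= f x.
Proof.
have [j e] := h_ex x; rewrite e /f ler_pdivlMr // -ler_expR lnK ?posrE ?S_gt0 // mulrC.
by rewrite /S (bigD1 j) //= lerDl sumr_ge0 // => i _; exact: expR_ge0.
Qed.

Lemma lse_le x : f x <= h x + ln #|J|%:R / be.
Proof.
have J0 : 0 < #|J|%:R :> R by rewrite ltr0n; apply/card_gt0P; exists j0.
rewrite /f ler_pdivrMr // mulrDl divfK ?gt_eqF // -ler_expR expRD !lnK ?posrE ?S_gt0 //.
rewrite mulr_natr -sumr_const; apply: ler_sum => j _; rewrite ler_expR mulrC ler_wpM2r //.
exact: ltW.
Qed.

Lemma max_expR_le_be : Ex P (fun w => expR (h (xi w))) <=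
  expR (Ex P (fun w => h (xi w)) + sigma2 / 2 + ln #|J|%:R / be).
Proof.
have cf := Lip_cont M0 f_Lip; have gf := Lip_growth M0 f_Lip.
have ch := Lip_cont M0 max_Lip; have gh := Lip_growth M0 max_Lip.
have ih := intg_growth gxi ch gh; have if_ := intg_growth gxi cf gf.
have lh := Lip_expR max_Lip; have lf := Lip_expR f_Lip.
have ihe := intg_growth gxi (LL_cont M0 lh) (LL_growthP M0 lh).
have ife := intg_growth gxi (LL_cont M0 lf) (LL_growthP M0 lf).
apply: (@le_trans _ _ (Ex P (fun w => expR (f (xi w))))).
  by apply: Ex_le => // w; rewrite ler_expR; exact: lse_ge.
apply: (le_trans lse_expR_le); rewrite ler_expR addrAC lerD2r.
rewrite -[X in _ + X](Ex_cst P) -ExD //; last exact: intg_cst.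
apply: Ex_le => //; first by apply: intgD => //; exact: intg_cst.
by move=> w; exact: lse_le.
Qed.

End GaussianMax.

(** The bound for the soft maximum with be = k + 1, as k tends to infinity: the cost ln #|J| / be
    vanishes. *)
Lemma gauss_max_expR_le {R : realType} {I J : finType} {dT : measure_display} {T : measurableType dT}
    (P : probability T R) (xi : T -> I -> R) (b : J -> R) (c : J -> I -> R) (sigma2 : R) (j0 : J)
    (h : (I -> R) -> R) : gvec P xi ->
  (forall j, Ex P (fun w => dotv (c j) (xi w) ^+ 2) <= sigma2) ->
  (forall x j, b j + dotv (c j) x <= h x) -> (forall x, exists j, h x = b j + dotv (c j) x) ->
  Ex P (fun w => expR (h (xi w))) <= expR (Ex P (fun w => h (xi w)) + sigma2 / 2).
Proof.
move=> gxi v hu he.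
have main (k : nat) := @max_expR_le_be _ _ _ _ _ P xi gxi b c sigma2 j0 v k.+1%:R (ltr0Sn _ k) h hu he.
set E := Ex P (fun w => h (xi w)).
have lim : expR (E + sigma2 / 2 + ln #|J|%:R / k.+1%:R) @[k --> \oo] --> expR (E + sigma2 / 2 + ln #|J|%:R * 0).
  apply: (@cvg_comp _ _ _ _ expR); last exact: continuous_expR.
  by apply: cvgD; [exact: cvg_cst|apply: cvgM; [exact: cvg_cst|exact: cvg_harmonic]].
rewrite mulr0 addr0 in lim.
have cst_ : (fun _ : nat => Ex P (fun w => expR (h (xi w)))) k @[k --> \oo] --> Ex P (fun w => expR (h (xi w))).
  exact: cvg_cst.
by apply: (ler_cvg_to cst_ lim); apply: nearW => k; exact: main.
Qed.

(** * Poissonization *)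

Section Poisson.
Variable R : realType.
Implicit Types (s x dl : R) (r n : nat).

Lemma is_derive_affine (f : R -> R) (a t : R) : (forall h, f (t + h) - f t = h * a) -> is_derive t 1 f a.
Proof.
by move=> e; apply: (@is_derive_quadratic _ _ _ _ 0) => h; rewrite e subrr normr0 mul0r.
Qed.

Lemma is_derive_MVT (f f' : R -> R) (a b : R) : a <= b -> (forall x, is_derive x 1 f (f' x)) ->
  exists2 c, a <= c <= b & f b - f a = f' c * (b - a).
Proof.
move=> ab d; have [|c] := @MVT_segment R f f' a b ab (fun x _ => d x).
  apply: continuous_subspaceT => x; apply: differentiable_continuous; apply/derivable1_diffP.
  by have [] := d x.
by rewrite in_itv /= => cab e; exists c.
Qed.

Lemma is_derive_le (f f' : R -> R) (a b : R) : a <= b -> (forall x, is_derive x 1 f (f' x)) ->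
  (forall x, a <= x <= b -> f' x <= 0) -> f b <= f a.
Proof.
move=> ab d h; have [c cab e] := is_derive_MVT ab d.
by rewrite -subr_le0 e mulr_le0_ge0 ?h // subr_ge0.
Qed.

(** Poisson mass at r and, next, the Poisson distribution function at r, both as functions of the
    mean s. *)
Definition poissp r s := expR (- s) * s ^+ r / r`!%:R.
Definition poissq r s := \sum_(k < r.+1) poissp k s.

Lemma poissp_ge0 r s : 0 <= s -> 0 <= poissp r s.
Proof. by move=> s0; rewrite !mulr_ge0 ?expR_ge0 ?exprn_ge0 ?invr_ge0. Qed.

Lemma poissp_le1 r s : 0 <= s -> poissp r s <= 1.
Proof.
move=> s0; rewrite /poissp ler_pdivrMr ?ltr0n ?fact_gt0 // mul1r expRN mulrC.
by rewrite ler_pdivrMr ?expR_gt0 // expR_ge_Xn.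
Qed.

Definition poissp_pred r s := if r is r'.+1 then poissp r' s else 0.

Lemma is_derive_expRN s : is_derive s 1 (fun x : R => expR (- x)) (- expR (- s)).
Proof.
have h1 : is_derive s 1 (fun x : R => - x) (-1) by apply: is_deriveNid.
by have := @is_derive1_comp R expR (fun x : R => - x) s _ _ (is_derive_expR _) h1; rewrite mulrN1.
Qed.

Lemma is_derive_poissp r s : is_derive s 1 (poissp r) (poissp_pred r s - poissp r s).
Proof.
have h1 := is_derive_expRN s.
have h2 : is_derive s 1 (fun x : R => x ^+ r / r`!%:R) (r%:R * s ^+ r.-1 / r`!%:R).
  case: r => [|r]; first rewrite !mul0r.
    rewrite (_ : (fun x => _) = cst 1); first exact: is_derive_cst.
    by apply/funext => x; rewrite expr0 fact0 divr1.
  move: (r.+1`!%:R^-1) => c.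
  have h : is_derive s 1 (fun x : R => x ^+ r.+1) ((r.+1%:R * s ^+ r) *: 1).
    have -> : (fun x : R => x ^+ r.+1) = id ^+ r.+1 by apply/funext => x; rewrite exprfctE.
    exact: (@is_deriveX R R id r.+1 s 1 1 (is_derive_id _ _)).
  have := is_deriveM h (is_derive_cst c s 1).
  by move/is_derive_eq; apply; rewrite /GRing.scale /=; ring.
have := is_deriveM h1 h2.
rewrite (_ : (fun x => expR (- x)) * _ = poissp r); last by apply/funext => x; rewrite /poissp !fctE mulrA.
move/is_derive_eq; apply; rewrite /poissp /GRing.scale /=; case: r {h2} => [|r] /=; first by ring.
have F0 : r`!%:R != 0 :> R by rewrite pnatr_eq0 -lt0n fact_gt0.
have r0 : r.+1%:R != 0 :> R by rewrite pnatr_eq0.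
rewrite factS natrM /poissp; move: r`!%:R r.+1%:R F0 r0 => F k F0 k0.
by field; rewrite F0.
Qed.

Lemma is_derive_poissq r s : is_derive s 1 (poissq r) (- poissp r s).
Proof.
have h : is_derive s 1 (fun x => \sum_(k < r.+1) poissp k x) (\sum_(k < r.+1) (poissp_pred k s - poissp k s)).
  elim: r => [|r IH].
    rewrite (_ : (fun x => _) = poissp 0); last by apply/funext => x; rewrite big_ord_recl big_ord0 addr0.
    by rewrite big_ord_recl big_ord0 addr0; exact: is_derive_poissp.
  rewrite (_ : (fun x => _) = (fun x => \sum_(k < r.+1) poissp k x) + poissp r.+1); last first.
    by apply/funext => x; rewrite big_ord_recr.
  by rewrite big_ord_recr /=; apply: is_deriveD => //; exact: is_derive_poissp.
apply: is_derive_eq h _; elim: r => [|r IH]; first by rewrite big_ord_recl big_ord0 addr0 sub0r.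
by rewrite big_ord_recr /= IH; ring.
Qed.

(** The derivative of [poissq r] in the mean is - p_r, and that of - p_r is p_r - p_(r-1) <= 1. The
    mean value theorem is applied twice. *)
Lemma poissq_taylor r s dl : 0 <= s -> 0 <= dl -> poissq r (s + dl) <= poissq r s - dl * poissp r s + dl ^+ 2.
Proof.
move=> s0 d0; have sd : s <= s + dl by rewrite lerDl.
have [c /andP[c1 c2] e] := is_derive_MVT sd (is_derive_poissq r).
have [c' /andP[c1' c2'] e'] := is_derive_MVT c1 (is_derive_poissp r).
have h1 : -1 <= poissp_pred r c' - poissp r c'.
  have c'0 : 0 <= c' by exact: le_trans c1'.
  have h := poissp_le1 r c'0; suff : 0 <= poissp_pred r c' by lra.
  by case: (r) => //= r'; exact: poissp_ge0.
have h2 : poissp r s - dl <= poissp r c.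
  have : - dl <= (poissp_pred r c' - poissp r c') * (c - s) by nra.
  by rewrite -e'; lra.
rewrite (_ : s + dl - s = dl) in e; last by ring.
by nra.
Qed.

(* The probability that a binomial variable of parameters N and dl is <= r. *)
Fixpoint bing dl N r : R := if N is N'.+1 then
  (1 - dl) * bing dl N' r + dl * (if r is r'.+1 then bing dl N' r' else 0) else 1.

Lemma poissq0 r : poissq r 0 = 1.
Proof.
rewrite /poissq big_ord_recl big1 => [|i _]; last by rewrite /poissp /= exprS mul0r mulr0 mul0r.
by rewrite /poissp oppr0 expR0 expr0 fact0 divr1 mulr1 addr0.
Qed.

(** Since q_r - dl p_r = (1 - dl) q_r + dl q_(r-1), one Bernoulli trial acts on the distribution
    function as an increase of the Poisson mean by dl does, up to dl ^ 2. The N trials accumulate N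
    dl ^ 2. *)
Lemma bing_ge dl N r : 0 <= dl <= 1 -> poissq r (N%:R * dl) - N%:R * dl ^+ 2 <= bing dl N r.
Proof.
move=> /andP[d0 d1]; elim: N r => [|N IH] r /=; first by rewrite !mul0r poissq0 subr0.
set G := (X in _ + dl * X); have Nd : 0 <= N%:R * dl by rewrite mulr_ge0.
rewrite -natr1 !mulrDl !mul1r; have h := poissq_taylor r Nd d0.
have h1 := IH r; have : poissq r (N%:R * dl) - poissp r (N%:R * dl) - N%:R * dl ^+ 2 <= G.
  rewrite /G; case: r {h h1 G} => [|r]; last first.
    have e x : poissq r.+1 x = poissq r x + poissp r.+1 x by rewrite /poissq big_ord_recr.
    by rewrite e; have := IH r; lra.
  have : 0 <= N%:R * dl ^+ 2 by rewrite mulr_ge0 ?sqr_ge0.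
  by rewrite /poissq big_ord_recl big_ord0; lra.
move=> hG; have a1 : (1 - dl) * (poissq r (N%:R * dl) - N%:R * dl ^+ 2) <= (1 - dl) * bing dl N r.
  by rewrite ler_wpM2l // subr_ge0.
have {hG}:= ler_wpM2l d0 hG; move: a1 h {h1}.
move: G (bing dl N r) (poissq r (N%:R * dl + dl)) (poissq r (N%:R * dl)) (poissp r (N%:R * dl)) N%:R => G b q' q p k a1 h a2.
by lra.
Qed.

(* h |-> q (n - h) + q (n + h), q the distribution function at n as a function
   of the mean, is nonincreasing on [0, n] and at least 1 at h = n. *)
Lemma poissq_ge_half n : 2^-1 <= poissq n n%:R.
Proof.
case: n => [|n]; first by rewrite poissq0; lra.
set m : R := n.+1%:R; have m0 : 0 < m by [].
(* Used at x = h / m and raised to the power m, this compares the Poisson masses at m for the means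
   m - h and m + h, that is, the derivative of the symmetrised distribution function. *)
have key x : 0 <= x -> (1 - x) * expR x <= (1 + x) * expR (- x).
  move=> x0; have d (y : R) : is_derive y 1 (fun z : R => (1 - z) * expR z - (1 + z) * expR (- z)) (y * expR (- y) - y * expR y).
    have h1 := is_derive_expRN y; have h2 := is_derive_expR y.
    have h3 : is_derive y 1 (fun z : R => 1 - z) (-1) by apply: is_derive_affine => k; ring.
    have h4 : is_derive y 1 (fun z : R => 1 + z) 1 by apply: is_derive_affine => k; ring.
    have := is_deriveB (is_deriveM h3 h2) (is_deriveM h4 h1).
    by move/is_derive_eq; apply; rewrite /GRing.scale /=; ring.
  have : (1 - x) * expR x - (1 + x) * expR (- x) <= (1 - 0) * expR 0 - (1 + 0) * expR (- 0).
    apply: (is_derive_le x0 d) => y /andP[y0 _]; rewrite -mulrBr mulr_ge0_le0 //.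
    by rewrite subr_le0 ler_expR; lra.
  by rewrite oppr0 expR0; lra.
pose f h := poissq n.+1 (m - h) + poissq n.+1 (m + h).
have df (h : R) : is_derive h 1 f (poissp n.+1 (m - h) - poissp n.+1 (m + h)).
  have h1 : is_derive h 1 (fun z : R => m - z) (-1) by apply: is_derive_affine => k; ring.
  have h2 : is_derive h 1 (fun z : R => m + z) 1 by apply: is_derive_affine => k; ring.
  have g1 := @is_derive1_comp R (poissq n.+1) (fun z => m - z) h _ _ (is_derive_poissq _ _) h1.
  have g2 := @is_derive1_comp R (poissq n.+1) (fun z => m + z) h _ _ (is_derive_poissq _ _) h2.
  by have := is_deriveD g1 g2; move/is_derive_eq; apply; ring.
have : f m <= f 0.
  apply: (is_derive_le (ltW m0) df) => x /andP[x0 xm]; rewrite subr_le0 /poissp ler_pM2r ?invr_gt0 ?ltr0n ?fact_gt0 //.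
  have e1 : expR (- (m - x)) = expR (- m) * expR (x / m) ^+ n.+1.
    by rewrite -expRM_natr -expRD divfK ?gt_eqF // opprB addrC.
  have e2 : expR (- (m + x)) = expR (- m) * expR (- (x / m)) ^+ n.+1.
    by rewrite -expRM_natr -expRD mulNr divfK ?gt_eqF // opprD.
  rewrite e1 e2 -!mulrA ler_pM2l ?expR_gt0 // -!exprMn; apply: lerXn2r; rewrite ?nnegrE ?mulr_ge0 ?expR_ge0 ?subr_ge0 ?addr_ge0 ?(ltW m0) //.
  have xm0 : 0 <= x / m by rewrite divr_ge0 // ltW.
  have := ler_wpM2l (ltW m0) (key _ xm0).
  rewrite !mulrA mulrBr mulrDr mulr1 [m * (x / m)]mulrC divfK ?gt_eqF //.
  by rewrite mulrC [(m + x) * _]mulrC.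
rewrite /f subr0 addr0 subrr poissq0.
have : 0 <= poissq n.+1 (m + m) by apply: sumr_ge0 => k _; apply: poissp_ge0; rewrite addr_ge0 // ltW.
lra.
Qed.

End Poisson.

Lemma bernoulli_ge {R : realType} (x : R) N : 0 <= x <= 1 -> 1 - N%:R * x <= (1 - x) ^+ N.
Proof.
case/andP=> x0 x1; elim: N => [|N IH]; first by rewrite mul0r subr0.
rewrite exprS -natr1; have p : 0 <= N%:R * x * x by rewrite !mulr_ge0.
have := ler_wpM2l (_ : 0 <= 1 - x) IH; rewrite subr_ge0 => /(_ x1); move: (_ ^+ N) N%:R p => E k p h; lra.
Qed.

(** * Comparison of the Gaussian flow with iterated addition of W *)

Section Comparison.
Context {R : realType} {I L : finType} {dT : measure_display} {T : measurableType dT}.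
Variable P : probability T R.
Variables (G : T -> I -> R) (W : T -> I -> R) (m : I -> R).
Hypotheses (gG : gvec P G) (mW : rvec W).
Hypothesis W_intg : forall c, intg P (fun w => dotv c (W w)).
Hypothesis W_mean : forall c, Ex P (fun w => dotv c (W w)) = dotv c m.
Hypothesis W_intg2 : forall c, intg P (fun w => dotv c (W w) ^+ 2).
Hypothesis W_mom : forall c, Ex P (fun w => dotv c (W w) ^+ 2) <= Ex P (fun w => dotv c (G w) ^+ 2).
Variable pos : (I -> R) -> Prop.
Hypothesis W_pos : forall w, pos (W w).
(** [D x] is the gradient of F at x, and the forms [Q x l] write the second derivative as a sum of
    squares of linear forms, so that the moment hypothesis can be applied to one form at a time. *)
Variables (F : (I -> R) -> R) (a : R) (D : (I -> R) -> I -> R) (Q : (I -> R) -> L -> I -> R) (B : R).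
Hypotheses (a0 : 0 <= a) (B0 : 0 <= B).
Implicit Types (x y z : I -> R) (phi psi : (I -> R) -> R) (s t : R).

Definition pdec phi := LL a phi /\ forall x y, pos y -> phi (x + y) <= phi x.
Hypothesis F_pdec : pdec F.
Hypothesis F_pos : forall x y, pos y ->
  F (x + y) <= F x + dotv (D x) y + (\sum_l dotv (Q x l) y ^+ 2) / 2.
Hypothesis F_symm : forall x y t, 0 <= t <= 1 ->
  F x + t ^+ 2 * dotv (D x) m + t ^+ 2 * (\sum_l dotv (Q x l) y ^+ 2) / 2
    - t ^+ 4 * (B * (1 + n1 y ^+ 2)) * F x <=
  (F (x + t ^+ 2 *: m + t *: y) + F (x + t ^+ 2 *: m - t *: y)) / 2.

Let mG : rvec G. Proof. by case: gG. Qed.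

(** Transition operator of one jump W: its n-th iterate at 0 is the expectation of phi over a sum of
    n independent copies. *)
Definition Kop phi x := Ex P (fun w => phi (x + W w)).

Lemma pdec_cont phi : pdec phi -> cont phi. Proof. by case=> l _; exact: LL_cont l. Qed.

Lemma pdec_gt0 phi x : pdec phi -> 0 < phi x. Proof. by case=> -[p _] _. Qed.

Lemma rvec_addW x : rvec (fun w => x + W w).
Proof. by move=> i; apply: measurable_funD => //; exact: mW. Qed.

Lemma intg_pdec phi x : pdec phi -> intg P (fun w => phi (x + W w)).
Proof.
move=> h; apply: (@intg_bounded _ _ _ _ _ (phi x)).
  exact: (measurable_cont (pdec_cont h) (rvec_addW x)).
by move=> w; rewrite gtr0_norm ?(pdec_gt0 _ h) //; case: h => _; apply.
Qed.

Lemma pdec_Kop phi : pdec phi -> pdec (Kop phi).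
Proof.
move=> h; have i := fun x => intg_pdec x h; have [[p l] d] := h.
split; first split.
- by move=> x; apply: Ex_gt0 => // w; exact: p.
- move=> x y; rewrite mulrC -ExZ //; apply: Ex_le => //; first exact: intgZ.
  by move=> w; rewrite addrAC mulrC; exact: l.
- by move=> x y py; apply: Ex_le => // w; rewrite addrAC; exact: d.
Qed.

Lemma pdec_comb phi psi (u v : R) : 0 < u -> 0 < v -> pdec phi -> pdec psi -> pdec (fun x => u * phi x + v * psi x).
Proof.
move=> u0 v0 [[p l] d] [[p' l'] d']; split; first split.
- by move=> x; rewrite addr_gt0 // mulr_gt0.
- by move=> x y; rewrite mulrDl -!mulrA lerD // ler_wpM2l // ltW.
- by move=> x y py; rewrite lerD // ler_wpM2l ?(ltW u0) ?(ltW v0) ?d ?d'.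
Qed.

Lemma Kop_comb phi psi (u v : R) x : pdec phi -> pdec psi ->
  Kop (fun x => u * phi x + v * psi x) x = u * Kop phi x + v * Kop psi x.
Proof.
move=> h1 h2; have i1 := intg_pdec x h1; have i2 := intg_pdec x h2.
by rewrite /Kop ExD ?ExZ //; exact: intgZ.
Qed.

Lemma Kop_le phi psi : pdec phi -> pdec psi -> (forall x, phi x <= psi x) -> forall x, Kop phi x <= Kop psi x.
Proof. by move=> h1 h2 h x; apply: Ex_le => [||w]; [exact: intg_pdec..|exact: h]. Qed.

Lemma Kop_dec phi x : pdec phi -> Kop phi x <= phi x.
Proof.
move=> h; rewrite -[leRHS](Ex_cst P); apply: Ex_le; [exact: intg_pdec|exact: intg_cst|].
by move=> w; case: h => _; apply.
Qed.

Lemma pdec_iter k phi : pdec phi -> pdec (iter k Kop phi).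
Proof. by move=> h; elim: k => //= k; exact: pdec_Kop. Qed.

Lemma iter_Kop_le k phi psi : pdec phi -> pdec psi -> (forall x, phi x <= psi x) ->
  forall x, iter k Kop phi x <= iter k Kop psi x.
Proof.
move=> h1 h2 h; elim: k => //= k IH; apply: Kop_le => //; exact: pdec_iter.
Qed.

Lemma iter_Kop_comb k phi psi (u v : R) x : pdec phi -> pdec psi -> 0 < u -> 0 < v ->
  iter k Kop (fun x => u * phi x + v * psi x) x = u * iter k Kop phi x + v * iter k Kop psi x.
Proof.
move=> h1 h2 u0 v0; elim: k x => //= k IH x.
rewrite -(@Kop_comb (iter k Kop phi) (iter k Kop psi)); [|exact: pdec_iter..].
by apply: eq_Ex => w; exact: IH.
Qed.

Lemma pdec_Gam phi s : pdec phi -> pdec (Gam P G s phi).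
Proof.
move=> h; have [l d] := h; have c := pdec_cont h; have g := LL_growthP a0 l.
split; first exact: (LL_Gam gG s a0 l).
move=> x y py; apply: Ex_le; [exact: intg_growth_shift..|move=> w].
by rewrite addrAC; exact: d.
Qed.

Lemma pdec_shift phi z : pdec phi -> pdec (fun x => phi (x + z)).
Proof.
case=> -[p l] d; split; first split => //.
- by move=> x y; rewrite addrAC; exact: l.
- by move=> x y py; rewrite addrAC; exact: d.
Qed.

Let C := B * (1 + Ex P (fun w => n1 (G w) ^+ 2)).

Let intg_sqr c : intg P (fun w => dotv c (G w) ^+ 2).
Proof.
apply: (intg_growth gG (phi := fun x => dotv c x ^+ 2)).
  apply: (@cont_comp _ _ (fun r => r ^+ 2)); first exact: exprn_continuous.
  apply: cont_dist_n1 => x e e0; exists (e / (\sum_i `|c i| + 1)).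
    by rewrite divr_gt0 // ltr_wpDl // sumr_ge0.
  move=> y; rewrite ltr_pdivlMr ?ltr_wpDl ?sumr_ge0 // => h.
  rewrite -[in dotv c y](subrK x y) dotvDr addrK.
  apply: le_lt_trans h; apply: (le_trans (ler_norm_sum _ _ _)).
  rewrite mulrDr mulr1 mulr_sumr; apply: (@le_trans _ _ (\sum_i n1 (y - x) * `|c i|)).
    apply: ler_sum => i _; rewrite normrM mulrC ler_wpM2r // /n1 (bigD1 i) //= lerDl; exact: sumr_ge0.
  by rewrite lerDl n1_ge0.
pose S := \sum_i `|c i|; exists (2 * S ^+ 2), 1; split => //; first by rewrite mulr_ge0 ?sqr_ge0.
move=> x; rewrite mul1r ger0_norm ?sqr_ge0 //.
have h : `|dotv c x| <= S * n1 x.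
  apply: (le_trans (ler_norm_sum _ _ _)); rewrite mulr_suml; apply: ler_sum => i _.
  rewrite normrM ler_wpM2l // /n1 (bigD1 i) //= lerDl; exact: sumr_ge0.
rewrite -real_normK ?num_real //; apply: (@le_trans _ _ ((S * n1 x) ^+ 2)).
  by rewrite ler_sqr ?nnegrE ?mulr_ge0 ?sumr_ge0.
rewrite exprMn [2 * _]mulrC -[leRHS]mulrA ler_wpM2l ?sqr_ge0 //.
by have := expR_ge_Xn 2 (n1_ge0 x); rewrite (_ : 2`!%:R = 2).
Qed.

Let C0 : 0 <= C.
Proof. by rewrite mulr_ge0 // addr_ge0 // Ex_ge0 // => w; exact: sqr_ge0. Qed.

Let EQ x := Ex P (fun w => (\sum_l dotv (Q x l) (G w) ^+ 2)).

Lemma Kop_taylor x : Kop F x <= F x + dotv (D x) m + EQ x / 2.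
Proof.
have i1 : intg P (fun w => \sum_l dotv (Q x l) (W w) ^+ 2) by apply: intg_sum => l; exact: W_intg2.
have i2 : intg P (fun w => F x + dotv (D x) (W w)) by apply: intgD; [exact: intg_cst|exact: W_intg].
have i3 : intg P (fun w => 2^-1 * \sum_l dotv (Q x l) (W w) ^+ 2) by exact: intgZ.
apply: (@le_trans _ _ (Ex P (fun w => F x + dotv (D x) (W w) + 2^-1 * \sum_l dotv (Q x l) (W w) ^+ 2))).
  apply: Ex_le; [exact: intg_pdec|exact: intgD|move=> w].
  by rewrite [2^-1 * _]mulrC; apply: F_pos.
rewrite ExD // ExD ?Ex_cst ?W_mean ?ExZ //; [|exact: intg_cst].
rewrite lerD2l mulrC ler_pM2r // /EQ !Ex_sum //.
by apply: ler_sum => l _; exact: W_mom.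
Qed.

Lemma Gam_taylor x t : 0 <= t <= 1 ->
  F x + t ^+ 2 * dotv (D x) m + t ^+ 2 * EQ x / 2 - t ^+ 4 * C * F x <= Gam P G (t ^+ 2) F (x + t ^+ 2 *: m).
Proof.
move=> t01; have /andP[t0 t1] := t01; have [lF _] := F_pdec.
have cF := LL_cont a0 lF; have gF := LL_growthP a0 lF.
set z := x + t ^+ 2 *: m.
have i1 : intg P (fun w => F (z + t *: G w)) by exact: intg_growth_shift.
have opp : Ex P (fun w => F (z + t *: - G w)) = Ex P (fun w => F (z + t *: G w)).
  exact: (gvec_opp gG (cont_shift z t cF) (intg_growth gG (cont_shift z t cF) (growth_shift z t gF))).
have i2 : intg P (fun w => F (z + (- t) *: G w)) by exact: intg_growth_shift.
have opp' : Ex P (fun w => F (z + (- t) *: G w)) = Ex P (fun w => F (z + t *: G w)).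
  by rewrite -opp; apply: eq_Ex => w; rewrite scalerN scaleNr.
have -> : Gam P G (t ^+ 2) F z = Ex P (fun w => 2^-1 * (F (z + t *: G w) + F (z + (- t) *: G w))).
  rewrite ExZ; last exact: intgD.
  by rewrite ExD // opp' /Gam sqrtr_sqr ger0_norm //; field.
have iQ : intg P (fun w => \sum_l dotv (Q x l) (G w) ^+ 2) by apply: intg_sum => l; exact: intg_sqr.
have in2 : intg P (fun w => n1 (G w) ^+ 2).
  by have := intg_n1X gG 2 0; under eq_fun do rewrite mul0r expR0 mulr1.
pose c1 := F x + t ^+ 2 * dotv (D x) m - t ^+ 4 * B * F x.
pose lhs w := c1 + (t ^+ 2 / 2) * (\sum_l dotv (Q x l) (G w) ^+ 2) + (- (t ^+ 4 * B * F x)) * n1 (G w) ^+ 2.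
have il : intg P lhs by apply: intgD; [apply: intgD; [exact: intg_cst|exact: intgZ]|exact: intgZ].
have El : Ex P lhs = F x + t ^+ 2 * dotv (D x) m + t ^+ 2 * EQ x / 2 - t ^+ 4 * C * F x.
  rewrite /lhs ExD; [|by apply: intgD; [exact: intg_cst|exact: intgZ]|exact: intgZ].
  rewrite (@ExD _ _ _ P (fun=> c1)); [|exact: intg_cst|exact: intgZ].
  by rewrite Ex_cst !ExZ // /EQ /C /c1; ring.
rewrite -El; apply: Ex_le => //; first by apply: intgZ; exact: intgD.
move=> w; have := F_symm x (G w) t01; rewrite -/z scaleNr /lhs /c1.
set S := \sum_l _; move: (F (z + _)) (F (z - _)) (F x) (dotv _ _) (n1 _) S => u u' f dd n S h.
rewrite [leRHS]mulrC; apply: le_trans h; rewrite le_eqVlt; apply/orP; left; apply/eqP.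
by field.
Qed.

(** t ^ 2 times [Kop_taylor] plus 1 - t ^ 2 times F is the main part of [Gam_taylor]. The error t ^
    4 C F is made relative to the mixture by F <= 2 ((1 - t ^ 2) F + t ^ 2 K F), where t ^ 2 <= 1/2
    and K F > 0. *)
Lemma F_step x t : 0 <= t -> t ^+ 2 <= 2^-1 ->
  (1 - 2 * C * t ^+ 4) * ((1 - t ^+ 2) * F x + t ^+ 2 * Kop F x) <= Gam P G (t ^+ 2) F (x + t ^+ 2 *: m).
Proof.
move=> t0 t2; have t1 : t <= 1 by nra.
apply: le_trans (Gam_taylor x _); last by rewrite t0.
have hK := Kop_taylor x; have K0 := pdec_gt0 x (pdec_Kop F_pdec); have F0 := pdec_gt0 x F_pdec.
have t20 := sqr_ge0 t; have t40 : 0 <= t ^+ 4 by exact: exprn_ge0.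
move: (Kop F x) (F x) (dotv _ _) (EQ x) hK K0 F0 => k f dd e hK K0 F0.
have h1 : t ^+ 2 * k <= t ^+ 2 * (f + dd + e / 2) by rewrite ler_wpM2l.
have h2 : f <= 2 * ((1 - t ^+ 2) * f + t ^+ 2 * k) by nra.
have h3 : C * t ^+ 4 * f <= C * t ^+ 4 * (2 * ((1 - t ^+ 2) * f + t ^+ 2 * k)) by rewrite ler_wpM2l // mulr_ge0.
move: (t ^+ 4) (t ^+ 2) h1 h3 => u v h1 h3; lra.
Qed.

(** F averaged over the Gaussian process with drift [m] at time s, started at y. *)
Definition bfun s y := Gam P G s F (y + s *: m).

Lemma pdec_bfun s : pdec (bfun s).
Proof. exact: (pdec_shift _ (pdec_Gam _ F_pdec)). Qed.

Lemma Gam_Kop s y : Gam P G s (Kop F) y = Kop (Gam P G s F) y.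
Proof.
have [lF dF] := F_pdec; have cF := LL_cont a0 lF; have gF := LL_growthP a0 lF.
transitivity (Ex P (fun w1 => Ex P (fun w2 => F (y + Num.sqrt s *: G w1 + W w2)))); first by [].
rewrite (Ex_swap (f := fun w1 w2 => F (y + Num.sqrt s *: G w1 + W w2))).
- by apply: eq_Ex => w2; apply: eq_Ex => w1; rewrite addrAC.
- apply: (measurable_cont cF) => i; apply: measurable_funD.
    apply: measurable_funD => //; apply: measurable_funM => //.
    exact: (measurableT_comp (mG i) measurable_fst).
  exact: (measurableT_comp (mW i) measurable_snd).
- by move=> w1 w2; apply: ltW; exact: pdec_gt0.
- by move=> w1; exact: intg_pdec.
- move=> w2; have := intg_growth_shift gG (y + W w2) (Num.sqrt s) cF gF.
  by under eq_fun do rewrite addrAC.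
Qed.

Lemma bfun_step s t y : 0 <= s -> 0 <= t -> t ^+ 2 <= 2^-1 ->
  (1 - 2 * C * t ^+ 4) * ((1 - t ^+ 2) * bfun s y + t ^+ 2 * Kop (bfun s) y) <= bfun (s + t ^+ 2) y.
Proof.
move=> s0 t0 t2; have [lF dF] := F_pdec; have cF := LL_cont a0 lF; have gF := LL_growthP a0 lF.
have [lK _] := pdec_Kop F_pdec; have cK := LL_cont a0 lK; have gK := LL_growthP a0 lK.
have [lG _] := pdec_Gam (t ^+ 2) F_pdec; have cG := LL_cont a0 lG; have gG' := LL_growthP a0 lG.
rewrite {3}/bfun (Gam_semigroup gG _ cF gF s0 (sqr_ge0 t)) scalerDl addrA.
set z := y + s *: m.
have -> : Kop (bfun s) y = Gam P G s (Kop F) z.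
  by rewrite Gam_Kop; apply: eq_Ex => w; rewrite /bfun addrAC.
have i1 : intg P (fun w => F (z + Num.sqrt s *: G w)) by exact: intg_growth_shift.
have i2 : intg P (fun w => Kop F (z + Num.sqrt s *: G w)) by exact: intg_growth_shift.
rewrite -/z; pose e := 1 - 2 * C * t ^+ 4.
have i3 := intgD (intgZ (e * (1 - t ^+ 2)) i1) (intgZ (e * t ^+ 2) i2).
have -> : e * ((1 - t ^+ 2) * bfun s y + t ^+ 2 * Gam P G s (Kop F) z) =
    Ex P (fun w => e * (1 - t ^+ 2) * F (z + Num.sqrt s *: G w) + e * t ^+ 2 * Kop F (z + Num.sqrt s *: G w)).
  by rewrite ExD ?ExZ //; [rewrite /bfun -/z /Gam; ring|exact: intgZ..].
apply: Ex_le; [exact: i3|exact: (intg_growth_shift gG _ _ cG gG')|move=> w].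
have := F_step (z + Num.sqrt s *: G w) t0 t2.
rewrite -[z + t ^+ 2 *: m + _]addrAC -/e; by move: (Gam _ _ _ _ _) (F _) (Kop _ _) => u f k; lra.
Qed.

Lemma iter_Kop_decr k j x : (k <= j)%N -> iter j Kop F x <= iter k Kop F x.
Proof.
elim: j => [|j IH]; first by rewrite leqn0 => /eqP ->.
rewrite leq_eqVlt => /orP[/eqP -> //|]; rewrite ltnS => /IH; apply: le_trans.
by apply: Kop_dec; exact: pdec_iter.
Qed.

(** After j steps the flow dominates, up to the losses, a mixture of the iterates of K with a
    binomial number of jumps. Only the outcomes with at most n jumps in all are kept, and each is at
    least the n-th iterate because the iterates decrease. The k jumps already made are carried along
    for the induction. *)
Lemma iter_Kop_bfun_ge n t j k : 0 < t -> t ^+ 2 <= 2^-1 -> 2 * C * t ^+ 4 < 1 -> (k <= n)%N ->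
  (1 - 2 * C * t ^+ 4) ^+ j * bing (t ^+ 2) j (n - k) * iter n Kop F 0 <= iter k Kop (bfun (j%:R * t ^+ 2)) 0.
Proof.
move=> t0 t2 e1; have t20 : 0 < t ^+ 2 by exact: exprn_gt0.
have t21 : 0 < 1 - t ^+ 2 by lra.
set e := 1 - _; have e0 : 0 < e by rewrite subr_gt0.
elim: j k => [|j IH] k kn /=.
  rewrite expr0 !mul1r mul0r; apply: le_trans (iter_Kop_decr 0 kn) _.
  rewrite le_eqVlt; apply/orP; left; apply/eqP.
  congr (iter k Kop _ 0); apply/funext => y; rewrite /bfun Gam0 scale0r addr0 //.
have s0 : 0 <= j%:R * t ^+ 2 by rewrite mulr_ge0 // ltW.
have hb := pdec_bfun (j%:R * t ^+ 2).
have step y : e * (1 - t ^+ 2) * bfun (j%:R * t ^+ 2) y + e * t ^+ 2 * Kop (bfun (j%:R * t ^+ 2)) y <=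
    bfun (j.+1%:R * t ^+ 2) y.
  have -> : j.+1%:R * t ^+ 2 = j%:R * t ^+ 2 + t ^+ 2 by rewrite -natr1 mulrDl mul1r.
  apply: le_trans (bfun_step y s0 (ltW t0) t2); rewrite -/e.
  by rewrite le_eqVlt; apply/orP; left; apply/eqP; rewrite [RHS]mulrDr !mulrA.
have u0 : 0 < e * (1 - t ^+ 2) by rewrite mulr_gt0.
have v0 : 0 < e * t ^+ 2 by rewrite mulr_gt0.
apply: le_trans (iter_Kop_le k (pdec_comb u0 v0 hb (pdec_Kop hb)) (pdec_bfun _) step 0).
rewrite (iter_Kop_comb k 0 hb (pdec_Kop hb) u0 v0) -iterSr exprS.
set b' := (X in _ + t ^+ 2 * X); have h1 := ler_wpM2l (ltW u0) (IH k kn).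
have h2 : e * t ^+ 2 * (e ^+ j * b' * iter n Kop F 0) <=
    e * t ^+ 2 * iter k.+1 Kop (bfun (j%:R * t ^+ 2)) 0.
  rewrite ler_wpM2l //; first exact: ltW.
  (* If k = n, one more jump leaves the outcomes that are kept; that branch is bounded below by
     0. *)
  rewrite /b'; case E : (n - k)%N => [|r]; first by rewrite mulr0 mul0r; apply: ltW; apply: pdec_gt0; exact: pdec_iter.
  have kn' : (k.+1 <= n)%N by rewrite -subn_gt0 E.
  by have := IH _ kn'; rewrite subnS E.
move: h1 h2; set U := iter k _ _ _; set V := iter k.+1 _ _ _; set N := iter n _ _ _.
set b := bing _ j _; move: (e ^+ j) U V N b b' (t ^+ 2) => E U V N b b' v.
by lra.
Qed.

(** With k + 1 steps of length dl = n / (k + 1), both the product of the losses and the distance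
    from binomial to Poisson are controlled by (k + 1) dl ^ 2 = n ^ 2 / (k + 1), which tends to 0.
    There remains the probability that a Poisson variable of mean n is at most n. *)
Lemma Kop_le_Gam n : 2^-1 * iter n Kop F 0 <= Gam P G n%:R F (n%:R *: m).
Proof.
have [->|n0] := posnP n.
  by rewrite /= scale0r Gam0; have := pdec_gt0 0 F_pdec; lra.
pose u (k : nat) : R := k.+1%:R^-1.
have cu : u k @[k --> \oo] --> (0 : R) by exact: cvg_harmonic.
set A := iter n Kop F 0; have A0 : 0 < A by apply: pdec_gt0; exact: pdec_iter.
set n2 := n%:R ^+ 2 : R; have n20 : 0 <= n2 by exact: sqr_ge0.
have lim : (1 - 2 * C * n2 * u k) * (2^-1 - n2 * u k) * A @[k --> \oo] --> (1 - 2 * C * n2 * 0) * (2^-1 - n2 * 0) * A.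
  apply: cvgM; last exact: cvg_cst.
  apply: cvgM; apply: cvgB; try exact: cvg_cst.
    by apply: cvgM => //; exact: cvg_cst.
  by apply: cvgM => //; exact: cvg_cst.
rewrite !mulr0 !subr0 mul1r in lim.
have cst_ : (fun _ : nat => Gam P G n%:R F (n%:R *: m)) k @[k --> \oo] --> Gam P G n%:R F (n%:R *: m) by exact: cvg_cst.
have cdl : n%:R * u k @[k --> \oo] --> n%:R * (0 : R) by apply: cvgM => //; exact: cvg_cst.
rewrite mulr0 in cdl.
have c1 : 2 * C * n2 * u k @[k --> \oo] --> 2 * C * n2 * (0 : R) by apply: cvgM => //; exact: cvg_cst.
have c2 : n2 * u k @[k --> \oo] --> n2 * (0 : R) by apply: cvgM => //; exact: cvg_cst.
rewrite mulr0 in c1; rewrite mulr0 in c2.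
have q0 : 0 < (2 * C + 1)^-1 by rewrite invr_gt0; have := C0; lra.
apply: (ler_cvg_to lim cst_); near=> k.
have uk0 : 0 < u k by rewrite invr_gt0.
pose dl := n%:R * u k; pose t := Num.sqrt dl.
have dl0 : 0 < dl by rewrite mulr_gt0 // ltr0n.
have t2 : t ^+ 2 = dl by rewrite sqr_sqrtr // ltW.
have t4 : t ^+ 4 = dl ^+ 2 by rewrite -t2 -exprM.
have t0 : 0 < t by rewrite sqrtr_gt0.
have small : dl <= 2^-1.
  by apply: ltW; rewrite /dl; near: k; apply: (@cvgr_lt _ _ _ _ _ 0 cdl); rewrite invr_gt0.
have small2 : 2 * C * dl ^+ 2 < 1.
  have h : dl < (2 * C + 1)^-1 by rewrite /dl; near: k; apply: (@cvgr_lt _ _ _ _ _ 0 cdl).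
  have q1 : 0 < 2 * C + 1 by have := C0; lra.
  have h2 : (2 * C + 1) * dl < 1 by rewrite mulrC -ltr_pdivlMr ?div1r.
  have := C0; nra.
have := @iter_Kop_bfun_ge n t k.+1 0 t0; rewrite t2 t4 => /(_ small small2 (leq0n _)).
have -> : k.+1%:R * dl = n%:R by rewrite /dl mulrCA divff ?mulr1 // pnatr_eq0.
rewrite subn0 /= /bfun add0r; apply: le_trans; rewrite ler_pM2r //.
have b1 : 1 - k.+1%:R * (2 * C * dl ^+ 2) <= (1 - 2 * C * dl ^+ 2) ^+ k.+1.
  apply: bernoulli_ge; apply/andP; split; last exact: ltW.
  by apply: mulr_ge0; [exact: mulr_ge0|exact: sqr_ge0].
have dl1 : 0 <= dl <= 1 by have := ltW dl0; lra.
have b2 := bing_ge k.+1 n dl1.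
have e3 : k.+1%:R * dl ^+ 2 = n2 * u k.
  by rewrite /dl /n2 exprMn [u k ^+ 2]expr2 mulrCA [k.+1%:R * _]mulrA divff ?mul1r // pnatr_eq0.
have e4 : k.+1%:R * dl = n%:R by rewrite /dl mulrCA divff ?mulr1 // pnatr_eq0.
rewrite e3 e4 in b2; have b3 := poissq_ge_half R n.
rewrite [k.+1%:R * _](_ : _ = 2 * C * n2 * u k) in b1; last by rewrite -[2 * C * n2 * u k]mulrA -e3; ring.
have h1 : 2 * C * n2 * u k < 1 by near: k; apply: (@cvgr_lt _ _ _ _ _ 0 c1).
have h2 : n2 * u k < 2^-1 by near: k; apply: (@cvgr_lt _ _ _ _ _ 0 c2); rewrite invr_gt0.
apply: ler_pM.
- by rewrite subr_ge0 ltW.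
- by rewrite subr_ge0 ltW.
- exact: b1.
- by apply: le_trans b2; rewrite lerD2r.
Unshelve. all: by end_near.
Qed.

End Comparison.

(** * Sums of independent vectors *)

Section Rectangles.
Context {R : realType} {dT : measure_display} {T : measurableType dT}.
Variable P : probability T R.

Lemma Ex_indic (f : T -> R) (D : set T) : measurable D -> (forall w, f w = \1_D w) -> Ex P f = fine (P D).
Proof.
move=> mD fD; rewrite (eq_Ex P fD) /Ex /Rintegral; congr fine.
by rewrite integral_indic // setIT.
Qed.

Lemma prod_indic (J : finType) (A : J -> set R) (x : J -> R) :
  \prod_j (\1_(A j) (x j) : R) = (`[< forall j, A j (x j) >])%:R.
Proof.
case: asboolP => h; first by rewrite big1 // => j _; rewrite indicE mem_set.
have [j nj] : exists j, ~ A j (x j) by apply/existsNP.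
by rewrite (bigD1 j) //= indicE memNset // mul0r.
Qed.

Lemma box_prod_indic (J : finType) (a b x : J -> R) :
  box a b x = \prod_j (\1_(`]a j, b j]%classic) (x j) : R).
Proof. by apply: eq_bigr => j _; rewrite indicE mem_setE in_itv. Qed.

Lemma measurable_rect (J : finType) (X : T -> J -> R) (A : J -> set R) : rvec X ->
  (forall j, measurable (A j)) -> measurable (\bigcap_j ((fun w => X w j) @^-1` A j)).
Proof.
move=> mX mA; apply: fin_bigcap_measurable => [|j _]; first exact: finite_finset.
by rewrite -[X in measurable X]setTI; apply: mX.
Qed.

Lemma Ex_box (J : finType) (X : T -> J -> R) a b : rvec X ->
  Ex P (fun w => box a b (X w)) = fine (P (\bigcap_j ((fun w => X w j) @^-1` `]a j, b j]%classic))).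
Proof.
move=> mX; apply: Ex_indic; first by apply: measurable_rect => // j; exact: measurable_itv.
move=> w; rewrite box_prod_indic prod_indic indicE; congr (nat_of_bool _)%:R.
by apply/asboolP/idP => [h|]; [apply: mem_set => j _; exact: h|move/set_mem => h j; exact: h].
Qed.

End Rectangles.

(** * Expectations over sums of independent copies as iterates of [Kop] *)

Section Independent.
Context {R : realType} {I : finType} {dT : measure_display} {T : measurableType dT}.
Variable P : probability T R.
Variables (n : nat) (Us : 'I_n -> T -> I -> R) (U : T -> I -> R).
Hypotheses (mUs : forall i, rvec (Us i)) (mU : rvec U).
Hypothesis indep : forall A : 'I_n -> I -> set R, (forall i k, measurable (A i k)) ->
  fine (P (\bigcap_i \bigcap_k ((fun w => Us i w k) @^-1` A i k))) =
  \prod_(i < n) fine (P (\bigcap_k ((fun w => Us i w k) @^-1` A i k))).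
Hypothesis same : forall i (A : I -> set R), (forall k, measurable (A k)) ->
  P (\bigcap_k ((fun w => Us i w k) @^-1` A k)) = P (\bigcap_k ((fun w => U w k) @^-1` A k)).

Lemma same_eqlaw i : eqlaw P P U (Us i).
Proof. by move=> a b; rewrite !Ex_box // same // => k; exact: measurable_itv. Qed.

Lemma indep_box (S : pred 'I_n) (a b : 'I_n -> I -> R) :
  Ex P (fun w => \prod_(i | S i) box (a i) (b i) (Us i w)) =
  \prod_(i | S i) Ex P (fun w => box (a i) (b i) (Us i w)).
Proof.
(* The whole line outside [S]: marginals are obtained from the joint independence. *)
pose A i k := if S i then `]a i k, b i k]%classic else [set: R].
have mA i k : measurable (A i k) by rewrite /A; case: ifP.
have -> : Ex P (fun w => \prod_(i | S i) box (a i) (b i) (Us i w)) =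
    fine (P (\bigcap_i \bigcap_k ((fun w => Us i w k) @^-1` A i k))).
  apply: Ex_indic.
    apply: fin_bigcap_measurable => [|i _]; first exact: finite_finset.
    exact: (measurable_rect (mUs i) (mA i)).
  move=> w; transitivity (\prod_i \prod_k (\1_(A i k) (Us i w k) : R)).
    rewrite [LHS]big_mkcond; apply: eq_bigr => i _; rewrite /A; case: ifP => _.
      exact: box_prod_indic.
    by rewrite big1 // => k _; rewrite indicT.
  rewrite pair_big /= (prod_indic (fun p => A p.1 p.2) (fun p => Us p.1 w p.2)) indicE.
  congr (nat_of_bool _)%:R; apply/asboolP/idP => [h|].
    by apply: mem_set => i _ k _; exact: (h (i, k)).
  by move/set_mem => h [i k]; exact: h.
rewrite indep // [RHS]big_mkcond; apply: eq_bigr => i _; rewrite /A; case: ifP => _.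
  by rewrite Ex_box.
rewrite [X in P X](_ : _ = setT); first by rewrite [X in fine X](_ : _ = 1%E) //; exact: probability_setT.
by apply/seteqP; split.
Qed.

Let Uj (w : T) (p : 'I_n * I) := Us p.1 w p.2.
Let Vj k (w : T * T) (p : 'I_n * I) := if (p.1 < k)%N then Us p.1 w.1 p.2 else Us p.1 w.2 p.2.

Lemma box_pair (a b : 'I_n * I -> R) (x : 'I_n * I -> R) :
  box a b x = \prod_i box (fun k => a (i, k)) (fun k => b (i, k)) (fun k => x (i, k)).
Proof. by rewrite /box pair_big /=; apply: eq_bigr => -[i k]. Qed.

Lemma rvec_joint : rvec Uj. Proof. by move=> [i k]; exact: mUs. Qed.

Lemma rvec_split k : rvec (Vj k).
Proof.
move=> [i c]; rewrite /Vj /=; case: (i < k)%N.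
  exact: (measurableT_comp (mUs i c) measurable_fst).
exact: (measurableT_comp (mUs i c) measurable_snd).
Qed.

(** Independence of the first k vectors from the others, restated as an equality in law with a
    product space, so that Fubini's theorem can freeze the partial sum. *)
Lemma joint_eqlaw k : eqlaw P (pprod P P) Uj (Vj k).
Proof.
move=> a b; pose bx i (w : T) := box (fun k => a (i, k)) (fun k => b (i, k)) (Us i w).
have e1 : Ex P (fun w => box a b (Uj w)) = \prod_i Ex P (bx i).
  rewrite -(indep_box xpredT (fun i k => a (i, k)) (fun i k => b (i, k))).
  by apply: eq_Ex => w; rewrite box_pair.
have bx01 i w : 0 <= bx i w <= 1.
  by rewrite box_ge0 /=; apply: prodr_ile1 => c _; exact: natr_bool01.
have mbx i : measurable_fun [set: T] (bx i) by exact: measurable_box.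
pose f1 w := \prod_(i < n | (i < k)%N) bx i w; pose f2 w := \prod_(i < n | ~~ (i < k)%N) bx i w.
have eV w : box a b (Vj k w) = f1 w.1 * f2 w.2.
  rewrite box_pair (bigID (fun i : 'I_n => (i < k)%N)) /=; congr (_ * _).
    by apply: eq_bigr => i ik; congr box; apply/funext => c; rewrite /Vj /= ik.
  by apply: eq_bigr => i /negbTE ik; congr box; apply/funext => c; rewrite /Vj /= ik.
have f01 (S : pred 'I_n) w : `|\prod_(i | S i) bx i w| <= 1.
  by rewrite ger0_norm; [apply: prodr_ile1 => i _; exact: bx01|apply: prodr_ge0 => i _; exact: box_ge0].
have mf (S : pred 'I_n) : measurable_fun [set: T] (fun w => \prod_(i | S i) bx i w).
  by under eq_fun do rewrite big_mkcond; apply: measurable_prod => i _; case: (S i).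
have intf (S : pred 'I_n) : intg P (fun w => \prod_(i | S i) bx i w) by apply: (@intg_bounded _ _ _ _ _ 1); [exact: mf|move=> w; exact: f01].
rewrite e1 (@Ex_fubini_bounded _ _ _ _ _ _ _ _ 1).
- transitivity (Ex P (fun w1 => Ex P f2 * f1 w1)).
    rewrite ExZ; last exact: intf.
    rewrite /f1 /f2 /bx (indep_box _ (fun i k => a (i, k)) (fun i k => b (i, k))).
    rewrite (indep_box _ (fun i k => a (i, k)) (fun i k => b (i, k))) mulrC.
    by rewrite (bigID (fun i : 'I_n => (i < k)%N)).
  apply: eq_Ex => w1; rewrite mulrC -ExZ; last exact: intf.
  by apply: eq_Ex => w2; rewrite eV.
- exact: (measurable_box a b (rvec_split k)).
- by move=> w; rewrite eV normrM -[leRHS]mulr1; apply: ler_pM => //; exact: f01.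
Qed.

(** A class of test functions stable under [Kop]. It is left abstract because it will be [pdec] for
    the trace exponential and [LL] for shifted cosines. *)
Variable cls : ((I -> R) -> R) -> Prop.
Hypothesis cls_cont : forall phi, cls phi -> cont phi.
Hypothesis cls_ge0 : forall phi x, cls phi -> 0 <= phi x.
Hypothesis cls_Kop : forall phi, cls phi -> cls (Kop P U phi).
Hypothesis cls_intg : forall phi x, cls phi -> intg P (fun w => phi (x + U w)).

Definition psum k (z : 'I_n * I -> R) : I -> R := fun c => \sum_(i < n | (i < k)%N) z (i, c).

Lemma cont_psum k phi : cont phi -> cont (fun z => phi (psum k z)).
Proof.
move=> c z e e0; have [dl dl0 h] := c (psum k z) e e0.
exists (dl / (n%:R + 1)) => [|y hy]; first by rewrite divr_gt0 // ltr_wpDl.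
apply: h => i; rewrite /psum -sumrB; apply: (le_lt_trans (ler_norm_sum _ _ _)).
apply: (@le_lt_trans _ _ (\sum_(j < n) dl / (n%:R + 1))).
  rewrite big_mkcond; apply: ler_sum => j _; case: ifP => _; first exact: (ltW (hy _)).
  by rewrite divr_ge0 ?(ltW dl0) // addr_ge0.
rewrite sumr_const card_ord -[X in X < _]mulr_natl mulrCA -[ltRHS]mulr1 ltr_pM2l //.
by rewrite ltr_pdivrMr ?ltr_wpDl // mul1r ltrDl.
Qed.

Lemma psum_split k w1 w2 (kn : (k < n)%N) :
  psum k.+1 (Vj k (w1, w2)) = psum k (Uj w1) + Us (Ordinal kn) w2.
Proof.
apply/funext => c; rewrite /psum fctE (bigD1 (Ordinal kn)) //= [X in X + _]/Vj /= ltnn addrC.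
congr (_ + _); apply: eq_big => [i|i /andP[ik /negbTE ne]].
  by rewrite -val_eqE /= ltnS ltn_neqAle andbC.
by rewrite /Vj /Uj /= ltn_neqAle -val_eqE /= in ne *; rewrite ne -ltnS ik.
Qed.

(** Integrating out the last of k + 1 vectors with the others frozen replaces [phi] by
    [Kop P U phi]; the induction goes over all [phi] of the class. *)
Lemma psum_Kop k phi : (k <= n)%N -> cls phi ->
  intg P (fun w => phi (psum k (Uj w))) /\ Ex P (fun w => phi (psum k (Uj w))) = iter k (Kop P U) phi 0.
Proof.
elim: k phi => [|k IH] phi kn cphi.
  have e w : psum 0 (Uj w) = 0 by apply/funext => c; rewrite /psum big1.
  split; first by under eq_fun do rewrite e; exact: intg_cst.
  by rewrite -[RHS](Ex_cst P); apply: eq_Ex => w; rewrite e.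
have [i1 e1] := IH (Kop P U phi) (ltnW kn) (cls_Kop cphi).
have cc := cls_cont cphi; have cp := cont_psum k.+1 cc.
pose f (w : T * T) := phi (psum k.+1 (Vj k w)).
have mf : measurable_fun [set: T * T] f by exact: (measurable_cont cp (rvec_split k)).
have f0 w : 0 <= f w by exact: cls_ge0.
have cx x : cont (fun y => phi (x + y)).
  by have := cont_shift x 1 cc; under eq_fun do rewrite scale1r.
have fE w1 w2 : f (w1, w2) = phi (psum k (Uj w1) + Us (Ordinal kn) w2) by rewrite /f psum_split.
have i2 w1 : intg P (fun w2 => f (w1, w2)).
  under eq_fun do rewrite fE.
  exact: (eqlaw_intg mU (mUs _) (same_eqlaw (Ordinal kn)) (cx _) (cls_intg _ cphi)).
have eI w1 : Ex P (fun w2 => f (w1, w2)) = Kop P U phi (psum k (Uj w1)).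
  under eq_Ex do rewrite fE.
  exact/esym/(eqlaw_Ex_ge0 mU (mUs _) (same_eqlaw (Ordinal kn)) (cx (psum k (Uj w1))) (fun y => cls_ge0 _ cphi)).
have i3 : intg P (fun w1 => Ex P (fun w2 => f (w1, w2))).
  by rewrite (_ : (fun w1 => _) = fun w1 => Kop P U phi (psum k (Uj w1))) //; apply/funext.
have [i4 e4] := Ex_fubini mf f0 i2 i3.
have jl := joint_eqlaw k; have lj : eqlaw (pprod P P) P (Vj k) Uj by move=> a b; rewrite jl.
split; first exact: (eqlaw_intg (rvec_split k) rvec_joint lj cp i4).
rewrite (eqlaw_Ex_ge0 rvec_joint (rvec_split k) jl cp (fun z => cls_ge0 _ cphi)).
by apply: (etrans e4); rewrite iterSr -e1; apply: eq_Ex => w1; exact: eI.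
Qed.

Lemma sum_Kop phi : cls phi ->
  intg P (fun w => phi (\sum_(i < n) Us i w)) /\
  Ex P (fun w => phi (\sum_(i < n) Us i w)) = iter n (Kop P U) phi 0.
Proof.
have e w : psum n (Uj w) = \sum_(i < n) Us i w.
  apply/funext => c; rewrite /psum fct_sumE; apply: eq_bigl => i; exact: ltn_ord.
move=> cphi; have [h1 h2] := psum_Kop (leqnn n) cphi; split.
  by move: h1; under eq_fun do rewrite e.
by rewrite -h2; apply: eq_Ex => w; rewrite e.
Qed.

End Independent.

Section Moments.
Context {R : realType} {dT : measure_display} {T : measurableType dT}.
Variable P : probability T R.

Lemma expectation_Ex (f : T -> R) : intg P f -> 'E_P[f]%E = (Ex P f)%:E.
Proof. by move=> h; rewrite unlock EFin_Ex. Qed.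

Lemma variance_Ex (f : T -> R) : intg P f -> intg P (fun w => (f w - Ex P f) ^+ 2) ->
  'V_P[f]%E = (Ex P (fun w => (f w - Ex P f) ^+ 2))%:E.
Proof.
move=> i1 i2; rewrite /variance covariance.unlock (expectation_Ex i1) /=.
by rewrite (_ : (_ * _)%R = fun w => (f w - Ex P f) ^+ 2) ?expectation_Ex.
Qed.

(** A finite bound on the extended expectation makes f ^ 2 integrable, and |f| <= 1 + f ^ 2 does the
    same for f. *)
Lemma second_moment_le (f : T -> R) r : measurable_fun [set: T] f ->
  ('E_P[fun w => (f w ^+ 2)%R] <= r%:E)%E ->
  [/\ intg P f, intg P (fun w => f w ^+ 2) & Ex P (fun w => f w ^+ 2) <= r].
Proof.
move=> mf; rewrite unlock => h.
have i2 : intg P (fun w => f w ^+ 2).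
  apply/integrableP; split; first by apply/measurable_EFinP; exact: measurable_funX.
  under eq_integral do rewrite /= ger0_norm ?sqr_ge0 //.
  by apply: le_lt_trans h _; rewrite ltry.
split => //; last by rewrite -lee_fin EFin_Ex.
apply: (@intg_le _ _ _ _ _ (fun w => 1 + f w ^+ 2)) => //; last by apply: intgD => //; exact: intg_cst.
by move=> w; rewrite -real_normK ?num_real //; have := normr_ge0 (f w); nra.
Qed.

End Moments.

Section GaussianFamilies.
Context {R : realType} {I : finType} {dT : measure_display} {T : measurableType dT}.
Variable P : probability T R.
Implicit Types (c x : I -> R).

Lemma intg_dotv (X : T -> I -> R) c : (forall k, intg P (fun w => X w k)) -> intg P (fun w => dotv c (X w)).
Proof. by move=> h; apply: intg_sum => k; exact: intgZ. Qed.

Lemma Ex_dotv (X : T -> I -> R) c : (forall k, intg P (fun w => X w k)) ->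
  Ex P (fun w => dotv c (X w)) = dotv c (fun k => Ex P (fun w => X w k)).
Proof.
by move=> h; rewrite Ex_sum; [apply: eq_bigr => k _; rewrite ExZ|move=> k; exact: intgZ].
Qed.

Lemma dotvB c x y : dotv c (x - y) = dotv c x - dotv c y.
Proof. by rewrite dotvDr -scaleN1r dotvZr mulN1r. Qed.

Lemma jointly_gaussian_gvec (X : T -> I -> R) : rvec X ->
  jointly_gaussian P (fun k w => X w k) ->
  (forall k, intg P (fun w => X w k)) /\ gvec P (fun w => X w - (fun k => Ex P (fun w => X w k))).
Proof.
move=> mX jg; pose m k := Ex P (fun w => X w k).
have iX k : intg P (fun w => X w k).
  have [h _ _] := gaussian_rv_facts (jg (fun i => (i == k)%:R)).
  move: h; rewrite (_ : (fun w => _) = fun w => X w k) //.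
  apply/funext => w; rewrite (bigD1 k) //= eqxx mul1r big1 ?addr0 // => i /negbTE ->.
  by rewrite mul0r.
split=> //; have facts c := gaussian_rv_facts (jg c).
have etaE c w : \sum_k c k * X w k - Ex P (fun w => \sum_k c k * X w k) = dotv c (X w - m).
  by rewrite dotvB -/(dotv c (X w)) (_ : Ex _ _ = Ex P (fun w => dotv c (X w))) // Ex_dotv.
split.
- by move=> k; apply: measurable_funB => //; exact: mX.
- move=> c; have [_ h _] := facts c; have := h 1.
  by under eq_fun do rewrite etaE mul1r.
- move=> c b; have [_ _ h] := facts c; have := h 1 b; rewrite expr1n mul1r.
  rewrite (_ : Ex P _ = Ex P (fun w => cos (dotv c (X w - m) + b))); last first.
    by apply: eq_Ex => w; rewrite etaE mul1r.
  rewrite (_ : Ex P (fun w => (_ - _) ^+ 2) = Ex P (fun w => dotv c (X w - m) ^+ 2)) //.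
  by apply: eq_Ex => w; rewrite etaE.
Qed.

Variables (G : T -> I -> R) (m : I -> R).
Hypothesis gG : gvec P G.
Let mG : rvec G. Proof. by case: gG. Qed.

Lemma gvec_intg_sqr c : intg P (fun w => dotv c (G w) ^+ 2).
Proof.
pose S := \sum_i `|c i|; apply: (@intg_le _ _ _ _ _ (fun w => S ^+ 2 * (n1 (G w) ^+ 2 * expR (0 * n1 (G w))))).
- by apply: measurable_funX; exact: measurable_dotv.
- move=> w; rewrite mul0r expR0 mulr1 ger0_norm ?sqr_ge0 // -exprMn -real_normK ?num_real //.
  by rewrite ler_sqr ?nnegrE ?mulr_ge0 ?n1_ge0 ?sumr_ge0 // dotv_le_n1.
- by apply: intgZ; exact: intg_n1X.
Qed.

Let v c := Ex P (fun w => dotv c (G w) ^+ 2).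

Lemma affine_char c a b : Ex P (fun w => cos (dotv c (a *: G w) + b)) = expR (- (a ^+ 2 * v c / 2)) * cos b.
Proof.
have [_ _ h] := gG.
rewrite (_ : Ex P _ = Ex P (fun w => cos (dotv (a *: c) (G w) + b))); last first.
  by apply: eq_Ex => w; rewrite dotvZr dotvZl.
rewrite h; congr (expR (- (_ / 2)) * _); rewrite /v -ExZ; last exact: gvec_intg_sqr.
by apply: eq_Ex => w; rewrite dotvZl exprMn.
Qed.

Variables (n : nat) (Us : 'I_n -> T -> I -> R) (U : T -> I -> R).
Hypotheses (mUs : forall i, rvec (Us i)) (mU : rvec U).
Hypothesis UE : forall w, U w = m + G w.
Hypothesis indep : forall A : 'I_n -> I -> set R, (forall i k, measurable (A i k)) ->
  fine (P (\bigcap_i \bigcap_k ((fun w => Us i w k) @^-1` A i k))) =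
  \prod_(i < n) fine (P (\bigcap_k ((fun w => Us i w k) @^-1` A i k))).
Hypothesis same : forall i (A : I -> set R), (forall k, measurable (A k)) ->
  P (\bigcap_k ((fun w => Us i w k) @^-1` A k)) = P (\bigcap_k ((fun w => U w k) @^-1` A k)).

Lemma rvec_sum : rvec (fun w => \sum_(i < n) Us i w).
Proof.
move=> k; under eq_fun do rewrite fct_sumE.
by apply: measurable_sum => i; exact: mUs.
Qed.

Lemma rvec_affine (x : I -> R) a : rvec (fun w => x + a *: G w).
Proof. by apply: rvec_shift. Qed.

Lemma intg_LL a phi x : 0 <= a -> LL a phi -> intg P (fun w => phi (x + U w)).
Proof.
move=> a0 l; have := intg_growth_shift gG (x + m) 1 (LL_cont a0 l) (LL_growthP a0 l).
by under eq_fun do rewrite scale1r -addrA -UE.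
Qed.

Lemma LL_Kop a phi : 0 <= a -> LL a phi -> LL a (Kop P U phi).
Proof.
move=> a0 l; have i x := intg_LL x a0 l; have [p h] := l.
split=> [x|x y]; first by apply: Ex_gt0.
rewrite mulrC -ExZ //; apply: Ex_le => //; first exact: intgZ.
by move=> w; rewrite addrAC mulrC.
Qed.

(* The shift by 2 makes the cosine positive and log-Lipschitz. *)
Let psi c A b x := A * cos (dotv c x + b) + 2.

Let psi_LL c b : LL (\sum_i `|c i|) (psi c 1 b).
Proof.
have p x : 1 <= psi c 1 b x by rewrite /psi mul1r; have := @cos_geN1 R (dotv c x + b); lra.
split=> [x|x y]; first exact: lt_le_trans (p x).
have h : psi c 1 b (x + y) <= psi c 1 b x + `|dotv c y|.
  rewrite /psi !mul1r dotvDr -addrA [dotv c y + b]addrC addrA; set u := dotv c x + b; set t := dotv c y.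
  have e : cos (u + t) - cos u = (- 2) * (sin (u + t / 2) * sin (t / 2)).
    have cs (z1 z2 : R) : cos (z1 + z2) - cos (z1 - z2) = (- 2) * (sin z1 * sin z2) by rewrite cosD cosB; ring.
    have e1 : u + t / 2 + t / 2 = u + t by field.
    by have := cs (u + t / 2) (t / 2); rewrite addrK e1.
  suff : cos (u + t) - cos u <= `|t| by lra.
  rewrite e; apply: (le_trans (ler_norm _)); rewrite normrM normrN (ger0_norm (ler0n _ 2)) normrM.
  have h1 := norm_sin_le (t / 2); have h2 := norm_sin_le1 (u + t / 2).
  rewrite normrM [`|2^-1|]ger0_norm // in h1.
  have := normr_ge0 (sin (t / 2)); have := normr_ge0 (sin (u + t / 2)); nra.
have S0 : 0 <= \sum_i `|c i| by exact: sumr_ge0.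
apply: (le_trans h); apply: (@le_trans _ _ (psi c 1 b x * (1 + (\sum_i `|c i|) * n1 y))).
  rewrite mulrDr mulr1 lerD2l; apply: (le_trans (dotv_le_n1 c y)).
  by rewrite -[leLHS]mul1r; apply: ler_wpM2r; [rewrite mulr_ge0 ?n1_ge0|exact: p].
by rewrite ler_wpM2l ?expR_ge1Dx // (le_trans _ (p x)).
Qed.

(** On a cosine, [Kop] multiplies the amplitude by e ^ (- v / 2) and moves the phase by the form at
    [m]. After n iterations this is the cosine transform of the affine image of [G], and cosines
    determine the law. *)
Lemma sum_gauss_eqlaw : eqlaw P P (fun w => \sum_(i < n) Us i w) (fun w => n%:R *: m + Num.sqrt n%:R *: G w).
Proof.
apply: cos_eqlaw => [||c b]; [exact: rvec_sum|exact: rvec_affine|].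
have S0 : 0 <= \sum_i `|c i| by exact: sumr_ge0.
pose cls (phi : (I -> R) -> R) := LL (\sum_i `|c i|) phi.
have [i1 e1] := sum_Kop mUs mU indep same (cls := cls) (fun phi l => LL_cont S0 l)
  (fun phi x l => ltW (proj1 l x)) (fun phi l => LL_Kop S0 l) (fun phi x l => intg_LL x S0 l) (psi_LL c b).
have step A b' x : Kop P U (psi c A b') x = psi c (A * expR (- (v c / 2))) (b' + dotv c m) x.
  have ic : intg P (fun w => cos (dotv c (1 *: G w) + (dotv c x + (b' + dotv c m)))).
    apply: (@intg_bounded _ _ _ _ _ 1); last by move=> w; exact: norm_cos_le1.
    by under eq_fun do rewrite scale1r; exact: measurable_cos_dotv.
  transitivity (Ex P (fun w => A * cos (dotv c (1 *: G w) + (dotv c x + (b' + dotv c m))) + 2)).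
    apply: eq_Ex => w; rewrite /psi UE scale1r !dotvDr; congr (_ * cos _ + _); ring.
  rewrite ExD ?Ex_cst ?ExZ ?affine_char //; [|exact: intgZ|exact: intg_cst].
  by rewrite expr1n mul1r /psi mulrA.
have it k x : iter k (Kop P U) (psi c 1 b) x = psi c (expR (- (v c / 2)) ^+ k) (b + k%:R * dotv c m) x.
  elim: k x => [|k IH] x; first by rewrite /= expr0 mul0r addr0.
  rewrite /= (_ : iter k _ _ = psi c (expR (- (v c / 2)) ^+ k) (b + k%:R * dotv c m)); last exact/funext.
  have e : k.+1%:R * dotv c m = k%:R * dotv c m + dotv c m by rewrite -addn1 natrD mulrDl mul1r.
  by rewrite step -exprSr e addrA.
have ic : intg P (fun w => cos (dotv c (\sum_(i < n) Us i w) + b)).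
  apply: (@intg_bounded _ _ _ _ _ 1); last by move=> w; exact: norm_cos_le1.
  by apply: measurable_cos_dotv; exact: rvec_sum.
have : Ex P (fun w => psi c 1 b (\sum_(i < n) Us i w)) = Ex P (fun w => cos (dotv c (\sum_(i < n) Us i w) + b)) + 2.
  rewrite -[X in _ + X](Ex_cst P) -ExD //; last exact: intg_cst.
  by apply: eq_Ex => w; rewrite /psi mul1r.
rewrite e1 it /psi => /addIr <-.
transitivity (Ex P (fun w => cos (dotv c (Num.sqrt n%:R *: G w) + (n%:R * dotv c m + b)))).
  rewrite affine_char sqr_sqrtr ?ler0n // -expRM_natr.
  congr (expR _ * cos _); first by rewrite mulNr [_ * n%:R]mulrC mulrA.
  by rewrite /dotv big1 ?add0r 1?addrC // => i _; rewrite mulr0.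
by apply: eq_Ex => w; rewrite dotvDr !dotvZr; congr cos; ring.
Qed.

End GaussianFamilies.

(** * Matrices in real coordinates *)

Lemma linear_dotv {R : realType} {I : finType} (f : (I -> R) -> R) :
  (forall x y, f (x + y) = f x + f y) -> (forall a x, f (a *: x) = a * f x) ->
  forall x, f x = dotv (fun k => f (fun i => (i == k)%:R)) x.
Proof.
move=> fD fZ x; have f0 : f 0 = 0 by have := fZ 0 0; rewrite scale0r mul0r.
have fS (s : seq I) (F : I -> I -> R) : f (\sum_(k <- s) F k) = \sum_(k <- s) f (F k).
  by elim: s => [|k s IH]; rewrite ?big_nil ?f0 // !big_cons fD IH.
have {1}-> : x = \sum_k x k *: (fun i => (i == k)%:R).
  apply/funext => i; rewrite fct_sumE (bigD1 i) //= big1 => [|k /negbTE ki].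
    by rewrite addr0 !fctE eqxx /GRing.scale /= mulr1.
  by rewrite !fctE eq_sym ki /GRing.scale /= mulr0.
by rewrite fS; apply: eq_bigr => k _; rewrite fZ mulrC.
Qed.

Section Coordinates.
Variables (R : realType) (d : nat).
Local Notation C := R[i].
Local Notation rm := (realmul d).
Local Notation I := (coordK d).
Implicit Types (x y : I -> R) (A B : 'M[C]_d).

(** Every coordinate vector is sent to a self-adjoint matrix, inversely to [mxcoord] on self-adjoint
    matrices ([herm_mxcoord]). Matrix functions thus become functions on all of R^I, where the
    Gaussian calculus takes place. *)
Definition herm x : 'M[C]_d := \matrix_(i, j)
  (((x (i, j, false) + x (j, i, false)) / 2) +i* ((x (i, j, true) - x (j, i, true)) / 2))%C.

Lemma hermD x y : herm (x + y) = herm x + herm y.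
Proof. by apply/matrixP => i j; rewrite !mxE; apply/eqP; rewrite eq_complex /= !fctE; apply/andP; split; apply/eqP; field. Qed.

Lemma hermZ a x : herm (a *: x) = rm a * herm x.
Proof.
by rewrite realmulE; apply/matrixP => i j; rewrite !mxE; apply/eqP; rewrite eq_complex /= !fctE /GRing.scale /=; apply/andP; split; apply/eqP; field.
Qed.

Lemma selfadj_herm x : selfadj (herm x).
Proof. by apply/matrixP => i j; rewrite !mxE; apply/eqP; rewrite eq_complex /=; apply/andP; split; apply/eqP; field. Qed.

Lemma selfadj_coord A i j : selfadj A -> complex.Re (A i j) = complex.Re (A j i) /\ complex.Im (A i j) = - complex.Im (A j i).
Proof. by move=> /matrixP/(_ j i); rewrite mxE; case: (A i j) (A j i) => [a b] [a' b'] /= [<- <-]; rewrite opprK. Qed.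

Lemma herm_mxcoord A : selfadj A -> herm (mxcoord A) = A.
Proof.
move=> sA; apply/matrixP => i j; rewrite !mxE /mxcoord /=.
have [<- e] := selfadj_coord i j sA; apply/eqP; rewrite eq_complex /=.
by apply/andP; split; apply/eqP; lra.
Qed.

Lemma l1mx_herm x : l1mx (herm x) <= n1 x.
Proof.
have reindex_ (h : I -> R) : \sum_k h (k.1.2, k.1.1, k.2) = \sum_k h k.
  rewrite [RHS](reindex_inj (h := fun k : I => (k.1.2, k.1.1, k.2))) //.
  by move=> [[a b] c] [[a' b'] c'] [-> -> ->].
pose y (k : I) := `|x k|.
apply: (@le_trans _ _ (\sum_k 2^-1 * (y k + y (k.1.2, k.1.1, k.2)))).
  apply: ler_sum => -[[i j] b] _; rewrite /mxcoord /= mxE /y.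
  case: b => /=; rewrite normrM [`|2^-1|]ger0_norm // mulrC ler_pM2l ?invr_gt0 //.
    exact: ler_normB.
  exact: ler_normD.
by rewrite -mulr_sumr big_split /= (reindex_ y) /n1; lra.
Qed.

(** The tangent at A + B in the direction - B gives (1 - |B|) F (A + B) <= F A. Applied along k + 1
    equal pieces of B, the factor (1 - |B| / (k + 1)) ^ (k + 1) tends to e ^ (- |B|). *)
Lemma trexp_LL A B : selfadj A -> selfadj B -> trexp (A + B) <= trexp A * expR (l1mx B).
Proof.
have dle A' B' : selfadj A' -> `|dtrexp A' B'| <= l1mx B' * trexp A'.
  move=> sA; rewrite normrN mulrC /trexp mulr_suml; apply: (le_trans (ler_norm_sum _ _ _)).
  apply: ler_sum => i _; rewrite normrM ger0_norm ?expR_ge0 // ler_wpM2l ?expR_ge0 //.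
  by apply: Re_le_norm; exact: conjU_le.
have step A' B' : selfadj A' -> selfadj B' -> (1 - l1mx B') * trexp (A' + B') <= trexp A'.
  move=> sA sB; have sAB := selfadjD sA sB.
  have := trexp_ge_tangent sAB (selfadjN sB); rewrite addrK; have := dle (A' + B') (- B') sAB.
  rewrite dtrexpN normrN (_ : l1mx (- B') = l1mx B'); last first.
    by rewrite -[- B']mulN1r -[-1](rmorphN1 rm) l1mx_rm normrN1 mul1r.
  by rewrite ler_norml => /andP[]; lra.
move=> sA sB; set l := l1mx B; have l0 : 0 <= l by exact: l1mx_ge0.
have rmD a b : rm (a + b) * B = rm a * B + rm b * B by rewrite !realmulE -scalerDl -rmorphD.
have it (c : R) j : 0 <= c -> c * l <= 1 ->
    (1 - c * l) ^+ j * trexp (A + rm (j%:R * c) * B) <= trexp A.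
  move=> c0 cl; elim: j => [|j IH]; first by rewrite expr0 mul1r mul0r addr_rm0.
  apply: le_trans IH; rewrite exprSr -mulrA ler_wpM2l ?exprn_ge0 ?subr_ge0 //.
  have sj : selfadj (A + rm (j%:R * c) * B) by apply: selfadjD => //; exact: selfadj_rm.
  have h := step (A + rm (j%:R * c) * B) (rm c * B) sj (selfadj_rm c sB).
  rewrite (l1mx_rm c B) (ger0_norm c0) in h.
  have -> : A + rm (j.+1%:R * c) * B = A + rm (j%:R * c) * B + rm c * B; last exact: h.
  by rewrite -natr1 (mulrDl j%:R) mul1r rmD addrA.
have cN : (k.+1)%:R^-1 @[k --> \oo] --> (0 : R) by exact: cvg_harmonic.
have lim : (1 - l / k.+1%:R) ^+ k.+1 @[k --> \oo] --> expR (- l).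
  apply: (@cvg_expn_expR _ (fun k => k.+1) (fun k => k.+1)) => //.
  by apply: cvg_near_cst; apply: nearW => k; rewrite divff // pnatr_eq0.
have {}lim : (1 - l / k.+1%:R) ^+ k.+1 * trexp (A + B) @[k --> \oo] --> expR (- l) * trexp (A + B).
  by apply: cvgM => //; exact: cvg_cst.
have cst_ : (fun _ : nat => trexp A) k @[k --> \oo] --> trexp A by exact: cvg_cst.
have : expR (- l) * trexp (A + B) <= trexp A.
  apply: (ler_cvg_to lim cst_); near=> k.
  have k0 : 0 <= (k.+1%:R^-1 : R) by rewrite invr_ge0.
  have kl : k.+1%:R^-1 * l <= 1.
    rewrite ler_pdivrMl // mulr1; apply: (@le_trans _ _ k%:R); last by rewrite ler_nat.
    by near: k; exact: nbhs_infty_ger.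
  have := it k.+1%:R^-1 k.+1 k0 kl; rewrite divff ?pnatr_eq0 // addr_rm1.
  by rewrite [_ * l]mulrC.
rewrite expRN => h; rewrite -ler_pdivrMr ?expR_gt0 //; by rewrite mulrC.
Unshelve. all: by end_near.
Qed.

End Coordinates.

(** * The minimum eigenvalue and Rayleigh quotients, real and complex *)

Section LambdaMin.
Variables (R : realType) (d : nat).
Hypothesis d0 : (0 < d)%N.
Local Notation C := R[i].
Implicit Types (A B : 'M[C]_d) (u v : 'cV[C]_d).

Definition ray A u : R := complex.Re (qform u A).

Lemma eigenvalue_lam A x : selfadj A -> eigenvalue A x%:C%C <-> exists i, x = lam A i.
Proof.
move=> sA; have e := selfadj_ediag sA; split.
  case/eigenvalueP => v vA v0; pose w := v *m adjmx (eigU A).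
  have w0 : w != 0.
    apply: contra_neq v0 => w0; rewrite -[v]mulmx1 -(adj_eigU A) mulmxA -/w w0 mul0mx //.
  have wD : w *m diagr (lam A) = x%:C%C *: w.
    have h : w *m diagr (lam A) *m eigU A = v *m A by rewrite [in RHS]e /ediag !mulmxA.
    by rewrite -[LHS]mulmx1 -(eigU_adj A) mulmxA h vA -scalemxAl.
  have [i wi] : exists i, w 0 i != 0.
    apply/existsP; apply: contraNT w0; rewrite negb_exists => /forallP h.
    by apply/eqP/matrixP => a b; rewrite ord1 [RHS]mxE; have := h b; rewrite negbK => /eqP.
  exists i; have := congr1 (fun M : 'M[C]_(1, d) => M 0 i) wD.
  clearbody w; rewrite /diagr mul_mx_diag !mxE mulrC => /(mulIf wi) /eqP; rewrite eq_complex /= => /andP[/eqP -> //].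
case=> i ->; apply/eigenvalueP; exists (row i (eigU A)).
  have h : eigU A *m ediag A (lam A) = diagr (lam A) *m eigU A by rewrite /ediag !mulmxA eigU_adj mul1mx.
  rewrite -e in h.
  rewrite -row_mul h.
  by apply/rowP => j; rewrite !mxE (bigD1 i) //= big1 => [|k ki]; rewrite !mxE ?eqxx ?addr0 // eq_sym (negbTE ki) mulr0n mul0r.
apply/eqP => h; have := congr1 (fun M : 'M[C]_(1, d) => (M *m adjmx (eigU A)) 0 i) h.
by rewrite -row_mul eigU_adj mul0mx !mxE eqxx => /eqP; rewrite oner_eq0.
Qed.

Lemma lambda_minP A : selfadj A -> exists2 i, lambda_min A = lam A i & forall j, lam A i <= lam A j.
Proof.
move=> sA; have [i _ imin] := @arg_minP _ _ _ (Ordinal d0) xpredT (lam A) isT.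
exists i; last by move=> j; exact: imin.
have lb : lbound [set x : R | eigenvalue A x%:C%C] (lam A i).
  by move=> x /= /(eigenvalue_lam _ sA)[j ->]; exact: imin.
have mem : [set x : R | eigenvalue A x%:C%C] (lam A i) by apply/(eigenvalue_lam _ sA); exists i.
apply/eqP; rewrite eq_le; apply/andP; split.
  by apply: ge_inf => //; exists (lam A i).
by apply: lb_le_inf => //; exists (lam A i).
Qed.

Lemma lambda_min_le_lam A j : selfadj A -> lambda_min A <= lam A j.
Proof. by move=> /lambda_minP[i ->]. Qed.

(** Together with [trexp_le_lambda_min] this passes from the minimum eigenvalue to the trace
    exponential and back; the return costs the dimensional factor d. *)
Lemma expR_lambda_min_le A : selfadj A -> expR (- lambda_min A) <= trexp A.
Proof.
move=> /lambda_minP[i -> _]; rewrite /trexp (bigD1 i) //= lerDl sumr_ge0 // => j _; exact: expR_ge0.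
Qed.

Lemma trexp_le_lambda_min A : selfadj A -> trexp A <= d%:R * expR (- lambda_min A).
Proof.
move=> sA; rewrite mulr_natl -[X in _ *+ X](card_ord d) -sumr_const; apply: ler_sum => j _.
by rewrite ler_expR lerN2; exact: lambda_min_le_lam.
Qed.

Lemma norm_lambda_min_le A : selfadj A -> `|lambda_min A| <= l1mx A.
Proof. by move=> sA; have [i -> _] := lambda_minP sA; exact: lam_le. Qed.

Lemma vnorm2E u : (vnorm2 u)%:C%C = (adjmx u *m u) 0 0.
Proof.
rewrite mxE rmorph_sum /=; apply: eq_bigr => i _; rewrite mxE mulrC; exact/esym/sqnormcE.
Qed.

Lemma vnorm2_ge0 u : 0 <= vnorm2 u.
Proof. by apply: sumr_ge0 => i _; rewrite addr_ge0 ?sqr_ge0. Qed.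

Lemma vnorm2_eigU A u : vnorm2 (eigU A *m u) = vnorm2 u.
Proof.
have : (vnorm2 (eigU A *m u))%:C%C = (vnorm2 u)%:C%C.
  by rewrite !vnorm2E adjmxM -mulmxA (mulmxA _ (eigU A)) adj_eigU mul1mx.
by case.
Qed.

Lemma ray_lam A u : selfadj A -> ray A u = \sum_i lam A i * sqnormc ((eigU A *m u) i 0).
Proof.
move=> sA; rewrite /ray /qform {1}(selfadj_ediag sA) /ediag !mulmxA -adjmxM -!mulmxA.
set w := eigU A *m u; clearbody w; rewrite mxE Re_sum; apply: eq_bigr => i _.
rewrite [(diagr _ *m _) i 0]mxE (bigD1 i) //= big1 => [|k /negbTE ki]; last by rewrite !mxE eq_sym ki mulr0n mul0r.
by rewrite addr0 !mxE eqxx mulr1n mulrCA ReZ [conjc _ * _]mulrC sqnormcE.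
Qed.

Lemma ray_ge A u : selfadj A -> lambda_min A * vnorm2 u <= ray A u.
Proof.
move=> sA; rewrite ray_lam // -(vnorm2_eigU A) mulr_sumr; apply: ler_sum => i _.
rewrite ler_wpM2r ?addr_ge0 ?sqr_ge0 //; exact: lambda_min_le_lam.
Qed.

Lemma exists_ray_complex A : selfadj A -> exists2 u, vnorm2 u = 1 & ray A u = lambda_min A.
Proof.
move=> sA; have [i e _] := lambda_minP sA.
have cE : eigU A *m col i (adjmx (eigU A)) = delta_mx i 0 by rewrite colE mulmxA eigU_adj mul1mx.
exists (col i (adjmx (eigU A))).
  rewrite -(vnorm2_eigU A) cE /vnorm2 (bigD1 i) //= big1 => [|k /negbTE ki].
    by rewrite mxE !eqxx /= expr1n expr0n !addr0.
  by rewrite mxE ki /= expr0n addr0.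
rewrite ray_lam // cE e (bigD1 i) //= big1 => [|k /negbTE ki].
  by rewrite mxE !eqxx /sqnormc /= expr1n expr0n !addr0 mulr1.
by rewrite mxE ki /sqnormc /= expr0n addr0 mulr0.
Qed.

Definition revec u : 'cV[C]_d := \col_i (complex.Re (u i 0))%:C%C.
Definition imvec u : 'cV[C]_d := \col_i (complex.Im (u i 0))%:C%C.

Lemma rayE A u : ray A u = \sum_i \sum_j complex.Re (conjc (u i 0) * A i j * u j 0).
Proof.
rewrite /ray /qform mxE Re_sum exchange_big /=; apply: eq_bigr => j _.
by rewrite mxE mulr_suml Re_sum; apply: eq_bigr => i _; rewrite mxE.
Qed.

Lemma ray_re_im A u : Fmx true A -> ray A u = ray A (revec u) + ray A (imvec u).
Proof.
move=> /(_ isT) rA; rewrite !rayE -big_split; apply: eq_bigr => i _; rewrite -big_split; apply: eq_bigr => j _.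
rewrite !mxE; have := rA i j; case: (A i j) (u i 0) (u j 0) => [a a'] [b b'] [c c'] /= ->; ring.
Qed.

Lemma vnorm2_re_im u : vnorm2 u = vnorm2 (revec u) + vnorm2 (imvec u).
Proof.
by rewrite /vnorm2 -big_split; apply: eq_bigr => i _; rewrite !mxE /= expr0n !addr0.
Qed.

Lemma Fvec_revec b u : Fvec b (revec u). Proof. by move=> _ i; rewrite mxE. Qed.
Lemma Fvec_imvec b u : Fvec b (imvec u). Proof. by move=> _ i; rewrite mxE. Qed.

Lemma ray_scale A (a : R) u : ray A (a%:C%C *: u) = a ^+ 2 * ray A u.
Proof.
rewrite /ray /qform adjmxZ -!scalemxAl -scalemxAr !scalerA mxE -rmorphM /= ReZ expr2 //.
Qed.

Lemma vnorm2_scale (a : R) u : vnorm2 (a%:C%C *: u) = a ^+ 2 * vnorm2 u.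
Proof.
rewrite /vnorm2 mulr_sumr; apply: eq_bigr => i _; rewrite mxE; case: (u i 0) => x y /=; ring.
Qed.

(** Over R, let u be a complex minimiser. Its real and imaginary parts have energies at least
    lambda_min times their square norms, and these inequalities add up to an equality; so each
    nonzero part, once normalised, is a real minimiser. *)
Lemma exists_ray b A : Fmx b A -> selfadj A -> exists2 u, unitF b u & ray A u = lambda_min A.
Proof.
move=> fA sA; have [u u1 ul] := exists_ray_complex sA.
case: b fA => fA; last by exists u => //; split.
have [h1 h2] := (ray_ge (revec u) sA, ray_ge (imvec u) sA).
have e := ray_re_im u fA; have n := vnorm2_re_im u; rewrite u1 in n; rewrite ul in e.
have ok v : Fvec true v -> 0 < vnorm2 v -> ray A v = lambda_min A * vnorm2 v ->
    exists2 u, unitF true u & ray A u = lambda_min A.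
  move=> fv v0 hv; exists (((Num.sqrt (vnorm2 v))^-1)%:C%C *: v).
    split; first by move=> _ i; rewrite mxE; have := fv isT i; case: (v i 0) => x y /= ->; rewrite mulr0 mul0r addr0.
    by rewrite vnorm2_scale exprVn sqr_sqrtr ?(ltW v0) // mulVf // gt_eqF.
  by rewrite ray_scale exprVn sqr_sqrtr ?(ltW v0) // hv mulrCA mulVf ?mulr1 // gt_eqF.
have le : lambda_min A = lambda_min A * vnorm2 (revec u) + lambda_min A * vnorm2 (imvec u).
  by rewrite -mulrDr -n mulr1.
have [z|z] := eqVneq (vnorm2 (revec u)) 0.
  by apply: (ok (imvec u)); [exact: Fvec_imvec|lra|lra].
apply: (ok (revec u)); [exact: Fvec_revec|by rewrite lt0r z vnorm2_ge0|lra].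
Qed.

Lemma qform_selfadj A u : selfadj A -> complex.Im (qform u A) = 0.
Proof.
move=> sA; have e : adjmx (adjmx u *m A *m u) = adjmx u *m A *m u.
  by rewrite !adjmxM adjmxK sA mulmxA.
have := congr1 (fun M : 'M[C]_1 => M 0 0) e; rewrite mxE -/(qform u A).
by case: (qform u A) => x y /= [] h; lra.
Qed.

Lemma psd_ray b A u : psd b A -> Fvec b u -> 0 <= ray A u.
Proof. by case=> sA h fu; have := h u fu; rewrite lecE /= => /andP[]. Qed.

(** For a real matrix the form at a complex vector is the sum of its values at the real and
    imaginary parts, so positivity on real vectors is enough. *)
Lemma psd_complex b A : Fmx b A -> psd b A -> psd false A.
Proof.
move=> fA pA; have [sA _] := pA; split=> // u _; rewrite lecE /= (qform_selfadj u sA) eqxx /=.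
case: b fA pA => fA pA; last by exact: (psd_ray pA).
have := ray_re_im u fA; rewrite /ray => ->; apply: addr_ge0.
  by apply: (psd_ray pA); exact: Fvec_revec.
by apply: (psd_ray pA); exact: Fvec_imvec.
Qed.

Lemma rayD A B u : ray (A + B) u = ray A u + ray B u.
Proof. by rewrite /ray /qform mulmxDr mulmxDl mxE ReD. Qed.

Lemma ray_rm a A u : ray (realmul d a * A) u = a * ray A u.
Proof. by rewrite realmulE /ray /qform -scalemxAr -scalemxAl mxE ReZ. Qed.

Lemma norm_ray_le A u : selfadj A -> `|ray A u| <= l1mx A * vnorm2 u.
Proof.
move=> sA; rewrite ray_lam // -(vnorm2_eigU A) mulr_sumr; apply: (le_trans (ler_norm_sum _ _ _)).
apply: ler_sum => i _; rewrite normrM [`|sqnormc _|]ger0_norm ?addr_ge0 ?sqr_ge0 //.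
by rewrite ler_wpM2r ?addr_ge0 ?sqr_ge0 // lam_le.
Qed.

End LambdaMin.

(** * The trace exponential in coordinates satisfies the hypotheses of the comparison *)

Section TraceExpCoordinates.
Variables (R : realType) (d : nat) (theta : R).
Hypotheses (d0 : (0 < d)%N) (theta0 : 0 <= theta).
Local Notation C := R[i].
Local Notation rm := (realmul d).
Local Notation I := (coordK d).
Local Notation L := ('I_d * 'I_d * bool)%type.
Implicit Types (x y : I -> R).

Definition herms x : 'M[C]_d := rm theta * herm x.
Definition trexpc x : R := trexp (herms x).

Lemma hermsD x y : herms (x + y) = herms x + herms y.
Proof. by rewrite /herms hermD mulrDr. Qed.

Lemma hermsZ a x : herms (a *: x) = rm a * herms x.
Proof. by rewrite /herms hermZ !realmulE scalerA mulrC -scalerA. Qed.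

Lemma hermsN x : herms (- x) = - herms x.
Proof. by rewrite -scaleN1r hermsZ realmulE rmorphN1 scaleN1r. Qed.

Lemma selfadj_herms x : selfadj (herms x).
Proof. by apply: selfadj_rm; exact: selfadj_herm. Qed.

Lemma l1mx_herms x : l1mx (herms x) <= theta * n1 x.
Proof. by rewrite l1mx_rm ger0_norm // ler_wpM2l // l1mx_herm. Qed.

Definition posc y := psd false (herm y).

Lemma psd_herms y : posc y -> psd false (herms y).
Proof.
case=> sA h; split; first exact: selfadj_rm.
move=> u fu; have -> : qform u (herms y) = theta%:C%C * qform u (herm y).
  by rewrite /herms realmulE /qform -scalemxAr -scalemxAl mxE.
by apply: mulr_ge0; [rewrite lecE /= eqxx|exact: h].
Qed.

Lemma trexpc_gt0 x : 0 < trexpc x.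
Proof.
rewrite /trexpc /trexp (bigD1 (Ordinal d0)) //= ltr_pwDl ?expR_gt0 // sumr_ge0 //.
Qed.

Lemma trexpc_pdec : pdec posc theta trexpc.
Proof.
split; first split.
- exact: trexpc_gt0.
- move=> x y; rewrite /trexpc hermsD.
  apply: (le_trans (trexp_LL (selfadj_herms x) (selfadj_herms y))).
  by rewrite ler_wpM2l ?trexp_ge0 // ler_expR l1mx_herms.
- move=> x y py; rewrite /trexpc hermsD; apply: trexp_psd_le; [exact: selfadj_herms|exact: psd_herms].
Qed.

Definition Dc x : I -> R := fun k => dtrexp (herms x) (herms (fun i => (i == k)%:R)).

Lemma DcE x y : dotv (Dc x) y = dtrexp (herms x) (herms y).
Proof.
rewrite (linear_dotv (f := fun y => dtrexp (herms x) (herms y))) // => [y1 y2|a y1].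
  by rewrite hermsD dtrexpD.
by rewrite hermsZ dtrexp_rm.
Qed.

(** The entries, in an eigenbasis at x, weighted by the root of the kernel [expdd], with real and
    imaginary parts separated: real linear forms in y whose squares add up to the second
    derivative. *)
Definition Qfun x (l : L) y : R := let z := conjU (herms x) (herms y) l.1.1 l.1.2 in
  Num.sqrt (expdd (lam (herms x) l.1.2) (lam (herms x) l.1.1)) * (if l.2 then complex.Im z else complex.Re z).

Definition Qc x l : I -> R := fun k => Qfun x l (fun i => (i == k)%:R).

Lemma QcE x l y : dotv (Qc x l) y = Qfun x l y.
Proof.
have partD (c : bool) (z z' : C) : (if c then complex.Im (z + z') else complex.Re (z + z')) =
    (if c then complex.Im z else complex.Re z) + (if c then complex.Im z' else complex.Re z').
  by case: z z' c => [p q] [p' q'] [].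
have partZ (c : bool) (a : R) (z : C) : (if c then complex.Im (a%:C%C * z) else complex.Re (a%:C%C * z)) =
    a * (if c then complex.Im z else complex.Re z).
  by case: z c => [p q] [] /=; rewrite ?mul0r ?subr0 ?addr0.
rewrite (linear_dotv (f := Qfun x l)) // => [y1 y2|a y1]; rewrite /Qfun.
  by rewrite hermsD conjUD mxE -mulrDr partD.
by rewrite hermsZ conjU_rm mxE partZ mulrCA.
Qed.

Lemma sum_Qc x y : \sum_l dotv (Qc x l) y ^+ 2 = d2trexp (herms x) (herms y).
Proof.
under eq_bigr do rewrite QcE.
rewrite /d2trexp pair_big /=.
transitivity (\sum_(p : 'I_d * 'I_d) \sum_(b : bool) Qfun x (p, b) y ^+ 2).
  by rewrite pair_big /=; apply: eq_bigr => -[p b].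
apply: eq_bigr => -[i j] _; rewrite big_bool /Qfun /= !exprMn sqr_sqrtr ?expdd_ge0 //.
by rewrite /sqnormc; ring.
Qed.

Lemma trexpc_pos x y : posc y ->
  trexpc (x + y) <= trexpc x + dotv (Dc x) y + (\sum_l dotv (Qc x l) y ^+ 2) / 2.
Proof.
move=> py; rewrite sum_Qc DcE /trexpc hermsD.
by apply: trexp_psd_taylor; [exact: selfadj_herms|exact: psd_herms].
Qed.

(** Comes from the error of [trexp_symm_taylor] with X of norm at most theta t ^ 2 n1 m and Y of
    norm at most theta t n1 y, after t ^ 6 <= t ^ 4 and with 1 + n1 y ^ 2 factored out. *)
Definition Bc (m : I -> R) : R := d%:R ^+ 3 * (theta ^+ 3 * (n1 m ^+ 3 + 3 * n1 m)).

Lemma Bc_ge0 m : 0 <= Bc m.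
Proof.
have N0 := n1_ge0 m; rewrite /Bc !mulr_ge0 ?exprn_ge0 ?ler0n ?addr_ge0 ?mulr_ge0 ?exprn_ge0 //.
Qed.

Lemma trexpc_symm m x y t : 0 <= t <= 1 ->
  trexpc x + t ^+ 2 * dotv (Dc x) m + t ^+ 2 * (\sum_l dotv (Qc x l) y ^+ 2) / 2
    - t ^+ 4 * (Bc m * (1 + n1 y ^+ 2)) * trexpc x <=
  (trexpc (x + t ^+ 2 *: m + t *: y) + trexpc (x + t ^+ 2 *: m - t *: y)) / 2.
Proof.
case/andP=> t0 t1.
have h := trexp_symm_taylor (selfadj_herms x) (selfadj_herms (t ^+ 2 *: m)) (selfadj_herms (t *: y)).
have -> : trexpc (x + t ^+ 2 *: m + t *: y) = trexp (herms x + (herms (t ^+ 2 *: m) + herms (t *: y))).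
  by rewrite /trexpc -addrA !hermsD.
have -> : trexpc (x + t ^+ 2 *: m - t *: y) = trexp (herms x + (herms (t ^+ 2 *: m) - herms (t *: y))).
  by rewrite /trexpc -addrA !hermsD hermsN.
apply: le_trans h; rewrite !hermsZ dtrexp_rm d2trexp_rm DcE sum_Qc -!hermsZ -/(trexpc x).
rewrite lerD2l lerN2 ler_wpM2r ?(ltW (trexpc_gt0 _)) //.
have h1 : l1mx (herms (t ^+ 2 *: m)) <= theta * t ^+ 2 * n1 m.
  by apply: (le_trans (l1mx_herms _)); rewrite n1Z ger0_norm ?sqr_ge0 // mulrA.
have h2 : l1mx (herms (t *: y)) <= theta * t * n1 y.
  by apply: (le_trans (l1mx_herms _)); rewrite n1Z ger0_norm // mulrA.
have := l1mx_ge0 (herms (t ^+ 2 *: m)); have := l1mx_ge0 (herms (t *: y)).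
have := n1_ge0 m; have := n1_ge0 y; move: h1 h2; rewrite /Bc.
move: (l1mx (herms (t ^+ 2 *: m))) (l1mx (herms (t *: y))) (n1 m) (n1 y) => X Y M N hX hY N0 M0 Y0 X0.
have pX : 0 <= theta * t ^+ 2 * M by rewrite !mulr_ge0 ?sqr_ge0.
have pY : 0 <= theta * t * N by rewrite !mulr_ge0.
have X3 : X ^+ 3 <= (theta * t ^+ 2 * M) ^+ 3 by apply: lerXn2r; rewrite ?nnegrE.
have Y2 : Y ^+ 2 <= (theta * t * N) ^+ 2 by apply: lerXn2r; rewrite ?nnegrE.
have XY : X * Y ^+ 2 <= theta * t ^+ 2 * M * (theta * t * N) ^+ 2 by rewrite ler_pM ?sqr_ge0.
have t64 : t ^+ 6 <= t ^+ 4 by rewrite -[6%N]/(2 + 4)%N exprD ler_piMl ?exprn_ge0 // expr_le1.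
have tM : theta ^+ 3 * M ^+ 3 * t ^+ 6 <= theta ^+ 3 * M ^+ 3 * t ^+ 4.
  by rewrite ler_wpM2l // mulr_ge0 ?exprn_ge0.
have e1 : (theta * t ^+ 2 * M) ^+ 3 = theta ^+ 3 * M ^+ 3 * t ^+ 6 by ring.
have e2 : theta * t ^+ 2 * M * (theta * t * N) ^+ 2 = theta ^+ 3 * M * (t ^+ 4 * N ^+ 2) by ring.
rewrite [leRHS](_ : _ = d%:R ^+ 3 * (theta ^+ 3 * M ^+ 3 * t ^+ 4 + 3 * (theta ^+ 3 * M * (t ^+ 4 * N ^+ 2)) +
   (theta ^+ 3 * M ^+ 3 * (t ^+ 4 * N ^+ 2) + 3 * (theta ^+ 3 * M * t ^+ 4)))); last by ring.
rewrite ler_wpM2l ?exprn_ge0 ?ler0n //.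
have p1 : 0 <= theta ^+ 3 * M ^+ 3 * (t ^+ 4 * N ^+ 2) by rewrite !mulr_ge0 ?exprn_ge0.
have p2 : 0 <= theta ^+ 3 * M * t ^+ 4 by rewrite !mulr_ge0 ?exprn_ge0.
rewrite e1 in X3; rewrite e2 in XY; rewrite -(mulrA 3).
move: (X ^+ 3) (X * Y ^+ 2) (theta ^+ 3 * M ^+ 3 * t ^+ 6) (theta ^+ 3 * M ^+ 3 * t ^+ 4) (theta ^+ 3 * M * (t ^+ 4 * N ^+ 2)) (theta ^+ 3 * M ^+ 3 * (t ^+ 4 * N ^+ 2)) (theta ^+ 3 * M * t ^+ 4) X3 XY tM p1 p2 => q1 q2 q3 q4 q5 q6 q7; lra.
Qed.

End TraceExpCoordinates.

(** * Finite nets of unit vectors *)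

Section UnitNet.
Variables (R : realType) (d : nat) (b : bool).
Hypothesis d0 : (0 < d)%N.
Local Notation C := R[i].
Implicit Types (A : 'M[C]_d) (u v : 'cV[C]_d).

Definition netidx k := {ffun 'I_d * bool -> 'I_(2 * k.+1).+1}.

Definition gridpt k (j : 'I_(2 * k.+1).+1) : R := j%:R / k.+1%:R - 1.

Definition gridvec k (j : netidx k) : 'cV[C]_d :=
  \col_i ((gridpt (j (i, false))) +i* (if b then 0 else gridpt (j (i, true))))%C.

(** Grid points of the cube, normalised to unit length; the origin, which cannot be normalised, is
    replaced by a basis vector. *)
Definition netvec k (j : netidx k) : 'cV[C]_d := let v := gridvec j in
  if vnorm2 v == 0 then delta_mx (Ordinal d0) 0 else ((Num.sqrt (vnorm2 v))^-1)%:C%C *: v.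

Lemma netvec_unit k (j : netidx k) : unitF b (netvec j).
Proof.
rewrite /netvec; have [z|z] := eqVneq.
  split.
    by move=> _ i; rewrite mxE; case: (_ && _).
  rewrite /vnorm2 (bigD1 (Ordinal d0)) //= big1 => [|k' /negbTE ki].
    by rewrite mxE !eqxx /= expr1n expr0n !addr0.
  by rewrite mxE ki /= expr0n addr0.
have v0 : 0 < vnorm2 (gridvec j) by rewrite lt0r z vnorm2_ge0.
split; last by rewrite vnorm2_scale exprVn sqr_sqrtr ?(ltW v0) // mulVf.
by move=> bb i; rewrite !mxE bb /= mulr0 mul0r addr0.
Qed.

Definition rnd k (r : R) : 'I_(2 * k.+1).+1 := inord (Num.truncn ((r + 1) * k.+1%:R)).

Lemma rnd_cvg (r : R) : `|r| <= 1 -> gridpt (rnd k r) @[k --> \oo] --> r.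
Proof.
rewrite ler_norml => /andP[r0 r1]; apply/cvgrPdist_le => e e0; near=> k.
have k0 : 0 < k.+1%:R :> R by [].
have x0 : 0 <= (r + 1) * k.+1%:R by rewrite mulr_ge0 //; lra.
have /andP[h1 h2] := truncn_itv x0; set n := Num.truncn _ in h1 h2.
have n2 : (n < (2 * k.+1).+1)%N.
  rewrite ltnS -(ler_nat R) natrM; apply: (le_trans h1); rewrite ler_pM2r //; lra.
rewrite /gridpt /rnd inordK // -/n.
have e1 : n%:R / k.+1%:R <= r + 1 by rewrite ler_pdivrMr.
have e2 : r + 1 <= n%:R / k.+1%:R + k.+1%:R^-1.
  by rewrite -(ler_pM2r k0) [leRHS]mulrDl divfK ?mulVf ?gt_eqF // natr1 ltW.
have e3 : k.+1%:R^-1 <= e.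
  by apply: ltW; near: k; exact: (@cvgr_lt _ _ _ _ _ 0 (@cvg_harmonic R) e e0).
move: (n%:R / k.+1%:R : R) (k.+1%:R^-1 : R) e1 e2 e3 => p q e1 e2 e3.
by rewrite ger0_norm; lra.
Unshelve. all: by end_near.
Qed.

Lemma cvg_ray (v : nat -> 'cV[C]_d) u A :
  (forall i, complex.Re (v k i 0) @[k --> \oo] --> complex.Re (u i 0)) ->
  (forall i, complex.Im (v k i 0) @[k --> \oo] --> complex.Im (u i 0)) ->
  ray A (v k) @[k --> \oo] --> ray A u.
Proof.
move=> cr ci.
have e w : ray A w = \sum_i \sum_j ((complex.Re (w i 0) * complex.Re (w j 0) + complex.Im (w i 0) * complex.Im (w j 0)) * complex.Re (A i j) -
     (complex.Re (w i 0) * complex.Im (w j 0) - complex.Im (w i 0) * complex.Re (w j 0)) * complex.Im (A i j)).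
  rewrite rayE; apply: eq_bigr => i _; apply: eq_bigr => j _.
  case: (A i j) (w i 0) (w j 0) => [p q] [x y] [x' y'] /=; ring.
rewrite e (_ : (fun k => _) = fun k => \sum_i \sum_j ((complex.Re (v k i 0) * complex.Re (v k j 0) + complex.Im (v k i 0) * complex.Im (v k j 0)) * complex.Re (A i j) -
     (complex.Re (v k i 0) * complex.Im (v k j 0) - complex.Im (v k i 0) * complex.Re (v k j 0)) * complex.Im (A i j))); last first.
  by apply/funext => k; rewrite e.
apply: cvg_sumr => i; apply: cvg_sumr => j; apply: cvgB; apply: cvgMl.
  by apply: cvgD; apply: cvgM.
by apply: cvgB; apply: cvgM.
Qed.

(** Rounding the coordinates of a minimising unit vector gives grid points that converge to it;
    eventually they are nonzero, and normalising does not change the limit. *)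
Lemma netvec_cvg A : Fmx b A -> selfadj A -> exists s : forall k, netidx k,
  ray A (netvec (s k)) @[k --> \oo] --> lambda_min A.
Proof.
move=> fA sA; have [u [fu u1] e] := exists_ray d0 fA sA.
pose s k : netidx k := [ffun p => rnd k (if p.2 then complex.Im (u p.1 0) else complex.Re (u p.1 0))].
exists s; have bd i : `|complex.Re (u i 0)| <= 1 /\ `|complex.Im (u i 0)| <= 1.
  have : complex.Re (u i 0) ^+ 2 + complex.Im (u i 0) ^+ 2 <= 1.
    by rewrite -u1 /vnorm2 (bigD1 i) //= lerDl sumr_ge0 // => j _; rewrite addr_ge0 ?sqr_ge0.
  move: (complex.Re _) (complex.Im _) => x y xy.
  have sq z : z ^+ 2 <= 1 -> `|z| <= 1 :> R by rewrite -real_normK ?num_real // expr_le1.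
  by split; apply: sq; have := sqr_ge0 x; have := sqr_ge0 y; lra.
have cr i : complex.Re (gridvec (s k) i 0) @[k --> \oo] --> complex.Re (u i 0).
  rewrite (_ : (fun k => _) = fun k => gridpt (rnd k (complex.Re (u i 0)))); first by apply: rnd_cvg; case: (bd i).
  by apply/funext => k; rewrite mxE /= ffunE.
have ci i : complex.Im (gridvec (s k) i 0) @[k --> \oo] --> complex.Im (u i 0).
  have [bt|bf] := boolP b.
    rewrite (fu bt i) (_ : (fun k => _) = fun k => 0); first exact: cvg_cst.
    by apply/funext => k; rewrite mxE /= bt.
  rewrite (_ : (fun k => _) = fun k => gridpt (rnd k (complex.Im (u i 0)))); first by apply: rnd_cvg; case: (bd i).
  by apply/funext => k; rewrite mxE /= (negbTE bf) ffunE.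
have c1 := @cvg_ray (fun k => gridvec (s k)) u A cr ci.
have c2 : vnorm2 (gridvec (s k)) @[k --> \oo] --> (1 : R).
  rewrite -u1 /vnorm2; apply: cvg_sumr => i; apply: cvgD; rewrite ?expr2.
    rewrite (_ : (fun k => _) = fun k => complex.Re (gridvec (s k) i 0) * complex.Re (gridvec (s k) i 0)); first exact: cvgM.
    by apply/funext => k; rewrite expr2.
  rewrite (_ : (fun k => _) = fun k => complex.Im (gridvec (s k) i 0) * complex.Im (gridvec (s k) i 0)); first exact: cvgM.
  by apply/funext => k; rewrite expr2.
have c3 : (vnorm2 (gridvec (s k)))^-1 * ray A (gridvec (s k)) @[k --> \oo] --> 1^-1 * ray A u.
  by apply: cvgM => //; apply: cvgV => //; rewrite oner_eq0.
rewrite invr1 mul1r e in c3.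
apply: cvg_trans c3; apply: near_eq_cvg; near=> k.
have v0 : 0 < vnorm2 (gridvec (s k)) by near: k; apply: (@cvgr_gt _ _ _ _ _ 1 c2).
by rewrite /netvec gt_eqF // ray_scale exprVn sqr_sqrtr // ltW.
Unshelve. all: by end_near.
Qed.

End UnitNet.

(** * Concentration of the minimum eigenvalue *)

Lemma Lip_lower {R : realType} {I : finType} (a : R) (f : (I -> R) -> R) :
  (forall x y, f x - a * n1 y <= f (x + y)) -> Lip a f.
Proof.
move=> half x y; rewrite ler_norml; apply/andP; split; first by have := half x y; lra.
have e : n1 (- y) = n1 y by rewrite -scaleN1r n1Z normrN1 mul1r.
by have := half (x + y) (- y); rewrite addrK e; lra.
Qed.

Section LambdaMinCoordinates.
Variables (R : realType) (d : nat).
Hypothesis d0 : (0 < d)%N.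
Local Notation C := R[i].
Local Notation I := (coordK d).
Implicit Types (A B M : 'M[C]_d) (u : 'cV[C]_d) (x y c : I -> R).

Lemma lambda_min_le_ray A u : selfadj A -> vnorm2 u = 1 -> lambda_min A <= ray A u.
Proof. by move=> sA u1; have := ray_ge d0 u sA; rewrite u1 mulr1. Qed.

Lemma lambda_min_rm (a : R) A : 0 <= a -> selfadj A -> lambda_min (realmul d a * A) = a * lambda_min A.
Proof.
move=> a0 sA; have saA := selfadj_rm a sA; apply/eqP; rewrite eq_le; apply/andP; split.
  have [u u1 <-] := exists_ray_complex d0 sA.
  by rewrite -ray_rm; exact: lambda_min_le_ray.
have [u u1 <-] := exists_ray_complex d0 saA.
by rewrite ray_rm ler_wpM2l //; exact: lambda_min_le_ray.
Qed.

Definition lmc x : R := lambda_min (herm x).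

Lemma lmc_Lip : Lip 1 lmc.
Proof.
apply: Lip_lower => x y; rewrite mul1r.
rewrite /lmc; have [u u1 <-] := exists_ray_complex d0 (selfadj_herm (x + y)).
rewrite hermD rayD; apply: lerD; first by apply: lambda_min_le_ray => //; exact: selfadj_herm.
have := norm_ray_le u (selfadj_herm y); rewrite u1 mulr1 ler_norml => /andP[h2 _].
by apply: le_trans h2; rewrite lerN2 l1mx_herm.
Qed.

Lemma mxcoordD A B : mxcoord (A + B) = mxcoord A + mxcoord B.
Proof. by apply/funext => -[[i j] b]; rewrite !fctE /mxcoord /= mxE; case: (A i j) (B i j) b => [p q] [p' q'] []. Qed.

Lemma mxcoord_sum n (F : 'I_n -> 'M[C]_d) : mxcoord (\sum_i F i) = \sum_i mxcoord (F i).
Proof.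
apply: (big_morph (@mxcoord R d)) => [A B|]; first exact: mxcoordD.
by apply/funext => -[[i j] b]; rewrite /mxcoord mxE; case: b.
Qed.

Lemma trip_mxcoord M A : trip M A = dotv (mxcoord M) (mxcoord A).
Proof.
rewrite /trip /dotv /mxtrace Re_sum.
transitivity (\sum_(p : 'I_d * 'I_d) (complex.Re (M p.1 p.2) * complex.Re (A p.1 p.2) + complex.Im (M p.1 p.2) * complex.Im (A p.1 p.2))).
  rewrite -(pair_big xpredT xpredT (fun i j => complex.Re (M i j) * complex.Re (A i j) + complex.Im (M i j) * complex.Im (A i j))) /= exchange_big /=.
  apply: eq_bigr => j _; rewrite mxE Re_sum; apply: eq_bigr => i _; rewrite mxE.
  by case: (M i j) (A i j) => [p q] [p' q'] /=; ring.
transitivity (\sum_(p : 'I_d * 'I_d) \sum_(b : bool) mxcoord M (p, b) * mxcoord A (p, b)).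
  by apply: eq_bigr => -[i j] _; rewrite big_bool /mxcoord /= addrC.
by rewrite pair_big; apply: eq_bigr => -[p b].
Qed.

(** In coordinates [herm] is the orthogonal projection onto the self-adjoint matrices, so it does
    not affect inner products with them. *)
Lemma dotv_herm c A : selfadj A -> dotv (mxcoord (herm c)) (mxcoord A) = dotv c (mxcoord A).
Proof.
move=> sA; pose sw (k : I) : I := (k.1.2, k.1.1, k.2).
have swI : injective sw by move=> [[a b] e] [[a' b'] e'] [-> -> ->].
pose sg (k : I) : R := if k.2 then -1 else 1.
have hE k : mxcoord (herm c) k = (c k + sg k * c (sw k)) / 2.
  by case: k => [[i j] []]; rewrite /mxcoord /= mxE /= /sg /sw /= ?mulN1r ?mul1r.
have aE k : mxcoord A (sw k) = sg k * mxcoord A k.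
  case: k => [[i j] b]; have [h1 h2] := selfadj_coord i j sA.
  by rewrite /mxcoord /sw /sg /=; case: b => /=; rewrite ?h1 ?h2 ?mul1r ?mulN1r ?opprK.
have e : \sum_k sg k * c (sw k) * mxcoord A k = \sum_k c k * mxcoord A k.
  rewrite [RHS](reindex_inj swI); apply: eq_bigr => k _; rewrite aE; ring.
have -> : dotv (mxcoord (herm c)) (mxcoord A) = 2^-1 * (\sum_k c k * mxcoord A k + \sum_k sg k * c (sw k) * mxcoord A k).
  by rewrite -big_split mulr_sumr; apply: eq_bigr => k _; rewrite hE /=; ring.
by rewrite e /dotv; lra.
Qed.

(** Project [c] with [herm], after deleting its imaginary coordinates if F = R. The hypothesis,
    stated for self-adjoint M over F, thereby reaches every linear form of the coordinates. *)
Lemma exists_trip b c : exists M, [/\ Fmx b M, selfadj M & forall A, Fmx b A -> selfadj A -> trip M A = dotv c (mxcoord A)].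
Proof.
pose c' (k : I) := if b && k.2 then 0 else c k.
exists (herm c'); split; last first.
- move=> A fA sA; rewrite trip_mxcoord dotv_herm //; apply: eq_bigr => -[[i j] e] _.
  rewrite /c' /mxcoord /=; case: ifP => // /andP[bb ->]; by rewrite fA // !mulr0.
- exact: selfadj_herm.
- by move=> bb i j; rewrite mxE /= /c' /= bb subrr mul0r.
Qed.

Lemma ray_dotv u : exists e, forall x, ray (herm x) u = dotv e x.
Proof.
eexists; apply: (linear_dotv (f := fun x => ray (herm x) u)) => [x y|a x].
  by rewrite hermD rayD.
by rewrite hermZ ray_rm.
Qed.

Lemma norm_ray_n1 x u : vnorm2 u = 1 -> `|ray (herm x) u| <= n1 x.
Proof.
move=> u1; have := norm_ray_le u (selfadj_herm x); rewrite u1 mulr1 => h.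
exact: (le_trans h (l1mx_herm x)).
Qed.

End LambdaMinCoordinates.

Section Concentration.
Context {R : realType} {dT : measure_display} {T : measurableType dT}.
Variables (P : probability T R) (d : nat) (b : bool) (G : T -> coordK d -> R).
Hypotheses (d0 : (0 < d)%N) (gG : gvec P G).
Variables (m : coordK d -> R) (s theta sigma2 : R).
Hypotheses (s0 : 0 <= s) (theta0 : 0 < theta).
Let zeta w := m + s *: G w.
Hypothesis F_zeta : forall w, Fmx b (herm (zeta w)).
Hypothesis var_le : forall u, unitF b u -> Ex P (fun w => ray (herm (s *: G w)) u ^+ 2) <= sigma2.

Let mG : rvec G. Proof. by case: gG. Qed.

Let f k x (j : netidx d k) := - theta * ray (herm (m + s *: x)) (netvec R b d0 j).
Let j0 k : netidx d k := [ffun=> ord0].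
(** The maximum over the k-th net: finitely many affine functions of x, hence within the scope of
    [gauss_max_expR_le]. *)
Let h k x := f x [arg max_(j > j0 k) f x j]%O.

Let h_ub k x (j : netidx d k) : f x j <= h k x.
Proof. by rewrite /h; case: arg_maxP => // i _; apply. Qed.

Let unit_net k (j : netidx d k) : vnorm2 (netvec R b d0 j) = 1.
Proof. by have [_] := netvec_unit R b d0 j. Qed.

Let aff k (j : netidx d k) : exists e, forall x, - theta * ray (herm (s *: x)) (netvec R b d0 j) = dotv e x.
Proof.
have [e eE] := ray_dotv (netvec R b d0 j); exists (- theta * s *: e) => x.
by rewrite dotvZl eE dotvZr mulrA.
Qed.

Let e_ k j := sval (cid (@aff k j)).
Let e_E k j x : - theta * ray (herm (s *: x)) (netvec R b d0 j) = dotv (@e_ k j) x.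
Proof. exact: (svalP (cid (@aff k j))). Qed.

Let fE k x (j : netidx d k) : f x j = - theta * ray (herm m) (netvec R b d0 j) + dotv (e_ j) x.
Proof. by rewrite /f hermD rayD mulrDr e_E. Qed.

Let h_expR_le k : Ex P (fun w => expR (h k (G w))) <= expR (Ex P (fun w => h k (G w)) + theta ^+ 2 * sigma2 / 2).
Proof.
apply: (@gauss_max_expR_le _ _ _ _ _ P G (fun j : netidx d k => - theta * ray (herm m) (netvec R b d0 j)) (@e_ k) _ (j0 k) (h k) gG).
- move=> j; rewrite (_ : Ex P _ = theta ^+ 2 * Ex P (fun w => ray (herm (s *: G w)) (netvec R b d0 j) ^+ 2)).
    by rewrite ler_wpM2l ?sqr_ge0 // var_le //; exact: netvec_unit.
  rewrite -ExZ; first by apply: eq_Ex => w; rewrite -e_E exprMn sqrrN.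
  have [e eE] := ray_dotv (netvec R b d0 j).
  apply: (@intg_le _ _ _ _ _ (fun w => s ^+ 2 * (n1 (G w) ^+ 2 * expR (0 * n1 (G w))))).
  - under eq_fun do rewrite eE dotvZr; apply: measurable_funX; apply: measurable_funM => //.
    exact: measurable_dotv.
  - move=> w; rewrite mul0r expR0 mulr1 ger0_norm ?sqr_ge0 // -exprMn -real_normK ?num_real //.
    rewrite ler_sqr ?nnegrE ?mulr_ge0 ?n1_ge0 //; apply: (le_trans (norm_ray_n1 _ (unit_net j))).
    by rewrite n1Z ger0_norm.
  - by apply: intgZ; exact: intg_n1X.
- by move=> x j; rewrite -fE; exact: h_ub.
- by move=> x; rewrite /h; eexists; exact: fE.
Qed.

Let bound w := theta * n1 m + theta * s * n1 (G w).

Let fbound k w (j : netidx d k) : `|f (G w) j| <= bound w.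
Proof.
rewrite /f normrM normrN (gtr0_norm theta0) /bound -mulrA -mulrDr ler_wpM2l ?(ltW theta0) //.
apply: (le_trans (norm_ray_n1 _ (unit_net j))); apply: (le_trans (n1D _ _)).
by rewrite n1Z ger0_norm.
Qed.

Let h_cvg w : h k (G w) @[k --> \oo] --> - theta * lmc (zeta w).
Proof.
have [sk c] := netvec_cvg d0 (F_zeta w) (selfadj_herm (zeta w)).
have c1 : - theta * ray (herm (zeta w)) (netvec R b d0 (sk k)) @[k --> \oo] --> - theta * lmc (zeta w).
  by apply: cvgM => //; exact: cvg_cst.
have c2 : (fun _ : nat => - theta * lmc (zeta w)) k @[k --> \oo] --> - theta * lmc (zeta w) by exact: cvg_cst.
apply: (squeeze_cvgr _ c1 c2); apply: nearW => k; apply/andP; split; first exact: h_ub.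
rewrite /h /f !mulNr lerN2 ler_wpM2l ?(ltW theta0) //.
by apply: lambda_min_le_ray => //; exact: selfadj_herm.
Qed.

Let measurable_h k : measurable_fun [set: T] (fun w => h k (G w)).
Proof.
apply: (measurable_cont _ mG); apply: (Lip_cont _ (@max_Lip _ _ _ (fun j : netidx d k => - theta * ray (herm m) (netvec R b d0 j)) (@e_ k) (h k) _ _)).
- by apply: sumr_ge0 => j _; exact: sumr_ge0.
- by move=> x j; rewrite -fE; exact: h_ub.
- by move=> x; rewrite /h; eexists; exact: fE.
Qed.

(** Limit of the net bounds by dominated convergence: [bound] dominates all the maxima, and its
    exponential is integrable for a Gaussian vector. *)
Lemma lambda_min_expR_le :
  [/\ intg P (fun w => lmc (zeta w)), intg P (fun w => expR (- theta * lmc (zeta w))) &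
  Ex P (fun w => expR (- theta * lmc (zeta w))) <=
    expR (- theta * Ex P (fun w => lmc (zeta w)) + theta ^+ 2 * sigma2 / 2)].
Proof.
have ib : intg P bound.
  apply: intgD; first exact: intg_cst.
  by apply: intgZ; have := intg_n1X gG 1 0; under eq_fun do rewrite mul0r expR0 mulr1 expr1.
have ieb : intg P (fun w => expR (bound w)).
  rewrite (_ : (fun w => _) = fun w => expR (theta * n1 m) * expR (theta * s * n1 (G w))).
    by apply: intgZ; exact: gvec_intg_expR_n1.
  by apply/funext => w; rewrite -expRD.
have [i1 l1] := @Ex_cvg _ _ _ P (fun k w => h k (G w)) (fun w => - theta * lmc (zeta w)) bound
  (fun k => measurable_h k) h_cvg ib (fun k w => fbound _ _).
have me k : measurable_fun [set: T] (fun w => expR (h k (G w))).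
  by apply: measurableT_comp => //; exact: measurable_h.
have be k w : `|expR (h k (G w))| <= expR (bound w).
  rewrite gtr0_norm ?expR_gt0 // ler_expR; apply: (le_trans (ler_norm _)); exact: fbound.
have [i2 l2] := @Ex_cvg _ _ _ P (fun k w => expR (h k (G w))) (fun w => expR (- theta * lmc (zeta w))) (fun w => expR (bound w))
  me
  (fun w => cvg_comp _ _ (@h_cvg w) (@continuous_expR R (- theta * lmc (zeta w)))) ieb be.
have i3 : intg P (fun w => lmc (zeta w)).
  have := intgZ (- theta)^-1 i1; rewrite (_ : (fun w => _) = fun w => lmc (zeta w)) //.
  by apply/funext => w; rewrite mulrA mulVf ?mul1r // oppr_eq0 gt_eqF.
split => //; rewrite ExZ // in l1.
have l3 : expR (Ex P (fun w => h k (G w)) + theta ^+ 2 * sigma2 / 2) @[k --> \oo] -->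
    expR (- theta * Ex P (fun w => lmc (zeta w)) + theta ^+ 2 * sigma2 / 2).
  apply: (@cvg_comp _ _ _ _ expR); last exact: continuous_expR.
  by apply: cvgD => //; exact: cvg_cst.
by apply: (ler_cvg_to l2 l3); apply: nearW => k; exact: h_expR_le.
Qed.

End Concentration.

(** * Comparison of the two sums *)

Section Optimization.
Variable R : realType.

(** For s > 0 the minimum is at t = q / s with q = sqrt (2 s L), where both terms equal q / 2. For s
    = 0 it is only approached, as t grows. *)
Lemma le_sqrt_optimize (D L s : R) : 0 < L -> 0 <= s -> (forall t, 0 < t -> D <= L / t + t * s / 2) ->
  D <= Num.sqrt (2 * s * L).
Proof.
move=> L0 s0 h; have [s00|sn0] := eqVneq s 0.
  rewrite s00 mulr0 mul0r sqrtr0; apply/ler_addgt0Pl => e e0; rewrite addr0.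
  have := h (L / e) (divr_gt0 L0 e0); rewrite s00 mulr0 mul0r addr0 invf_div mulrCA divff ?mulr1 //.
  by rewrite gt_eqF.
have s1 : 0 < s by rewrite lt0r sn0.
have p0 : 0 < 2 * s * L by rewrite !mulr_gt0.
set q := Num.sqrt _; have q0 : 0 < q by rewrite sqrtr_gt0.
have q2 : q ^+ 2 = 2 * s * L by rewrite sqr_sqrtr // ltW.
have := h (q / s) (divr_gt0 q0 s1); rewrite invf_div.
have -> : L * (s / q) = q / 2.
  have qn0 : q != 0 by rewrite gt_eqF.
  by apply: (mulIf qn0); rewrite -mulrA divfK // mulrAC -expr2 q2; field.
have -> : q / s * s / 2 = q / 2 by rewrite divfK // gt_eqF.
by rewrite -splitr.
Qed.

Context {dT : measure_display} {T : measurableType dT}.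
Variable P : probability T R.

Lemma jensen_expR (f : T -> R) : intg P f -> intg P (fun w => expR (f w)) ->
  expR (Ex P f) <= Ex P (fun w => expR (f w)).
Proof.
move=> i1 i2; set a := Ex P f.
have i3 : intg P (fun w => f w - a) by apply: intgB => //; exact: intg_cst.
have i4 : intg P (fun w => expR a * (1 + (f w - a))) by apply: intgZ; apply: intgD => //; exact: intg_cst.
apply: (@le_trans _ _ (Ex P (fun w => expR a * (1 + (f w - a))))).
  rewrite ExZ; last by apply: intgD => //; exact: intg_cst.
  rewrite (@ExD _ _ _ P (fun=> 1)) //; last exact: intg_cst.
  by rewrite ExB ?Ex_cst ?subrr ?addr0 ?mulr1 //; exact: intg_cst.
apply: Ex_le => // w.
have -> : expR (f w) = expR a * expR (f w - a) by rewrite -expRD addrC subrK.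
by rewrite ler_wpM2l ?expR_ge0 // expR_ge1Dx.
Qed.

Lemma measurable_sublevel (f : T -> R) (a : R) : measurable_fun [set: T] f -> measurable [set w | f w <= a].
Proof.
move=> mf; rewrite (_ : [set w | _] = f @^-1` `]-oo, a]%classic).
  by rewrite -[X in measurable X]setTI; apply: mf => //; exact: measurable_itv.
by apply/seteqP; split => w /=; rewrite in_itv.
Qed.

Lemma markov_expR (f : T -> R) (a t : R) : measurable_fun [set: T] f -> 0 < t ->
  intg P (fun w => expR (- t * f w)) ->
  fine (P [set w | f w <= a]) <= expR (t * a) * Ex P (fun w => expR (- t * f w)).
Proof.
move=> mf t0 i1; have mD := measurable_sublevel a mf.
rewrite -(Ex_indic P (f := \1_[set w | f w <= a]) mD) // -ExZ //.
apply: Ex_le => [||w].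
- apply: (@intg_bounded _ _ _ _ _ 1); first exact: measurable_indic.
  by move=> w; rewrite indicE; case: (_ \in _); rewrite ?normr1 ?normr0.
- exact: intgZ.
rewrite -expRD indicE; case: (boolP (w \in _)) => h; last exact: expR_ge0.
rewrite -expR0 ler_expR mulNr -mulrBr mulr_ge0 ?(ltW t0) // subr_ge0.
by move: h; rewrite inE.
Qed.

End Optimization.

Lemma n1_sum {R : realType} {I : finType} n (F : 'I_n -> I -> R) : n1 (\sum_i F i) <= \sum_i n1 (F i).
Proof.
apply: (big_ind2 (fun (x : I -> R) r => n1 x <= r)) => // [|x1 r1 x2 r2 h1 h2].
  by rewrite n1_0.
by apply: (le_trans (n1D _ _)); exact: lerD.
Qed.

Lemma Lip_dotv {R : realType} {I : finType} (c : I -> R) : Lip (\sum_i `|c i|) (dotv c).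
Proof. by move=> x y; rewrite dotvDr [_ + dotv c y]addrC addrK dotv_le_n1. Qed.

Lemma cont_dotv {R : realType} {I : finType} (c : I -> R) : cont (dotv c).
Proof. by apply: Lip_cont (Lip_dotv c); exact: sumr_ge0. Qed.

(** * Application to the random matrices W and X *)

Section Main.
Context {R : realType} {dT : measure_display} {T : measurableType dT}.
Variables (P : probability T R) (b : bool) (d : nat) (n : nat).
Variables (W X : T -> 'M[R[i]]_d) (Ws Xs : 'I_n -> T -> 'M[R[i]]_d).
Hypothesis d0 : (0 < d)%N.
Hypotheses (mW : random_matrix W) (W_psd : forall w, Fmx b (W w) /\ psd b (W w)).
Hypotheses (mX : random_matrix X) (X_sa : forall w, Fmx b (X w) /\ selfadj (X w)).
Hypothesis X_gauss : gaussian_matrix P X.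
Hypothesis EXW : forall k : coordK d,
  ('E_P[fun w => mxcoord (X w) k] = 'E_P[fun w => mxcoord (W w) k])%E.
Hypothesis VXW : forall M : 'M[R[i]]_d, Fmx b M -> selfadj M ->
  ('E_P[fun w => ((trip M (W w)) ^+ 2)%R] <= 'V_P[fun w => trip M (X w)])%E.
Hypotheses (mWs : forall i, random_matrix (Ws i)) (Ws_psd : forall i w, Fmx b (Ws i w) /\ psd b (Ws i w)).
Hypotheses (Ws_law : forall i, same_law P (Ws i) W) (Ws_indep : indep_matrices P Ws).
Hypotheses (mXs : forall i, random_matrix (Xs i)) (Xs_sa : forall i w, Fmx b (Xs i w) /\ selfadj (Xs i w)).
Hypotheses (Xs_law : forall i, same_law P (Xs i) X) (Xs_indep : indep_matrices P Xs).

Let Xv w := mxcoord (X w).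
Let Wv w := mxcoord (W w).
Let Yv w := \sum_(i < n) mxcoord (Ws i w).
Let Zv w := \sum_(i < n) mxcoord (Xs i w).
Let m k := Ex P (fun w => Xv w k).
Let G w := Xv w - m.
(** A single Gaussian vector on the same space with the law of the sum Z; it is the end point at
    time n of the Gaussian flow started at 0. *)
Let zeta w := n%:R *: m + Num.sqrt n%:R *: G w.

Let iX k : intg P (fun w => Xv w k).
Proof. by have [h _] := jointly_gaussian_gvec (X := Xv) mX X_gauss; exact: h. Qed.

Let gG : gvec P G.
Proof. by have [_ h] := jointly_gaussian_gvec (X := Xv) mX X_gauss. Qed.

Let sum_selfadj (F : 'I_n -> 'M[R[i]]_d) : (forall i, selfadj (F i)) -> selfadj (\sum_i F i).
Proof.
move=> h; apply: big_ind => //; last by move=> A B; exact: selfadjD.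
by apply/matrixP => i j; rewrite !mxE conjc0.
Qed.

Let Y_sa w : selfadj (\sum_(i < n) Ws i w).
Proof. by apply: sum_selfadj => i; have [_ []] := Ws_psd i w. Qed.

Let Z_sa w : selfadj (\sum_(i < n) Xs i w).
Proof. by apply: sum_selfadj => i; have [] := Xs_sa i w. Qed.

Let herm_Yv w : herm (Yv w) = \sum_(i < n) Ws i w.
Proof. by rewrite /Yv -mxcoord_sum herm_mxcoord. Qed.

Let herm_Zv w : herm (Zv w) = \sum_(i < n) Xs i w.
Proof. by rewrite /Zv -mxcoord_sum herm_mxcoord. Qed.

(** [exists_trip] realises [c] by an admissible M, for which the hypothesis says that the second
    moment of the form under W is at most its finite Gaussian variance. *)
Let W_facts c : [/\ intg P (fun w => dotv c (Wv w)), intg P (fun w => dotv c (Wv w) ^+ 2) &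
  Ex P (fun w => dotv c (Wv w) ^+ 2) <= Ex P (fun w => dotv c (G w) ^+ 2)].
Proof.
have [M [fM sM tM]] := exists_trip b c.
have eX w : trip M (X w) = dotv c (Xv w) by have [f s] := X_sa w; exact: tM.
have eW w : trip M (W w) = dotv c (Wv w) by have [f [s _]] := W_psd w; exact: tM.
have := VXW fM sM; rewrite (_ : (fun w => trip M (X w)) = fun w => dotv c (Xv w)); last exact/funext.
have mean : Ex P (fun w => dotv c (Xv w)) = dotv c m by rewrite Ex_dotv.
have cE w : dotv c (Xv w) - Ex P (fun w => dotv c (Xv w)) = dotv c (G w) by rewrite mean -dotvB.
have i2 : intg P (fun w => (dotv c (Xv w) - Ex P (fun w => dotv c (Xv w))) ^+ 2).
  by under eq_fun do rewrite cE; exact: gvec_intg_sqr.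
rewrite (variance_Ex (intg_dotv c iX) i2).
rewrite (_ : Ex P (fun w => (_ - _) ^+ 2) = Ex P (fun w => dotv c (G w) ^+ 2)); last first.
  by apply: eq_Ex => w; rewrite cE.
rewrite (_ : (fun w => ((trip M (W w)) ^+ 2)%R) = fun w => dotv c (Wv w) ^+ 2); last first.
  by apply/funext => w; rewrite eW.
by apply: second_moment_le; exact: measurable_dotv.
Qed.

Let iW k : intg P (fun w => Wv w k).
Proof.
have [h _ _] := W_facts (fun i => (i == k)%:R); move: h; rewrite (_ : (fun w => _) = fun w => Wv w k) //.
apply/funext => w; rewrite /dotv (bigD1 k) //= eqxx mul1r big1 ?addr0 // => i /negbTE ->.
by rewrite mul0r.
Qed.

Let W_mean c : Ex P (fun w => dotv c (Wv w)) = dotv c m.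
Proof.
rewrite Ex_dotv //; congr dotv; apply/funext => k; apply/EFin_inj.
rewrite -(expectation_Ex (iW k)) -(expectation_Ex (iX k)); exact/esym/EXW.
Qed.

Let rYv : rvec Yv. Proof. exact: rvec_sum. Qed.
Let rZv : rvec Zv. Proof. exact: rvec_sum. Qed.
Let rzeta : rvec zeta. Proof. exact: (rvec_affine gG). Qed.

Let W_pos w : posc (Wv w).
Proof.
have [fA pA] := W_psd w; rewrite /posc /Wv herm_mxcoord; last by case: pA.
exact: psd_complex fA pA.
Qed.

Let trexp_comparison theta : 0 < theta ->
  intg P (fun w => trexpc theta (Yv w)) /\
  Ex P (fun w => trexpc theta (Yv w)) <= 2 * Ex P (fun w => trexpc theta (zeta w)).
Proof.
move=> t0; have t00 := ltW t0; have pd := trexpc_pdec d0 t00.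
have [i1 e1] := sum_Kop (P := P) (Us := fun i w => mxcoord (Ws i w)) (U := Wv) mWs mW Ws_indep Ws_law
  (cls := pdec (@posc R d) theta)
  (fun phi h => pdec_cont t00 h) (fun phi x h => ltW (pdec_gt0 x h))
  (fun phi h => pdec_Kop P mW W_pos t00 h) (fun phi x h => intg_pdec P mW W_pos t00 x h) pd.
split; first exact: i1.
have W1 c : intg P (fun w => dotv c (Wv w)) by have [] := W_facts c.
have W2 c : intg P (fun w => dotv c (Wv w) ^+ 2) by have [] := W_facts c.
have W3 c : Ex P (fun w => dotv c (Wv w) ^+ 2) <= Ex P (fun w => dotv c (G w) ^+ 2) by have [] := W_facts c.
have := Kop_le_Gam (W := Wv) gG mW W1 W_mean W2 W3 W_pos t00 (Bc_ge0 (d := d) t00 m) pd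
  (trexpc_pos t00) (trexpc_symm d0 t00 m) n.
by rewrite -e1 ler_pdivrMl.
Qed.

Let eq_zeta : eqlaw P P Zv zeta.
Proof.
have UE w : Xv w = m + G w by rewrite /G addrC subrK.
exact: (sum_gauss_eqlaw gG mXs mX UE Xs_indep Xs_law).
Qed.

Let eq_Zv : eqlaw P P zeta Zv.
Proof. by move=> a c; exact/esym/eq_zeta. Qed.

Let F_zeta w : Fmx b (herm (n%:R *: m + Num.sqrt n%:R *: G w)).
Proof.
move=> hb; have Xi w' i j : Xv w' (i, j, true) = 0 by have [h _] := X_sa w'; exact: h.
have m_im i j : m (i, j, true) = 0.
  by rewrite -[RHS](Ex_cst P); apply: eq_Ex => w'; rewrite Xi.
have z i j : (n%:R *: m + Num.sqrt n%:R *: G w) (i, j, true) = 0.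
  rewrite (_ : (_ + _) _ = n%:R * m (i, j, true) + Num.sqrt n%:R * (Xv w (i, j, true) - m (i, j, true))) //.
  by rewrite m_im Xi subrr !mulr0 addr0.
by move=> i j; rewrite mxE /= !z subrr mul0r.
Qed.

Let iG c : intg P (fun w => dotv c (G w)) /\ Ex P (fun w => dotv c (G w)) = 0.
Proof.
rewrite (_ : (fun w => _) = fun w => dotv c (Xv w) - dotv c m); last first.
  by apply/funext => w; rewrite -dotvB.
have i1 := intg_dotv c iX; have i2 := intg_cst P (dotv c m).
by split; [exact: intgB | rewrite ExB // Ex_cst Ex_dotv // subrr].
Qed.

(** The variance of the quadratic form at u is computed on [zeta], where the mean is explicit, and
    transferred to Z by equality in law. *)
Let variance_ray u : 'V_P[fun w => complex.Re (qform u (\sum_(i < n) Xs i w))]%E =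
  (Ex P (fun w => ray (herm (Num.sqrt n%:R *: G w)) u ^+ 2))%:E.
Proof.
have [e eE] := ray_dotv u; pose a := n%:R * dotv e m; have [iGe EGe] := iG e.
have fE : (fun w => complex.Re (qform u (\sum_(i < n) Xs i w))) = fun w => dotv e (Zv w).
  by apply/funext => w; rewrite -eE herm_Zv.
have zE w : dotv e (zeta w) = a + Num.sqrt n%:R * dotv e (G w) by rewrite dotvDr !dotvZr.
have i1 : intg P (fun w => Num.sqrt n%:R * dotv e (G w)) by exact: intgZ.
have i2 : intg P (fun w => dotv e (zeta w)).
  by under eq_fun do rewrite zE; apply: intgD => //; exact: intg_cst.
have E2 : Ex P (fun w => dotv e (zeta w)) = a.
  rewrite (_ : Ex _ _ = Ex P (fun w => a + Num.sqrt n%:R * dotv e (G w))); last by apply: eq_Ex => w.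
  rewrite (@ExD _ _ _ P (fun=> a)) //; last exact: intg_cst.
  by rewrite Ex_cst ExZ // EGe mulr0 addr0.
have i3 := eqlaw_intg rzeta rZv eq_Zv (cont_dotv e) i2.
have E3 : Ex P (fun w => dotv e (Zv w)) = a by rewrite -E2 (eqlaw_Ex rzeta rZv eq_Zv (cont_dotv e) i2).
have c4 : cont (fun x => (dotv e x - a) ^+ 2) 
    by apply: (cont_comp (exprn_continuous (n := 2))); apply: contD; [exact: cont_dotv|exact: cont_cst].
have q w : (dotv e (zeta w) - a) ^+ 2 = ray (herm (Num.sqrt n%:R *: G w)) u ^+ 2.
  by rewrite zE [a + _]addrC addrK eE dotvZr.
have i4 : intg P (fun w => (dotv e (zeta w) - a) ^+ 2).
  under eq_fun do rewrite q eE dotvZr exprMn.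
  by apply: intgZ; exact: (gvec_intg_sqr gG).
have i5 := eqlaw_intg rzeta rZv eq_Zv c4 i4.
rewrite fE variance_Ex ?E3 // -(eqlaw_Ex rzeta rZv eq_Zv c4 i4); congr EFin.
by apply: eq_Ex => w; rewrite q.
Qed.

Let s2 := sigma_star2 P b (fun w => \sum_(i < n) Xs i w).

Let var_le u : unitF b u -> Ex P (fun w => ray (herm (Num.sqrt n%:R *: G w)) u ^+ 2) <= s2.
Proof.
move=> hu; apply: ub_le_sup; last by exists u => //; rewrite variance_ray.
have i2 : intg P (fun w => n1 (G w) ^+ 2).
  have := intg_n1X gG 2 0; rewrite (_ : (fun w => _) = fun w => n1 (G w) ^+ 2) //.
  by apply/funext => w; rewrite mul0r expR0 mulr1.
exists (Ex P (fun w => n%:R * n1 (G w) ^+ 2)) => _ [v [_ v1] <-]; rewrite variance_ray /=.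
have [e eE] := ray_dotv v.
have rE w : ray (herm (Num.sqrt n%:R *: G w)) v ^+ 2 = n%:R * dotv e (G w) ^+ 2.
  by rewrite eE dotvZr exprMn sqr_sqrtr ?ler0n.
apply: Ex_le => [||w]; first by under eq_fun do rewrite rE; apply: intgZ; exact: (gvec_intg_sqr gG).
  exact: intgZ.
rewrite rE ler_wpM2l ?ler0n // -eE -real_normK ?num_real //.
by rewrite ler_sqr ?nnegrE ?n1_ge0 // norm_ray_n1.
Qed.

Let s2_ge0 : 0 <= s2.
Proof.
have j : netidx d 0 := [ffun=> ord0].
by apply: (le_trans _ (var_le (netvec_unit R b d0 j))); apply: Ex_ge0 => w; exact: sqr_ge0.
Qed.

Let cont_lmc : cont (@lmc R d).
Proof. exact: Lip_cont ler01 (lmc_Lip d0). Qed.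

Let rsqrtn := sqrtr_ge0 (n%:R : R).

Let intg_lmcZ : intg P (fun w => lmc (Zv w)).
Proof.
have [i _ _] := lambda_min_expR_le d0 gG rsqrtn ltr01 F_zeta var_le.
exact: (eqlaw_intg rzeta rZv eq_Zv cont_lmc i).
Qed.

Let mu := Ex P (fun w => lmc (Zv w)).

Let intg_lmcY : intg P (fun w => lmc (Yv w)).
Proof.
have rWi i : rvec (fun w => mxcoord (Ws i w)) := mWs i.
have iWn1 i : intg P (fun w => n1 (mxcoord (Ws i w))).
  apply: (eqlaw_intg mW (rWi i) (same_eqlaw (Us := fun i w => mxcoord (Ws i w)) mWs mW Ws_law i) cont_n1).
  by apply: intg_sum => k; exact: (@integrable_norm _ _ _ _ _ (fun w => Wv w k) (iW k)).
apply: (@intg_le _ _ _ _ _ (fun w => \sum_(i < n) n1 (mxcoord (Ws i w)))).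
- exact: measurable_cont cont_lmc rYv.
- move=> w; apply: (le_trans (norm_lambda_min_le d0 (selfadj_herm _))); apply: (le_trans (l1mx_herm _)).
  exact: n1_sum.
- by apply: intg_sum.
Qed.

(** The factor 2 d has two sources: 2 from the comparison of the trace exponentials, d from bounding
    the trace at Z by its largest term. *)
Let lmcY_expR_le theta : 0 < theta ->
  intg P (fun w => expR (- theta * lmc (Yv w))) /\
  Ex P (fun w => expR (- theta * lmc (Yv w))) <= 2 * d%:R * expR (- theta * mu + theta ^+ 2 * s2 / 2).
Proof.
move=> t0; have t00 := ltW t0; have [iT leT] := trexp_comparison t0.
have [iz ie lez] := lambda_min_expR_le d0 gG rsqrtn t0 F_zeta var_le.
have muE : Ex P (fun w => lmc (n%:R *: m + Num.sqrt n%:R *: G w)) = mu := eqlaw_Ex rzeta rZv eq_Zv cont_lmc iz.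
rewrite muE in lez.
have scale (x : coordK d -> R) : lambda_min (herms theta x) = theta * lmc x.
  by rewrite /herms (lambda_min_rm d0 t00 (selfadj_herm x)).
have lo w : expR (- theta * lmc (Yv w)) <= trexpc theta (Yv w).
  by rewrite mulNr -scale; exact: (expR_lambda_min_le d0 (selfadj_herms theta _)).
have up w : trexpc theta (zeta w) <= d%:R * expR (- theta * lmc (zeta w)).
  by rewrite mulNr -scale; exact: (trexp_le_lambda_min d0 (selfadj_herms theta _)).
have iE : intg P (fun w => expR (- theta * lmc (Yv w))).
  apply: (@intg_le _ _ _ _ _ (fun w => trexpc theta (Yv w))); last exact: iT.
    have c1 : cont (fun x => expR (- theta * @lmc R d x)).
      by apply: (cont_comp (@continuous_expR R)); exact: contZ.
    exact: (measurable_cont c1 rYv).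
  by move=> w; rewrite ger0_norm; [exact: lo|exact: expR_ge0].
have iTz : intg P (fun w => trexpc theta (zeta w)).
  apply: (@intg_le _ _ _ _ _ (fun w => d%:R * expR (- theta * lmc (zeta w)))).
  - exact: measurable_cont (pdec_cont t00 (trexpc_pdec d0 t00)) rzeta.
  - by move=> w; rewrite ger0_norm; [exact: up|exact/ltW/trexpc_gt0].
  - exact: (intgZ d%:R ie).
split; first exact: iE.
apply: (le_trans (Ex_le iE iT lo)); apply: (le_trans leT); rewrite -mulrA.
apply: ler_wpM2l; first exact: ler0n.
apply: (le_trans (Ex_le iTz (intgZ d%:R ie) up)); rewrite (ExZ d%:R ie).
by apply: ler_wpM2l; [exact: ler0n|exact: lez].
Qed.

Let d1 : 1 <= d%:R :> R.
Proof. by rewrite ler1n. Qed.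

Let lambda_min_Y w : lambda_min (\sum_(i < n) Ws i w) = lmc (Yv w).
Proof. by rewrite /lmc herm_Yv. Qed.

Let lambda_min_Z w : lambda_min (\sum_(i < n) Xs i w) = lmc (Zv w).
Proof. by rewrite /lmc herm_Zv. Qed.

Let ln2d_gt0 : 0 < ln (2 * d%:R : R).
Proof. by apply: ln_gt0; move: d1; lra. Qed.

Let dd_gt0 : 0 < 2 * d%:R :> R.
Proof. by move: d1; lra. Qed.

Let expectation_Y : 'E_P[fun w => lambda_min (\sum_(i < n) Ws i w)]%E = (Ex P (fun w => lmc (Yv w)))%:E.
Proof.
have e := congr1 (fun f : T -> R => 'E_P[f]%E) (funext lambda_min_Y).
exact: etrans e (expectation_Ex intg_lmcY).
Qed.

Let expectation_Z : 'E_P[fun w => lambda_min (\sum_(i < n) Xs i w)]%E = mu%:E.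
Proof.
have e := congr1 (fun f : T -> R => 'E_P[f]%E) (funext lambda_min_Z).
exact: etrans e (expectation_Ex intg_lmcZ).
Qed.

Lemma expectation_lambda_min_ge :
  ('E_P[fun w => lambda_min (\sum_(i < n) Xs i w)] - (Num.sqrt (2 * s2 * ln (2 * d%:R)))%:E
     <= 'E_P[fun w => lambda_min (\sum_(i < n) Ws i w)])%E.
Proof.
suff fin_ge (z y : \bar R) : z = mu%:E -> y = (Ex P (fun w => lmc (Yv w)))%:E ->
  (z - (Num.sqrt (2 * s2 * ln (2 * d%:R)))%:E <= y)%E by exact: (fin_ge _ _ expectation_Z expectation_Y).
move=> -> ->; rewrite -EFinB lee_fin lerBlDr addrC -lerBlDr.
have key theta (theta0 : 0 < theta) := jensen_expR (intgZ (- theta) intg_lmcY) (lmcY_expR_le theta0).1.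
have bound theta (theta0 : 0 < theta) := le_trans (key theta theta0) (lmcY_expR_le theta0).2.
have {}bound theta (theta0 : 0 < theta) : - theta * Ex P (fun w => lmc (Yv w)) <=
    ln (2 * d%:R) + (- theta * mu + theta ^+ 2 * s2 / 2).
  by have := bound theta theta0; rewrite (ExZ _ intg_lmcY) -[2 * d%:R in X in X -> _]lnK // -expRD ler_expR.
move: (Ex P (fun w => lmc (Yv w))) bound => r bound {key}.
apply: (le_sqrt_optimize ln2d_gt0 s2_ge0) => t t0; have h := bound t t0.
rewrite -(ler_pM2l t0).
have -> : t * (ln (2 * d%:R) / t + t * s2 / 2) = ln (2 * d%:R) + t ^+ 2 * s2 / 2.
  by field; rewrite gt_eqF.
move: (ln _) (t ^+ 2 * s2 / 2) mu h => l q v; lra.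
Qed.

Lemma lambda_min_tail t : 0 <= t ->
  (P [set w | (lambda_min (\sum_(i < n) Ws i w))%:E <=
       'E_P[fun w => lambda_min (\sum_(i < n) Xs i w)] - t%:E]
    <= ((2 * d%:R) * expR (- t ^+ 2 / (2 * s2)))%:E)%E.
Proof.
move=> t0; suff le_P A : A = [set w | lmc (Yv w) <= mu - t] ->
    (P A <= ((2 * d%:R) * expR (- t ^+ 2 / (2 * s2)))%:E)%E.
  apply: le_P; apply/seteqP; split => w /=.
    by rewrite expectation_Z -EFinB lee_fin lambda_min_Y.
  by rewrite expectation_Z -EFinB lee_fin lambda_min_Y.
move=> ->.
have mA := measurable_sublevel (mu - t) (measurable_cont cont_lmc rYv).
(* This covers t = 0 and, since division by 0 gives 0, also s2 = 0. The claimed bound is then 2 d >=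
   1. *)
have [z|nz] := eqVneq (t ^+ 2 / (2 * s2)) 0.
  rewrite mulNr z oppr0 expR0 mulr1; apply: (le_trans (probability_le1 P mA)).
  by rewrite lee_fin; move: d1; lra.
have tn0 : t != 0 by apply: contraNneq nz => ->; rewrite expr0n mul0r.
have sn0 : s2 != 0 by apply: contraNneq nz => ->; rewrite mulr0 invr0 mulr0.
have t1 : 0 < t by rewrite lt0r tn0.
have s1 : 0 < s2 by rewrite lt0r sn0.
(* theta = t / s2 minimises the exponent - theta t + theta ^ 2 s2 / 2. *)
have th0 := divr_gt0 t1 s1; have [iE lE] := lmcY_expR_le th0.
have := markov_expR (mu - t) (measurable_cont cont_lmc rYv) th0 iE.
move=> h; rewrite -(fineK (fin_num_measure P _ mA)) lee_fin.
apply: (le_trans h); apply: (le_trans (ler_wpM2l (expR_ge0 _) lE)).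
rewrite mulrCA -expRD ler_wpM2l ?(ltW dd_gt0) // ler_expR.
suff -> : t / s2 * (mu - t) + (- (t / s2) * mu + (t / s2) ^+ 2 * s2 / 2) = - t ^+ 2 / (2 * s2) by [].
by field.
Qed.

End Main.

Theorem theorem2p3 (R : realType) (realF : bool) (d : nat)
    (dT : measure_display) (T : measurableType dT) (P : probability T R)
    (W X : T -> 'M[R[i]]_d) (n : nat) (Ws Xs : 'I_n -> T -> 'M[R[i]]_d) :
  (0 < d)%N ->
  (* W: random positive-semidefinite matrix over F with E||W||^2 < +oo *)
  random_matrix W ->
  (forall w, Fmx realF (W w) /\ psd realF (W w)) ->
  (\int[P]_w ((opnorm realF (W w)) ^+ 2)%:E < +oo)%E ->
  (* X: self-adjoint Gaussian random matrix over F *)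
  random_matrix X ->
  (forall w, Fmx realF (X w) /\ selfadj (X w)) ->
  gaussian_matrix P X ->
  (* E[X] = E[W] *)
  (forall k : coordK d,
     'E_P[fun w => mxcoord (X w) k] = 'E_P[fun w => mxcoord (W w) k])%E ->
  (* Var[X](M) >= Mom[W](M) for all self-adjoint M over F *)
  (forall M : 'M[R[i]]_d, Fmx realF M -> selfadj M ->
     'E_P[fun w => ((trip M (W w)) ^+ 2)%R] <= 'V_P[fun w => trip M (X w)])%E ->
  (* W_1, ..., W_n iid copies of W *)
  (forall i, random_matrix (Ws i)) ->
  (forall i w, Fmx realF (Ws i w) /\ psd realF (Ws i w)) ->
  (forall i, same_law P (Ws i) W) ->
  indep_matrices P Ws ->
  (* X_1, ..., X_n iid copies of X *)
  (forall i, random_matrix (Xs i)) ->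
  (forall i w, Fmx realF (Xs i w) /\ selfadj (Xs i w)) ->
  (forall i, same_law P (Xs i) X) ->
  indep_matrices P Xs ->
  let Y := fun w => \sum_(i < n) Ws i w in
  let Z := fun w => \sum_(i < n) Xs i w in
  let s2 := sigma_star2 P realF Z in
  ('E_P[fun w => lambda_min (Z w)]
     - (Num.sqrt (2 * s2 * ln (2 * d%:R)))%:E
     <= 'E_P[fun w => lambda_min (Y w)])%E /\
  (forall t : R, 0 <= t ->
     (P [set w | (lambda_min (Y w))%:E <= 'E_P[fun w => lambda_min (Z w)] - t%:E]
      <= ((2 * d%:R) * expR (- t ^+ 2 / (2 * s2)))%:E)%E).
Proof.
move=> d0 mW W_psd _ mX X_sa X_gauss EXW VXW mWs Ws_psd Ws_law Ws_indep mXs Xs_sa Xs_law Xs_indep Y Z s2.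
split.
  exact: (expectation_lambda_min_ge d0 mW W_psd mX X_sa X_gauss EXW VXW mWs Ws_psd Ws_law Ws_indep
    mXs Xs_sa Xs_law Xs_indep).
move=> t; exact: (lambda_min_tail d0 mW W_psd mX X_sa X_gauss EXW VXW mWs Ws_psd Ws_law Ws_indep
  mXs Xs_sa Xs_law Xs_indep).
Qed.
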